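(* Let $k\ge 3$ and $k/2<\ell<3k/4$ be integers such that $(k-\ell)\nmid k$, and let $s=\lceil \frac{k}{k-\ell}\rceil$. Then for all sufficiently large $n\in (k-\ell)\mathbb{N}$ (i.e. all $n\ge n_0(k,\ell)$ divisible by $k-\ell$) the following holds. If $\mathcal{H}=(V,E)$ is an $n$-vertex $k$-graph such that $$\delta_{k-1}(\mathcal{H})\ge \frac{n}{s(k-\ell)},$$ then $\mathcal{H}$ contains a Hamilton $\ell$-cycle.
   Context: A $k$-graph ($k$-uniform hypergraph) $\mathcal{H}=(V,E)$ has a finite vertex set $V$ and edge set $E\subseteq\binom{V}{k}$. For a $(k-1)$-set $S\subseteq V$, $\deg_{\mathcal{H}}(S)$ is the number of vertices $v\in V\setminus S$ with $S\cup\{v\}\in E$, and the minimum co-degree $\delta_{k-1}(\mathcal{H})$ is the minimum of $\deg_{\mathcal{H}}(S)$ over all $(k-1)$-sets $S\subseteq V$. For $1\le \ell<k$, a $k$-graph is a ($k$-uniform) $\ell$-cycle if there is a cyclic ordering of its vertices such that every edge consists of $k$ consecutive vertices and two consecutive edges share exactly $\ell$ vertices. $\mathcal{H}$ contains a Hamilton $\ell$-cycle if it contains an $\ell$-cycle as a spanning subhypergraph. *)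

(* Defs.v *)
From mathcomp Require Import all_boot all_order all_algebra.

Set Implicit Arguments.
Unset Strict Implicit.
Unset Printing Implicit Defensive.

Section Hypergraphs.

(* The vertex set is the whole finite type T; a hypergraph is its edge set. *)
Variable T : finType.
Implicit Types (E C : {set {set T}}) (S : {set T}) (p : seq T).

Definition kgraph (k : nat) E : Prop := forall e, e \in E -> #|e| = k.

Definition codeg E S : nat := #|[set v | (v \notin S) && (v |: S \in E)]|.

(* #|T| bounds every codegree, so the default value of the minimum only
   matters when T has no set of size k.-1. *)
Definition min_codeg (k : nat) E : nat :=
  \big[minn/#|T|]_(S : {set T} | #|S| == k.-1) codeg E S.

(* The k cyclically consecutive entries of p from position i (mod size p). *)
Definition window (k : nat) p (i : nat) : {set T} :=
  [set x in take k (rot (i %% size p) p)].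

(* The l-cycles on the full vertex set T, for 1 <= l < k; p is the cyclic
   ordering.  Consecutive edges, of size k and overlapping in l vertices, start
   k - l positions apart, so there are #|T| %/ (k - l) of them and the last one
   is followed by the first, the indices in window being cyclic.  The explicit
   intersection condition rules out small #|T|, where two consecutive windows
   could meet at both ends. *)
Definition spanning_lcycle (k l : nat) C : Prop :=
  kgraph k C /\
  exists p : seq T,
    [/\ uniq p,
        p =i T,
        k - l %| #|T|,
        C = [set window k p (i * (k - l)) | i : 'I_(#|T| %/ (k - l))]
      & forall i : 'I_(#|T| %/ (k - l)),
          #|window k p (i * (k - l)) :&: window k p (i.+1 * (k - l))| = l].

Definition has_hamilton_lcycle (k l : nat) E : Prop :=
  exists2 C : {set {set T}}, spanning_lcycle k l C & C \subset E.

End Hypergraphs.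

(* Main.v *)
Require Import Defs.
From mathcomp Require Import all_boot all_order all_algebra zify.
Import Order.TTheory GRing.Theory Num.Theory.

(** Put d = k - l and t = (k %/ d).+1 * d; the hypothesis says that every (k-1)-set has at least n / t neighbours.
A path is a sequence whose windows of length k starting at multiples of d are edges.  As d does not divide k, the
letters of a window can be permuted arbitrarily along a blow-up of a single edge, so any two ends are connected by
a positive proportion of the sequences of some fixed length, and likewise every d-set has a positive proportion of
absorbers.  This reduces the problem to an almost perfect tiling by paths of bounded length.  In a maximal tiling
that misses many vertices, the tile vertices with many edges into the uncovered part can be exchanged for new
tiles, so they form a set A of about n / t vertices; unless almost every edge meets A, edges outside A allow a
further improvement of the tiling.

In the remaining extremal case V is the union of A and B, where |A| is close to n / t, almost no edge lies in B and
almost every k-set with exactly one vertex in A is an edge.  A cyclic sequence with one A-vertex in each window is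
then a cycle, as long as it avoids atypical sets.  The difference n - t |A| is corrected by disjoint edges inside B,
which the codegree condition provides, or by pairs of A-vertices at a smaller distance; exceptional vertices are put
on short paths, and the last vertices are swapped into blocks that tolerate many vertices at a given position. *)

(** The number [t] is the right denominator because a vertex lies in at most [k %/ d + 1] of the
    [n / d] windows of a cycle: a set meeting all of them has at least [n / t] vertices. So the
    family of all [k]-sets meeting a slightly smaller set has no Hamilton cycle, although its
    codegrees are almost [n / t]; the extremal case is what is close to this family. A word over
    letters stands for many paths at once: a pattern that holds for a positive proportion of tuples
    holds for a positive proportion of its blow-ups, so no regularity lemma is used, and connecting
    and absorbing become questions about words. The obstacle there is how often each letter occurs;
    since [d] does not divide [k], a letter can return after [k %/ d] steps or after one more, and
    playing these two return times against each other changes the letter counts as needed. Random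
    choices are replaced by a potential function. In the extremal case A-vertices cannot be absorbed
    freely: their number is tied to the length of the cycle by an exact equation, which is why two
    kinds of correction occur. *)

Set Implicit Arguments.
Unset Strict Implicit.
Unset Printing Implicit Defensive.

(** * Counting sequences *)

(* [s] lists [r] groups of [B] entries, and every choice of one entry per group satisfies [P]. *)
Fixpoint blown (T : eqType) (B r : nat) (P : pred (seq T)) (s : seq T) : bool :=
  if r is r'.+1 then
    all (fun v => blown B r' (fun s' => P (v :: s')) (drop B s)) (take B s)
  else P [::].

Section Tsum.
Variable T : finType.
Local Notation n := #|T|.
Implicit Types (f g : seq T -> nat) (P : pred (seq T)).

Fixpoint tsum (m : nat) f : nat :=
  if m is m'.+1 then \sum_(v : T) tsum m' (fun s => f (v :: s)) else f [::].

Lemma leq_tsum m f g : (forall s, size s = m -> f s <= g s) ->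
  tsum m f <= tsum m g.
Proof.
elim: m f g => [|m IH] f g H /=; first exact: H.
by apply: leq_sum => v _; apply: IH => s Hs; apply: H; rewrite /= Hs.
Qed.

Lemma eq_tsum m f g : (forall s, size s = m -> f s = g s) ->
  tsum m f = tsum m g.
Proof.
move=> H; apply/eqP; rewrite eqn_leq; apply/andP.
by split; apply: leq_tsum => s Hs; rewrite H.
Qed.

Lemma tsum_cat a b f :
  tsum (a + b) f = tsum a (fun s => tsum b (fun s' => f (s ++ s'))).
Proof.
by elim: a f => [|a IH] f //=; apply: eq_bigr => v _; rewrite IH.
Qed.

Lemma tsumD m f g : tsum m (fun s => f s + g s) = tsum m f + tsum m g.
Proof.
elim: m f g => [|m IH] f g //=.
by rewrite -big_split; apply: eq_bigr => v _; rewrite IH.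
Qed.

Lemma tsum_const m c : tsum m (fun=> c) = n ^ m * c.
Proof.
elim: m => [|m IH] /=; first by rewrite mul1n.
under eq_bigr do rewrite IH.
by rewrite sum_nat_const expnS mulnA.
Qed.

Lemma tsum_mull m c f : tsum m (fun s => c * f s) = c * tsum m f.
Proof.
elim: m f => [|m IH] f //=.
by rewrite big_distrr; apply: eq_bigr => v _; rewrite IH.
Qed.

Lemma tsum_mulr m c f : tsum m (fun s => f s * c) = tsum m f * c.
Proof.
by rewrite mulnC -tsum_mull; apply: eq_tsum => s _; rewrite mulnC.
Qed.

Lemma tsum_sum (I : finType) m (Q : pred I) (f : I -> seq T -> nat) :
  tsum m (fun s => \sum_(i | Q i) f i s) = \sum_(i | Q i) tsum m (f i).
Proof.
elim: m f => [|m IH] f //=.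
rewrite exchange_big; apply: eq_bigr => v _; exact: IH.
Qed.

Lemma tsum_exchange a b (f : seq T -> seq T -> nat) :
  tsum a (fun s => tsum b (f s)) = tsum b (fun s' => tsum a (f^~ s')).
Proof.
elim: a f => [|a IH] f //=.
rewrite (tsum_sum b predT (fun v s' => tsum a (fun s => f (v :: s) s'))).
by apply: eq_bigr => v _; rewrite IH.
Qed.

Lemma tsum_gt0 m f : 0 < tsum m f -> exists2 s, size s = m & 0 < f s.
Proof.
elim: m f => [|m IH] f /=; first by exists [::].
rewrite lt0n sum_nat_eq0 => /forallPn[v]; rewrite implyTb -lt0n => /IH[s Hs Hf].
by exists (v :: s); rewrite //= Hs.
Qed.

Lemma leq_tsum_term m f s : size s = m -> f s <= tsum m f.
Proof.
elim: m f s => [|m IH] f [|v s] //= [Hs].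
by rewrite (bigD1 v) //=; apply: leq_trans (leq_addr _ _); apply: (IH _ s).
Qed.

Lemma tsum_le_const m f c : (forall s, size s = m -> f s <= c) ->
  tsum m f <= n ^ m * c.
Proof. by move=> H; rewrite -tsum_const; apply: leq_tsum. Qed.

Lemma tsum_le1 m P : tsum m P <= n ^ m.
Proof.
by apply: leq_trans (tsum_le_const (c := 1) _) _; rewrite ?muln1 // => s _;
  case: (P s).
Qed.

Lemma tsum_all m (P : pred T) : tsum m (fun s => all P s) = #|P| ^ m.
Proof.
elim: m => [|m IH] //=.
rewrite expnS -IH -sum1_card big_distrl [RHS]big_mkcond /=; apply: eq_bigr => v _ /=.
rewrite unfold_in; case: (P v) => /=; last by rewrite tsum_const muln0.
by rewrite mul1n.
Qed.

Lemma tsum_has m (P : pred T) : tsum m (fun s => has P s) * n <= m * #|P| * n ^ m.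
Proof.
elim: m => [|m IH]; first by [].
have E : tsum m.+1 (fun s => has P s) <=
    #|P| * n ^ m + n * tsum m (fun s => has P s).
  rewrite /=; apply: (@leq_trans (\sum_(v : T) (P v * n ^ m + tsum m (fun s => has P s)))).
    apply: leq_sum => v _; case: (P v) => /=; last by rewrite mul0n.
    by rewrite mul1n; apply: leq_trans (leq_addr _ _); rewrite tsum_const muln1.
  rewrite big_split /= sum_nat_const leq_add2r -big_distrl leq_mul2r.
  apply/orP; right; rewrite -sum1_card [X in _ <= X]big_mkcond; apply: leq_sum => v _.
  by rewrite unfold_in; case: (P v).
apply: leq_trans (leq_mul E (leqnn n)) _.
have := leq_mul (leqnn n) IH; rewrite expnS.
move: (n ^ m) (tsum m _) (#|P|) => N X p; clear; nia.
Qed.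

Lemma tsum_nuniq m : tsum m (fun s => ~~ uniq s) * n <= m * m * n ^ m.
Proof.
elim: m => [|m IH]; first by [].
have E : tsum m.+1 (fun s => ~~ uniq s) <= m * n ^ m + n * tsum m (fun s => ~~ uniq s).
  rewrite /=; apply: (@leq_trans (\sum_(v : T) (tsum m (fun s => v \in s) + tsum m (fun s => ~~ uniq s)))).
    apply: leq_sum => v _; rewrite -tsumD; apply: leq_tsum => s _.
    by case: (v \in s); case: (uniq s).
  rewrite big_split /= sum_nat_const leq_add2r.
  rewrite -(tsum_sum m predT (fun v s => (v \in s) : nat)).
  apply: leq_trans (tsum_le_const (c := m) _) _; last by rewrite mulnC.
  move=> s <-; rewrite -big_mkcond sum1_card; exact: card_size.
apply: leq_trans (leq_mul E (leqnn n)) _.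
have := leq_mul (leqnn n) IH; rewrite expnS.
move: (n ^ m) (tsum m _) => N X; clear; nia.
Qed.

(** The constant [K] is the reciprocal of a density, which keeps all arithmetic in [nat]. Sequences
    with repetitions are counted too, so that sums factor under concatenation; the repetitions are
    discarded later by [dense_avoid]. *)
Definition dense (K m : nat) f := n ^ m <= K * tsum m f.

Lemma denseW K K' m f g : dense K m f -> K <= K' ->
  (forall s, size s = m -> f s <= g s) -> dense K' m g.
Proof.
rewrite /dense => H HK Hfg; apply: leq_trans H _.
by apply: leq_mul => //; apply: leq_tsum.
Qed.

(** At most [m * (m + #|Z|) * n ^ m / n] sequences repeat an entry or meet [Z], and the last
    hypothesis makes this at most half of the dense family. *)
Lemma dense_avoid K m P (Z : {set T}) : 0 < n -> dense K m P ->
  2 * K * (m * (m + #|Z|)) <= n ->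
  dense (2 * K) m (fun s => [&& P s, uniq s & all [predC Z] s]).
Proof.
rewrite /dense => n0 H HZ.
have E : tsum m P <= tsum m (fun s => [&& P s, uniq s & all [predC Z] s])
   + (tsum m (fun s => ~~ uniq s) + tsum m (fun s => has (mem Z) s)).
  rewrite -!tsumD; apply: leq_tsum => s _.
  have -> : has (mem Z) s = ~~ all [predC Z] s.
    by rewrite -has_predC; apply: eq_has => x /=; rewrite negbK.
  by case: (P s); case: (uniq s); case: (all _ s).
have Hu := tsum_nuniq m; have Hh := tsum_has m (mem Z).
rewrite -(leq_pmul2r n0).
have HC : tsum m (fun s => has (mem Z) s) * n <= m * #|Z| * n ^ m.
  by apply: leq_trans Hh _; rewrite leq_mul2r leq_mul2l; apply/orP; right; apply/orP; right; apply: subset_leq_card; apply/subsetP.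
move: (n ^ m) H Hu HC HZ E => N.
move: (tsum m P) (tsum m (fun s => [&& _, _ & _])) => D A.
move: (tsum m (fun s => ~~ _)) (tsum m (fun s => has _ _)) => B C H Hu HC HZ E.
have : N * n <= K * (A + (B + C)) * n.
  by rewrite leq_mul2r (leq_trans H) ?orbT // leq_mul2l E orbT.
have : K * (B + C) * n * 2 <= N * n by move: HZ Hu HC; clear; nia.
clear; nia.
Qed.

Lemma dense_exists K m P (Z : {set T}) : 0 < n -> dense K m P ->
  2 * K * (m * (m + #|Z|)) <= n ->
  exists s, [/\ size s = m, P s, uniq s & all [predC Z] s].
Proof.
move=> n0 H /(dense_avoid n0 H); rewrite /dense => D.
have : 0 < tsum m (fun s => [&& P s, uniq s & all [predC Z] s]).
  have : 0 < 2 * K * tsum m (fun s => [&& P s, uniq s & all [predC Z] s]).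
    by apply: leq_trans D; rewrite expn_gt0 n0.
  by rewrite muln_gt0 => /andP[].
by case/tsum_gt0 => s Hs; rewrite lt0b => /and3P[? ? ?]; exists s.
Qed.

(** A weak power mean inequality. By averaging, at least [n ^ m / (2 * K)] sequences are popular,
    meaning [N <= 2 * K * f s], and these alone contribute enough to the sum of the powers. *)
Lemma tsum_mean m f (K N B : nat) : 0 < N -> (forall s, f s <= N) ->
  n ^ m * N <= K * tsum m f ->
  n ^ m * N ^ B <= (2 * K) ^ B.+1 * tsum m (fun s => f s ^ B).
Proof.
move=> N0 Hf H.
pose L := tsum m (fun s => N <= 2 * K * f s).
have E1 : 2 * K * tsum m f <= 2 * K * N * L + n ^ m * N.
  rewrite -tsum_const -!tsum_mull -tsumD; apply: leq_tsum => s _.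
  case: (leqP N (2 * K * f s)) => [HN|/ltnW HN] /=; last by apply: leq_trans HN _; apply: leq_addl.
  by apply: leq_trans (leq_addr _ _); rewrite muln1 leq_mul2l Hf orbT.
have E2 : L * N ^ B <= (2 * K) ^ B * tsum m (fun s => f s ^ B).
  rewrite -tsum_mulr -tsum_mull; apply: leq_tsum => s _.
  case: (leqP N (2 * K * f s)) => [HN|_]; last by rewrite mul0n.
  by rewrite mul1n -expnMn; case: (B) => // b; rewrite leq_exp2r.
have E3 : n ^ m <= 2 * K * L by rewrite -(leq_pmul2r N0); nia.
apply: leq_trans (leq_mul E3 (leqnn _)) _.
by rewrite expnS -!mulnA !leq_mul2l E2 !orbT.
Qed.

End Tsum.

(** Erdos's induction for partite hypergraphs. The context [y] holds variables that are not blown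
    up: the first variable is moved into it, the induction hypothesis blows up the others, and the
    power mean inequality then turns one value of that variable into [B] values. *)
Lemma blown_ctx B r c K : exists K', forall (T : finType) (P : seq T -> pred (seq T)), 0 < #|T| ->
  #|T| ^ (c + r) <= K * tsum c (fun y => tsum r (P y)) ->
  #|T| ^ (c + r * B) <= K' * tsum c (fun y => tsum (r * B) (blown B r (P y))).
Proof.
elim: r c K => [|r IH] c K; first by exists K => T P n0; rewrite mul0n.
have [K1 HK] := IH c.+1 K; exists ((2 * K1) ^ B.+1) => T P n0 H.
pose P' y s := if y is v :: y' then P y' (v :: s) else false.
have {}H : #|T| ^ (c.+1 + r) <= K * tsum c.+1 (fun y => tsum r (P' y)).
  move: H; rewrite addnS addSn /= => H; apply: leq_trans H _.
  rewrite leq_mul2l; apply/orP; right.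
  by rewrite (tsum_sum c predT (fun v y => tsum r (fun s => P y (v :: s)))).
have {H} := HK T P' n0 H; rewrite {HK} /=.
pose h s := \sum_(v : T) (blown B r (fun s => P (take c (s : seq T)) (v :: s)) (drop c s) : nat).
(* For a context [y] and a blown-up rest [z], this is the number of admissible values of the first
   variable, so its [B]-th power counts the lists of [B] admissible values. *)
pose d y z := \sum_(v : T) (blown B r (fun s => P y (v :: s)) z : nat).
rewrite -(tsum_sum c predT (fun v y => tsum (r * B) (blown B r (P' (v :: y))))).
have -> : tsum c (fun y => \sum_(v : T) tsum (r * B) (blown B r (P' (v :: y))))
   = tsum (c + r * B) (fun s => d (take c s) (drop c s)).
  rewrite tsum_cat; apply: eq_tsum => y Hy.
  rewrite -(tsum_sum _ predT (fun v z => blown B r (P' (v :: y)) z : nat)).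
  by apply: eq_tsum => z _; rewrite take_size_cat ?drop_size_cat.
rewrite addSn expnSr => /(tsum_mean B n0) H.
rewrite [X in _ <= _ * X](_ : _ = tsum (c + r * B) (fun s => d (take c s) (drop c s) ^ B)).
  rewrite mulSn addnCA addnC expnD; apply: H => s.
  rewrite /d; apply: (@leq_trans (\sum_(v : T) 1)); last by rewrite sum1_card.
  by apply: leq_sum => v _; case: blown.
rewrite tsum_cat; apply: eq_tsum => y Hy.
rewrite mulSn tsum_cat tsum_exchange; apply: eq_tsum => z Hz.
rewrite take_size_cat ?drop_size_cat //.
rewrite (_ : d y z = #|[pred v | blown B r (fun s => P y (v :: s)) z]|); last first.
  by rewrite -sum1_card [RHS]big_mkcond; apply: eq_bigr => v _; rewrite inE; case: blown.
rewrite -tsum_all; apply: eq_tsum => x Hx /=.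
by rewrite take_size_cat ?drop_size_cat.
Qed.

Lemma dense_blown (B r K : nat) : exists K', forall (T : finType) (P : pred (seq T)),
  0 < #|T| -> dense K r P -> dense K' (r * B) (blown B r P).
Proof.
have [K' HK] := blown_ctx B r 0 K.
by exists K' => T P n0 H; apply: (HK T (fun=> P)).
Qed.

Lemma blown_choice (T : eqType) (x0 : T) (B r : nat) (P : pred (seq T)) s (c : nat -> nat) :
  blown B r P s -> size s = r * B -> (forall i, c i < B) ->
  P (mkseq (fun i => nth x0 s (i * B + c i)) r).
Proof.
elim: r P s c => [|r IH] P s c //= /allP H Hs Hc.
have HB : size (take B s) = B by rewrite size_takel // Hs leq_addr.
have H0 : nth x0 s (c 0) \in take B s.
  by rewrite -(nth_take x0 (Hc 0)) mem_nth // HB.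
have /= := IH _ _ (fun i => c i.+1) (H _ H0); rewrite size_drop Hs addKn => /(_ erefl (fun i => Hc i.+1)).
rewrite /mkseq /= add0n -[1]addn0 iotaDl -map_comp.
congr (P (_ :: _)); apply: eq_map => i /=.
by rewrite nth_drop add1n mulSn addnA.
Qed.

(** * Words and walks between windows *)

Section Lpath.
Variables (k d : nat).

Definition lpath (A : Type) (P : seq A -> Prop) (p : seq A) : Prop :=
  forall i, i * d + k <= size p -> P (take k (drop (i * d) p)).

Lemma take_drop_catl (A : Type) x (u v : seq A) : x + k <= size u ->
  take k (drop x (u ++ v)) = take k (drop x u).
Proof.
move=> H; rewrite drop_cat; case: ltnP => Hx; first by rewrite takel_cat // size_drop; lia.
have k0 : k = 0 by lia.
by rewrite k0 !take0.
Qed.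

Lemma drop_catr (A : Type) x (u v : seq A) : size u <= x ->
  drop x (u ++ v) = drop (x - size u) v.
Proof. by move=> H; rewrite drop_cat ltnNge H. Qed.

Lemma lpath_sub (A : Type) (P Q : seq A -> Prop) p :
  (forall s, size s = k -> P s -> Q s) -> lpath P p -> lpath Q p.
Proof.
move=> H Hp i Hi; apply: H; last exact: Hp.
by rewrite size_takel // size_drop; lia.
Qed.

(** A window that starts inside [p1] starts at least [d] places before its end, hence it ends within
    [m]; every other window avoids [p1] and keeps its alignment because [d] divides [size p1]. *)
Lemma lpath_cat (A : Type) (P : seq A -> Prop) p1 m p2 : d %| size p1 ->
  k <= size m + d -> lpath P (p1 ++ m) -> lpath P (m ++ p2) ->
  lpath P (p1 ++ m ++ p2).
Proof.
move=> /dvdnP[a Ha] Hm H1 H2 i Hi; case: (ltnP i a) => Hia.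
  have Hx : i * d + k <= size (p1 ++ m) by rewrite size_cat Ha; nia.
  by rewrite catA take_drop_catl //; apply: H1.
have E : i * d - size p1 = (i - a) * d by rewrite Ha mulnBl.
have Hsz : size p1 <= i * d by rewrite Ha leq_mul2r Hia orbT.
rewrite drop_catr // E; apply: H2; move: Hi; rewrite !size_cat -E; lia.
Qed.

Lemma lpath_catl (A : Type) (P : seq A -> Prop) u v : lpath P (u ++ v) -> lpath P u.
Proof.
move=> H i Hi; rewrite -(take_drop_catl v) //; apply: H.
by rewrite size_cat; lia.
Qed.

Lemma lpath_take (A : Type) (P : seq A -> Prop) j p : lpath P p -> lpath P (take j p).
Proof. by rewrite -{1}(cat_take_drop j p) => /lpath_catl. Qed.

Lemma lpath_map (A B : Type) (f : A -> B) (P : seq B -> Prop) p :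
  lpath (fun s => P (map f s)) p -> lpath P (map f p).
Proof. by move=> H i; rewrite size_map => /H; rewrite map_take map_drop. Qed.

(** The exact length makes the windows counted from the right end the same as those counted from the
    left end. *)
Lemma lpath_rev (A : Type) (P : seq A -> Prop) N p : size p = N * d + k ->
  lpath (fun s => P (rev s)) p -> lpath P (rev p).
Proof.
move=> Hp H i; rewrite size_rev => Hi.
have -> : take k (drop (i * d) (rev p)) = rev (take k (drop ((N - i) * d) p)).
  rewrite drop_rev take_rev; congr rev; rewrite size_takel ?leq_subr //.
  have -> : size p - i * d = (N - i) * d + k by rewrite Hp mulnBl; nia.
  rewrite addnK -{1}[p](cat_take_drop ((N - i) * d)) take_cat size_takel; last by rewrite Hp; nia.
  by rewrite ltnNge leq_addr /= addKn drop_size_cat // size_takel // Hp; nia.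
by apply: H; rewrite Hp; nia.
Qed.

Lemma lpath_size_k (A : Type) (P : seq A -> Prop) w : 0 < d -> size w = k -> P w -> lpath P w.
Proof.
move=> d0 Hw Pw i; rewrite Hw => Hi; have -> : i = 0 by nia.
by rewrite mul0n drop0 -Hw take_size.
Qed.

(* [z] is what is dropped on the way from the window [w] to the window [w']. *)
Definition walk (A : Type) (P : seq A -> Prop) w z w' : Prop :=
  [/\ size w' = k, d %| size z, lpath P (z ++ w') & take k (z ++ w') = w].

Section Walks.
Variables (A : Type) (P : seq A -> Prop).
Hypotheses (d0 : 0 < d) (dk : d < k).

Lemma walk_refl w : size w = k -> P w -> walk P w [::] w.
Proof. by move=> Hw Pw; split=> //=; [apply: lpath_size_k|rewrite -Hw take_size]. Qed.

Lemma walk_trans w1 z1 w2 z2 w3 : walk P w1 z1 w2 -> walk P w2 z2 w3 ->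
  walk P w1 (z1 ++ z2) w3.
Proof.
case=> H1 Hd1 Hp1 Ht1 [H2 Hd2 Hp2 Ht2].
have E : z2 ++ w3 = w2 ++ drop k (z2 ++ w3) by rewrite -{1}Ht2 cat_take_drop.
split=> //; first by rewrite size_cat dvdn_add.
  rewrite -catA E; apply: lpath_cat => //; last by rewrite -E.
  by rewrite H1 leq_addr.
by rewrite -catA E catA takel_cat // size_cat H1 leq_addl.
Qed.

Lemma walk_step u v u' : size u = d -> size u' = d -> size (u ++ v) = k ->
  P (u ++ v) -> P (v ++ u') -> walk P (u ++ v) u (v ++ u').
Proof.
move=> Hu Hu' Huv P1 P2; have Hv : size v = k - d by rewrite -Huv size_cat Hu addKn.
split; rewrite ?Hu ?dvdnn //; first by rewrite size_cat Hv Hu'; lia.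
  by apply: lpath_cat; rewrite ?Hu ?Hv //; [lia|..]; apply: lpath_size_k => //; rewrite size_cat; lia.
by rewrite catA takel_cat ?Huv // -Huv take_size.
Qed.

End Walks.

Lemma walk_map (A B : Type) (f : A -> B) (P : seq A -> Prop) (Q : seq B -> Prop) w z w' :
  (forall s, P s -> Q (map f s)) -> walk P w z w' -> walk Q (map f w) (map f z) (map f w').
Proof.
move=> H [Hw Hd Hl Ht]; split; rewrite ?size_map // -?map_cat -?map_take ?Ht //.
by apply: lpath_map; apply: lpath_sub Hl => s _; apply: H.
Qed.

End Lpath.

(* Bubble sort. *)
Lemma perm_adjacent_ind (A : eqType) (R : seq A -> seq A -> Prop) :
  (forall w, R w w) -> (forall u v w, R u v -> R v w -> R u w) ->
  (forall a x y b, R (a ++ x :: y :: b) (a ++ y :: x :: b)) ->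
  forall w w', perm_eq w w' -> R w w'.
Proof.
move=> Rr Rt Ra w w' H; suff: forall a, R (a ++ w) (a ++ w') by move/(_ [::]).
elim: w' w H => [|x w' IH] w H a.
  by move: H => /perm_nilP->.
have xw : x \in w by rewrite (perm_mem H) mem_head.
case/splitPr: w / xw H => p1 p2 H.
apply: (Rt _ (a ++ x :: p1 ++ p2)).
  elim/last_ind: p1 p2 {H} => [|p1 y IHp] p2 //.
  rewrite /= !cat_rcons; apply: (Rt _ _ _ _ (IHp (y :: p2))).
  by rewrite !(catA a p1); apply: Ra.
rewrite -cat_rcons -[a ++ x :: w']cat_rcons; apply: IH.
by rewrite -(perm_cons x); apply: perm_trans H; rewrite -cat1s perm_catCA.
Qed.

(** Two neighbouring positions [p] and [p + 1] are separated by a boundary between blocks of length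
    [d]. Going once around a cyclic word of length [k] shifts the boundaries by [r], so after
    [q + c] rotations the two positions become [r - 1] and [r], both in the first block since
    [0 < r < d]. *)
Lemma wrap_index q r d k c p : k = q * d + r -> 0 < r -> r < d -> 1 < d -> 0 < q ->
  p.+1 = c * d -> p.+1 < k -> q + c < k /\ r.-1 + (q + c) * d = p + k.
Proof.
move=> -> r0 rd d1 q0 Ec Hp.
have cq : c <= q by rewrite leqNgt; apply/negP => cq; nia.
by split; nia.
Qed.

(** A letter at index [K] of the window moves [d] places to the left in each step; after [s - 1]
    steps it is among the first [d] letters, and the next step puts it back at [K]. *)
Lemma return_time s d e K j : 0 < s -> e < d -> K = s.-1 * d + e ->
  (K - j %% s * d < d) = (s %| j.+1) /\
  K - j.+1 %% s * d = if s %| j.+1 then K else K - j %% s * d - d.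
Proof.
move=> s0 ed ->; rewrite modnS; have := ltn_pmod j s0.
have : (s %| j.+1) = ((j %% s).+1 == s).
  rewrite /dvdn modnS; case: ifP => [/dvdnP[m Hm]|Hd].
    rewrite eqxx; symmetry; apply/eqP.
    have := ltn_pmod j s0; have := divn_eq j s; move: (j %% s) (j %/ s) => x y Ej Hx.
    have : m = y.+1 by nia.
    by nia.
  symmetry; apply/eqP => E; move/negP: Hd; apply; apply/dvdnP; exists (j %/ s).+1.
  by rewrite mulSn addnC -{3}E addnS -divn_eq.
move=> ->; move: (j %% s) => x Hx; case: eqP => Ex; first by split; nia.
split; last by nia.
by apply/negbTE; rewrite -leqNgt; nia.
Qed.

(** * Walks through the permutations of one word, and the letter counts they allow *)

Section CompletePartite.
Variables (A : eqType) (k d : nat).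
Hypotheses (d1 : 1 < d) (dk : d < k) (ndk : ~~ (d %| k)).
Local Notation q := (k %/ d).
Local Notation r := (k %% d).
Variable w0 : seq A.
Hypotheses (w0k : size w0 = k) (w0u : uniq w0).
Local Notation St := (fun w => is_true (perm_eq w w0)).
Local Notation wk := (walk k d St).

Let d0 : 0 < d. Proof. exact: ltnW. Qed.
Let r0 : 0 < r. Proof. by rewrite lt0n; apply: contra ndk => /eqP; rewrite /dvdn => ->. Qed.
Let rd : r < d. Proof. exact: ltn_pmod. Qed.
Let kE : k = q * d + r. Proof. exact: divn_eq. Qed.
Let q0 : 0 < q. Proof. by rewrite divn_gt0 // ltnW. Qed.

Let St_size w : perm_eq w w0 -> size w = k.
Proof. by move/perm_size->. Qed.

Let St_uniq w : perm_eq w w0 -> uniq w.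
Proof. by move/perm_uniq->. Qed.

Lemma wk_step u v u' : size u = d -> perm_eq (u ++ v) w0 -> perm_eq u' u ->
  wk (u ++ v) u (v ++ u').
Proof.
move=> Hu Hw Huu; apply: walk_step => //; first by rewrite (perm_size Huu).
  exact: St_size.
by apply: perm_trans Hw; rewrite perm_catC perm_cat2r.
Qed.

Lemma wk_rot w : perm_eq w w0 -> wk w (take d w) (rot d w).
Proof.
move=> Hw; rewrite -{1}(cat_take_drop d w); apply: wk_step => //.
  by rewrite size_takel // St_size // ltnW.
by rewrite cat_take_drop.
Qed.

Lemma perm_iter_rot j (w : seq A) : perm_eq (iter j (rot d) w) w.
Proof. by elim: j => //= j IH; rewrite perm_rot. Qed.

Lemma wk_iter_rot j w : perm_eq w w0 ->
  exists2 z, wk w z (iter j (rot d) w) & size z = j * d.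
Proof.
move=> Hw; elim: j => [|j [z Hz Hs]]; first by exists [::] => //; apply: walk_refl => //; apply: St_size.
have Hj : perm_eq (iter j (rot d) w) w0 by apply: perm_trans Hw; apply: perm_iter_rot.
exists (z ++ take d (iter j (rot d) w)).
  by apply: walk_trans Hz _ => //; apply: wk_rot.
by rewrite size_cat Hs size_takel ?St_size // 1?ltnW // mulSn addnC.
Qed.

Lemma nth_iter_rot (x0 : A) j w i : size w = k -> i < k ->
  nth x0 (iter j (rot d) w) i = nth x0 w ((i + j * d) %% k).
Proof.
move=> Hw; elim: j i => [|j IH] i Hi /=; first by rewrite addn0 modn_small.
have Hs : size (iter j (rot d) w) = k by rewrite (perm_size (perm_iter_rot j w)).
rewrite /rot nth_cat size_drop Hs.
case: ltnP => Hx; first by rewrite nth_drop IH; [congr (nth _ _ (_ %% _)); lia|lia].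
rewrite nth_take; last lia.
rewrite IH; last lia.
by rewrite -modnDr mulSn; congr (nth _ _ (_ %% _)); lia.
Qed.

Lemma iter_rot_id (w : seq A) : size w = k -> iter k (rot d) w = w.
Proof.
move=> Hw; case: (posnP k) => [k0|k0]; first by rewrite k0.
have x0 : A by case: w Hw => [|x //]; move: k0; case: k.
apply: (@eq_from_nth _ x0); rewrite (perm_size (perm_iter_rot k w)) // Hw => i Hi.
by rewrite nth_iter_rot // mulnC addnC modnMDl modn_small.
Qed.

Definition swp (x y c : A) := if c == x then y else if c == y then x else c.

Lemma swpK x y : involutive (swp x y).
Proof.
move=> c; rewrite /swp; case: (eqVneq c x) => [->|cx]; first by rewrite eqxx; case: eqVneq.
by case: (eqVneq c y) => [->|cy]; rewrite ?eqxx // (negPf cx) (negPf cy).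
Qed.

Lemma count_swp x y c s : count_mem c (map (swp x y) s) = count_mem (swp x y c) s.
Proof.
rewrite count_map; apply: eq_count => e /=.
by apply/eqP/eqP => [<-|->]; rewrite swpK.
Qed.

Lemma map_swp_id x y (s : seq A) : x \notin s -> y \notin s -> map (swp x y) s = s.
Proof.
move=> Hx Hy; rewrite -[RHS]map_id; apply/eq_in_map => c cs; rewrite /swp.
by case: eqVneq => [E|_]; [move: Hx; rewrite -E cs|case: eqVneq => [E|//]; move: Hy; rewrite -E cs].
Qed.

Lemma perm_swp x y (s : seq A) : uniq s -> x \in s -> y \in s -> perm_eq (map (swp x y) s) s.
Proof.
move=> Hu Hx Hy; apply: uniq_perm => //.
  by rewrite map_inj_uniq //; apply: inv_inj; apply: swpK.
move=> c; rewrite -{1}[c](swpK x y) mem_map; last by apply: inv_inj; apply: swpK.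
by rewrite /swp; case: (eqVneq c x) => [->|_]; [rewrite Hx Hy|case: (eqVneq c y) => [->|//]; rewrite Hx Hy].
Qed.

Lemma wk_swp x y w z w' : x \in w0 -> y \in w0 -> wk w z w' ->
  wk (map (swp x y) w) (map (swp x y) z) (map (swp x y) w').
Proof.
move=> Hx Hy; apply: walk_map => s Hs; apply: perm_trans (Hs).
by apply: perm_swp; rewrite ?(perm_uniq Hs) ?(perm_mem Hs).
Qed.

Lemma wk_step_swp x y w u' : perm_eq w w0 -> x \in take d w -> y \in take d w ->
  perm_eq u' (take d w) ->
  wk w (take d w) (map (swp x y) (drop d w ++ u')).
Proof.
move=> Hw Hx Hy Hu'; rewrite -{1}(cat_take_drop d w) map_cat.
have := St_uniq Hw; rewrite -{1}(cat_take_drop d w) cat_uniq => /and3P[Ut /hasPn Hn _].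
rewrite map_swp_id.
+ apply: wk_step; rewrite ?cat_take_drop //.
    by rewrite size_takel // St_size // ltnW.
  apply: perm_trans (Hu').
  by apply: perm_swp; rewrite ?(perm_uniq Hu') ?(perm_mem Hu').
+ by apply/negP => /Hn; rewrite Hx.
+ by apply/negP => /Hn; rewrite Hy.
Qed.

(** The first [d] letters of a window are dropped and may come back in any order. So the word is
    rotated until [x] and [y] are both among them, these two are exchanged while passing from the
    front to the back, and the rotation is continued to [k] steps in all, which is the identity. *)
Lemma wk_adjacent a x y b : perm_eq (a ++ x :: y :: b) w0 ->
  exists2 z, wk (a ++ x :: y :: b) z (a ++ y :: x :: b) & size z = k * d.
Proof.
set w := a ++ x :: y :: b => Hw.
have Hk : size w = k by apply: St_size.
have xw : x \in w by rewrite mem_cat mem_head orbT.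
have yw : y \in w by rewrite mem_cat !inE eqxx !orbT.
have -> : a ++ y :: x :: b = map (swp x y) w.
  have := St_uniq Hw; rewrite /w cat_uniq => /and3P[_ /hasPn Hn] /andP[]; rewrite inE negb_or => /andP[xy xb] /andP[yb _].
  have xa : x \notin a by apply: (Hn x); rewrite mem_head.
  have ya : y \notin a by apply: (Hn y); rewrite !inE eqxx orbT.
  have ex : swp x y x = y by rewrite /swp eqxx.
  have ey : swp x y y = x by rewrite /swp eqxx; case: eqVneq.
  by rewrite map_cat /= ex ey !map_swp_id.
have Hp : (size a).+1 < k by rewrite -Hk size_cat /=; lia.
have nx : nth x w (size a) = x by rewrite nth_cat ltnn subnn.
have ny : nth x w (size a).+1 = y by rewrite nth_cat ltnNge leqnSn /= subSnn.
(* After [j] rotations the letters [x] and [y] stand at [i] and [i + 1] in the first block. If they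
   share a block, [j] is the number of that block; if a boundary separates them, a full turn is
   needed, as in [wrap_index]. *)
have [j [i [Hj Hi Ei]]] : exists j i, [/\ j < k, i.+1 < d & (i + j * d) %% k = size a /\ (i.+1 + j * d) %% k = (size a).+1].
  have Epd := divn_eq (size a) d; have Hpd : size a %% d < d by rewrite ltn_mod.
  case: (ltnP (size a %% d).+1 d) => H.
    exists (size a %/ d), (size a %% d); split=> //; first by nia.
    by rewrite addSn addnC -Epd !modn_small //; lia.
  have r0' := r0; have rd' := rd; have kE' := kE; have q0' := q0.
  set c := (size a %/ d).+1; have Ec : (size a).+1 = c * d by rewrite /c; nia.
  have [qck Eqc] := wrap_index kE' r0' rd' d1 q0' Ec Hp.
  exists (q + c), (r.-1); split; [exact: qck|lia|].
  have -> : r.-1.+1 + (q + c) * d = (size a).+1 + k by lia.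
  rewrite Eqc.
  by rewrite !modnDr !modn_small //; lia.
set wj := iter j (rot d) w.
have Hwj : perm_eq wj w0 by apply: perm_trans Hw; apply: perm_iter_rot.
have Hin h : h < d -> nth x wj h \in take d wj.
  by move=> Hh; rewrite -(nth_take x Hh) mem_nth // size_takel ?St_size // ltnW.
have xin : x \in take d wj.
  have := Hin i (ltnW Hi); rewrite nth_iter_rot ?Ei.1 ?nx //; lia.
have yin : y \in take d wj.
  have := Hin i.+1 Hi; rewrite nth_iter_rot ?Ei.2 ?ny //; lia.
have [z1 Hz1 s1] := wk_iter_rot j Hw.
have Hz2 := wk_step_swp Hwj xin yin (perm_refl _).
rewrite -[_ ++ _]/(rot d wj) -/(iter j.+1 (rot d) w) in Hz2.
have Hmap m : map (swp x y) (iter m (rot d) w) = iter m (rot d) (map (swp x y) w).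
  by elim: m => //= m <-; rewrite map_rot.
have Hw' : perm_eq (map (swp x y) (iter j.+1 (rot d) w)) w0.
  by case: Hz2 => Hs _ Hl _; apply: perm_trans (perm_swp _ _ _) _;
   rewrite ?(perm_uniq (perm_iter_rot _ _)) ?(perm_mem (perm_iter_rot _ _)) ?St_uniq //; apply: perm_trans Hw; apply: perm_iter_rot.
have [z3 Hz3 s3] := wk_iter_rot (k - j.+1) Hw'.
exists (z1 ++ take d wj ++ z3).
  apply: walk_trans (Hz1) _ => //; apply: walk_trans (Hz2) _ => //.
  by move: Hz3; rewrite Hmap -iterD subnK // iter_rot_id // size_map.
rewrite !size_cat s1 s3 size_takel ?St_size // 1?ltnW //; nia.
Qed.

(** The length is recorded because [m * k] rotations form a closed walk of the same length, a
    comparison on which [ach_degree] rests. *)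
Lemma wk_flex w w' : perm_eq w w0 -> perm_eq w w' ->
  exists m z, wk w z w' /\ size z = m * k * d.
Proof.
move=> Hw Hww'; move: Hw.
suff : perm_eq w w0 -> perm_eq w' w0 /\ exists m z, wk w z w' /\ size z = m * k * d by move=> H /H[].
elim/(@perm_adjacent_ind A): w w' / Hww' => [w|u v w|a x y b].
+ move=> Hw; split=> //; exists 0, [::]; split=> //; apply: walk_refl => //; exact: St_size.
+ move=> Huv Hvw /Huv[/Hvw[Hw [m2 [z2 [Hz2 s2]]]] [m1 [z1 [Hz1 s1]]]]; split=> //.
  exists (m1 + m2), (z1 ++ z2); split; first exact: walk_trans Hz1 Hz2.
  by rewrite size_cat s1 s2 !mulnDl.
+ move=> Hw; split.
    by apply: perm_trans Hw; rewrite perm_cat2l -!(cat1s _ (_ :: b)) -!(cat1s _ b) perm_catCA.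
  by have [z Hz s] := wk_adjacent Hw; exists 1, z; rewrite mul1n.
Qed.

(* The attainable differences of letter counts of two closed walks at [w0]. *)
Definition ach (v : A -> int) : Prop := exists z1 z2, [/\ wk w0 z1 w0, wk w0 z2 w0 &
  forall c, c \in w0 -> ((count_mem c z1)%:Z = (count_mem c z2)%:Z + v c)%R].

Lemma ach_walks v w w' z1 z2 : perm_eq w w0 -> perm_eq w' w0 ->
  wk w z1 w' -> wk w z2 w' ->
  (forall c, c \in w0 -> ((count_mem c z1)%:Z = (count_mem c z2)%:Z + v c)%R) -> ach v.
Proof.
move=> Hw Hw' H1 H2 Hv.
have [m [y [Hy _]]] : exists m y, wk w0 y w /\ size y = m * k * d.
  by apply: wk_flex; rewrite // perm_sym.
have [m' [y' [Hy' _]]] := wk_flex Hw' Hw'.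
exists (y ++ z1 ++ y'), (y ++ z2 ++ y'); split.
+ by apply: walk_trans (Hy) _ => //; apply: walk_trans (H1) _.
+ by apply: walk_trans (Hy) _ => //; apply: walk_trans (H2) _.
move=> c cw; rewrite !count_cat !PoszD (Hv c cw).
by rewrite !GRing.addrA -!GRing.addrA; do 2 congr (_ + _)%R; rewrite GRing.addrC.
Qed.

Lemma ach0 : ach (fun=> 0%R).
Proof.
have H : wk w0 [::] w0 by apply: walk_refl.
by exists [::], [::]; split=> // c _; rewrite GRing.addr0.
Qed.

Lemma achN v : ach v -> ach (fun c => - v c)%R.
Proof.
case=> z1 [z2 [H1 H2 Hv]]; exists z2, z1; split=> // c /Hv ->.
by rewrite GRing.addrK.
Qed.

Lemma achD v v' : ach v -> ach v' -> ach (fun c => v c + v' c)%R.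
Proof.
case=> z1 [z2 [H1 H2 Hv]] [y1 [y2 [G1 G2 Gv]]].
exists (z1 ++ y1), (z2 ++ y2); split.
+ exact: walk_trans H1 G1.
+ exact: walk_trans H2 G2.
+ by move=> c cw; rewrite !count_cat !PoszD Hv // Gv // GRing.addrACA.
Qed.

Lemma ach_eq v v' : (forall c, c \in w0 -> v c = v' c) -> ach v -> ach v'.
Proof.
by move=> E [z1 [z2 [H1 H2 Hv]]]; exists z1, z2; split=> // c cw; rewrite Hv // E.
Qed.

Lemma achM (m : int) v : ach v -> ach (fun c => m * v c)%R.
Proof.
move=> Hv; have Hn (n : nat) : ach (fun c => n%:Z * v c)%R.
  elim: n => [|n IH]; first by apply: ach_eq ach0 => c _; rewrite GRing.mul0r.
  by apply: ach_eq (achD Hv IH) => c _; rewrite -addn1 PoszD GRing.mulrDl GRing.mul1r GRing.addrC.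
case: m => n; first exact: Hn.
by apply: ach_eq (achN (Hn n.+1)) => c _; rewrite NegzE GRing.mulNr.
Qed.

Lemma ach_sum (s : seq A) (f : A -> A -> int) : (forall b, b \in s -> ach (f b)) ->
  ach (fun c => \sum_(b <- s) f b c)%R.
Proof.
elim: s => [|b s IH] H; first by apply: ach_eq ach0 => c _; rewrite big_nil.
have Hb : ach (f b) by apply: H; rewrite mem_head.
have Hs : ach (fun c => \sum_(b <- s) f b c)%R.
  by apply: IH => c cs; apply: H; rewrite inE cs orbT.
by apply: ach_eq (achD Hb Hs) => c _; rewrite big_cons.
Qed.

Lemma count_sum_size z : {subset z <= w0} -> \sum_(c <- w0) count_mem c z = size z.
Proof.
elim: z => [|x z IH] H /=; first by rewrite big1.
rewrite big_split /= IH; last by move=> c cz; apply: H; rewrite inE cz orbT.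
rewrite -add1n; congr (_ + _).
rewrite (bigD1_seq x) ?H ?mem_head //= eqxx big1 ?addn0 // => c cx.
by rewrite eq_sym (negPf cx).
Qed.

Lemma wk_letters w z w' : wk w z w' -> {subset z <= w0}.
Proof.
case=> Hw' /dvdnP[N HN] Hl _ c cz.
have [i Hi Ei] : exists2 i, i < size z & nth c z i = c by exists (index c z); rewrite ?index_mem ?nth_index.
have H := divn_eq i d; have Hm : i %% d < d by rewrite ltn_mod.
have Hs : i %/ d * d + k <= size (z ++ w').
  by rewrite size_cat Hw' leq_add2r (leq_trans _ (ltnW Hi)) // {2}H leq_addr.
rewrite -(perm_mem (Hl _ Hs)) -Ei.
have -> : nth c z i = nth c (take k (drop (i %/ d * d) (z ++ w'))) (i %% d).
  by rewrite nth_take ?nth_drop -?H ?nth_cat ?Hi // (ltn_trans Hm).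
apply: mem_nth; rewrite size_takel ?(ltn_trans Hm) // size_drop; lia.
Qed.

(** One rotation followed by a walk back to [w0] has length [m * k * d + d], whereas [m * k]
    rotations close up with length [m * k * d]. *)
Lemma ach_degree : exists2 v, ach v & (\sum_(c <- w0) v c = d%:Z)%R.
Proof.
have H1 := wk_rot (perm_refl w0).
have [m [y [Hy sy]]] : exists m y, wk (rot d w0) y w0 /\ size y = m * k * d.
  by apply: wk_flex; rewrite perm_rot.
have [z Hz sz] := wk_iter_rot (m * k) (perm_refl w0).
have E : iter (m * k) (rot d) w0 = w0.
  by elim: (m) => //= j IH; rewrite mulSn iterD IH iter_rot_id.
rewrite E {E} in Hz.
have Hy1 := walk_trans H1 Hy.
pose v c := ((count_mem c (take d w0 ++ y))%:Z - (count_mem c z)%:Z)%R.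
exists v.
  by apply: (ach_walks (z1 := take d w0 ++ y) (z2 := z) _ _ Hy1 Hz) => // c _; rewrite /v GRing.addrC GRing.subrK.
rewrite /v GRing.sumrB -!(big_morph Posz PoszD (erefl _)).
rewrite !count_sum_size; try exact: wk_letters Hz; try exact: wk_letters Hy1.
by rewrite size_cat sz sy size_takel ?w0k ?(ltnW dk) // PoszD GRing.addrK.
Qed.

Section Steer.
Variables (a b : A).
Hypotheses (ab : a != b) (aw : a \in w0) (bw : b \in w0).

(* [b] goes first and returns after [q] steps, [a] goes last and returns after [q + 1]. *)
Definition arrange (u : seq A) : seq A :=
  filter (pred1 b) u ++ filter [pred c | (c != a) && (c != b)] u ++ filter (pred1 a) u.
Definition steer (w : seq A) : seq A := drop d w ++ arrange (take d w).

Lemma perm_arrange u : perm_eq (arrange u) u.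
Proof.
rewrite perm_sym -(perm_filterC (pred1 b) u) perm_cat2l perm_sym perm_catC perm_sym.
rewrite -(perm_filterC (pred1 a) (filter (predC (pred1 b)) u)) -!filter_predI.
have <- : filter (pred1 a) u = filter (predI (pred1 a) (predC (pred1 b))) u.
  by apply: eq_filter => c /=; case: eqVneq => //= ->; rewrite ab.
by rewrite perm_cat2l; apply/permP => p; congr (count p _); apply: eq_filter => c /=.
Qed.

Lemma size_arrange u : size (arrange u) = size u.
Proof. exact: perm_size (perm_arrange u). Qed.

Lemma index_arrange_b u : b \in u -> index b (arrange u) = 0.
Proof.
move=> bu; rewrite /arrange index_cat mem_filter /= eqxx bu.
have : b \in filter (pred1 b) u by rewrite mem_filter /= eqxx.
have /allP : all (pred1 b) (filter (pred1 b) u) by apply: filter_all.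
by case: (filter _ u) => //= c t H _; rewrite (eqP (H c (mem_head _ _))) eqxx.
Qed.

Lemma index_arrange_a u : uniq u -> a \in u -> index a (arrange u) = (size u).-1.
Proof.
move=> Hu au; have E : filter (pred1 a) u = [:: a] by rewrite filter_pred1_uniq.
rewrite -(size_arrange u) /arrange E !index_cat !mem_filter /= eqxx (negPf ab) /=.
by rewrite !size_cat /= addn1 addnS addn0.
Qed.

Lemma perm_steer w : perm_eq (steer w) w.
Proof.
by rewrite /steer perm_catC -{3}(cat_take_drop d w) perm_cat2r perm_arrange.
Qed.

Lemma wk_steer w : perm_eq w w0 -> wk w (take d w) (steer w).
Proof.
move=> Hw; rewrite -{1}(cat_take_drop d w); apply: wk_step (perm_arrange _).
  by rewrite size_takel // St_size // ltnW.
by rewrite cat_take_drop.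
Qed.

Lemma index_steer c w : perm_eq w w0 -> c \in w0 ->
  index c (steer w) = if index c w < d then k - d + index c (arrange (take d w)) else index c w - d.
Proof.
move=> Hw cw0; have cw : c \in w by rewrite (perm_mem Hw).
have := St_uniq Hw; rewrite -{1}(cat_take_drop d w) cat_uniq => /and3P[_ /hasPn Hn _].
have Ht : size (take d w) = d by rewrite size_takel // St_size // ltnW.
have Hi : (index c w < d) = (c \in take d w) by rewrite in_take_leq // St_size // ltnW.
rewrite Hi /steer index_cat; case: ifP => cd; case: ifP => ct.
+ by move: (Hn c cd); rewrite ct.
+ by rewrite -[in RHS](cat_take_drop d w) index_cat ct Ht addKn.
+ by rewrite size_drop St_size.
+ by move: cw; rewrite -{1}(cat_take_drop d w) mem_cat ct cd.
Qed.

Lemma steer_spec w : perm_eq w w0 -> index a w = k.-1 -> index b w = k - d ->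
  forall j, exists z, [/\ wk w z (iter j steer w),
    index a (iter j steer w) = k.-1 - j %% q.+1 * d,
    index b (iter j steer w) = k - d - j %% q * d,
    count_mem a z = j %/ q.+1 & count_mem b z = j %/ q].
Proof.
(* The two return times come from here: the last index is [q * d + (r - 1)], while the first index
   of the last block is [(q - 1) * d + r]. *)
move=> Hw Ha Hb; have EKa : k.-1 = q.+1.-1 * d + r.-1 by have := kE; have := r0; lia.
have EKb : k - d = q.-1 * d + r by have := kE; have := q0; case: q => [|m _ {1}->] //; rewrite mulSn; lia.
have ra : r.-1 < d by apply: leq_ltn_trans rd; apply: leq_pred.
elim=> [|j [z [Hz Ia Ib Ca Cb]]].
  exists [::]; rewrite !mod0n !div0n !mul0n !subn0; split=> //.
  by apply: walk_refl => //; apply: St_size.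
set wj := iter j steer w in Hz Ia Ib *.
have Hj : perm_eq wj w0.
  by apply: perm_trans Hw; rewrite /wj; elim: (j) => //= i IH; apply: perm_trans IH; apply: perm_steer.
have Hsz : size wj = k by apply: St_size.
have Ht : size (take d wj) = d by rewrite size_takel // Hsz ltnW.
have Hut : uniq (take d wj) by rewrite take_uniq // St_uniq.
have Hin c : c \in w0 -> (c \in take d wj) = (index c wj < d).
  by move=> cw; rewrite in_take_leq ?Hsz ?(ltnW dk) //.
have [aj aj'] := return_time j (ltn0Sn q) ra EKa.
have [bj bj'] := return_time j q0 rd EKb.
exists (z ++ take d wj); split.
+ by apply: walk_trans (Hz) _ => //; apply: wk_steer.
+ rewrite /= index_steer // Ia aj aj'; case: ifP => // Hd.
  rewrite index_arrange_a ?Hin ?Ia ?aj // Ht.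
  by move: (d0) (dk); clear; lia.
+ rewrite /= index_steer // Ib bj bj'; case: ifP => // Hd.
  by rewrite index_arrange_b ?Hin ?Ib ?bj // addn0.
+ by rewrite count_cat Ca count_uniq_mem // Hin // Ia aj divnS // addnC.
+ by rewrite count_cat Cb count_uniq_mem // Hin // Ib bj divnS ?q0 // addnC.
Qed.

(** Steering runs from one moment at which [a] and [b] are both about to be dropped to the next one,
    a period of [q * (q + 1)] steps; in between [b] occurs [q] times and [a] only [q - 1] times. The
    second walk has the two letters exchanged throughout this period, which is possible because the
    exchange can be made and undone when both are in the front block. *)
Lemma ach_exchange : ach (fun c => (c == b)%:Z - (c == a)%:Z)%R.
Proof.
have [W HW [Wa Wb]] : exists2 W, perm_eq W w0 & a \in take d W /\ b \in take d W.
  have Hp : perm_eq (a :: b :: filter (predC (pred2 a b)) w0) w0.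
    apply: uniq_perm => //=; first by rewrite !inE !mem_filter /= !eqxx /= orbT (negPf ab) filter_uniq.
    move=> c; rewrite !inE mem_filter /=.
    by case: (eqVneq c a) => [->|_] /=; rewrite ?aw //; case: (eqVneq c b) => [->|].
  exists (a :: b :: filter (predC (pred2 a b)) w0) => //.
  by case: (d) d1 => [|[|m]] // _; rewrite /= !inE !eqxx !orbT.
have szt w : perm_eq w w0 -> size (take d w) = d by move=> H; rewrite size_takel // St_size // ltnW.
have Hin c w : perm_eq w w0 -> c \in w0 -> (c \in take d w) = (index c w < d).
  by move=> H cw; rewrite in_take_leq ?St_size ?(ltnW dk) //.
have Hs0 : perm_eq (steer W) w0 by apply: perm_trans HW; apply: perm_steer.
have Ia : index a (steer W) = k.-1.
  rewrite index_steer // -Hin // Wa index_arrange_a // ?szt //; last by rewrite take_uniq // St_uniq.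
  by move: (d0) (dk); clear; lia.
have Ib : index b (steer W) = k - d.
  by rewrite index_steer // -Hin // Wb index_arrange_b // addn0.
have [z [Hz Ja Jb Ca Cb]] := steer_spec Hs0 Ia Ib (q * q.+1).-1.
set S := iter _ steer _ in Hz Ja Jb.
have HS : perm_eq S w0.
  by apply: perm_trans Hs0; rewrite /S; elim: (_.-1) => //= i IH; apply: perm_trans IH; apply: perm_steer.
(* The number of steps is [-1] modulo both [q] and [q + 1], so both letters have arrived in the
   front block; the two quotients [q - 1] and [q] are their numbers of occurrences. *)
have Eq : (q * q.+1).-1 = q.-1 * q.+1 + q by move: q0; move: q => x; clear; nia.
have Eq' : (q * q.+1).-1 = q * q + q.-1 by move: q0; move: q => x; clear; nia.
have Sa : a \in take d S.
  rewrite Hin // Ja Eq modnMDl modn_small //.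
  by move: kE rd r0; move: q r => x y; clear; nia.
have Sb : b \in take d S.
  rewrite Hin // Jb Eq' modnMDl modn_small; last by rewrite prednK ?q0.
  by move: kE rd q0; move: q r => x y; clear; nia.
have {}Ca : count_mem a z = q.-1 by rewrite Ca Eq divnMDl // (divn_small (ltnSn q)) addn0.
have {}Cb : count_mem b z = q.
  rewrite Cb Eq' divnMDl ?q0 // (@divn_small q.-1 q) ?addn0 // prednK //; exact: q0.
have H1 := walk_trans (wk_steer HW) (walk_trans Hz (wk_steer HS)).
have H2a := wk_step_swp HW Wa Wb (perm_arrange _).
have H2b := wk_swp aw bw Hz.
have HS' : perm_eq (map (swp a b) S) w0.
  by apply: perm_trans (HS); apply: perm_swp; [exact: St_uniq HS|rewrite (perm_mem HS) aw|rewrite (perm_mem HS) bw].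
have H2c : wk (map (swp a b) S) (map (swp a b) (take d S)) (steer S).
  have := @wk_step_swp a b _ (map (swp a b) (arrange (take d S))) HS'.
  rewrite -map_take -map_drop.
  have Hmem c : (swp a b c \in take d S) -> c \in map (swp a b) (take d S).
    by move=> H; rewrite -[c](swpK a b) map_f.
  rewrite -map_cat (mapK (swpK a b)).
  apply; last by rewrite perm_map ?perm_arrange.
  + by apply: Hmem; rewrite /swp eqxx.
  + by apply: Hmem; rewrite /swp eqxx; case: eqVneq.
have H2 := walk_trans H2a (walk_trans H2b H2c).
have HW1 : perm_eq (steer S) w0 by apply: perm_trans HS; apply: perm_steer.
apply: (ach_walks HW HW1 H1 H2) => c cw; rewrite !count_cat !PoszD !count_swp.
have Hu : uniq (take d S) by rewrite take_uniq // St_uniq.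
rewrite /swp; case: (eqVneq c a) => [->|ca].
  rewrite (negPf ab) Ca Cb !(count_uniq_mem _ Hu) Sa Sb.
  by move: q0; move: q => x; clear; lia.
case: (eqVneq c b) => [->|cb]; last by move: (count_mem c _) => x; clear; lia.
rewrite Ca Cb !(count_uniq_mem _ Hu) Sa Sb.
by move: q0; move: q => x; clear; lia.
Qed.

End Steer.

Lemma exchange_words a b : a \in w0 -> b \in w0 -> a != b ->
  exists z1 z2, [/\ wk w0 z1 w0, wk w0 z2 w0 &
    forall c, c \in w0 -> count_mem c z1 + (c == b) = count_mem c z2 + (c == a)].
Proof.
move=> aw bw ab; have ba : b != a by rewrite eq_sym.
have [z1 [z2 [H1 H2 H]]] := ach_exchange ba bw aw.
by exists z1, z2; split=> // c /H; lia.
Qed.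

(** The attainable differences form a group that contains a vector of total [d] and all exchanges of
    one letter for another; moving every coordinate of that vector to [a] leaves [d] times the unit
    vector of [a]. *)
Lemma insertion_words a : a \in w0 ->
  exists z1 z2, [/\ wk w0 z1 w0, wk w0 z2 w0 &
    forall c, c \in w0 -> count_mem c z1 = count_mem c z2 + d * (c == a)].
Proof.
move=> aw; have [v Hv sv] := ach_degree.
have He b : b \in w0 -> ach (fun c => v b * ((c == a)%:Z - (c == b)%:Z))%R.
  move=> bw; apply: achM; case: (eqVneq b a) => [->|ba]; last exact: ach_exchange.
  by apply: ach_eq ach0 => c _; rewrite GRing.subrr.
have [z1 [z2 [H1 H2 H]]] := achD Hv (ach_sum He).
exists z1, z2; split=> // c cw; have := H c cw.
have -> : (\sum_(b <- w0) v b * ((c == a)%:Z - (c == b)%:Z) = d%:Z * (c == a)%:Z - v c)%R.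
  under eq_bigr do rewrite GRing.mulrBr.
  rewrite GRing.sumrB -GRing.mulr_suml sv; congr (_ - _)%R.
  rewrite (bigD1_seq c) //= eqxx GRing.mulr1 big1 ?GRing.addr0 // => b bc.
  by rewrite eq_sym (negPf bc) GRing.mulr0.
by rewrite mulnC; case: (c == a); lia.
Qed.

End CompletePartite.

(** * Paths in a hypergraph *)

Section Edges.
Variable T : finType.
Implicit Types (E : {set {set T}}) (s p : seq T).

Definition edg E s : bool := [set x in s] \in E.

Lemma edg_perm E s s' : perm_eq s s' -> edg E s = edg E s'.
Proof.
move=> H; rewrite /edg; congr (_ \in E); apply/setP => x; rewrite !inE; exact: perm_mem.
Qed.

Lemma edg_uniq k E s : kgraph k E -> size s = k -> edg E s -> uniq s.
Proof.
move=> H Hs /H; rewrite cardsE => Hc; apply/card_uniqP; by rewrite Hc.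
Qed.

End Edges.

Section LpathBool.
Variables (k d : nat).
Hypothesis d0 : 0 < d.

Definition lpathb (A : Type) (P : pred (seq A)) p :=
  all (fun i => (i * d + k <= size p) ==> P (take k (drop (i * d) p))) (iota 0 (size p).+1).

Lemma lpathP (A : Type) (P : pred (seq A)) p : reflect (lpath k d P p) (lpathb P p).
Proof.
apply: (iffP allP) => [H i Hi|H i _]; last by apply/implyP; apply: H.
have /H/implyP : i \in iota 0 (size p).+1 by rewrite mem_iota; nia.
exact.
Qed.
End LpathBool.

Section Hamilton.
Variables (T : finType) (E : {set {set T}}) (k l : nat).
Local Notation d := (k - l).
Local Notation n := #|T|.
Hypotheses (kE : kgraph k E) (l0 : 0 < l) (lk : l < k) (dn : d %| n) (nk : 2 * k <= n).

(** Appending the first [l] vertices turns the windows across the end into ordinary ones. Since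
    [2 * k <= n], any [k + d] cyclically consecutive entries are distinct, so two consecutive
    windows share just the [l] entries in the middle. *)
Lemma hamilton_of_cycle (c : seq T) : uniq c -> c =i T ->
  lpath k d (edg E) (c ++ take l c) -> has_hamilton_lcycle k l E.
Proof.
move=> cu cT Hl; have d0 : 0 < d by rewrite subn_gt0.
have cn : size c = n by rewrite -(card_uniqP cu); apply: eq_card.
have Hm i : i < n %/ d -> i * d + d <= n.
  by move=> Hi; rewrite -mulSnr -(divnK dn) leq_mul2r Hi orbT.
have Hwin i : i < n %/ d -> window k c (i * d) \in E.
  move=> /Hm Hi; rewrite /window cn modn_small; last lia.
  have Hi2 : i * d + k <= size (c ++ take l c) by rewrite size_cat size_takel cn; lia.
  rewrite (_ : take k _ = take k (drop (i * d) (c ++ take l c))); first exact: Hl.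
  have Hu : size (drop (i * d) c) = n - i * d by rewrite size_drop cn.
  rewrite /rot drop_cat cn; case: ltnP => Hx; last lia.
  rewrite !take_cat Hu; case: ltnP => // Hx2; congr (_ ++ _).
  by rewrite !take_takel //; lia.
pose C := [set window k c (i * (k - l)) | i : 'I_(n %/ (k - l))].
have CE : C \subset E by apply/subsetP => e /imsetP[i _ ->]; apply: Hwin.
exists C => //; split; first by move=> e /(subsetP CE)/kE.
exists c; split=> // i.
set c' := rot (i * d %% size c) c.
have Hi := Hm _ (ltn_ord i).
have -> : window k c (i.+1 * d) = [set x in take k (rot d c')].
  rewrite /window /c' cn [i * d %% n]modn_small; last lia.
  rewrite -rotD ?cn; last by lia.
  have -> : d + i * d = i.+1 * d by rewrite mulSn.
  case: (ltnP (i.+1 * d) n) => Hx; first by rewrite modn_small.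
  by have -> : i.+1 * d = n; [rewrite mulSn; lia|rewrite modnn rot0 -cn rot_size].
have c'u : uniq c' by rewrite rot_uniq.
have c'n : size c' = n by rewrite size_rot.
rewrite /window -/c'.
pose a := take d c'; pose b := take l (drop d c'); pose e := take d (drop k c').
have Ek : take k c' = a ++ b.
  by rewrite /a /b -{1}(subnK (ltnW lk)) takeD.
have Ek2 : take k (rot d c') = b ++ e.
  rewrite /rot takel_cat; last by rewrite size_drop c'n; lia.
  rewrite /b /e -{1}(subnKC (ltnW lk)) takeD drop_drop; congr (_ ++ take _ (drop _ _)); lia.
have Hab : uniq (a ++ b ++ e).
  suff -> : a ++ b ++ e = take (k + d) c' by rewrite take_uniq.
  by rewrite takeD Ek -catA.
have bs : size b = l by rewrite size_takel // size_drop c'n; lia.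
rewrite Ek Ek2 (_ : _ :&: _ = [set x in b]).
  rewrite cardsE -[RHS]bs; apply/card_uniqP.
  by move: Hab; rewrite !cat_uniq => /and3P[_ _ /and3P[]].
apply/setP => x; rewrite !inE !mem_cat; move: Hab; rewrite !cat_uniq => /and3P[_ /hasPn Hn _].
case xb : (x \in b); rewrite ?orbT //= orbF.
apply/negbTE/negP => /andP[xa xe]; have : x \notin a by apply: Hn; rewrite mem_cat xe orbT.
by rewrite xa.
Qed.

End Hamilton.

(** * Joining paths at their ends *)

Section Linking.
Variables (A : eqType) (k d : nat) (P : seq A -> Prop).
Hypotheses (d0 : 0 < d) (dk : d < k).
Local Notation l := (k - d).

Definition start (p : seq A) := take l p.
Definition finish (p : seq A) := drop (size p - l) p.
(** By the congruence [finish p] begins at a multiple of [d], so that windows continuing past the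
    end of [p] remain aligned. *)
Definition pth p := [/\ lpath k d P p, l <= size p & d %| size p - l].

Lemma size_start p : pth p -> size (start p) = l.
Proof. by case=> _ H _; rewrite size_takel. Qed.

Lemma size_finish p : pth p -> size (finish p) = l.
Proof. by case=> _ H _; rewrite size_drop subKn. Qed.

Lemma pth_link p z p' : pth p -> pth p' -> d %| l + size z ->
  lpath k d P (finish p ++ z ++ start p') ->
  [/\ pth (p ++ z ++ p'), start (p ++ z ++ p') = start p & finish (p ++ z ++ p') = finish p'].
Proof.
move=> Hp Hp' Hz Hl; have sf := size_finish Hp; have ss := size_start Hp'.
case: Hp Hp' => Lp Sp Dp [Lp' Sp' Dp'].
have Ep : p = take (size p - l) p ++ finish p by rewrite cat_take_drop.
have Ep' : p' = start p' ++ drop l p' by rewrite cat_take_drop.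
have sa : size (take (size p - l) p) = size p - l by rewrite size_takel // leq_subr.
have L1 : lpath k d P (p ++ z ++ start p').
  rewrite Ep -catA; apply: lpath_cat; rewrite ?sa ?sf -?Ep //; lia.
have L2 : lpath k d P (p ++ z ++ p').
  have -> : p ++ z ++ p' = (p ++ z) ++ start p' ++ drop l p' by rewrite -catA -Ep'.
  apply: lpath_cat; rewrite ?ss -?Ep' -?catA //; last lia.
  by rewrite size_cat -(subnK Sp) -addnA dvdn_add.
split.
+ split=> //; first by rewrite !size_cat; lia.
  rewrite !size_cat (_ : _ - l = (size p - l) + ((l + size z) + (size p' - l))); last lia.
  by apply: dvdn_add => //; apply: dvdn_add.
+ by rewrite /start takel_cat.
+ rewrite /finish !size_cat catA drop_cat size_cat ltnNge (_ : _ <= _); last lia.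
  by congr drop; lia.
Qed.

(** Only the ends of the paths enter. Hence a path may later be replaced by another one with the
    same ends without touching the links, which is how absorption takes place. *)
Fixpoint linked (X : seq A) (zs ps : seq (seq A)) : Prop :=
  match zs, ps with
  | z :: zs', p :: ps' => [/\ d %| l + size z, lpath k d P (X ++ z ++ start p) & linked (finish p) zs' ps']
  | [::], [::] => True
  | _, _ => False
  end.

Fixpoint joined (p : seq A) (zs ps : seq (seq A)) : seq A :=
  match zs, ps with
  | z :: zs', p' :: ps' => joined (p ++ z ++ p') zs' ps'
  | _, _ => p
  end.

Lemma pth_joined p zs ps : pth p -> (forall p', p' \in ps -> pth p') ->
  linked (finish p) zs ps ->
  [/\ pth (joined p zs ps), start (joined p zs ps) = start p,
      finish (joined p zs ps) = finish (last p ps) &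
      perm_eq (joined p zs ps) (p ++ flatten zs ++ flatten ps)].
Proof.
elim: zs p ps => [|z zs IH] p [|p' ps] //= Hp Hps.
  by move=> _; rewrite cats0; split.
case=> Hz Hl Hlk; have Hp' : pth p' by apply: Hps; rewrite mem_head.
have [H1 H2 H3] := pth_link Hp Hp' Hz Hl.
have [G1 G2 G3 G4] := IH (p ++ z ++ p') ps H1 (fun x hx => Hps x (mem_behead (s := p' :: ps) hx)) (eq_ind_r (fun X => linked X zs ps) Hlk H3).
split=> //; first by rewrite G2.
+ by rewrite G3; case: (ps) => //=.
+ apply: perm_trans G4 _; rewrite -!catA !perm_cat2l.
  by rewrite perm_catCA.
Qed.

Lemma linked_replace X zs ps ps' : linked X zs ps -> size ps = size ps' ->
  (forall i, start (nth [::] ps i) = start (nth [::] ps' i)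
          /\ finish (nth [::] ps i) = finish (nth [::] ps' i)) ->
  linked X zs ps'.
Proof.
elim: zs X ps ps' => [|z zs IH] X [|p ps] [|p' ps'] //= [H1 H2 H3] [Hs] He.
have [E1 E2] := He 0; rewrite /= in E1 E2; split=> //; first by rewrite -E1.
by rewrite -E2; apply: IH H3 Hs _ => i; apply: (He i.+1).
Qed.

Lemma cycle_of_linked p z zs ps : pth p -> (forall p', p' \in ps -> pth p') ->
  linked (finish p) zs ps -> d %| l + size z ->
  lpath k d P (finish (last p ps) ++ z ++ start p) ->
  exists c, [/\ perm_eq c (p ++ z ++ flatten zs ++ flatten ps), d %| size c &
    lpath k d P (c ++ take l c)].
Proof.
move=> Hp Hps Hl Hz Hc; have [H1 H2 H3 H4] := pth_joined Hp Hps Hl.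
exists (joined p zs ps ++ z); split.
+ by rewrite perm_catC perm_sym perm_catCA perm_cat2l perm_sym.
+ case: H1 => _ Hs Hd; rewrite size_cat (_ : _ + _ = size (joined p zs ps) - l + (l + size z)); last lia.
  by rewrite dvdn_add.
+ have H1' := size_finish H1; case: H1 => L Hs Hd.
  rewrite takel_cat //.
  rewrite -/(start _) H2 -catA -[joined p zs ps](cat_take_drop (size (joined p zs ps) - l)) -/(finish _).
  rewrite -[X in lpath _ _ _ X]catA; apply: lpath_cat; rewrite ?H1' ?H3 //; last by rewrite -H3 cat_take_drop.
    by rewrite size_takel // leq_subr.
  lia.
Qed.

End Linking.

(** * Connecting two paths *)

Section SequentialDensity.
Variable T : finType.
Local Notation n := #|T|.

Lemma tsum_rcons m (f : seq T -> nat) :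
  tsum m.+1 f = tsum m (fun s => \sum_(v : T) f (rcons s v)).
Proof.
rewrite -addn1 tsum_cat; apply: eq_tsum => s _ /=.
by apply: eq_bigr => v _; rewrite cats1.
Qed.

Lemma dense_seq c m (Inv : pred (seq T)) : Inv [::] ->
  (forall s, size s < m -> Inv s -> n <= c * #|[pred v | Inv (rcons s v)]|) ->
  dense (c ^ m) m Inv.
Proof.
rewrite /dense => H0; elim: m => [|m IH] H; first by rewrite /= H0.
rewrite tsum_rcons (expnSr n) (expnSr c).
have {}IH := IH (fun s Hs => H s (leqW Hs)).
apply: leq_trans (leq_mul IH (leqnn n)) _.
rewrite -!mulnA leq_mul2l -tsum_mulr -tsum_mull; apply/orP; right.
apply: leq_tsum => s Hs; case Is : (Inv s) => //=; rewrite mul1n.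
apply: leq_trans (H s _ Is) _; first by rewrite Hs.
by rewrite leq_mul2l -sum1_card big_mkcond leq_sum ?orbT // => v _; rewrite inE; case: (Inv _).
Qed.

Lemma dense_cat K1 K2 a b (P : pred (seq T)) (Q : seq T -> pred (seq T)) :
  dense K1 a P -> (forall s, size s = a -> P s -> dense K2 b (Q s)) ->
  dense (K1 * K2) (a + b) (fun s => P (take a s) && Q (take a s) (drop a s)).
Proof.
rewrite /dense => H1 H2; rewrite expnD tsum_cat.
apply: leq_trans (leq_mul H1 (leqnn _)) _.
rewrite -!mulnA leq_mul2l -tsum_mulr -tsum_mull; apply/orP; right.
apply: leq_tsum => s Hs; case Ps : (P s) => //=; rewrite mul1n.
apply: leq_trans (H2 s Hs Ps) _; rewrite leq_mul2l; apply/orP; right.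
by apply: leq_tsum => s' _; rewrite take_size_cat // drop_size_cat // Ps.
Qed.

Lemma card_avoid (P : pred T) (F : seq T) K : n <= K * #|P| -> 2 * K * size F <= n ->
  n <= 2 * K * #|[pred v | P v && (v \notin F)]|.
Proof.
move=> H HF; have E : #|P| <= #|[pred v | P v && (v \notin F)]| + size F.
  apply: leq_trans (leq_add (leqnn _) (card_size F)).
  rewrite -cardUI; apply: leq_trans (leq_addr _ _); apply: subset_leq_card.
  by apply/subsetP => v; rewrite !inE unfold_in => ->; case: (v \in F).
have := leq_mul (leqnn K) E; rewrite mulnDr; nia.
Qed.

End SequentialDensity.

Section Extension.
Variables (T : finType) (E : {set {set T}}) (k d K0 : nat).
Local Notation n := #|T|.
Hypotheses (k1 : 0 < k) (d0 : 0 < d) (dk : d < k) (K00 : 0 < K0).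

Definition codegree_ge :=
  forall s : seq T, uniq s -> size s = k.-1 -> n <= K0 * #|[pred v | edg E (rcons s v)]|.
Hypothesis HE : codegree_ge.

Lemma ext_dense (Y F : seq T) m : size Y < k -> uniq Y ->
  2 * K0 * (k + m + size F) <= n ->
  dense ((2 * K0) ^ m) m (fun s => [&& uniq (Y ++ s), all [predC F] s & lpathb k d (edg E) (Y ++ s)]).
Proof.
move=> sY uY Hn; apply: dense_seq.
  rewrite cats0 uY /=; apply/(lpathP _ d0) => i Hi; lia.
move=> s Hs /and3P[us aF /(lpathP _ d0) Lp].
set p := Y ++ s in us Lp; have sp : size p <= k + m by rewrite size_cat; lia.
pose Inv' v := edg E (rcons (drop (size p - k.-1) p) v).
have Hfin (v : T) : v \notin p ++ F -> (d %| (size p).+1 - k -> k <= (size p).+1 -> Inv' v) ->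
    [&& uniq (Y ++ rcons s v), all [predC F] (rcons s v) & lpathb k d (edg E) (Y ++ rcons s v)].
  rewrite mem_cat negb_or => /andP[vp vF] H.
  rewrite -rcons_cat -/p rcons_uniq vp us all_rcons /= vF aF /=.
  apply/(lpathP _ d0) => i; rewrite size_rcons => Hi.
  case: (leqP (i * d + k) (size p)) => Hi'; first by rewrite -cats1 take_drop_catl //; apply: Lp.
  have Ei : i * d = size p - k.-1 by lia.
  rewrite drop_rcons; last by lia.
  rewrite take_oversize ?size_rcons ?size_drop; last by lia.
  by rewrite Ei; apply: H; last lia; rewrite (_ : _ - k = i * d) ?dvdn_mull //; lia.
have Hpf : 2 * K0 * size (p ++ F) <= n.
  apply: leq_trans Hn; rewrite leq_mul2l size_cat; lia.
have [Hw|Hw] := boolP ((d %| (size p).+1 - k) && (k <= (size p).+1)).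
  have Hc : n <= K0 * #|[pred v | Inv' v]|.
    apply: HE; first by rewrite drop_uniq.
    case/andP: Hw => _ Hw; rewrite size_drop; lia.
  apply: leq_trans (card_avoid Hc Hpf) _; rewrite leq_mul2l; apply/orP; right.
  apply: subset_leq_card; apply/subsetP => v; rewrite !inE /= => /andP[H1 H2].
  by apply: Hfin.
have Hc : n <= K0 * #|[pred v : T | true]|.
  by rewrite -{1}[n]mul1n leq_mul.
apply: leq_trans (card_avoid Hc Hpf) _; rewrite leq_mul2l; apply/orP; right.
apply: subset_leq_card; apply/subsetP => v; rewrite !inE /= => H2.
by apply: Hfin => // H3 H4; rewrite H3 H4 in Hw.
Qed.

(* The edges of the chain exchange the vertices of [xs] for those of [ys] one at a time. *)
Lemma chain_dense (x0 : T) (xs ys : seq T) : size xs = k -> size ys = k -> uniq (xs ++ ys) ->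
  dense (K0 ^ k.-1) k.-1 (fun u => all (fun i =>
    edg E (rcons (take i.+1 ys ++ drop i.+2 xs) (nth x0 u i))) (iota 0 (size u))).
Proof.
move=> sx sy; rewrite cat_uniq => /and3P[ux /hasPn Hn uy]; apply: dense_seq => // s Hs /allP Hs'.
apply: leq_trans (HE (s := take (size s).+1 ys ++ drop (size s).+2 xs) _ _) _.
+ rewrite cat_uniq take_uniq // drop_uniq // andbT; apply/hasPn => x /mem_drop Hx.
  by apply: contraL Hx => /mem_take/Hn.
+ rewrite size_cat size_drop size_takel ?sx ?sy; lia.
rewrite leq_mul2l; apply/orP; right; apply: subset_leq_card; apply/subsetP => v; rewrite !inE => H.
apply/allP => i; rewrite mem_iota size_rcons add0n /= => Hi; rewrite nth_rcons.
case: ltnP => Hi2; first by apply: Hs'; rewrite mem_iota.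
by have -> : i = size s by [lia]; rewrite eqxx.
Qed.

End Extension.

Section Words.
Variables (A : eqType) (k d : nat) (P : seq A -> Prop).
Hypotheses (d1 : 1 < d) (dk : d < k) (ndk : ~~ (d %| k)).
Hypothesis Pperm : forall s s', perm_eq s s' -> P s -> P s'.

Lemma walk_flex w w' : uniq w -> size w = k -> P w -> perm_eq w w' ->
  exists z, walk k d P w z w'.
Proof.
move=> uw sw Pw Hw; have [m [z [[H1 H2 H3 H4] _]]] := wk_flex d1 dk ndk sw uw (perm_refl w) Hw.
exists z; split=> //; apply: lpath_sub H3 => s _ Hs; apply: Pperm Pw; by rewrite perm_sym.
Qed.

(** Inside the edge [w] the letters are permuted until [a] and [b] are among the first [d], which is
    possible as [d >= 2]. In the next step these two are dropped for good and [a'], [b'] enter in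
    their place; a permutation inside the new edge finishes the walk. *)
Lemma walk_change a b a' b' c w w' : uniq w -> uniq w' -> size w = k ->
  perm_eq w (a :: b :: c) -> perm_eq w' (a' :: b' :: c) -> P w -> P w' ->
  exists z, walk k d P w z w'.
Proof.
move=> uw uw' sw Hw Hw' Pw Pw'; have dO := ltnW d1.
have sc : size c = k - 2 by move: (perm_size Hw); rewrite sw /=; lia.
have Hc := cat_take_drop (d - 2) c.
have st : size (take (d - 2) c) = d - 2 by rewrite size_takel // sc; lia.
pose u := a :: b :: take (d - 2) c; pose u' := a' :: b' :: take (d - 2) c; pose v := drop (d - 2) c.
have E1 : perm_eq w (u ++ v) by rewrite /u /v /= Hc.
have E2 : perm_eq (v ++ u') w' by rewrite perm_catC /u' /v /= Hc perm_sym.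
have [z1 H1] := walk_flex uw sw Pw E1.
have sw' : size (v ++ u') = k by rewrite size_cat /= size_drop st sc; lia.
have [z3 H3] : exists z, walk k d P (v ++ u') z w'.
  apply: walk_flex => //; first by rewrite (perm_uniq E2).
  by apply: Pperm Pw'; rewrite perm_sym.
have H2 : walk k d P (u ++ v) u (v ++ u').
  apply: walk_step => //; rewrite ?size_cat /= ?st ?size_drop ?sc; try lia.
    exact: Pperm E1 Pw.
  by apply: Pperm Pw'; rewrite perm_sym.
by exists (z1 ++ u ++ z3); apply: walk_trans (H1) _ => //; apply: walk_trans (H2) H3.
Qed.

Lemma walk_letters (Q : A -> Prop) w z w' : (forall s, P s -> forall c, c \in s -> Q c) ->
  walk k d P w z w' -> forall c, c \in z -> Q c.
Proof.
move=> HQ [Hw' /dvdnP[N HN] Hl _] c cz.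
have [i Hi Ei] : exists2 i, i < size z & nth c z i = c by exists (index c z); rewrite ?index_mem ?nth_index.
have H := divn_eq i d; have Hm : i %% d < d by rewrite ltn_mod ltnW.
have Hs : i %/ d * d + k <= size (z ++ w').
  by rewrite size_cat Hw' leq_add2r (leq_trans _ (ltnW Hi)) // {2}H leq_addr.
apply: HQ (Hl _ Hs) _ _.
have {1}-> : c = nth c (take k (drop (i %/ d * d) (z ++ w'))) (i %% d).
  by rewrite nth_take ?nth_drop -?H ?nth_cat ?Hi ?Ei // (ltn_trans Hm).
apply: mem_nth; rewrite size_takel ?(ltn_trans Hm) // size_drop; lia.
Qed.

End Words.

Section Realize.
Variables (T : finType) (E : {set {set T}}) (k d : nat) (x0 : T).

(* A letter below [r] is a variable; the others denote the fixed vertices [cs]. *)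
Definition pattern_edge (r : nat) (cs : seq T) (E' : pred (seq T)) (e : seq nat) : Prop :=
  uniq e /\ forall s, size s = r -> E' s -> edg E (map (nth x0 (s ++ cs)) e).

Lemma pattern_edge_perm r cs E' e e' : perm_eq e e' -> pattern_edge r cs E' e -> pattern_edge r cs E' e'.
Proof.
move=> H [ue He]; split; first by rewrite -(perm_uniq H).
by move=> s Hs HE; rewrite -(edg_perm _ (perm_map _ H)); apply: He.
Qed.

Definition vertex_at B r cs (t : seq T) (c j : nat) : T :=
  if c < r then nth x0 t (c * B + j) else nth x0 cs (c - r).

(** The letters of a window are distinct, so each variable occurs at most once in it and the window
    picks one copy per variable; [blown_choice] then applies, with a choice function depending on
    the window. *)
Lemma realize B r cs E' t (w : seq nat) (idx : nat -> nat) :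
  blown B r E' t -> size t = r * B -> (forall i, idx i < B) ->
  lpath k d (pattern_edge r cs E') w ->
  lpath k d (edg E) (mkseq (fun i => vertex_at B r cs t (nth 0 w i) (idx i)) (size w)).
Proof.
move=> Ht st HB Hw i; rewrite size_mkseq => Hi.
have [ue He] := Hw i Hi; set e := take k _ in ue He.
have se : size e = k by rewrite size_takel // size_drop; lia.
pose c x := idx (i * d + index x e).
have := He _ (size_mkseq _ _) (blown_choice x0 Ht st (fun x => HB (i * d + index x e))).
congr (edg E _); apply: (@eq_from_nth _ x0).
  by rewrite size_map se size_takel // size_drop size_mkseq; lia.
rewrite size_map se => j Hj; rewrite (nth_map 0) ?se //.
rewrite nth_take // nth_drop nth_mkseq; last lia.
have Ej : nth 0 e j = nth 0 w (i * d + j) by rewrite nth_take // nth_drop.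
rewrite nth_cat size_mkseq /vertex_at -Ej; case: ltnP => // Hr.
by rewrite nth_mkseq // index_uniq ?se.
Qed.

End Realize.

Section ConnectingWord.
Variables (k d : nat).
Hypotheses (d1 : 1 < d) (dk : d < k) (ndk : ~~ (d %| k)).
Local Notation l := (k - d).
Local Notation a := ((k %/ d).+1 * d).
Local Notation r := (a + (a + k.-1)).

Let ka : k <= a. Proof. by rewrite mulSn {1}(divn_eq k d) addnC leq_add2r ltnW // ltn_pmod // ltnW. Qed.

(** The variables below [a] continue the given left end, those from [a] to [2 * a] continue the
    reversed right end, and the remaining [k - 1] are the chain vertices; the letters from [r] on
    are the two ends themselves. As [a] is a multiple of [d] and at least [k], the word has a last
    window consisting of variables only, from which the walk can leave. *)
Definition word_left := iota r l ++ iota 0 a.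
Definition word_right := rev (iota a a) ++ iota (r + l) l.
Definition xs_letters := iota (a - k) k.
Definition ys_letters := iota (a + (a - k)) k.
Definition chain_edge i :=
  rcons (take i.+1 ys_letters ++ drop i.+2 xs_letters) (a + a + i).

Definition connect_pattern (e : seq nat) : Prop :=
  [\/ exists2 i, i * d + k <= size word_left & perm_eq (take k (drop (i * d) word_left)) e,
      exists2 i, i * d + k <= size word_right & perm_eq (take k (drop (i * d) word_right)) e |
      exists2 i, i < k.-1 & perm_eq (chain_edge i) e].

Let PatV e := connect_pattern e /\ forall c, c \in e -> c < r.

Let PatV_perm s s' : perm_eq s s' -> PatV s -> PatV s'.
Proof.
move=> H [HP Hr]; split; last by move=> c; rewrite -(perm_mem H); apply: Hr.
case: HP => [[i Hi Hp]|[i Hi Hp]|[i Hi Hp]]; [constructor 1|constructor 2|constructor 3];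
  by exists i => //; apply: perm_trans Hp H.
Qed.

Lemma uniq_chain_edge i : i < k.-1 -> uniq (chain_edge i).
Proof.
move=> Hi; rewrite /chain_edge /xs_letters /ys_letters rcons_uniq cat_uniq take_iota drop_iota !iota_uniq /= andbT mem_cat !mem_iota negb_or.
apply/andP; split; first by apply/andP; split; have := ka; lia.
by apply/hasPn => x; rewrite !mem_iota; have := ka; lia.
Qed.

Lemma size_chain_edge i : i < k.-1 -> size (chain_edge i) = k.
Proof.
move=> Hi; rewrite size_rcons size_cat take_iota drop_iota !size_iota; lia.
Qed.

Lemma uniq_word_left : uniq word_left.
Proof.
by rewrite /word_left cat_uniq !iota_uniq andbT; apply/hasPn => x; rewrite !mem_iota; lia.
Qed.

Lemma uniq_word_right : uniq word_right.
Proof.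
by rewrite /word_right cat_uniq rev_uniq !iota_uniq andbT; apply/hasPn => x; rewrite mem_rev !mem_iota; lia.
Qed.

Lemma connect_pattern_uniq e : connect_pattern e -> uniq e.
Proof.
case=> [[i Hi H]|[i Hi H]|[i Hi H]]; rewrite -(perm_uniq H).
+ by rewrite take_uniq // drop_uniq // uniq_word_left.
+ by rewrite take_uniq // drop_uniq // uniq_word_right.
+ exact: uniq_chain_edge.
Qed.

Let size_left : size word_left = l + a.
Proof. by rewrite size_cat !size_iota. Qed.

Let size_right : size word_right = a + l.
Proof. by rewrite size_cat size_rev !size_iota. Qed.

Let d_la : l + (a - k) = (k %/ d) * d.
Proof. by have := ka; rewrite mulSn; lia. Qed.

Let PatV_xs : PatV xs_letters.
Proof.
split; last by move=> c; rewrite mem_iota; have := ka; lia.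
constructor 1; exists (k %/ d); first by rewrite size_left -d_la; have := ka; lia.
rewrite -d_la /word_left drop_catr ?size_iota ?leq_addr // addKn drop_iota.
by rewrite take_iota (minn_idPl _) ?perm_refl //; have := ka; lia.
Qed.

Let PatV_ys : PatV (take k (rev (iota a a))).
Proof.
have sk : k <= size (rev (iota a a)) by rewrite size_rev size_iota ka.
split; last by move=> c /mem_take; rewrite mem_rev mem_iota; lia.
constructor 2; exists 0; first by rewrite size_right; have := ka; lia.
by rewrite mul0n drop0 /word_right takel_cat.
Qed.

Let perm_ys : perm_eq (take k (rev (iota a a))) ys_letters.
Proof.
rewrite take_rev size_iota drop_iota perm_rev /ys_letters.
by have -> : a - (a - k) = k by have := ka; lia.
Qed.

Let PatV_chain i : i < k.-1 -> PatV (chain_edge i).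
Proof.
move=> Hi; split; last first.
  move=> c; rewrite mem_rcons inE mem_cat take_iota drop_iota !mem_iota; have := ka; lia.
by constructor 3; exists i.
Qed.

(** Consecutive chain edges have [k - 2] letters in common: one letter of [xs_letters] gives way to
    one of [ys_letters], and one chain vertex to the next. This is the situation of
    [walk_change]. *)
Lemma chain_walk i : i < k.-1 -> exists z, walk k d PatV xs_letters z (chain_edge i).
Proof.
have d0 : 0 < d by apply: ltnW.
have split_ys j : j < k -> take j.+1 ys_letters = rcons (take j ys_letters) (nth 0 ys_letters j).
  by move=> Hj; rewrite (take_nth 0) // size_iota.
have split_xs j : j < k -> drop j xs_letters = nth 0 xs_letters j :: drop j.+1 xs_letters.
  by move=> Hj; rewrite (drop_nth 0) // size_iota.
elim: i => [|i IH] Hi.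
  apply: (@walk_change _ k d PatV d1 dk ndk PatV_perm (nth 0 xs_letters 0) (nth 0 xs_letters 1)
    (nth 0 ys_letters 0) (a + a + 0) (drop 2 xs_letters)) => //.
  + exact: iota_uniq.
  + exact: uniq_chain_edge.
  + exact: size_iota.
  + by rewrite -!split_xs ?drop0 //; lia.
  + by rewrite /chain_edge split_ys ?take0 //=; [rewrite perm_cons perm_rcons|lia].
  + exact: PatV_chain.
have [z Hz] := IH (ltnW Hi).
have [z' Hz'] : exists z', walk k d PatV (chain_edge i) z' (chain_edge i.+1).
  apply: (@walk_change _ k d PatV d1 dk ndk PatV_perm (nth 0 xs_letters i.+2) (a + a + i)
    (nth 0 ys_letters i.+1) (a + a + i.+1) (take i.+1 ys_letters ++ drop i.+3 xs_letters)).
  + exact: uniq_chain_edge (ltnW Hi).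
  + exact: uniq_chain_edge.
  + exact: size_chain_edge (ltnW Hi).
  + rewrite /chain_edge (split_xs i.+2); last lia.
    by apply/permP => p; rewrite -cats1 /= !count_cat /=; lia.
  + rewrite /chain_edge (split_ys i.+1); last lia.
    by apply/permP => p; rewrite -!cats1 /= !count_cat /=; lia.
  + exact: PatV_chain (ltnW Hi).
  + exact: PatV_chain.
by exists (z ++ z'); apply: walk_trans Hz Hz'.
Qed.

Lemma connecting_word : exists mid, [/\ lpath k d connect_pattern (iota r l ++ mid ++ iota (r + l) l),
  d %| l + size mid & forall c, c \in mid -> c < r].
Proof.
have d0 : 0 < d by apply: ltnW.
have k3 : k.-2 < k.-1 by lia.
have [z1 H1] := chain_walk k3.
have [z2 H2] : exists z, walk k d PatV (chain_edge k.-2) z (take k (rev (iota a a))).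
  have Ek1 : k.-2.+1 = k.-1 by lia.
  have Ek2 : k.-1.+1 = k by lia.
  have Hy : ys_letters = rcons (rcons (take k.-2 ys_letters) (nth 0 ys_letters k.-2)) (nth 0 ys_letters k.-1).
    rewrite -take_nth ?size_iota; last lia.
    rewrite Ek1 -take_nth ?size_iota; last lia.
    by rewrite Ek2 take_oversize // size_iota.
  apply: (@walk_change _ k d PatV d1 dk ndk PatV_perm (nth 0 ys_letters k.-2) (a + a + k.-2)
    (nth 0 ys_letters k.-2) (nth 0 ys_letters k.-1) (take k.-2 ys_letters)).
  + exact: uniq_chain_edge.
  + by rewrite take_uniq // rev_uniq iota_uniq.
  + exact: size_chain_edge.
  + rewrite /chain_edge [drop _ _]drop_oversize ?size_iota; last lia.
    rewrite cats0 (take_nth 0) ?size_iota; last lia.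
    by apply/permP => p; rewrite -!cats1 /= !count_cat /=; lia.
  + apply: perm_trans perm_ys _; rewrite {1}Hy.
    by apply/permP => p; rewrite -!cats1 /= !count_cat /=; lia.
  + exact: PatV_chain.
  + exact: PatV_ys.
have Hz := walk_trans H1 H2; set z := z1 ++ z2 in Hz.
have Hlet : forall c, c \in z -> c < r by apply: (walk_letters (P := PatV) _ _ _ _ Hz) => // s [].
have [sw dz Lz Tz] := Hz.
set w := take k (rev (iota a a)) in Hz sw Lz Tz.
have Ew : rev (iota a a) = w ++ drop k (rev (iota a a)) by rewrite cat_take_drop.
have Sub : forall s, size s = k -> PatV s -> connect_pattern s by move=> s _ [].
have Ll : lpath k d connect_pattern word_left.
  by move=> i Hi; constructor 1; exists i.
have Lr : lpath k d connect_pattern word_right.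
  by move=> i Hi; constructor 2; exists i.
have Ea : iota 0 a = iota 0 (a - k) ++ xs_letters.
  by rewrite -{1}(subnK ka) iotaD add0n.
have Ez : z ++ w = xs_letters ++ drop k (z ++ w) by rewrite -{1}Tz cat_take_drop.
have L1 : lpath k d connect_pattern ((iota r l ++ iota 0 (a - k)) ++ z ++ w).
  rewrite Ez; apply: lpath_cat => //.
  + by rewrite size_cat !size_iota d_la dvdn_mull.
  + by rewrite size_iota leq_addr.
  + by rewrite -catA -Ea.
  + by rewrite -Ez; apply: lpath_sub Sub Lz.
exists (iota 0 (a - k) ++ z ++ rev (iota a a)); split.
+ have -> : iota r l ++ (iota 0 (a - k) ++ z ++ rev (iota a a)) ++ iota (r + l) l =
    ((iota r l ++ iota 0 (a - k)) ++ z) ++ w ++ drop k (rev (iota a a)) ++ iota (r + l) l.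
    by rewrite {1}Ew -!catA.
  apply: lpath_cat.
  - by rewrite size_cat dvdn_add // size_cat !size_iota d_la dvdn_mull.
  - by rewrite sw leq_addr.
  - by rewrite -!catA in L1 *.
  - by rewrite catA -Ew.
+ rewrite size_cat size_iota (size_cat z) size_rev size_iota addnA d_la.
  by apply: dvdn_add; [exact: dvdn_mull|apply: dvdn_add => //; exact: dvdn_mull].
+ move=> c; rewrite mem_cat (mem_cat c z) mem_rev !mem_iota => /or3P[H|H|H]; [have := ka; lia|exact: Hlet H|by case/andP: H => _ /leq_trans; apply; rewrite leq_add2l leq_addr].
Qed.

End ConnectingWord.

Lemma map_nth_iota_cat (T : Type) (x0 : T) (u v w : seq T) :
  map (nth x0 (u ++ v ++ w)) (iota (size u) (size v)) = v.
Proof.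
apply: (@eq_from_nth _ x0); rewrite size_map size_iota // => i Hi.
by rewrite (nth_map 0) ?size_iota // nth_iota // nth_cat ltnNge leq_addr /= addKn nth_cat Hi.
Qed.

(* The vertices [map (nth x0 t) idx] of a random tuple [t] connect any two given ends. *)
Lemma connect (k d K0 : nat) : 1 < d -> d < k -> ~~ (d %| k) -> 0 < K0 ->
  exists C K n0 (idx : seq nat),
  [/\ uniq idx, forall i, i \in idx -> i < C, d %| k - d + size idx, 0 < K & forall (T : finType) (E : {set {set T}}) (x0 : T) (X Y : seq T),
    n0 <= #|T| -> codegree_ge E k K0 ->
    size X = k - d -> size Y = k - d -> uniq X -> uniq Y ->
    dense K C (fun t => lpathb k d (edg E) (X ++ map (nth x0 t) idx ++ Y))].
Proof.
move=> d1 dk ndk K00; have d0 := ltnW d1; have k0 : 0 < k by apply: leq_ltn_trans dk.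
set l := k - d; set a := (k %/ d).+1 * d; set r := a + (a + k.-1).
have ka : k <= a by rewrite /a mulSn {1}(divn_eq k d) addnC leq_add2r ltnW // ltn_pmod.
have [mid [Lmid Dmid Rmid]] := connecting_word d1 dk ndk.
rewrite -/l -/a -/r in Lmid Dmid Rmid.
(* There are enough copies for position [i] of [mid] to use copy number [i], which makes all
   vertices of the connection distinct however often a letter recurs. *)
pose B := (size mid).+1.
pose K1 := (2 * K0) ^ a * ((2 * K0) ^ a * K0 ^ k.-1).
have [K HK] := dense_blown B r K1.
pose idx := mkseq (fun i => nth 0 mid i * B + i) (size mid).
exists (r * B), K.+1, (2 * K0 * (k + a + a)).+1, idx; split=> //.
+ rewrite map_inj_in_uniq ?iota_uniq // => i j; rewrite !mem_iota /= add0n => Hi Hj H.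
  have := congr1 (modn^~ B) H; rewrite /= !modnMDl !modn_small //; rewrite /B; lia.
+ move=> i /mapP[j]; rewrite mem_iota /= add0n => Hj ->.
  have : nth 0 mid j < r by apply: Rmid; rewrite mem_nth.
  by rewrite /B; nia.
+ by rewrite size_mkseq.
move=> T E x0 X Y Hn HE sX sY uX uY; have n0 : 0 < #|T| by apply: leq_ltn_trans Hn.
pose PR (s : seq T) := [&& uniq (X ++ s), all [predC (Nil T)] s & lpathb k d (edg E) (X ++ s)].
pose PL (s s' : seq T) := [&& uniq (rev Y ++ s'), all [predC s] s' & lpathb k d (edg E) (rev Y ++ s')].
pose PU s s' s'' := all (fun i =>
    edg E (rcons (take i.+1 (drop (a - k) s') ++ drop i.+2 (drop (a - k) s)) (nth x0 s'' i))) (iota 0 (size s'')).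
pose E' s := PR (take a s) && (PL (take a s) (take a (drop a s)) && PU (take a s) (take a (drop a s)) (drop a (drop a s))).
have DE' : dense K1 r E'.
  apply: (@dense_cat T _ _ a (a + k.-1) PR (fun s s' => PL s (take a s') && PU s (take a s') (drop a s'))).
    by apply: ext_dense => //; [by rewrite sX ltn_subrL d0 k0|]; apply: leq_trans (ltnW Hn); rewrite leq_mul2l /= addn0 leq_addr orbT.
  move=> s Hs /and3P[us _ _]; apply: (@dense_cat T _ _ a k.-1 (PL s) (fun s' => PU s s')).
    by apply: ext_dense => //; rewrite ?size_rev ?rev_uniq ?Hs ?sY ?ltn_subrL ?d0 ?k0 //; apply: ltnW.
  move=> s' Hs' /and3P[us' /allP Hss' _]; apply: (chain_dense (d := d)) => //; try by rewrite size_drop ?Hs ?Hs' subKn.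
  move: us us'; rewrite !cat_uniq => /and3P[_ _ us] /and3P[_ _ us'].
  rewrite !drop_uniq // andbT; apply/hasPn => x /mem_drop Hx; apply/negP => /mem_drop xs.
  by have := Hss' _ Hx; rewrite /= xs.
apply: denseW (HK T E' n0 DE') (leqnSn _) _ => t st.
case Ht : (blown _ _ _ t) => //; rewrite lt0b; apply/(lpathP _ d0).
have Pat e : size e = k -> connect_pattern k d e -> pattern_edge E x0 r (X ++ Y) E' e.
  move=> se He; split; first exact: connect_pattern_uniq He.
  move=> s Hs /andP[/and3P[_ _ /(lpathP _ d0) L1] /andP[/and3P[_ _ /(lpathP _ d0) L2] /allP L3]].
  pose s1 := take a s; pose s2 := take a (drop a s); pose s3 := drop a (drop a s).
  have z1 : size s1 = a by rewrite size_takel // Hs leq_addr.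
  have z2 : size s2 = a by rewrite size_takel // size_drop Hs /r; lia.
  have z3 : size s3 = k.-1 by rewrite !size_drop Hs /r; lia.
  have Es : s = s1 ++ s2 ++ s3 by rewrite !cat_take_drop.
  have EX : map (nth x0 (s ++ X ++ Y)) (iota r l) = X by rewrite -Hs -sX map_nth_iota_cat.
  have EY : map (nth x0 (s ++ X ++ Y)) (iota (r + l) l) = Y.
    by rewrite -{1}sX -sY -Hs -size_cat catA -[X in nth _ X]cats0 -catA map_nth_iota_cat.
  have E1 : map (nth x0 (s ++ X ++ Y)) (iota 0 a) = s1.
    by rewrite -z1 Es -!catA -[s1 ++ _]cat0s (map_nth_iota_cat x0 [::]).
  have E2 : map (nth x0 (s ++ X ++ Y)) (iota a a) = s2.
    by rewrite -{1}z1 -z2 Es -!catA map_nth_iota_cat.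
  case: He => [[i Hi Hp]|[i Hi Hp]|[i Hi Hp]].
  + rewrite -(edg_perm _ (perm_map _ Hp)) map_take map_drop map_cat EX E1.
    by apply: L1; move: Hi; rewrite !size_cat !size_iota sX z1.
  + rewrite -(edg_perm _ (perm_map _ Hp)) map_take map_drop map_cat EY map_rev E2.
    (* The right half was built as an extension of [rev Y], so it is turned around here; its length
       [k %/ d * d + k] keeps the windows aligned. *)
    have L2' : lpath k d (edg E) (rev (rev Y ++ s2)).
      apply: (@lpath_rev k d _ _ (k %/ d)).
        by rewrite size_cat size_rev sY z2 /a /l; lia.
      apply: lpath_sub L2 => e0 _ He0; rewrite (_ : edg E (rev e0) = edg E e0) //.
      by apply: edg_perm; rewrite perm_rev.
    rewrite rev_cat revK in L2'; apply: L2'.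
    by move: Hi; rewrite !size_cat !size_rev !size_iota sY z2.
  + rewrite -(edg_perm _ (perm_map _ Hp)) /chain_edge map_rcons map_cat map_take map_drop.
    have -> : map (nth x0 (s ++ X ++ Y)) (xs_letters k d) = drop (a - k) s1.
      by rewrite -E1 -map_drop drop_iota add0n subKn.
    have -> : map (nth x0 (s ++ X ++ Y)) (ys_letters k d) = drop (a - k) s2.
      by rewrite -E2 -map_drop drop_iota subKn.
    have -> : nth x0 (s ++ X ++ Y) ((k %/ d).+1 * d + (k %/ d).+1 * d + i) = nth x0 s3 i.
      rewrite -/a Es -catA nth_cat ltnNge z1 -addnA leq_addr /= addKn -catA nth_cat z2 ltnNge leq_addr /= addKn.
      by rewrite nth_cat z3 Hi.
    by apply: (L3 i); rewrite mem_iota z3.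
have Hl : lpath k d (pattern_edge E x0 r (X ++ Y) E') (iota r l ++ mid ++ iota (r + l) l).
  by apply: lpath_sub Lmid => e; apply: Pat.
pose idxf i := if (l <= i) && (i < l + size mid) then i - l else 0.
have HB i : idxf i < B by rewrite /idxf /B; case: ifP => //; lia.
have := realize Ht st HB Hl; congr (lpath _ _ _ _).
rewrite !size_cat !size_iota /mkseq !iotaD !map_cat !add0n; congr (_ ++ _ ++ _).
+ apply: (@eq_from_nth _ x0); rewrite size_map size_iota ?sX // => i Hi.
  rewrite (nth_map 0) ?size_iota // nth_iota // add0n nth_cat size_iota Hi nth_iota //.
  by rewrite /vertex_at ltnNge leq_addr /= addKn nth_cat sX Hi.
+ apply: (@eq_from_nth _ x0); rewrite !size_map !size_iota // => i Hi.
  rewrite !(nth_map 0) ?size_map ?size_iota // !nth_iota // nth_cat size_iota ltnNge leq_addr /= addKn add0n.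
  rewrite nth_cat Hi /vertex_at Rmid ?mem_nth //.
  by rewrite /idxf leq_addr ltn_add2l Hi addKn.
+ apply: (@eq_from_nth _ x0); rewrite size_map size_iota ?sY // => i Hi.
  rewrite (nth_map 0) ?size_iota // nth_iota // nth_cat size_iota ltnNge -addnA leq_addr /= addKn.
  rewrite nth_cat ltnNge leq_addr /= addKn nth_iota // /vertex_at ltnNge -addnA leq_addr /= addKn.
  by rewrite nth_cat sX ltnNge leq_addr /= addKn.
Qed.

(** * Absorbers *)

(** Each letter is paired with its occurrence number. Two words then have the same set of pairs as
    soon as their letter counts agree, so that comparing the vertices of two paths becomes comparing
    counts. *)
Definition numbered (z : seq nat) : seq (nat * nat) :=
  mkseq (fun i => (nth 0 z i, (count_mem (nth 0 z i) (take i z)).+1)) (size z).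

Lemma numbered_rcons z x : numbered (rcons z x) = rcons (numbered z) (x, (count_mem x z).+1).
Proof.
rewrite /numbered /mkseq size_rcons -[in LHS]addn1 iotaD map_cat add0n /= cats1; congr rcons.
  apply/eq_in_map => i; rewrite mem_iota add0n /= => Hi.
  by rewrite nth_rcons Hi -cats1 takel_cat // ltnW.
by rewrite nth_rcons ltnn eqxx -cats1 take_size_cat.
Qed.

Lemma mem_numbered z c j : ((c, j) \in numbered z) = (0 < j <= count_mem c z).
Proof.
elim/last_ind: z => [|z x IH]; first by case: j.
rewrite numbered_rcons mem_rcons inE IH -cats1 count_cat /= addn0 xpair_eqE eq_sym.
by case: (eqVneq x c) => [->|_] /=; lia.
Qed.

Lemma uniq_numbered z : uniq (numbered z).
Proof.
elim/last_ind: z => [|z x IH] //.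
by rewrite numbered_rcons rcons_uniq IH mem_numbered ltnn andbF.
Qed.

Lemma size_numbered z : size (numbered z) = size z.
Proof. exact: size_mkseq. Qed.

Lemma take_numbered l z z' : l <= size z -> l <= size z' -> take l z = take l z' ->
  take l (numbered z) = take l (numbered z').
Proof.
move=> Hz Hz' E; apply: (@eq_from_nth _ (0, 0)); rewrite !size_takel ?size_numbered // => i Hi.
have Hi1 := leq_trans Hi Hz; have Hi2 := leq_trans Hi Hz'.
have En : nth 0 z i = nth 0 z' i by rewrite -(nth_take 0 Hi) E nth_take.
have Et : take i z = take i z' by rewrite -(take_takel z (ltnW Hi)) E take_takel // ltnW.
by rewrite !nth_take // !nth_mkseq // En Et.
Qed.

Lemma ltn_mulD x y r B : x < r -> y < B -> x * B + y < r * B.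
Proof. by move=> H1 H2; nia. Qed.

Section Tokens.
Variables (k d : nat).
Local Notation w0 := (iota 0 k).

(** The final window gets the separate number 0, so that the last vertices of a path are the same
    for every word [z]. *)
Definition tokens (z : seq nat) : seq (nat * nat) := numbered z ++ map (fun c => (c, 0)) w0.

Lemma map_fst_tokens z : map fst (tokens z) = z ++ w0.
Proof.
rewrite map_cat -map_comp map_id; congr (_ ++ _).
by rewrite /numbered -map_comp -[RHS](mkseq_nth 0).
Qed.

Lemma mem_tokens z c j : {subset z <= w0} ->
  ((c, j) \in tokens z) = (c < k) && (j <= count_mem c z).
Proof.
move=> Hz; rewrite mem_cat mem_numbered; have -> : ((c, j) \in map (fun c => (c, 0)) w0) = (c < k) && (j == 0).
  by apply/mapP/andP => [[x]|[ck /eqP->]]; [rewrite mem_iota => Hx [-> ->]|exists c; rewrite ?mem_iota].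
case: j => [|j] /=; first by case: (c < k).
rewrite andbF orbF; case: leqP => H /=; rewrite ?andbT ?andbF //.
have : c \in z by rewrite -has_pred1 has_count; apply: leq_trans H.
by move/Hz; rewrite mem_iota add0n /= => ->.
Qed.

Lemma uniq_tokens z : uniq (tokens z).
Proof.
rewrite cat_uniq uniq_numbered map_inj_uniq ?iota_uniq ?andbT /=; last by move=> ? ? [].
by apply/hasPn => -[c j] /mapP[x _ [_ ->]]; rewrite mem_numbered.
Qed.

Lemma lpath_tokens (Pat : seq nat -> Prop) (h : nat * nat -> nat) z :
  (forall tk, {subset tk <= tokens z} -> perm_eq (map fst tk) w0 -> Pat (map h tk)) ->
  walk k d (fun w => is_true (perm_eq w w0)) w0 z w0 -> lpath k d Pat (map h (tokens z)).
Proof.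
move=> H [_ _ L _]; apply: lpath_map => i Hi; apply: H.
  by move=> x /mem_take /mem_drop.
rewrite map_take map_drop map_fst_tokens; apply: L.
by rewrite -map_fst_tokens size_map.
Qed.

End Tokens.

Section AbsorbPattern.
Variables (k d : nat).
Local Notation l := (k - d).
Local Notation w0 := (iota 0 k).
Local Notation r := (k + d * k.-1).
Hypotheses (d1 : 1 < d) (dk : d < k) (ndk : ~~ (d %| k)).
Variables y1 y2 z1 z2 : seq nat.
Local Notation wk0 z := (walk k d (fun w => is_true (perm_eq w w0)) w0 z w0).
Hypotheses (Wy1 : wk0 y1) (Wy2 : wk0 y2) (Wz1 : wk0 z1) (Wz2 : wk0 z2).
Hypotheses (Cy : forall c, c < k -> count_mem c y1 = count_mem c y2 + d * (c == 0)).
Hypotheses (Cz : forall c, c < k -> count_mem c z1 + (c == 1) = count_mem c z2 + (c == 0)).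
Hypotheses (sy1 : l <= size y1) (sy2 : l <= size y2) (sz1 : l <= size z1) (sz2 : l <= size z2).

Let d0 : 0 < d. Proof. exact: ltnW. Qed.
Let k3 : 2 < k. Proof. exact: leq_trans dk. Qed.

Let letters z : wk0 z -> {subset z <= w0}.
Proof. by move=> W c; apply: (walk_letters (Q := fun c => c \in w0) d1 dk ndk _ W) => s Hs x; rewrite (perm_mem Hs). Qed.

Definition count_z2_0 := count_mem 0 z2.
Definition count_z2_1 := count_mem 1 z2.
Definition count_y2_0 := count_mem 0 y2.
(** This exceeds every occurrence number. With it, and with [second_base] as the number of copies
    per variable, each of the [d + 1] paths has a range of copies of its own. *)
Definition copy_width := (size y1 + size y2 + size z1 + size z2 + d).+2.
Definition second_base := d.+1 * copy_width.

(** Path 0 runs along the edge with variables below [k]. Path [i + 1] runs along an edge in which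
    letter 1 is again variable 0 and the other letters are private to [i]. Passing from [z2] to [z1]
    on this path frees one copy of variable 0 and creates one more letter 0, a place which absorbed
    vertex [i] takes; passing from [y2] to [y1] on path 0 uses up the [d] freed copies. *)
Definition lam (i c : nat) : nat :=
  if i is i'.+1 then
    if c == 0 then k + i' * k.-1 + (k - 2) else if c == 1 then 0 else k + i' * k.-1 + (c - 2)
  else c.

(** The token [(0, count_z2_0.+1)] is the one that [z1] has beyond [z2]; it is given to the absorbed
    vertex [i']. *)
Definition hB (i : nat) (tk : nat * nat) : nat :=
  if i is i'.+1 then if tk == (0, count_z2_0.+1) then r + i' else lam i tk.1 else tk.1.

Definition numA (i : nat) (tk : nat * nat) : nat := i * copy_width + tk.2.
(** The [d] tokens by which [y1] exceeds [y2] receive the copies of variable 0 that the other paths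
    set free. *)
Definition numB (i : nat) (tk : nat * nat) : nat :=
  if (i == 0) && (tk.1 == 0) && (count_y2_0 < tk.2) then (tk.2 - count_y2_0) * copy_width + count_z2_1 else numA i tk.

Definition ix (h num : nat * nat -> nat) (tk : nat * nat) : nat :=
  if h tk < r then h tk * second_base + num tk else r * second_base + (h tk - r).

Definition fA i := ix (fun tk => lam i tk.1) (numA i).
Definition fB i := ix (hB i) (numB i).
Definition wA i := if i is 0 then y2 else z2.
Definition wB i := if i is 0 then y1 else z1.

Definition pathsA := [seq map (fA i) (tokens k (wA i)) | i <- iota 0 d.+1].
Definition pathsB := [seq map (fB i) (tokens k (wB i)) | i <- iota 0 d.+1].

Lemma lam_lt i c : i <= d -> c < k -> lam i c < r.
Proof.
case: i => [|i] /= Hi Hc; first by apply: leq_trans Hc (leq_addr _ _).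
have H : i * k.-1 + k.-1 <= d * k.-1 by rewrite -mulSnr leq_mul2r Hi orbT.
have := k3; move: (i * k.-1) (d * k.-1) H => x y H kk; case: eqP => _; first lia.
by case: eqP => _; lia.
Qed.

Lemma lam_inj i c c' : c < k -> c' < k -> lam i c = lam i c' -> c = c'.
Proof.
case: i => [|i] //= Hc Hc'; have := leq_addr (i * k.-1) k; move: (k + i * k.-1) => x.
by have := k3; do ! case: eqP => ?; lia.
Qed.

Let Wk i : wk0 (wA i). Proof. by case: i. Qed.
Let Wk' i : wk0 (wB i). Proof. by case: i. Qed.

Let size_wA i : size (wA i) < copy_width. Proof. by case: i => [|i] /=; rewrite /copy_width; lia. Qed.
Let size_wB i : size (wB i) < copy_width. Proof. by case: i => [|i] /=; rewrite /copy_width; lia. Qed.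
Let m1M : count_z2_1 < copy_width.
Proof. exact: leq_ltn_trans (count_size _ _) (size_wA 1). Qed.

Let small z c j : {subset z <= w0} -> (c, j) \in tokens k z -> c < k /\ j <= size z.
Proof.
by move=> Hz; rewrite mem_tokens // => /andP[-> H]; split=> //; apply: leq_trans H (count_size _ _).
Qed.

Let numA_lt i tk : i <= d -> tk.2 < copy_width -> numA i tk < second_base.
Proof. by rewrite /numA /second_base => Hi Ht; rewrite mulSn; nia. Qed.

Let fA_E i tk : i <= d -> tk \in tokens k (wA i) -> fA i tk = lam i tk.1 * second_base + numA i tk.
Proof.
case: tk => c j Hi /(small (letters (Wk i)))[Hc _].
by rewrite /fA /ix lam_lt.
Qed.

Let numA_wA i tk : i <= d -> tk \in tokens k (wA i) -> numA i tk < second_base.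
Proof.
case: tk => c j Hi /(small (letters (Wk i)))[_ Hj]; apply: numA_lt => //=.
exact: leq_ltn_trans Hj (size_wA i).
Qed.

Lemma pathsA_lt i : i \in flatten pathsA -> i < r * second_base.
Proof.
case/flattenP => p /mapP[b]; rewrite mem_iota add0n ltnS => /andP[_ Hb] -> /mapP[tk Ht ->].
rewrite fA_E //; apply: ltn_mulD; last exact: numA_wA.
by apply: lam_lt => //; case: tk Ht => c j /(small (letters (Wk b)))[].
Qed.

Let B0 : 0 < second_base. Proof. by rewrite /second_base muln_gt0. Qed.

Lemma fA_inj b b' tk tk' : b <= d -> b' <= d -> tk \in tokens k (wA b) -> tk' \in tokens k (wA b') ->
  fA b tk = fA b' tk' -> b = b' /\ tk = tk'.
Proof.
move=> Hb Hb' Ht Ht'; rewrite !fA_E // => H.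
have E1 := congr1 (modn^~ second_base) H; rewrite /= !modnMDl !modn_small ?numA_wA // in E1.
have E2 := congr1 (divn^~ second_base) H; rewrite /= !divnMDl // !divn_small ?numA_wA // !addn0 in E2.
case: tk tk' Ht Ht' E1 E2 {H} => c j [c' j'] /(small (letters (Wk b)))[Hc Hj] /(small (letters (Wk b')))[Hc' Hj'].
rewrite /numA /= => E1 E2.
have jM : j < copy_width by apply: leq_ltn_trans Hj (size_wA b).
have jM' : j' < copy_width by apply: leq_ltn_trans Hj' (size_wA b').
have M0 : 0 < copy_width by [].
have F1 := congr1 (modn^~ copy_width) E1; rewrite /= !modnMDl !modn_small // in F1.
have F2 := congr1 (divn^~ copy_width) E1; rewrite /= !divnMDl // !divn_small // !addn0 in F2.
by rewrite F2 in E2 *; rewrite F1 (lam_inj Hc Hc' E2).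
Qed.

Lemma uniq_flatten_map (S : eqType) (U : eqType) (f : nat -> U -> S) (g : nat -> seq U) (s : seq nat) :
  uniq s -> (forall b, b \in s -> uniq (g b)) ->
  (forall b b' x x', b \in s -> b' \in s -> x \in g b -> x' \in g b' -> f b x = f b' x' -> b = b' /\ x = x') ->
  uniq (flatten [seq map (f b) (g b) | b <- s]).
Proof.
elim: s => //= b s IH /andP[bs us] Hg Hf; rewrite cat_uniq; apply/and3P; split.
+ rewrite map_inj_in_uniq ?Hg ?mem_head // => x x' Hx Hx' E.
  by have [] := Hf b b x x' (mem_head _ _) (mem_head _ _) Hx Hx' E.
+ apply/hasPn => y /flattenP[p /mapP[b' b's ->] /mapP[x' Hx' ->]]; apply/negP => /mapP[x Hx E].
  have [] := Hf b' b x' x _ (mem_head _ _) Hx' Hx E; first by rewrite inE b's orbT.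
  by move=> Eb; rewrite -Eb b's in bs.
+ apply: IH => // [b' H|b' b'' x x' H H']; first by apply: Hg; rewrite inE H orbT.
  by apply: Hf; rewrite inE ?H ?H' orbT.
Qed.

Lemma uniq_pathsA : uniq (flatten pathsA).
Proof.
apply: uniq_flatten_map; first exact: iota_uniq.
  by move=> b _; apply: uniq_tokens.
by move=> b b' tk tk'; rewrite !mem_iota !add0n !ltnS => /= Hb Hb'; apply: fA_inj.
Qed.

Definition freed i := fA i.+1 (1, count_z2_1).

Let memz2 : (1, count_z2_1) \in tokens k z2.
Proof. by rewrite mem_tokens ?leqnn ?andbT; [exact: ltnW k3|exact: letters Wz2]. Qed.

Let perm_z : perm_eq ((1, count_z2_1) :: tokens k z1) ((0, count_z2_0.+1) :: tokens k z2).
Proof.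
have L1 := letters Wz1; have L2 := letters Wz2.
have k1 : 1 < k by apply: ltnW k3.
have E1 : count_mem 1 z2 = (count_mem 1 z1).+1 by have := Cz k1; rewrite /= addn0 addn1.
have E0 : count_mem 0 z1 = (count_mem 0 z2).+1 by have := Cz (ltnW k1); rewrite /= addn0 addn1.
apply: uniq_perm => [||[c j]].
+ by rewrite /= uniq_tokens andbT mem_tokens // /count_z2_1 E1 ltnn andbF.
+ by rewrite /= uniq_tokens andbT mem_tokens // ltnn andbF.
rewrite !inE !mem_tokens // !xpair_eqE.
case: (eqVneq c 1) => [->|c1].
  by rewrite /count_z2_1 E1 k1 /=; move: (count_mem 1 z1) => x; clear; lia.
case: (eqVneq c 0) => [->|c0] /=.
  by rewrite /count_z2_0 E0 (ltnW k1) /=; move: (count_mem 0 z2) => x; clear; lia.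
case: ltnP => //= ck; have := Cz ck; rewrite (negPf c1) (negPf c0) !addn0 => ->; by [].
Qed.

Let perm_y : perm_eq (tokens k y1) (tokens k y2 ++ [seq (0, count_y2_0.+1 + i) | i <- iota 0 d]).
Proof.
have L1 := letters Wy1; have L2 := letters Wy2.
have Hin c j : ((c, j) \in [seq (0, count_y2_0.+1 + i) | i <- iota 0 d]) = (c == 0) && (count_y2_0 < j <= count_y2_0 + d).
  apply/mapP/andP => [[i]|[/eqP-> Hj]].
    by rewrite mem_iota => Hi [-> ->]; split=> //; lia.
  by exists (j - count_y2_0.+1); rewrite ?mem_iota; [lia|congr (_, _); lia].
apply: uniq_perm => [||[c j]].
+ exact: uniq_tokens.
+ rewrite cat_uniq uniq_tokens map_inj_uniq ?iota_uniq ?andbT /=; last by move=> ? ? []; lia.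
  apply/hasPn => -[c j]; rewrite Hin mem_tokens // => /andP[/eqP-> Hj]; rewrite /count_y2_0 in Hj; lia.
rewrite [RHS]mem_cat (Hin c j) !mem_tokens //.
have k0 : 0 < k by have := k3; lia.
case: (eqVneq c 0) => [->|c0] /=.
  by rewrite k0 Cy // eqxx muln1 /count_y2_0 /=; lia.
by rewrite orbF; case: ltnP => //= ck; rewrite Cy // (negPf c0) muln0 addn0.
Qed.

Let fB_A i tk : i <= d -> tk \in tokens k (wA i) -> fB i tk = fA i tk.
Proof.
case: i => [|i] Hi; case: tk => c j Ht; rewrite /fB /fA /ix.
+ have -> : numB 0 (c, j) = numA 0 (c, j).
    rewrite /numB /=; case: eqP => //= c0; case: ltnP => //= Hj.
    by move: Ht; rewrite /= c0 mem_tokens; [rewrite [j <= _]leqNgt (_ : count_mem 0 y2 < j) ?andbF //|exact: letters Wy2].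
  by [].
+ have -> : hB i.+1 (c, j) = lam i.+1 c.
    rewrite /hB; case: eqP => // -[c0 jm]; move: Ht.
    by rewrite /= c0 jm mem_tokens; [rewrite ltnn andbF|exact: letters Wz2].
  by [].
Qed.

Lemma perm_blockS i : i < d -> perm_eq (freed i :: map (fB i.+1) (tokens k z1))
   (r * second_base + i :: map (fA i.+1) (tokens k z2)).
Proof.
move=> Hi; have -> : freed i = fB i.+1 (1, count_z2_1) by rewrite fB_A.
rewrite -map_cons (permPl (perm_map _ perm_z)) /=.
have -> : fB i.+1 (0, count_z2_0.+1) = r * second_base + i by rewrite /fB /ix /hB eqxx ltnNge leq_addr /= addKn.
have -> // : map (fB i.+1) (tokens k z2) = map (fA i.+1) (tokens k z2).
by apply/eq_in_map => tk Ht; apply: (@fB_A i.+1 tk).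
Qed.

Lemma perm_block0 : perm_eq (map (fB 0) (tokens k y1)) (map (fA 0) (tokens k y2) ++ map freed (iota 0 d)).
Proof.
rewrite (permPl (perm_map _ perm_y)) map_cat -map_comp.
have -> : map (fB 0) (tokens k y2) = map (fA 0) (tokens k y2) by apply/eq_in_map => tk Ht; apply: (@fB_A 0 tk).
rewrite perm_cat2l; have -> // : map (fB 0 \o (fun i => (0, count_y2_0.+1 + i))) (iota 0 d) = map freed (iota 0 d).
apply/eq_in_map => i; rewrite mem_iota add0n /= => Hi.
have r0 : 0 < r by apply: leq_trans (leq_addr _ _); apply: ltn_trans k3.
rewrite /freed /fA /fB /ix /= r0 /numB /= /numA /= (_ : count_y2_0 < count_y2_0.+1 + i); last lia.
by congr (_ + (_ * _ + _)); lia.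
Qed.

(** The freed indices occur once as a gain of path 0 and once as a loss of the other paths, so they
    cancel and only the [d] indices of the absorbed set are left over. *)
Lemma perm_paths : perm_eq (flatten pathsB) (flatten pathsA ++ iota (r * second_base) d).
Proof.
rewrite /pathsA /pathsB /= (iotaDl 1 0) -!map_comp.
have H : perm_eq (map freed (iota 0 d) ++ flatten [seq map (fB (1 + i)) (tokens k z1) | i <- iota 0 d])
  (map (addn (r * second_base)) (iota 0 d) ++ flatten [seq map (fA (1 + i)) (tokens k z2) | i <- iota 0 d]).
  have : all (fun i => i < d) (iota 0 d) by apply/allP => i; rewrite mem_iota.
  elim: (iota 0 d) => //= i s IH /andP[Hi Hs]; rewrite !add1n.
  move: (perm_blockS Hi) (IH Hs) => /permP P1 /permP P2; apply/permP => p.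
  by have := P1 p; have := P2 p; rewrite /= ?count_cat /= ?count_cat; lia.
have -> : iota (r * second_base) d = map (addn (r * second_base)) (iota 0 d) by rewrite -iotaDl addn0.
move: perm_block0 H => /permP P1 /permP P2; apply/permP => p.
by have := P1 p; have := P2 p; rewrite /= !count_cat; rewrite /comp /=; lia.
Qed.

Let take_walk z : wk0 z -> l <= size z -> take l z = take l w0.
Proof.
case=> _ _ _ Hz sz; rewrite -Hz take_takel ?leq_subr //.
by rewrite takel_cat.
Qed.

Let take_tokens z : wk0 z -> l <= size z -> take l (tokens k z) = take l (numbered z).
Proof. by move=> W sz; rewrite takel_cat // size_numbered. Qed.

Let size_tokens z : size (tokens k z) = size z + k.
Proof. by rewrite size_cat size_numbered size_map size_iota. Qed.

Let sA i : l <= size (wA i). Proof. by case: i. Qed.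
Let sB i : l <= size (wB i). Proof. by case: i. Qed.

Let drop_tokens z : drop (size (tokens k z) - l) (tokens k z) = drop d (map (fun c => (c, 0)) w0).
Proof.
rewrite size_tokens drop_cat size_numbered ltnNge (_ : _ <= _); last by rewrite -addnBA ?leq_subr // leq_addr.
by congr drop; rewrite -addnBA ?leq_subr // addKn subKn // ltnW.
Qed.

Let size_paths z (f : nat * nat -> nat) : wk0 z ->
  l <= size (map f (tokens k z)) /\ d %| size (map f (tokens k z)) - l.
Proof.
case=> _ dz _ _; rewrite size_map size_tokens; split; first by apply: leq_trans (leq_subr _ _) (leq_addl _ _).
by rewrite -addnBA ?leq_subr // dvdn_add // subKn // ltnW.
Qed.

Definition absorb_shape (C : nat) (pA pB : seq (seq nat)) :=
  [/\ size pA = size pB, uniq (flatten pA), forall i, i \in flatten pA -> i < C,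
     perm_eq (flatten pB) (flatten pA ++ iota C d) &
     forall j, j < size pA -> let a := nth [::] pA j in let b := nth [::] pB j in
     [/\ l <= size a /\ d %| size a - l, l <= size b /\ d %| size b - l,
         take l a = take l b & drop (size a - l) a = drop (size b - l) b]].

Lemma absorb_shape_paths : absorb_shape (r * second_base) pathsA pathsB.
Proof.
split; [by rewrite !size_map|exact: uniq_pathsA|exact: pathsA_lt|exact: perm_paths|].
move=> j; rewrite size_map size_iota => Hj; have Hj' : j <= d by [].
rewrite !(nth_map 0) ?size_iota // !nth_iota // add0n /=.
have Hsub tk : tk \in tokens k (wA j) -> fB j tk = fA j tk by apply: fB_A.
split; [exact: size_paths|exact: size_paths| |].
+ rewrite -!map_take !take_tokens // (@take_numbered l (wB j) (wA j)) //; last by rewrite !take_walk.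
  by apply/eq_in_map => tk; rewrite -take_tokens // => /mem_take /Hsub.
+ rewrite !size_map -!map_drop !drop_tokens -(drop_tokens (wA j)).
  by apply/eq_in_map => tk /mem_drop /Hsub.
Qed.

Section Host.
Variables (T : finType) (E : {set {set T}}) (x0 : T) (S : seq T).

(** With step 1 on [k + 1] vertices, [lpathb k 1] says that two [k]-sets are edges, differing by an
    exchange of absorbed vertex [i] for the last vertex of the block; both contain [nth x0 s 0], and
    so does the edge of path 0. *)
Definition absorb_hom (s : seq T) : bool :=
  lpathb k 1 (edg E) (take k s) &&
  all (fun i => lpathb k 1 (edg E) (nth x0 S i :: nth x0 s 0 :: take k.-1 (drop (k + i * k.-1) s))) (iota 0 d).

Local Notation Pat := (pattern_edge E x0 r S absorb_hom).

Let k_r : k <= r. Proof. exact: leq_addr. Qed.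
Let k1 : 1 < k. Proof. exact: ltnW k3. Qed.
Let w0E : w0 = 0 :: 1 :: iota 2 (k - 2).
Proof. by have := k3; case: k => [|[|[|x]]] //= _; rewrite subn2. Qed.

Lemma Pat0 : Pat w0.
Proof.
split=> [|s Hs /andP[/(lpathP _ (ltn0Sn 0)) H _]]; first exact: iota_uniq.
rewrite map_nth_iota0; last by rewrite size_cat Hs; exact: leq_trans k_r (leq_addr _ _).
have sk : size (take k s) = k by rewrite size_takel // Hs.
rewrite takel_cat ?Hs //; move: (H 0); rewrite mul0n drop0 sk => /(_ (leqnn _)).
by rewrite take_oversize // sk.
Qed.

Let blk_le i : i < d -> k + i * k.-1 + k.-1 <= r.
Proof. by move=> Hi; rewrite -addnA leq_add2l -mulSnr leq_mul2r Hi orbT. Qed.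

Let map_lam i : [seq lam i.+1 c | c <- iota 2 (k - 2)] = iota (k + i * k.-1) (k - 2).
Proof.
apply: (@eq_from_nth _ 0); rewrite !size_map !size_iota // => j Hj.
by rewrite (nth_map 0) ?size_iota // !nth_iota // add2n /= !subSS subn0.
Qed.

Let Pat_block i (s : seq T) : i < d -> size s = r -> absorb_hom s ->
  let F := map (nth x0 (s ++ S)) (iota (k + i * k.-1) (k - 2)) in
  edg E (nth x0 s 0 :: rcons F (nth x0 (s ++ S) (k + i * k.-1 + (k - 2)))) /\
  edg E (nth x0 S i :: nth x0 s 0 :: F).
Proof.
move=> Hi Hs /andP[_ /allP H] F; have Hb := blk_le Hi.
have /(lpathP _ (ltn0Sn 0)) {}H : lpathb k 1 (edg E) (nth x0 S i :: nth x0 s 0 :: take k.-1 (drop (k + i * k.-1) s)).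
  by apply: H; rewrite mem_iota.
have EF : F = take (k - 2) (drop (k + i * k.-1) s).
  rewrite /F map_nth_iota; last first.
    by rewrite size_cat Hs; move: Hb (k3); move: (k + i * k.-1) r => x y; clear; lia.
  rewrite drop_cat ltn_neqAle (_ : _ <= _) ?Hs; last by apply: leq_trans Hb; apply: leq_addr.
  case: eqP => [E0|_] /=; first by move: Hb (k3); rewrite E0 /=; lia.
  by rewrite takel_cat // size_drop Hs; move: Hb (k3); lia.
have Ek : k.-1 = (k - 2).+1 by move: (k3); lia.
have sd : k.-1 <= size (drop (k + i * k.-1) s) by rewrite size_drop Hs; move: Hb; lia.
have EG : take k.-1 (drop (k + i * k.-1) s) = rcons F (nth x0 (s ++ S) (k + i * k.-1 + (k - 2))).
  rewrite {1}Ek (take_nth x0); last by rewrite -Ek.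
  rewrite -EF nth_drop nth_cat Hs; case: ltnP => // Hx; move: Hb Hx (k3); lia.
rewrite EG in H.
have sF : size F = k - 2 by rewrite size_map size_iota.
split.
  have := H 1; rewrite /= size_rcons sF take_oversize; first by apply; move: (k3); lia.
  by rewrite /= size_rcons sF; move: (k3); lia.
have := H 0; rewrite /= size_rcons sF.
have -> : k = (size F).+2 by rewrite sF; move: (k3); lia.
rewrite /= -cats1 take_size_cat //; apply; lia.
Qed.

Lemma PatS i : i < d -> Pat (map (lam i.+1) w0).
Proof.
move=> Hi; split=> [|s Hs HE].
  by rewrite map_inj_in_uniq ?iota_uniq // => c c'; rewrite !mem_iota; apply: lam_inj.
have [H _] := Pat_block Hi Hs HE; rewrite w0E /= map_lam.
have -> : nth x0 (s ++ S) 0 = nth x0 s 0 by rewrite nth_cat Hs (leq_trans _ k_r) ?(ltnW k1).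
apply: etrans H; apply: edg_perm; apply/permP => p; rewrite /= -cats1 count_cat /= addn0.
by rewrite addnC -addnA.
Qed.

Lemma PatS' i : i < d -> Pat (map (fun c => if c == 0 then r + i else lam i.+1 c) w0).
Proof.
move=> Hi; split=> [|s Hs HE].
  rewrite map_inj_in_uniq ?iota_uniq // => c c'; rewrite !mem_iota !add0n => /andP[_ Hc] /andP[_ Hc'].
  have L := @lam_lt i.+1 c Hi Hc; have L' := @lam_lt i.+1 c' Hi Hc'.
  case: eqP => c0; case: eqP => c0' H; rewrite ?c0 ?c0' //.
  + by move: L'; rewrite -H ltnNge leq_addr.
  + by move: L; rewrite H ltnNge leq_addr.
  + exact: (lam_inj Hc Hc' H).
have [_ H] := Pat_block Hi Hs HE; rewrite w0E /=.
have -> : [seq (if c == 0 then r + i else if c == 0 then k + i * k.-1 + (k - 2) else if c == 1 then 0 else k + i * k.-1 + (c - 2)) | c <- iota 2 (k - 2)]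
   = iota (k + i * k.-1) (k - 2).
  by rewrite -map_lam; apply/eq_in_map => -[|[|c]]; rewrite mem_iota.
apply: etrans H; congr (edg E [:: _, _ & _]); last by rewrite nth_cat Hs (leq_trans _ k_r) ?(ltnW k1).
by rewrite nth_cat Hs ltnNge leq_addr /= addKn.
Qed.

Lemma Pat_lam i e : i <= d -> perm_eq e w0 -> Pat (map (lam i) e).
Proof.
move=> Hi He; apply: (@pattern_edge_perm _ _ _ _ _ _ (map (lam i) w0)); first by rewrite perm_sym perm_map.
by case: i Hi => [|i] Hi; [rewrite map_id; apply: Pat0|apply: PatS].
Qed.

Lemma Pat_hB i tk : i <= d -> perm_eq (map fst tk) w0 -> Pat (map (hB i) tk).
Proof.
case: i => [|i] Hi He.
  by rewrite (_ : map _ _ = map (lam 0) (map fst tk)) ?map_id //; apply: pattern_edge_perm Pat0; rewrite perm_sym.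
case: (boolP ((0, count_z2_0.+1) \in tk)) => Hin; last first.
  have -> : map (hB i.+1) tk = map (lam i.+1) (map fst tk).
    rewrite -map_comp; apply/eq_in_map => x Hx /=; case: eqP => // Ex.
    by move: Hin; rewrite -Ex Hx.
  exact: Pat_lam.
have -> : map (hB i.+1) tk = map (fun c => if c == 0 then r + i else lam i.+1 c) (map fst tk).
  rewrite -map_comp; apply/eq_in_map => -[c j] Hx /=; rewrite xpair_eqE.
  case: (eqVneq c 0) => //= c0; case: eqP => // nj; exfalso; apply: nj.
  have u1 : uniq (map fst tk) by rewrite (perm_uniq He) iota_uniq.
  have : (c, j) = (0, count_z2_0.+1); last by case.
  have [p [q [Hp Hq Ep Eq]]] : exists p q, [/\ p < size tk, q < size tk, nth (0, 0) tk p = (c, j) & nth (0, 0) tk q = (0, count_z2_0.+1)].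
    by exists (index (c, j) tk), (index (0, count_z2_0.+1) tk); rewrite !index_mem !nth_index.
  rewrite -Ep -Eq; congr nth; apply/eqP; rewrite -(nth_uniq 0 _ _ u1) ?size_map //.
  by rewrite !(nth_map (0, 0)) // Ep Eq /= c0.
apply: pattern_edge_perm (PatS' Hi).
by rewrite perm_sym perm_map.
Qed.

Lemma lpath_ix (h num : nat * nat -> nat) z t : wk0 z ->
  (forall tk, perm_eq (map fst tk) w0 -> Pat (map h tk)) ->
  (forall tk, tk \in tokens k z -> num tk < second_base) ->
  blown second_base r absorb_hom t -> size t = r * second_base ->
  lpath k d (edg E) (map (nth x0 (t ++ S)) (map (ix h num) (tokens k z))).
Proof.
move=> Wz Hh Hn Ht st.
have Hl : lpath k d Pat (map h (tokens k z)) by apply: lpath_tokens Wz => tk _; apply: Hh.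
pose idx i := num (nth (0, 0) (tokens k z) i) %% second_base.
have := realize Ht st (fun i => ltn_pmod (num (nth (0, 0) (tokens k z) i)) B0) Hl.
congr (lpath _ _ _ _); apply: (@eq_from_nth _ x0); rewrite size_mkseq !size_map // => i Hi.
rewrite nth_mkseq // !(nth_map 0) ?size_map // !(nth_map (0, 0)) //.
set tk := nth _ _ _; have Htk : num tk < second_base by apply: Hn; apply: mem_nth.
rewrite /vertex_at /ix modn_small // nth_cat st; case: ltnP => Hr; first by rewrite ltn_mulD.
by rewrite ltnNge leq_addr /= addKn.
Qed.

Lemma numB_lt i tk : i <= d -> tk \in tokens k (wB i) -> numB i tk < second_base.
Proof.
move=> Hi; case: tk => c j Ht; have Hw := size_wB i.
have [Hc Hj] := small (letters (Wk' i)) Ht.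
have jM : j < copy_width by apply: leq_ltn_trans Hj Hw.
rewrite /numB; case: ifP => [/andP[/andP[/eqP Ei /eqP /= Ec] _]|_]; last exact: numA_lt.
move: Ht; rewrite Ei /= Ec mem_tokens; last exact: letters.
rewrite Cy ?(ltnW k1) // eqxx muln1 => /andP[_ Hj'].
by rewrite /second_base; apply: ltn_mulD => //; rewrite ltnS leq_subLR.
Qed.

Lemma lpath_pathsA t p : blown second_base r absorb_hom t -> size t = r * second_base -> p \in pathsA ->
  lpath k d (edg E) (map (nth x0 t) p).
Proof.
move=> Ht st Hp; have -> : map (nth x0 t) p = map (nth x0 (t ++ S)) p.
  apply/eq_in_map => i ip; rewrite nth_cat st pathsA_lt //.
  by apply/flattenP; exists p.
case/mapP: Hp => i; rewrite mem_iota => Hi ->; apply: lpath_ix => // tk Htk.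
  by rewrite (map_comp (lam i) fst); apply: Pat_lam.
exact: numA_wA.
Qed.

Lemma lpath_pathsB t p : blown second_base r absorb_hom t -> size t = r * second_base -> p \in pathsB ->
  lpath k d (edg E) (map (nth x0 (t ++ S)) p).
Proof.
move=> Ht st /mapP[i]; rewrite mem_iota => Hi ->; apply: lpath_ix => // tk Htk.
  exact: Pat_hB.
exact: numB_lt.
Qed.

End Host.
End AbsorbPattern.

Lemma dense_blocks (T : finType) K m j (Q : nat -> pred (seq T)) : (forall i, i < j -> dense K m (Q i)) ->
  dense (K ^ j) (j * m) (fun s => all (fun i => Q i (take m (drop (i * m) s))) (iota 0 j)).
Proof.
elim: j => [|j IH] H; first by rewrite /dense /= mul0n.
rewrite mulSnr expnSr.
have D := @dense_cat T _ _ (j * m) m (fun s => all (fun i => Q i (take m (drop (i * m) s))) (iota 0 j)) (fun _ => Q j)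
  (IH (fun i Hi => H i (leqW Hi))) (fun _ _ _ => H j (ltnSn j)).
apply: denseW D (leqnn _) _ => s Hs; case: (boolP (all _ _ && _)) => // /andP[/allP H1 H2]; rewrite lt0b.
rewrite -addn1 iotaD all_cat add0n /=; apply/andP; split; last first.
  by rewrite take_oversize ?H2 // size_drop Hs addKn.
apply/allP => i Hi; have := H1 i Hi; move: Hi; rewrite mem_iota add0n /= => Hi.
have Him : i * m + m <= j * m by rewrite -mulSnr leq_mul2r Hi orbT.
congr (Q i _); rewrite -[in RHS](cat_take_drop (j * m) s) take_drop_catl //.
by rewrite size_takel // Hs; lia.
Qed.

(* [absorb_shape] says that the paths of indices in [pA] and [pB] have the same ends, and that those in [pB] use
   the [d] further indices [C, ..., C + d - 1], which stand for the vertices of the absorbed set [S]. *)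
Lemma absorber (k d K0 : nat) : 1 < d -> d < k -> ~~ (d %| k) -> 0 < K0 ->
  exists C K n0 (pA pB : seq (seq nat)), [/\ absorb_shape k d C pA pB, 0 < K & forall (T : finType) (E : {set {set T}}) (x0 : T) (S : seq T),
    n0 <= #|T| -> codegree_ge E k K0 -> size S = d ->
    dense K C (fun t => all (fun p => lpathb k d (edg E) (map (nth x0 t) p)) pA &&
                 all (fun p => lpathb k d (edg E) (map (nth x0 (t ++ S)) p)) pB)].
Proof.
move=> d1 dk ndk K00; have d0 := ltnW d1; have k0 : 0 < k by apply: leq_ltn_trans dk.
have k3 : 2 < k by apply: leq_trans dk.
have s0 : size (iota 0 k) = k by apply: size_iota.
have u0 := iota_uniq 0 k.
have in0 : 0 \in iota 0 k by rewrite mem_iota.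
have in1 : 1 \in iota 0 k by rewrite mem_iota; lia.
have [z1 [z2 [Wz1 Wz2 Cz]]] := exchange_words d1 dk ndk s0 u0 in0 in1 isT.
have [y1 [y2 [Wy1 Wy2 Cy]]] := insertion_words d1 dk ndk s0 u0 in0.
(* A closed walk of [k] rotations is put in front of all four words. It leaves the differences of
   letter counts unchanged and makes each word longer than [l], so that the starting ends agree. *)
have [z [Wz sz]] : exists z, walk k d (fun w => is_true (perm_eq w (iota 0 k))) (iota 0 k) z (iota 0 k) /\ size z = k * d.
  have [z Hz sz] := wk_iter_rot d1 dk s0 k (perm_refl (iota 0 k)).
  by exists z; split=> //; move: Hz; rewrite (iter_rot_id d1 dk ndk s0 u0).
have Hlong z' : k - d <= size (z ++ z') by rewrite size_cat sz; nia.
have Cy' c : c < k -> count_mem c (z ++ y1) = count_mem c (z ++ y2) + d * (c == 0).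
  by move=> Hc; rewrite !count_cat Cy ?mem_iota // addnA.
have Cz' c : c < k -> count_mem c (z ++ z1) + (c == 1) = count_mem c (z ++ z2) + (c == 0).
  by move=> Hc; rewrite !count_cat -!addnA Cz ?mem_iota.
have W z' : walk k d (fun w => is_true (perm_eq w (iota 0 k))) (iota 0 k) z' (iota 0 k) ->
   walk k d (fun w => is_true (perm_eq w (iota 0 k))) (iota 0 k) (z ++ z') (iota 0 k) by apply: walk_trans.
have Sh := absorb_shape_paths d1 dk ndk (W _ Wy1) (W _ Wy2) (W _ Wz1) (W _ Wz2) Cy' Cz' (Hlong _) (Hlong _) (Hlong _) (Hlong _).
have LA := fun T E x0 S => @lpath_pathsA k d d1 dk ndk _ _ _ _ (W _ Wy1) (W _ Wy2) (W _ Wz1) (W _ Wz2) Cy' Cz' T E x0 S.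
have LB := fun T E x0 S => @lpath_pathsB k d d1 dk ndk _ _ _ _ (W _ Wy1) (W _ Wy2) (W _ Wz1) (W _ Wz2) Cy' Cz' T E x0 S.
set r := k + d * k.-1 in Sh LA LB; set B := second_base _ _ _ _ _ in Sh LA LB.
pose K1 := (2 * K0) ^ k * ((2 * K0) ^ k.-1) ^ d.
have [K HK] := dense_blown B r K1.
eexists (r * B), K.+1, (2 * K0 * (k + k + d)).+1, _, _; split; [exact: Sh|by []|].
move=> T E x0 S Hn HE sS; have n0 : 0 < #|T| by apply: leq_ltn_trans Hn.
have D : dense K1 r (absorb_hom k d E x0 S).
  pose P (s : seq T) := [&& uniq ([::] ++ s), all [predC S] s & lpathb k 1 (edg E) ([::] ++ s)].
  pose Q (w : seq T) i (s : seq T) := [&& uniq ([:: nth x0 S i; nth x0 w 0] ++ s), all [predC (Nil T)] s & lpathb k 1 (edg E) ([:: nth x0 S i; nth x0 w 0] ++ s)].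
  have DP : dense ((2 * K0) ^ k) k P.
    apply: ext_dense => //; first by case: (k) k3 => [|[]].
    by apply: leq_trans (ltnW Hn); rewrite sS leq_mul2l leqnn orbT.
  have DQ w : size w = k -> P w -> dense (((2 * K0) ^ k.-1) ^ d) (d * k.-1)
     (fun s => all (fun i => Q w i (take k.-1 (drop (i * k.-1) s))) (iota 0 d)).
    move=> sw /and3P[_ /allP aw _]; apply: dense_blocks => i Hi.
    apply: ext_dense => //.
    + by case: (k) k3 => [|[]].
    + by rewrite /= andbT inE; apply: contraTneq (mem_nth x0 (s := w) (n := 0) _) => [<-|]; rewrite ?sw //;
        apply/negP => /aw; rewrite /= mem_nth // sS.
    + by apply: leq_trans (ltnW Hn); rewrite leq_mul2l /= addn0 -addnA leq_add2l (leq_trans (leq_pred _)) ?orbT // leq_addr.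
  apply: denseW (dense_cat DP DQ) (leqnn _) _ => s Hs.
  case: (boolP (_ && _)) => // /andP[/and3P[_ _ HP] /allP HQ]; rewrite lt0b /absorb_hom HP /=.
  apply/allP => i Hi; have /and3P[_ _] := HQ i Hi; rewrite drop_drop nth_take // addnC.
  exact.
apply: denseW (HK T _ n0 D) (leqnSn _) _ => t st.
case Ht : (blown _ _ _ t) => //; rewrite lt0b; apply/andP; split; apply/allP => p Hp; apply/(lpathP _ d0).
  exact: LA Ht st Hp.
exact: LB Ht st Hp.
Qed.

(** * Greedy selection *)

Lemma bernoulli_nat x n : x ^ n * (x + n) <= x.+1 ^ n * x.
Proof.
elim: n => [|n IH]; first by rewrite !expn0 addn0.
rewrite !expnS; have := leq_mul (leqnn x.+1) IH; move: (x ^ n) (x.+1 ^ n) => u v; nia.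
Qed.

(** The integer form of [(1 - 1 / R) ^ R <= 1 / 2], obtained from Bernoulli's inequality. *)
Lemma half_power R : 0 < R -> 2 * R.-1 ^ R <= R ^ R.
Proof.
case: R => // -[|x] _ //=; have := bernoulli_nat x.+1 x.+2.
move: (x.+1 ^ _) (x.+2 ^ _) => u v; nia.
Qed.

(** This allows [h] in [select] to be linear in [n] although polynomially many requirements, one for
    each tuple of [D] vertices, must be met. *)
Lemma leq_expn_exp2 D b : exists n0, forall n, n0 <= n -> n ^ D <= 2 ^ (n %/ b.+1).
Proof.
case: D => [|D]; first by exists 0 => n _; rewrite expn0 expn_gt0.
set D' := 2 * D.+1; set g := b.+1 * D'.
exists (g * g) => n Hn; have g0 : 0 < g by [].
set y := n %/ g; have Hy : g <= y by rewrite leq_divRL.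
have H1 : n <= 2 ^ (2 * y).
  apply: (@leq_trans (y.+1 * g)); first by apply: ltnW; rewrite -ltn_divLR.
  rewrite mul2n -addnn expnD leq_mul //; first exact: ltn_expl.
  by apply: leq_trans Hy (ltnW (ltn_expl _ _)).
apply: (@leq_trans ((2 ^ (2 * y)) ^ D.+1)); first by rewrite leq_exp2r.
rewrite -expnM leq_exp2l // (_ : 2 * y * D.+1 = D' * y); last by rewrite /D'; lia.
rewrite leq_divRL // -mulnA mulnC -mulnA (mulnC _ D') mulnA -/g.
have := leq_divM n g; rewrite -/y; rewrite /g; nia.
Qed.

Section Selection.
Variables (T X : finType) (C K : nat) (A : X -> pred (seq T)) (Z : {set T}).
Local Notation n := #|T|.
Hypotheses (K0 : 0 < K) (n0 : 0 < n) (HA : forall x, dense K C (A x)).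

(** The method of conditional expectations in place of a random family: a requirement [x] doubles
    its weight with every member that does not serve it. *)
Definition potential (L : seq (seq T)) := \sum_(x : X) 2 ^ (size L - count (A x) L).

(** Over the tuples disjoint from [Z] and [L], a proportion of at least [1 / (2 * K)] serves each
    [x]. So the potential grows on average by a factor of at most [2 - 1 / (2 * K)], and some tuple
    does at least as well as the average. *)
Lemma select_step (L : seq (seq T)) : (forall s, s \in L -> size s = C) ->
  2 * K * (C * (C + (#|Z| + size L * C))) <= n ->
  exists s, [/\ size s = C, uniq s, all [predC Z] s, all [predC flatten L] s &
    2 * K * potential (s :: L) <= (4 * K).-1 * potential L].
Proof.
move=> HL Hn.
pose Z' := Z :|: [set x in flatten L].
have HZ' : #|Z'| <= #|Z| + size L * C.
  rewrite cardsU; apply: leq_trans (leq_subr _ _) _; rewrite leq_add2l cardsE.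
  apply: leq_trans (card_size _) _; rewrite size_flatten /shape.
  elim: (L) HL => //= s L' IH HL; rewrite HL ?mem_head // mulSn leq_add2l; apply: IH => s' Hs'.
  by apply: HL; rewrite inE Hs' orbT.
pose av s := uniq s && all [predC Z'] s.
pose N := tsum C (fun s => av s).
have Hx x : n ^ C <= 2 * K * tsum C (fun s => A x s && av s).
  apply: dense_avoid => //; apply: leq_trans Hn; rewrite !leq_mul2l leq_add2l HZ' !orbT //.
have HN : N <= n ^ C by apply: tsum_le1.
(* Without requirements the potential is 0, and any tuple that avoids [Z'] serves. *)
case: (pickP (@predT X)) => [x1 _|HX]; last first.
  have [s [Hs _ us as']] := dense_exists (Z := Z') n0 (K := 1) (m := C) (P := predT) (leq_trans (leqnn _) (eq_leq (esym (etrans (mul1n _) (etrans (tsum_const _ _ 1) (muln1 _)))))) (leq_trans (leq_mul (leq_mul (leqnn 2) K0) (leq_mul (leqnn C) (leq_add (leqnn C) HZ'))) Hn).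
  exists s; split=> //; try (apply: sub_all as' => v; rewrite /= !inE negb_or => /andP[] //).
  by rewrite /potential big1 ?muln0 // => x; have := HX x.
have N0 : 0 < N.
  have := Hx x1; have Hle : tsum C (fun s => A x1 s && av s) <= N.
    by apply: leq_tsum => s _; case: (A x1 s).
  have : 0 < n ^ C by rewrite expn_gt0 n0.
  move=> Hp Hq; have := leq_trans Hp (leq_trans Hq (leq_mul (leqnn _) Hle)).
  by rewrite muln_gt0 => /andP[].
pose w x := 2 ^ (size L - count (A x) L).
pose Phi s := \sum_(x : X) w x * (2 - A x s).
have Hphi s : potential (s :: L) = Phi s.
  apply: eq_bigr => x _; rewrite /w /=; have := count_size (A x) L.
  case: (A x s) => H /=; first by rewrite subSS muln1.
  by rewrite add0n subSn // expnS mulnC.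
have Hsum : 2 * K * tsum C (fun s => av s * Phi s) <= (4 * K).-1 * potential L * N.
  have -> : tsum C (fun s => av s * Phi s) = \sum_(x : X) w x * tsum C (fun s => av s * (2 - A x s)).
    under [RHS]eq_bigr => x _ do rewrite -tsum_mull.
    rewrite -(tsum_sum C predT (fun x s => w x * (av s * (2 - A x s)))).
    by apply: eq_tsum => s _; rewrite /Phi big_distrr; apply: eq_bigr => x _; rewrite mulnCA.
  have -> : (4 * K).-1 * potential L * N = \sum_(x : X) (4 * K).-1 * w x * N.
    by rewrite /potential big_distrr big_distrl.
  rewrite big_distrr; apply: leq_sum => x _ /=.
  rewrite mulnCA (mulnC _.-1) -(mulnA (w x)) leq_mul2l; apply/orP; right.
  have E : tsum C (fun s => av s * (2 - A x s)) + tsum C (fun s => A x s && av s) = 2 * N.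
    rewrite -tsumD -tsum_mull; apply: eq_tsum => s _.
    by case: (A x s); case: (av s).
  have := Hx x; move: E HN; set a := tsum C _; set b := tsum C _; nia.
have [s Hs Hlt] : exists2 s, size s = C & av s && (2 * K * Phi s <= (4 * K).-1 * potential L).
  have [s Hs] : exists2 s, size s = C & 0 < (av s && (2 * K * Phi s <= (4 * K).-1 * potential L) : nat).
    apply: tsum_gt0; rewrite lt0n; apply/eqP => E0.
    have : tsum C (fun s => av s * ((4 * K).-1 * potential L).+1) <= tsum C (fun s => av s * (2 * K * Phi s)).
      apply: leq_tsum => s Hs; case Ha : (av s) => //; rewrite !mul1n ltnNge.
      apply/negP => Hc; have := leq_tsum_term (fun s => av s && (2 * K * Phi s <= (4 * K).-1 * potential L) : nat) Hs.
      by rewrite E0 Ha Hc.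
    rewrite tsum_mulr; have -> : tsum C (fun s => av s * (2 * K * Phi s)) = 2 * K * tsum C (fun s => av s * Phi s).
      by rewrite -tsum_mull; apply: eq_tsum => s _; rewrite mulnCA.
    move=> H; have := leq_trans H Hsum; rewrite -/N mulnC leq_pmul2r // ltnn.
    by [].
  by rewrite lt0b => H; exists s.
case/andP: Hlt => /andP[us as'] Hlt; exists s; rewrite Hphi; split=> //.
  by apply: sub_all as' => v; rewrite /= !inE negb_or => /andP[].
by apply: sub_all as' => v; rewrite /= !inE negb_or => /andP[].
Qed.

Lemma select h : #|X| <= 2 ^ h -> 2 * K * (C * (C + (#|Z| + 8 * K * h * C))) <= n ->
  exists L : seq (seq T), [/\ size L = 8 * K * h, forall s, s \in L -> size s = C,
    uniq (flatten L), all [predC Z] (flatten L) & forall x, h <= count (A x) L].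
Proof.
move=> HX Hn.
have [L [sL cL uL aL PL]] : exists L : seq (seq T), [/\ size L = 8 * K * h, forall s, s \in L -> size s = C,
    uniq (flatten L), all [predC Z] (flatten L) & (2 * K) ^ size L * potential L <= (4 * K).-1 ^ size L * #|X|].
  suff : forall m, m <= 8 * K * h -> exists L : seq (seq T), [/\ size L = m, forall s, s \in L -> size s = C,
    uniq (flatten L), all [predC Z] (flatten L) & (2 * K) ^ size L * potential L <= (4 * K).-1 ^ size L * #|X|].
    exact.
  elim=> [|m IH] Hm.
    exists [::]; split=> //; rewrite !expn0 !mul1n /potential -sum1_card.
    by apply: leq_sum => x _.
  have [L [sL cL uL aL PL]] := IH (ltnW Hm).
  have [|s [cs us sZ sL' Ps]] := select_step cL.
    apply: leq_trans Hn; rewrite !leq_mul2l !leq_add2l leq_mul2r sL ltnW ?orbT //.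
  exists (s :: L); split.
  + by rewrite /= sL.
  + by move=> s'; rewrite inE => /orP[/eqP->|/cL].
  + rewrite /= cat_uniq us uL andbT; apply/hasPn => v Hv; apply/negP => vs.
    by move/allP: sL' => /(_ _ vs); rewrite /= Hv.
  + by rewrite /= all_cat sZ.
  + rewrite /= !expnS -mulnA mulnCA; apply: leq_trans (leq_mul (leqnn _) Ps) _.
    by rewrite mulnCA -!mulnA leq_mul2l PL orbT.
exists L; split=> // x.
(* Each run of [4 * K] steps gains a factor 2 over mere doubling. The [2 * h] runs gain
   [2 ^ (2 * h)], of which the initial potential [#|X|] takes at most [2 ^ h]; the rest gives [h]
   serving members for every [x]. *)
have Hsz : size L = 4 * K * (2 * h) by rewrite sL; lia.
have H1 : (2 * K) ^ size L * 2 ^ (size L - count (A x) L) <= (4 * K).-1 ^ size L * #|X|.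
  apply: leq_trans PL; rewrite leq_mul2l /potential (bigD1 x) //= leq_addr orbT //.
have H2 : 2 ^ (2 * h) * (4 * K).-1 ^ size L <= (4 * K) ^ size L.
  rewrite Hsz [_.-1 ^ _]expnM [X in _ <= X]expnM -expnMn.
  case: (h) => [|h']; first by rewrite muln0 !expn0.
  by rewrite leq_exp2r ?half_power ?muln_gt0.
have H3 : (4 * K) ^ size L = (2 * K) ^ size L * 2 ^ size L by rewrite -expnMn; congr (_ ^ _); lia.
have c1 : count (A x) L <= size L by apply: count_size.
have H4 : 2 ^ (2 * h) * 2 ^ (size L - count (A x) L) <= 2 ^ size L * 2 ^ h.
  have p0 : 0 < (2 * K) ^ size L by rewrite expn_gt0 muln_gt0 K0.
  rewrite -(leq_pmul2l p0) mulnCA; apply: leq_trans (leq_mul (leqnn _) H1) _.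
  rewrite mulnA [X in _ <= X]mulnA -H3; exact: leq_mul.
rewrite -!expnD leq_exp2l // in H4; lia.
Qed.

End Selection.

Section Links.
Variables (T : eqType) (k d m B : nat) (P : seq T -> Prop) (R : pred T).
Local Notation l := (k - d).
Hypothesis dm : d %| l + m.
Hypothesis supply : forall X Y used : seq T, size X = l -> size Y = l -> uniq X -> uniq Y ->
  size used <= B -> exists z, [/\ size z = m, uniq z, all R z, all [predC used] z & lpath k d P (X ++ z ++ Y)].

Lemma linked_exist ps X used : size X = l -> uniq X ->
  (forall p, p \in ps -> pth k d P p /\ uniq p) -> size used + size ps * m <= B ->
  exists zs, [/\ linked k d P X zs ps, uniq (flatten zs), all R (flatten zs),
    all [predC used] (flatten zs) & size (flatten zs) = size ps * m].
Proof.
elim: ps X used => [|p ps IH] X used sX uX Hps HB; first by exists [::].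
have [Hp up] := Hps p (mem_head _ _).
have [||z [sz uz Rz az Lz]] := supply (X := X) (Y := start k d p) (used := used) sX (size_start Hp) uX.
+ by rewrite take_uniq.
+ by apply: leq_trans HB; apply: leq_addr.
have [|p' Hp'||zs [Lzs uzs Rzs azs szs]] := IH (finish k d p) (z ++ used) (size_finish Hp).
+ by rewrite drop_uniq.
+ by apply: Hps; rewrite inE Hp' orbT.
+ by move: HB; rewrite size_cat sz /= mulSn; lia.
exists (z :: zs); split => /=.
+ by split; rewrite ?sz.
+ rewrite cat_uniq uz uzs andbT; apply/hasPn => v Hv; have /= := allP azs v Hv.
  by rewrite mem_cat negb_or => /andP[].
+ by rewrite all_cat Rz Rzs.
+ rewrite all_cat az; apply/allP => v Hv; have /= := allP azs v Hv.
  by rewrite mem_cat negb_or => /andP[].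
+ by rewrite size_cat sz szs mulSn.
Qed.

End Links.

Lemma linked_cat (T : eqType) k d (P : seq T -> Prop) X zs ps zs' ps' p0 :
  linked k d P X zs ps -> X = finish k d p0 ->
  linked k d P (finish k d (last p0 ps)) zs' ps' -> linked k d P X (zs ++ zs') (ps ++ ps').
Proof.
elim: zs X ps p0 => [|z zs IH] X [|p ps] //= p0; first by move=> _ ->.
by move=> [H1 H2 H3] _ H4; split=> //; apply: (IH _ _ p).
Qed.

(** * Almost perfect path tilings *)

Lemma perm_iota_modn c N : 0 < N -> perm_eq (map (modn^~ N) (iota c N)) (iota 0 N).
Proof.
move=> N0; apply: uniq_perm; rewrite ?iota_uniq //.
  rewrite map_inj_in_uniq ?iota_uniq // => i j; rewrite !mem_iota => Hi Hj E.
  wlog ij : i j Hi Hj E / i <= j => [H|].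
    by case: (leqP i j) => [|/ltnW] ij; [apply: H|symmetry; apply: H].
  move: E => /esym/eqP; rewrite eqn_mod_dvd // => /dvdnP[[|x] Hx]; [lia|move: Hx; rewrite mulSn; lia].
move=> x; apply/mapP/idP => [[i _ ->]|]; first by rewrite mem_iota add0n ltn_mod.
rewrite mem_iota add0n /= => xN.
have cN : c %% N < N by rewrite ltn_mod.
have Ec := divn_eq c N; move: (c %/ N) (c %% N) Ec cN => a b Ec bN.
case: (leqP b x) => H; [exists (a * N + x)|exists (a.+1 * N + x)].
+ by rewrite mem_iota Ec; lia.
+ by rewrite modnMDl modn_small.
+ by rewrite mem_iota Ec mulSn; lia.
+ by rewrite modnMDl modn_small.
Qed.

Section TileWord.
Variables (k d : nat).
Local Notation q := (k %/ d).
Local Notation t := (q.+1 * d).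
Hypotheses (d1 : 1 < d) (dk : d < k) (ndk : ~~ (d %| k)).

Let d0 : 0 < d. Proof. exact: ltnW. Qed.
Let k1 : 1 < k. Proof. by apply: leq_ltn_trans dk; apply: ltnW. Qed.
Let kE : exists q' r', [/\ q = q', k = q' * d + r', 0 < r', r' < d & 0 < q'].
Proof.
exists q, (k %% d); split=> //; [exact: divn_eq| |by rewrite ltn_mod|by rewrite divn_gt0 // ltnW].
by rewrite lt0n; apply: contra ndk => /eqP; rewrite /dvdn => ->.
Qed.

(* The letters [k.-1 + a] occur every [t] positions, once in each window, with the letters below [k.-1] cyclically in between. *)
Definition tile_letter (i : nat) : nat :=
  if t %| i then k.-1 + i %/ t else (i - (i %/ t).+1) %% k.-1.

(** A window contains exactly [k %/ d + 1] consecutive multiples of [d], because [d] does not divide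
    [k], and hence exactly one multiple of [t]. Once that place is removed, its other [k - 1]
    letters are consecutive terms of a sequence of period [k - 1]. *)
Lemma tile_window m j : j * d + k <= t * m ->
  exists2 a, a < m & perm_eq (map tile_letter (iota (j * d) k)) (k.-1 + a :: iota 0 k.-1).
Proof.
have [q' [r' [Eq Ek r0 rd q0]]] := kE; rewrite Eq => Hj.
have t0 : 0 < q'.+1 * d by rewrite muln_gt0.
(* The special letter of the window is the [a]-th one, at distance [X * d] from the start of the
   window. *)
have [a [X [EX Xq]]] : exists a X, j * d + X * d = a * (q'.+1 * d) /\ X <= q'.
  have Ej := divn_eq j q'.+1; have Hlt : j %% q'.+1 < q'.+1 by rewrite ltn_mod.
  move: (j %/ q'.+1) (j %% q'.+1) Ej Hlt => u v -> Hv.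
  case: (posnP v) => [->|v0]; first by exists u, 0; split=> //; nia.
  exists u.+1, (q'.+1 - v); split; last lia.
  by rewrite -mulnDl mulnA; congr (_ * d); lia.
have am : a < m.
  rewrite ltnNge; apply/negP => H.
  have : m * (q'.+1 * d) <= a * (q'.+1 * d) by rewrite leq_mul2r H orbT.
  rewrite -EX; have : X * d <= q' * d by rewrite leq_mul2r Xq orbT.
  by move: Hj; rewrite mulnC Ek; lia.
exists a => //.
have XY : X * d + (k - X * d).-1.+1 = k.
  have : X * d <= q' * d by rewrite leq_mul2r Xq orbT.
  by rewrite Ek; lia.
set Y := (k - X * d).-1 in XY.
have Yk : Y < q'.+1 * d by rewrite mulSn; move: XY; rewrite Ek; lia.
have Ej : j * d = a * (q'.+1 * d) - X * d by lia.
have E2 : a * (q'.+1 * d) = a * (q'.+1 * d).-1 + a by rewrite -{1}(prednK t0) mulnS addnC.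
have Xt : X * d < q'.+1 * d by rewrite ltn_mul2r d0 ltnS.
have L1 : map tile_letter (iota (j * d) (X * d)) = map (modn^~ k.-1) (iota (a * (q'.+1 * d).-1 - X * d) (X * d)).
  case: (posnP X) => [->|X0]; first by rewrite mul0n.
  have a0 : 0 < a by case: (a) EX => //; rewrite mul0n; have : 0 < X * d by [rewrite muln_gt0 X0]; lia.
  apply: (@eq_from_nth _ 0); rewrite !size_map !size_iota // => i Hi.
  rewrite !(nth_map 0) ?size_iota // !nth_iota // /tile_letter Eq.
  have Ei : j * d + i = a.-1 * (q'.+1 * d) + (q'.+1 * d - (X * d - i)) by rewrite Ej -(prednK a0) mulSn /=; lia.
  have Hs : q'.+1 * d - (X * d - i) < q'.+1 * d by lia.
  have Hs0 : 0 < q'.+1 * d - (X * d - i) by lia.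
  rewrite Ei (dvdn_addr _ (dvdn_mull _ (dvdnn _))) (gtnNdvd Hs0 Hs).
  rewrite divnMDl // divn_small // addn0 prednK // -Ei; congr (_ %% _).
  have : X * d <= a * (q'.+1 * d).-1.
    have : (q'.+1 * d).-1 <= a * (q'.+1 * d).-1 by rewrite leq_pmull.
    by lia.
  by rewrite Ej E2; lia.
have L2 : map tile_letter (iota (a * (q'.+1 * d)).+1 Y) = map (modn^~ k.-1) (iota (a * (q'.+1 * d).-1) Y).
  apply: (@eq_from_nth _ 0); rewrite !size_map !size_iota // => i Hi.
  rewrite !(nth_map 0) ?size_iota // !nth_iota // /tile_letter Eq addSn -addnS.
  have Hs : i.+1 < q'.+1 * d by lia.
  rewrite (dvdn_addr _ (dvdn_mull _ (dvdnn _))) (gtnNdvd (ltn0Sn i) Hs) divnMDl // divn_small // addn0; congr (_ %% _).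
  rewrite E2; move: (a * _.-1) => u. by lia.
rewrite -XY iotaD map_cat (_ : j * d + X * d = a * (q'.+1 * d)) // L1.
rewrite [iota _ Y.+1]/= map_cons L2 /tile_letter Eq dvdn_mull // mulnK // perm_catC /= XY perm_cons perm_catC.
have -> : map (modn^~ k.-1) (iota (a * (q'.+1 * d).-1 - X * d) (X * d)) ++ map (modn^~ k.-1) (iota (a * (q'.+1 * d).-1) Y) =
  map (modn^~ k.-1) (iota (a * (q'.+1 * d).-1 - X * d) k.-1).
  rewrite -map_cat; congr map; rewrite (_ : k.-1 = X * d + Y); last lia.
  rewrite iotaD subnK //.
  case: (posnP a) => [a0|a0]; first by move: EX; rewrite a0; lia.
  have : (q'.+1 * d).-1 <= a * (q'.+1 * d).-1 by rewrite leq_pmull.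
  by lia.
by apply: perm_iota_modn; lia.
Qed.

End TileWord.

Lemma mem_blown (T : eqType) (x0 : T) B r (E' : pred (seq T)) (Q : pred T) t c j :
  (forall s, size s = r -> E' s -> all Q s) -> blown B r E' t -> size t = r * B ->
  c < r -> j < B -> Q (nth x0 t (c * B + j)).
Proof.
move=> HQ Ht st Hc Hj.
have /allP := HQ _ (size_mkseq _ _) (blown_choice x0 Ht st (fun _ => Hj)); apply.
by apply/mapP; exists c; rewrite ?mem_iota.
Qed.

(* A word over [r] variables and the letters [cs], each of which is used once, is realised injectively
   inside a blow-up. *)
Lemma realize_path (k d B r K : nat) : 0 < d -> 0 < B -> exists n0, forall (T : finType) (E : {set {set T}})
  (x0 : T) (cs : seq T) (U : {set T}) (E' : pred (seq T)) (w : seq nat),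
  n0 <= #|T| -> size w <= B -> uniq cs -> all [predC U] cs ->
  (forall i, i < size w -> nth 0 w i < r + size cs) ->
  (forall i j, i < size w -> j < size w -> r <= nth 0 w i -> nth 0 w i = nth 0 w j -> i = j) ->
  (forall s, size s = r -> E' s -> all (mem U) s) ->
  lpath k d (pattern_edge E x0 r cs E') w -> dense K r E' ->
  exists p, [/\ size p = size w, uniq p, lpath k d (edg E) p,
    forall i, i < size w -> nth 0 w i < r -> nth x0 p i \in U &
    forall i, i < size w -> r <= nth 0 w i -> nth x0 p i = nth x0 cs (nth 0 w i - r)].
Proof.
move=> d0 B0; have [K' HK'] := dense_blown B r K.
exists (2 * K' * (r * B * (r * B + 0))).+1 => T E x0 cs U E' w Hn Hw ucs acs Hlt Hone HU Lw D.
have n0 : 0 < #|T| by apply: leq_ltn_trans Hn.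
have [|t [st Ht ut _]] := dense_exists (Z := set0) n0 (HK' T E' n0 D).
  by rewrite cards0; apply: ltnW.
pose idx i := if i < B then i else 0.
have Hidx i : idx i < B by rewrite /idx; case: ifP.
have Lp := realize Ht st Hidx Lw.
set p := mkseq _ _ in Lp.
have Np i : i < size w -> nth x0 p i = vertex_at x0 B r cs t (nth 0 w i) i.
  by move=> Hi; rewrite nth_mkseq // /idx (leq_trans Hi Hw).
have HinU c j : c < r -> j < B -> nth x0 t (c * B + j) \in U.
  by apply: mem_blown HU Ht st.
have sp : size p = size w by rewrite size_mkseq.
exists p; split=> //.
+ apply/(uniqP x0) => i j; rewrite !inE sp => Hi Hj; rewrite !Np // /vertex_at.
  case: ltnP => Hci; case: ltnP => Hcj.
  - move/eqP; rewrite nth_uniq // ?st ?ltn_mulD // ?(leq_trans _ Hw) // => /eqP H.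
    by have := congr1 (modn^~ B) H; rewrite /= !modnMDl !modn_small // (leq_trans _ Hw).
  - move=> Eij; have := HinU _ _ Hci (leq_trans Hi Hw); rewrite Eij => Hu.
    by have /= := allP acs (nth x0 cs (nth 0 w j - r)); rewrite Hu => /(_ _)/negP[] //; rewrite mem_nth // ltn_subLR ?Hlt.
  - move=> Eij; have := HinU _ _ Hcj (leq_trans Hj Hw); rewrite -Eij => Hu.
    by have /= := allP acs (nth x0 cs (nth 0 w i - r)); rewrite Hu => /(_ _)/negP[] //; rewrite mem_nth // ltn_subLR ?Hlt.
  - move/eqP; rewrite nth_uniq // ?ltn_subLR ?Hlt // => /eqP H.
    by apply: Hone => //; lia.
+ by move=> i Hi Hc; rewrite Np // /vertex_at Hc; apply: HinU => //; apply: leq_trans Hw.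
+ by move=> i Hi Hc; rewrite Np // /vertex_at ltnNge Hc.
Qed.

(** * Tiles found in dense links and in dense sets of edges *)

Section Tiles.
Variables (k d : nat).
Local Notation t := ((k %/ d).+1 * d).
Hypotheses (d1 : 1 < d) (dk : d < k) (ndk : ~~ (d %| k)).

Let d0 : 0 < d. Proof. exact: ltnW. Qed.
Let k1 : 1 < k. Proof. by apply: leq_ltn_trans dk; apply: ltnW. Qed.

Definition tile_word m := map (tile_letter k d) (iota 0 (t * m)).

(** The [m] vertices of [ws] are the special letters of the tile word and occur once each; all other
    places lie in a blow-up of their common link. Such a tile therefore spends one vertex of [ws] on
    every [t] vertices. *)
Lemma star_tile m K : 0 < m -> exists n0, forall (T : finType) (E : {set {set T}}) (ws : seq T) (U : {set T}),
  n0 <= #|T| -> size ws = m -> uniq ws -> all [predC U] ws ->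
  dense K k.-1 (fun s => all (mem U) s && all (fun w => edg E (w :: s)) ws) ->
  exists p, [/\ size p = t * m, uniq p, lpath k d (edg E) p & forall v, v \in p -> (v \in U) || (v \in ws)].
Proof.
move=> m0; have k10 : 0 < k.-1 by lia.
have B0 : 0 < t * m by rewrite !muln_gt0 d0.
have [n1 Hn1] := @realize_path k d (t * m) k.-1 K d0 B0.
exists n1.+1 => T E ws U Hn sws uws aws D.
have [x0 _] : exists x0 : T, true by have : 0 < #|T| by [apply: leq_ltn_trans Hn]; case/card_gt0P => x; exists x.
have sw : size (tile_word m) = t * m by rewrite size_map size_iota.
have Nw i : i < t * m -> nth 0 (tile_word m) i = tile_letter k d i.
  by move=> Hi; rewrite (nth_map 0) ?size_iota // nth_iota.
have t0 : 0 < t by rewrite muln_gt0.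
have small i : ~~ (t %| i) -> tile_letter k d i < k.-1.
  by move=> Hi; rewrite /tile_letter (negPf Hi) ltn_mod.
have [|i|i j|s _ /andP[]//|j|p [sp up Lp HU Hws]] := Hn1 T E x0 ws U (fun s => all (mem U) s && all (fun w => edg E (w :: s)) ws) (tile_word m) (ltnW Hn) _ uws aws _ _ _ _ D.
+ by rewrite sw.
+ rewrite sw => Hi; rewrite Nw //; case: (boolP (t %| i)) => Ht.
    by rewrite /tile_letter Ht ltn_add2l sws ltn_divLR // mulnC.
  by apply: leq_trans (small _ Ht) (leq_addr _ _).
+ rewrite sw => Hi Hj; rewrite !Nw // => Hr E0.
  have Hti : t %| i by apply: contraLR Hr => /small; rewrite -ltnNge.
  have Htj : t %| j by apply: contraLR Hr => /small; rewrite E0 -ltnNge.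
  move: E0; rewrite /tile_letter Hti Htj => /addnI E0.
  by rewrite -(divnK Hti) E0 divnK.
+ move=> Hj; have [a am Hp] : exists2 a, a < m & perm_eq (take k (drop (j * d) (tile_word m))) (k.-1 + a :: iota 0 k.-1).
    rewrite -map_drop -map_take drop_iota add0n take_iota (minn_idPl _); last by rewrite sw in Hj; lia.
    by apply: tile_window => //; rewrite sw in Hj.
  apply: (@pattern_edge_perm _ _ _ _ _ _ (k.-1 + a :: iota 0 k.-1)); first by rewrite perm_sym.
  split=> [|s Hs /andP[_ /allP He]].
    by rewrite /= iota_uniq andbT mem_iota add0n /=; lia.
  rewrite /= map_nth_iota0; last by rewrite size_cat Hs leq_addr.
  by rewrite nth_cat Hs ltnNge leq_addr /= addKn take_size_cat //; apply: He; rewrite mem_nth // sws.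
exists p; split=> // [|v Hv]; first by rewrite sp sw.
have Hi : index v p < size p by rewrite index_mem.
rewrite -(nth_index x0 Hv); rewrite sp in Hi.
case: (ltnP (nth 0 (tile_word m) (index v p)) k.-1) => Hc; first by rewrite HU.
rewrite Hws // mem_nth ?orbT // ltn_subLR //.
rewrite sw in Hi; rewrite Nw // in Hc *.
have Ht : t %| index v p by apply: contraLR Hc => /small; rewrite -ltnNge.
by rewrite /tile_letter Ht ltn_add2l sws ltn_divLR // mulnC.
Qed.

Lemma tight_tile L K : 0 < L -> exists n0, forall (T : finType) (E : {set {set T}}) (U : {set T}) (E' : pred (seq T)),
  n0 <= #|T| -> (forall s, size s = k -> E' s -> all (mem U) s && edg E s) ->
  dense K k E' ->
  exists p, [/\ size p = L, uniq p, lpath k d (edg E) p & forall v, v \in p -> v \in U].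
Proof.
move=> L0; have [n1 Hn1] := @realize_path k d L k K d0 L0.
have kk : 0 < k by apply: ltnW.
exists n1.+1 => T E U E' Hn HE D.
have [x0 _] : exists x0 : T, true by have : 0 < #|T| by [apply: leq_ltn_trans Hn]; case/card_gt0P => x; exists x.
pose w := map (modn^~ k) (iota 0 L).
have sw : size w = L by rewrite size_map size_iota.
have Nw i : i < L -> nth 0 w i = i %% k.
  by move=> Hi; rewrite (nth_map 0) ?size_iota // nth_iota.
have [|i|i j|s Hs|j|p [sp up Lp HU _]] := Hn1 T E x0 [::] U E' w (ltnW Hn) _ isT isT _ _ _ _ D.
+ by rewrite sw.
+ by rewrite sw => Hi; rewrite Nw // addn0 ltn_mod.
+ by rewrite sw => Hi Hj; rewrite Nw // leqNgt ltn_mod kk.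
+ by case/(HE _ Hs)/andP.
+ move=> Hj; apply: (@pattern_edge_perm _ _ _ _ _ _ (iota 0 k)).
    rewrite perm_sym -map_drop -map_take drop_iota add0n take_iota (minn_idPl _); last by rewrite sw in Hj; lia.
    exact: perm_iota_modn.
  split=> [|s Hs /(HE _ Hs)/andP[_ He]]; first exact: iota_uniq.
  by rewrite cats0 map_nth_iota0 ?Hs // take_oversize ?Hs.
exists p; split=> // [|v Hv]; first by rewrite sp sw.
have Hi : index v p < size p by rewrite index_mem.
by rewrite -(nth_index x0 Hv) HU -?sp // Nw ?ltn_mod // -sw -sp.
Qed.

End Tiles.

Lemma size_flatten_const (T : eqType) L (Q : seq (seq T)) : (forall p, p \in Q -> size p = L) ->
  size (flatten Q) = size Q * L.
Proof.
elim: Q => //= p Q IH H; rewrite size_cat H ?mem_head // IH ?mulSn // => p' Hp'.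
by apply: H; rewrite inE Hp' orbT.
Qed.

Lemma greedy_tiles (T : eqType) (good : seq T -> Prop) j :
  (forall Q, size Q < j -> (forall p, p \in Q -> good p) -> uniq (flatten Q) ->
     exists p, [/\ good p, uniq p & all [predC flatten Q] p]) ->
  exists Q, [/\ size Q = j, forall p, p \in Q -> good p & uniq (flatten Q)].
Proof.
move=> H; suff : forall i, i <= j -> exists Q, [/\ size Q = i, forall p, p \in Q -> good p & uniq (flatten Q)].
  by move/(_ j); apply.
elim=> [|i IH] Hi; first by exists [::].
have [Q [sQ gQ uQ]] := IH (ltnW Hi).
have [|p [gp up ap]] := H Q _ gQ uQ; first by rewrite sQ.
exists (p :: Q); split; first by rewrite /= sQ.
  by move=> p'; rewrite inE => /orP[/eqP->|/gQ].
rewrite /= cat_uniq up uQ andbT; apply/hasPn => v Hv; apply/negP => vp.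
by move/allP: ap => /(_ _ vp); rewrite /= Hv.
Qed.

Lemma dense_remove (T : finType) K m (P : pred (seq T)) (U U' : {set T}) : 0 < #|T| ->
  dense K m (fun s => all (mem U) s && P s) -> 2 * K * (m * #|U :\: U'|) <= #|T| ->
  dense (2 * K) m (fun s => all (mem U') s && P s).
Proof.
rewrite /dense => n0 H Hn.
have E : tsum m (fun s => all (mem U) s && P s) <= tsum m (fun s => all (mem U') s && P s) + tsum m (fun s => has (mem (U :\: U')) s).
  rewrite -tsumD; apply: leq_tsum => s _; case: (boolP (all (mem U) s)) => //= /allP HU.
  case: (boolP (all (mem U') s)) => [_|]; first by rewrite leq_addr.
  rewrite -has_predC => /hasP[x xs Hx]; have -> : has (mem (U :\: U')) s; last by case: (P s).
  by apply/hasP; exists x => //; rewrite /= inE; apply/andP; split; [exact: Hx|exact: HU].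
have Hh := tsum_has m (mem (U :\: U')).
have HC : tsum m (fun s => has (mem (U :\: U')) s) * #|T| <= m * #|U :\: U'| * #|T| ^ m.
  by apply: leq_trans Hh _; rewrite leq_mul2r leq_mul2l; apply/orP; right; apply/orP; right; apply: subset_leq_card; apply/subsetP.
move: (#|T| ^ m) H HC Hn E => N.
move: (tsum m (fun s => all (mem U) s && _)) (tsum m (fun s => all (mem U') s && _)) => D A.
move: (tsum m (fun s => has _ _)) => C H HC Hn E.
have H1 : N * #|T| <= K * (A + C) * #|T| by rewrite leq_mul2r (leq_trans H) ?orbT // leq_mul2l E orbT.
have H2 : K * C * #|T| * 2 <= N * #|T| by move: Hn HC; clear; nia.
rewrite -(leq_pmul2r n0); move: H1 H2; clear; nia.
Qed.

Section Stars.
Variables (k d : nat).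
Local Notation t := ((k %/ d).+1 * d).
Hypotheses (d1 : 1 < d) (dk : d < k) (ndk : ~~ (d %| k)).
Let d0 : 0 < d. Proof. exact: ltnW. Qed.

(** Among [2 * K * m] vertices with dense links, double counting shows that many [(k - 1)]-tuples
    lie in the links of at least [m] of them. There are only [2 ^ c0] possible sets of such
    vertices, so one choice of [m] vertices has a dense common link. *)
Lemma star_exists m K : 0 < m -> 0 < K -> exists n0, forall (T : finType) (E : {set {set T}}) (W0 U : {set T}),
  n0 <= #|T| -> 2 * K * m <= #|W0| -> [disjoint W0 & U] ->
  (forall w, w \in W0 -> dense K k.-1 (fun s => all (mem U) s && edg E (w :: s))) ->
  exists p, [/\ size p = t * m, uniq p, lpath k d (edg E) p, {subset p <= W0 :|: U} & #|W0 :&: [set x in p]| <= m].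
Proof.
move=> m0 K0; set c0 := 2 * K * m; set K' := 2 * K * 2 ^ c0.
have [n1 Hn1] := star_tile d1 dk ndk K' m0.
exists n1 => T E W0 U Hn /card_geqP[W1 [uW1 sW1 HW1]] WU HW.
pose g u := all (mem U) u * count (fun w => edg E (w :: u)) W1.
have n1T : #|T| ^ k.-1 * 0 = 0 by rewrite muln0.
have Hg : c0 * #|T| ^ k.-1 <= K * tsum k.-1 g.
  rewrite /g -sW1; elim: (W1) HW1 => [|w ws IH] Hws; first by rewrite mul0n.
  have -> : tsum k.-1 (fun u => all (mem U) u * count (fun w => edg E (w :: u)) (w :: ws)) =
     tsum k.-1 (fun u => all (mem U) u && edg E (w :: u)) + tsum k.-1 (fun u => all (mem U) u * count (fun w => edg E (w :: u)) ws).
    by rewrite -tsumD; apply: eq_tsum => u _; rewrite /= mulnDr mulnb.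
  rewrite /= mulSn mulnDr leq_add //; first by apply: HW; apply: Hws; apply: mem_head.
  by apply: IH => w' Hw'; apply: Hws; rewrite inE Hw' orbT.
(* The mask [b] records which vertices of [W1] have the tuple in their links; the first [m] of them
   are retained. *)
pose F (b : c0.-tuple bool) u := all (mem U) u && all (fun w => edg E (w :: u)) (take m (mask b W1)) && (size (take m (mask b W1)) == m).
have H1 : c0 * tsum k.-1 (fun u => m <= g u) <= c0 * \sum_(b : c0.-tuple bool) tsum k.-1 (F b).
  rewrite leq_mul2l; apply/orP; right; rewrite -(tsum_sum _ predT (fun b u => F b u : nat)).
  apply: leq_tsum => u _; case: (leqP m (g u)) => //= Hm.
  have [HU Hc] : all (mem U) u /\ m <= count (fun w => edg E (w :: u)) W1.
    move: Hm; rewrite /g; case: (all (mem U) u) => /= Hm; split=> //.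
    - by rewrite mul1n in Hm.
    - by rewrite mul0n leqn0 (gtn_eqF m0) in Hm.
    - by rewrite mul0n leqn0 (gtn_eqF m0) in Hm.
  pose b := map_tuple (fun w => edg E (w :: u)) (tcast sW1 (in_tuple W1)).
  have Hb : mask b W1 = filter (fun w => edg E (w :: u)) W1.
    by rewrite filter_mask; congr mask; rewrite /= val_tcast.
  rewrite (bigD1 b) //= /F Hb HU size_takel ?size_filter // eqxx andbT.
  rewrite (_ : all _ _) ?leq_addr //; apply/allP => w /mem_take.
  by rewrite mem_filter => /andP[].
have H2 : c0 * #|T| ^ k.-1 <= K * (c0 * \sum_(b : c0.-tuple bool) tsum k.-1 (F b) + m * #|T| ^ k.-1).
  apply: leq_trans Hg _; rewrite leq_mul2l; apply/orP; right.
  apply: leq_trans (leq_add H1 (leqnn _)); rewrite mulnC -[m * _]mulnC -tsum_const -tsum_mulr -tsumD.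
  apply: leq_tsum => u _; rewrite /g; case: (leqP m) => /= [_|/ltnW //].
  rewrite mul1n; apply: leq_trans (leq_addr _ _); case: (all _ _); [rewrite mul1n -sW1; exact: count_size|by rewrite mul0n].
have [b Hb] : exists b, #|T| ^ k.-1 <= K' * tsum k.-1 (F b).
  apply/existsP; rewrite -[X in is_true X]negbK negb_exists; apply/negP => /forallP Hall.
  have Hlt : \sum_(b : c0.-tuple bool) K' * tsum k.-1 (F b) < \sum_(b : c0.-tuple bool) #|T| ^ k.-1.
    apply: (@leq_ltn_trans (\sum_(b : c0.-tuple bool) (#|T| ^ k.-1).-1)).
      by apply: leq_sum => b _; have := Hall b; rewrite -ltnNge; case: (#|T| ^ _).
    rewrite !sum_nat_const ltn_mul2l card_tuple card_bool expn_gt0 /=.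
    by have := Hall (nseq_tuple c0 true); rewrite -ltnNge; case: (#|T| ^ _).
  move: Hlt; rewrite -big_distrr /= sum_nat_const card_tuple card_bool /K'.
  have c00 : 0 < c0 by rewrite !muln_gt0 K0.
  have p0 : 0 < 2 ^ c0 by rewrite expn_gt0.
  move: H2; rewrite {1 2}/c0; move: (\sum_(b | _) _) (#|T| ^ _) (2 ^ c0) p0 => S N P P0 H2.
  rewrite ltnNge => /negP; apply.
  have : N * (K * m) <= 2 * K * S * (K * m) by move: H2; clear; nia.
  have Km : 0 < K * m by rewrite muln_gt0 K0.
  by rewrite leq_pmul2r // => H3; move: (leq_mul (leqnn P) H3); clear; nia.
pose ws := take m (mask b W1).
have sws : size ws = m.
  have p0 : 0 < #|T| ^ k.-1.
    rewrite expn_gt0; apply/orP; left; apply/card_gt0P; case: W1 sW1 {HW1 Hg H1 H2 uW1 g F b Hb ws} => [|x W1'] //; last by exists x.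
    by move/esym/eqP; rewrite /c0 !muln_eq0 (gtn_eqF K0) (gtn_eqF m0).
  apply/eqP; apply: contraLR (leq_trans p0 Hb) => Hs.
  rewrite (_ : tsum _ _ = 0) ?muln0 //; apply/eqP; rewrite -leqn0 -(muln0 (#|T| ^ k.-1)).
  by apply: tsum_le_const => u _; rewrite /F (negPf Hs) andbF.
have HwsW : {subset ws <= W0} by move=> w /mem_take /mem_mask; apply: HW1.
have uws : uniq ws by rewrite take_uniq // mask_uniq.
have aws : all [predC U] ws.
  by apply/allP => w /HwsW wW /=; rewrite (disjointFr WU wW).
have [|p [sp up Lp Hp]] := Hn1 T E ws U Hn sws uws aws.
  apply: denseW Hb (leqnn _) _ => u _; rewrite /F -/ws.
  by rewrite sws eqxx andbT.
exists p; split=> //.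
  by move=> v /Hp /orP[vU|/HwsW vW]; rewrite inE ?vU ?vW ?orbT.
apply: (@leq_trans #|ws|); last by rewrite -sws card_size.
apply: subset_leq_card; apply/subsetP => v; rewrite !inE => /andP[vW /Hp /orP[vU|//]].
by move: (disjointFr WU vW); rewrite vU.
Qed.

Lemma star_tiles m K : 0 < m -> 0 < K -> exists n0, forall (T : finType) (E : {set {set T}}) (W0 U U0 : {set T}) j,
  n0 <= #|T| -> [disjoint W0 & U0] -> j * m + 4 * K * m <= #|W0| ->
  (forall w, w \in W0 -> dense K k.-1 (fun s => all (mem U) s && edg E (w :: s))) ->
  2 * K * (k.-1 * (#|U :\: U0| + j * (t * m))) <= #|T| ->
  exists Q, [/\ size Q = j, forall p, p \in Q -> [/\ size p = t * m, lpath k d (edg E) p & {subset p <= W0 :|: U0}] & uniq (flatten Q)].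
Proof.
move=> m0 K0; have K20 : 0 < 2 * K by rewrite muln_gt0.
have [n1 Hn1] := star_exists m0 K20.
exists n1.+1 => T E W0 U U0 j Hn WU Hj HW Hsm.
have n0 : 0 < #|T| by apply: leq_ltn_trans Hn.
have [|Q [sQ gQ uQ]] := @greedy_tiles T (fun p => [/\ size p = t * m, lpath k d (edg E) p, {subset p <= W0 :|: U0} & #|W0 :&: [set x in p]| <= m]) j.
  move=> Q HQ gQ uQ; pose V := [set x in flatten Q].
  have cV : #|V| <= j * (t * m).
    rewrite cardsE; apply: leq_trans (card_size _) _.
    rewrite (size_flatten_const (L := t * m)) ?leq_mul2r ?(ltnW HQ) ?orbT //.
    by move=> p /gQ[].
  have cW : #|W0 :&: V| <= size Q * m.
    rewrite /V; elim: Q gQ {HQ uQ V cV} => [|p Q IH] gQ.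
      by rewrite (_ : _ :&: _ = set0) ?cards0 //; apply/setP => x; rewrite !inE andbF.
    have -> : W0 :&: [set x in flatten (p :: Q)] = (W0 :&: [set x in p]) :|: (W0 :&: [set x in flatten Q]).
      by apply/setP => x; rewrite !inE mem_cat andb_orr.
    apply: leq_trans (leq_card_setU _ _) _; rewrite /= mulSn leq_add //.
      by have [] := gQ p (mem_head _ _).
    by apply: IH => p' Hp'; apply: gQ; rewrite inE Hp' orbT.
  have [|||p [sp up Lp Hp cp]] := Hn1 T E (W0 :\: V) (U0 :\: V) (ltnW Hn).
  + have := cardsID V W0; move: cW Hj; have : size Q * m <= j * m by rewrite leq_mul2r (ltnW HQ) orbT.
    by move: (#|_ :&: _|) (#|_ :\: _|) => x y; clear; nia.
  + by apply: disjointWl (subsetDl _ _) _; apply: disjointWr (subsetDl _ _) WU.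
  + move=> w; rewrite inE => /andP[_ /HW Dw]; apply: dense_remove Dw _ => //.
    apply: leq_trans Hsm; rewrite !leq_mul2l; apply/orP; right; apply/orP; right.
    apply: (@leq_trans #|(U :\: U0) :|: V|).
      by apply: subset_leq_card; apply/subsetP => x; rewrite !inE; case: (x \in flatten Q); case: (x \in U0); case: (x \in U).
    by apply: leq_trans (leq_card_setU _ _) _; rewrite leq_add2l.
  exists p; split=> //.
    split=> //; first by move=> v /Hp; rewrite !inE => /orP[] /andP[_ ->]; rewrite ?orbT.
    apply: leq_trans cp; apply: subset_leq_card; apply/subsetP => v; rewrite !inE => /andP[vW vp].
    by rewrite vW vp !andbT; have := Hp v vp; rewrite !inE => /orP[] /andP[].
  by apply/allP => v /Hp; rewrite !inE => /orP[] /andP[].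
exists Q; split=> // p /gQ[]; by [].
Qed.

End Stars.

Lemma tsum_exchange2 (T1 T2 : finType) a b (f : seq T1 -> seq T2 -> nat) :
  tsum a (fun s => tsum b (f s)) = tsum b (fun s' => tsum a (f^~ s')).
Proof.
elim: a f => [|a IH] f //=.
rewrite (tsum_sum b predT (fun v s' => tsum a (fun s => f (v :: s) s'))).
by apply: eq_bigr => v _; rewrite IH.
Qed.

Lemma tsum_sumseq (I : finType) k (g : I -> nat) :
  tsum k (fun G => \sum_(i <- G) g i) * #|I| = k * #|I| ^ k * \sum_i g i.
Proof.
elim: k => [|k IH]; first by rewrite /= big_nil.
set X := tsum k _ in IH.
have -> : tsum k.+1 (fun G => \sum_(i <- G) g i) = #|I| ^ k * (\sum_i g i) + #|I| * X.
  rewrite /= big_distrr -sum_nat_const -big_split /=; apply: eq_bigr => v _.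
  by rewrite -tsum_const -tsumD; apply: eq_tsum => s _; rewrite big_cons.
move: IH; rewrite expnS; move: (#|I| ^ k) (\sum_i _) (#|I|) => N S x; clear; nia.
Qed.

(** The loss caused by [V] is measured against the box of side [f] rather than against all of [T];
    otherwise adding up over all boxes would cost a factor equal to the number of groups to a high
    power. *)
Lemma tsum_box (T : finType) (I : eqType) (B : I -> {set T}) (V : {set T}) f (G : seq I) :
  (forall g, #|B g| <= f) ->
  tsum (size G) (fun s => all2 (fun v g => v \in B g) s G && has (mem V) s) * f <= size G * #|V| * f ^ size G.
Proof.
move=> HB; have Hbox G' : tsum (size G') (fun s => all2 (fun v g => v \in B g) s G') <= f ^ size G'.
  elim: G' => //= g G' IH; rewrite expnS.
  apply: (@leq_trans (\sum_(v : T) (v \in B g) * tsum (size G') (fun s => all2 (fun v g => v \in B g) s G'))).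
    by apply: leq_sum => v _; rewrite -tsum_mull; apply: leq_tsum => s _; case: (v \in B g); rewrite ?mul1n.
  rewrite -big_distrl /= leq_mul //; apply: leq_trans (HB g).
  by rewrite -sum1_card [X in _ <= X]big_mkcond; apply: leq_sum => v _; case: (v \in B g).
elim: G => //= g G IH.
set X := tsum _ (fun s => _ && has _ _) in IH.
have E : tsum (size G).+1 (fun s => all2 (fun v g => v \in B g) s (g :: G) && has (mem V) s) <= #|V| * f ^ size G + f * X.
  rewrite /=; apply: (@leq_trans (\sum_(v : T) ((v \in V) * f ^ size G + (v \in B g) * X))).
    apply: leq_sum => v _; case: (boolP (v \in B g)) => vB /=; last first.
      by rewrite (leq_trans (tsum_le_const (c := 0) _)) ?muln0.
    case: (boolP (v \in V)) => vV; rewrite ?mul1n ?mul0n ?add0n.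
      apply: leq_trans (leq_addr _ _); apply: leq_trans (Hbox G); apply: leq_tsum => s _.
      by case: (all2 _ _ _).
    by rewrite /X; apply: leq_tsum => s _.
  rewrite big_split -!big_distrl /=; apply: leq_add; rewrite leq_mul //.
    by rewrite -sum1_card [X in _ <= X]big_mkcond; apply: leq_sum => v _; case: (v \in V).
  apply: leq_trans (HB g).
  by rewrite -sum1_card [X in _ <= X]big_mkcond; apply: leq_sum => v _; case: (v \in B g).
apply: leq_trans (leq_mul E (leqnn f)) _.
have := leq_mul (leqnn f) IH; rewrite expnS; move: (f ^ size G) (#|V|) => u v; nia.
Qed.

Lemma count_modn N g L : g < N -> count (fun i => i %% N == g) (iota 0 L) <= L %/ N + 1.
Proof.
move=> gN; have N0 : 0 < N by apply: leq_ltn_trans gN.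
suff E : count (fun i => i %% N == g) (iota 0 L) = (L + (N.-1 - g)) %/ N.
  rewrite E; apply: (@leq_trans ((L + N) %/ N)); first by apply: leq_div2r; lia.
  by rewrite divnDr // divnn N0.
elim: L => [|L IH]; first by rewrite add0n divn_small //; lia.
rewrite -addn1 iotaD count_cat IH /= add0n addn0 addn1 addSn divnS // addnC; congr (nat_of_bool _ + _).
have EL := divn_eq L N; have HL : L %% N < N by rewrite ltn_mod.
have -> : (L + (N.-1 - g)).+1 = (L %/ N) * N + (L %% N + (N - g)) by lia.
rewrite dvdn_addr ?dvdn_mull //; move: (L %% N) HL => x xN.
apply/eqP/idP => [->|/dvdnP[y Hy]]; first by rewrite subnKC ?dvdnn // ltnW.
have : y = 1 by nia.
by move=> y1; rewrite y1 in Hy; lia.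
Qed.

Lemma count_index_modn (T : eqType) (s : seq T) N g : uniq s -> g < N ->
  count (fun x => index x s %% N == g) s <= size s %/ N + 1.
Proof.
move=> us gN; rewrite -(count_map (index^~ s) (fun i => i %% N == g)).
have -> : map (index^~ s) s = iota 0 (size s).
  apply: (@eq_from_nth _ 0); rewrite size_map ?size_iota // => i Hi.
  have x0 : T by case: s Hi {us}.
  by rewrite (nth_map x0) // index_uniq // nth_iota.
exact: count_modn.
Qed.

(** * Maximal tilings and what they imply *)

Section TilingDef.
Variables (k d : nat).
Local Notation t := ((k %/ d).+1 * d).

Definition tiling (T : finType) (E : {set {set T}}) (Z : {set T}) m (Q : seq (seq T)) : Prop :=
  [/\ forall p, p \in Q -> size p = t * m /\ lpath k d (edg E) p, uniq (flatten Q) & all [predC Z] (flatten Q)].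

Lemma max_tiling (T : finType) (E : {set {set T}}) (Z : {set T}) m : 0 < t * m -> 0 < d ->
  exists2 Q, tiling E Z m Q & forall Q', tiling E Z m Q' -> size Q' <= size Q.
Proof.
move=> tm0 d0.
pose tb (Q : seq (seq T)) := [&& all (fun p => (size p == t * m) && lpathb k d (edg E) p) Q, uniq (flatten Q) & all [predC Z] (flatten Q)].
have tbP Q : reflect (tiling E Z m Q) (tb Q).
  apply: (iffP and3P) => [[/allP H1 H2 H3]|[H1 H2 H3]]; split=> //.
    by move=> p /H1/andP[/eqP ? /(lpathP _ d0)].
  by apply/allP => p /H1[-> /(lpathP _ d0)->]; rewrite eqxx.
pose P j := [exists X : j.-tuple ((t * m).-tuple T), tb (map val X)].
have HP Q : tiling E Z m Q -> P (size Q).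
  move=> HQ; case: (HQ) => H1 _ _; case: Q HQ H1 => [|p Q] HQ H1.
    by apply/existsP; exists [tuple]; apply/tbP.
  have [sp _] := H1 p (mem_head _ _).
  pose dflt : (t * m).-tuple T := tcast sp (in_tuple p).
  pose X := in_tuple (map (fun p' => insubd dflt p') (p :: Q)).
  have EX : map val X = p :: Q.
    rewrite /X /= -map_comp; apply: etrans (map_id (p :: Q)); apply: (eq_in_map _ _ (p :: Q)).1 => p' Hp' /=.
    by rewrite val_insubd; have [-> _] := H1 p' Hp'; rewrite eqxx.
  have : P (size (map (fun p' => insubd dflt p') (p :: Q))) by apply/existsP; exists X; rewrite EX; apply/tbP.
  by rewrite size_map.
have ubP j : P j -> j <= #|T|.
  case/existsP => X /tbP[H1 H2 _]; have := card_size (flatten (map val X)).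
  rewrite (card_uniqP H2) => _; have := max_card (mem (flatten (map val X))).
  rewrite (card_uniqP H2) (size_flatten_const (L := t * m)); last by move=> p /H1[].
  by rewrite size_map size_tuple; apply: leq_trans; rewrite leq_pmulr.
have exP : exists j, P j by exists 0; apply/existsP; exists [tuple].
case: (ex_maxnP exP ubP) => j /existsP[X /tbP HX] Hmax.
exists (map val X) => // Q' /HP /Hmax; by rewrite size_map size_tuple.
Qed.

End TilingDef.

Section Exchange.
Variables (k d m : nat) (T : finType) (E : {set {set T}}) (Z : {set T}) (Q : seq (seq T)).
Local Notation t := ((k %/ d).+1 * d).
Hypotheses (d1 : 1 < d) (dk : d < k) (ndk : ~~ (d %| k)) (m0 : 0 < m) (K0 : 0 < (k %/ d)).
Hypothesis TQ : tiling k d E Z m Q.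
Hypothesis maxQ : forall Q', tiling k d E Z m Q' -> size Q' <= size Q.

Definition covered := [set x in flatten Q].
Definition uncovered := ~: (Z :|: covered).

Lemma size_covered : #|covered| = size Q * (t * m).
Proof.
case: TQ => H1 H2 _; rewrite cardsE (card_uniqP H2); apply: size_flatten_const => p /H1[]; by [].
Qed.

(* Otherwise replacing the selected tiles by the new ones would give a larger tiling. *)
Lemma exchange (sel : pred (seq T)) (Q1 : seq (seq T)) :
  (forall p, p \in Q1 -> size p = t * m /\ lpath k d (edg E) p) -> uniq (flatten Q1) ->
  (forall v, v \in flatten Q1 -> v \notin Z /\ forall p, p \in Q -> v \in p -> sel p) ->
  size Q1 <= count sel Q.
Proof.
case: TQ => H1 H2 H3 G1 G2 G3.
have Hsub v : v \in flatten (filter (predC sel) Q) -> v \in flatten Q.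
  by case/flattenP => p; rewrite mem_filter => /andP[_ pQ] vp; apply/flattenP; exists p.
have : size (filter (predC sel) Q ++ Q1) <= size Q.
  apply: maxQ; split.
  + by move=> p; rewrite mem_cat mem_filter => /orP[/andP[_ /H1]|/G1].
  + rewrite flatten_cat cat_uniq G2 andbT; apply/andP; split.
      elim: (Q) H2 => //= p Q' IH; rewrite cat_uniq => /and3P[up /hasPn Hn uQ]; case: ifP => _; last exact: IH.
      rewrite /= cat_uniq up IH // andbT; apply/hasPn => v /flattenP[p']; rewrite mem_filter => /andP[_ p'Q] vp'.
      by apply: Hn; apply/flattenP; exists p'.
    apply/hasPn => v /G3[_ Hv]; apply/negP => /flattenP[p]; rewrite mem_filter /= => /andP[ns pQ] vp.
    by rewrite (Hv p pQ vp) in ns.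
  + rewrite flatten_cat all_cat; apply/andP; split; first by apply/allP => v /Hsub; apply: (allP H3).
    by apply/allP => v /G3[].
rewrite size_cat size_filter -(count_predC sel Q); lia.
Qed.

Lemma tile_in_uncovered (p : seq T) : size p = t * m -> uniq p -> lpath k d (edg E) p ->
  {subset p <= uncovered} -> False.
Proof.
move=> sp up Lp Hp; have : size [:: p] <= count pred0 Q.
  apply: exchange; rewrite /= ?cats0 //; first by move=> p'; rewrite inE => /eqP->.
  move=> v /Hp; rewrite !inE negb_or => /andP[-> Hv]; split=> // p' p'Q vp'.
  by case/negP: Hv; apply/flattenP; exists p'.
by rewrite count_pred0.
Qed.

End Exchange.

Lemma tsum_uncons (T : finType) k f : 0 < k ->
  tsum k f = \sum_(v : T) tsum k.-1 (fun s => f (v :: s)).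
Proof. by case: k. Qed.

Lemma find_tile (T : eqType) (Q : seq (seq T)) v p : uniq (flatten Q) -> p \in Q -> v \in p ->
  find (fun p' : seq T => v \in p') Q = index p Q.
Proof.
elim: Q => //= p' Q IH; rewrite cat_uniq => /and3P[_ /hasPn Hn uQ]; rewrite inE eq_sym.
case: (eqVneq p' p) => [->|np] /= => [_ ->//|pQ vp].
rewrite ifN; first by rewrite IH.
by apply: Hn; apply/flattenP; exists p.
Qed.

Section TilingMain.
Variables (k d m : nat) (T : finType) (E : {set {set T}}) (Z : {set T}) (Q : seq (seq T)).
Local Notation t := ((k %/ d).+1 * d).
Local Notation n := #|T|.
Hypotheses (d1 : 1 < d) (dk : d < k) (ndk : ~~ (d %| k)) (m0 : 0 < m).
Hypothesis TQ : tiling k d E Z m Q.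
Hypothesis maxQ : forall Q', tiling k d E Z m Q' -> size Q' <= size Q.
Hypothesis HE : codegree_ge E k t.
Variables (Kw K2 N : nat).
Hypotheses (Kw0 : 0 < Kw) (K20 : 0 < K2) (N0 : 0 < N).
Local Notation U := (uncovered Z Q).
Local Notation cov := (covered Q).

Let d0 : 0 < d. Proof. exact: ltnW. Qed.
Let k0 : 0 < k. Proof. exact: leq_ltn_trans dk. Qed.
Let t0 : 0 < t. Proof. by rewrite muln_gt0. Qed.

Definition linkdeg v := tsum k.-1 (fun s => all (mem U) s && edg E (v :: s)).
Definition heavy := [set v in cov | n ^ k.-1 <= Kw * linkdeg v].
Local Notation A := heavy.

Lemma sum_indicator (S : {set T}) c : \sum_(v : T) (v \in S) * c = #|S| * c.
Proof.
rewrite -big_distrl /= -sum1_card [X in _ = X * _]big_mkcond; congr (_ * _); apply: eq_bigr => v _; case: (v \in S).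
Qed.

(** Every [(k - 1)]-set of uncovered vertices has [n / t] neighbours. Those outside the heavy set
    lie in [Z], span an edge inside the uncovered part, or are covered vertices with small link
    degree, whose total contribution is [R]. *)
Lemma lower_heavy : exists2 R, Kw * R <= n * n ^ k.-1 &
  n * #|U| ^ k.-1 <= t * ((#|A| + #|Z|) * #|U| ^ k.-1 + tsum k (fun s => all (mem U) s && edg E s) + R)
     + k.-1 * k.-1 * n ^ k.-1.
Proof.
pose R := \sum_(v : T) (v \in cov :\: A) * linkdeg v; exists R.
  rewrite /R big_distrr -sum_nat_const; apply: leq_sum => v _ /=; rewrite mulnCA.
  case: (boolP (v \in cov :\: A)) => //; rewrite inE mul1n => /andP[vA vc].
  by move: vA; rewrite inE vc /= -ltnNge => /ltnW.
have H1 : n * #|U| ^ k.-1 <= t * (\sum_(v : T) linkdeg v) + n * tsum k.-1 (fun s : seq T => ~~ uniq s : nat).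
  rewrite /linkdeg -(tsum_sum k.-1 predT (fun v s => (all (mem U) s && edg E (v :: s) : nat))).
  have -> : #|U| ^ k.-1 = tsum k.-1 (fun s => all (mem U) s).
    by rewrite (tsum_all k.-1 (mem U)).
  rewrite -[X in X <= _]tsum_mull -[X in _ <= X + _]tsum_mull -[X in _ <= _ + X]tsum_mull -tsumD.
  apply: leq_tsum => s Hs; case: (boolP (uniq s)) => us; last first.
    by apply: leq_trans (leq_addl _ _); rewrite leq_mul2l; case: (all _ _); rewrite orbT.
  case: (boolP (all (mem U) s)) => aU; last by rewrite muln0.
  rewrite muln1 muln0 addn0; apply: leq_trans (HE us Hs) _; rewrite leq_mul2l -sum1_card big_mkcond; apply/orP; right.
  apply: leq_sum => v _; rewrite inE -(@edg_perm _ E (v :: s)); last by rewrite perm_sym perm_rcons.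
  by case: (edg _ _).
have H2 : \sum_(v : T) linkdeg v <= (#|A| + #|Z|) * #|U| ^ k.-1 + tsum k (fun s => all (mem U) s && edg E s) + R.
  have Hw v : linkdeg v <= #|U| ^ k.-1.
    rewrite -(tsum_all k.-1 (mem U)); apply: leq_tsum => s _; by case: (all _ _) => //=; case: (edg _ _).
  have -> : tsum k (fun s => all (mem U) s && edg E s) = \sum_(v : T) (v \in U) * linkdeg v.
    rewrite tsum_uncons //; apply: eq_bigr => v _; rewrite -tsum_mull; apply: eq_tsum => s _ /=.
    by rewrite -andbA mulnb.
  rewrite mulnDl -!sum_indicator /R -!big_split /=; apply: leq_sum => v _.
  case: (boolP (v \in A)) => vA; first by rewrite mul1n -!addnA; apply: leq_trans (Hw v) (leq_addr _ _).
  case: (boolP (v \in Z)) => vZ; first by rewrite mul1n mul0n add0n -!addnA; apply: leq_trans (Hw v) (leq_addr _ _).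
  rewrite !mul0n !add0n !inE (negPf vZ) /=; rewrite inE in vA.
  case: (boolP (v \in flatten Q)) vA => vc /= vA; rewrite ?mul1n ?leq_addr //.
  by move: vA; rewrite inE vc /= => ->; rewrite mul0n mul1n.
apply: leq_trans H1 _; apply: leq_add; first by rewrite leq_mul2l H2 orbT.
by rewrite mulnC tsum_nuniq.
Qed.

Lemma arith_lower (Ng Ne y a z e R : nat) : 0 < y -> 0 < Ng -> 0 < Ne ->
  n ^ k.-1 <= Ne * y -> Kw = 4 * t * Ng * Ne -> Kw * R <= n * n ^ k.-1 -> Kw * e <= n * n ^ k.-1 ->
  4 * Ng * (k.-1 * k.-1 * Ne) <= n -> Ng * z <= n ->
  n * y <= t * ((a + z) * y + e + R) + k.-1 * k.-1 * n ^ k.-1 ->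
  Ng * n <= Ng * (t * a) + t.+1 * n.
Proof.
move=> y0 g0 e0 Hy EK HR He Hn Hz; move: (n ^ k.-1) (k.-1 * k.-1) Hy HR He Hn => P kk Hy HR He Hn H.
have EX x : Ne * (4 * t * Ng * x) = Kw * x by rewrite EK mulnCA !mulnA.
have HR' : 4 * t * Ng * R <= n * y.
  rewrite -(leq_pmul2l e0); apply: leq_trans (_ : n * P <= _); first by rewrite EX.
  by rewrite mulnCA leq_mul2l Hy orbT.
have He' : 4 * t * Ng * e <= n * y.
  rewrite -(leq_pmul2l e0); apply: leq_trans (_ : n * P <= _); first by rewrite EX.
  by rewrite mulnCA leq_mul2l Hy orbT.
have Hk : 4 * Ng * (kk * P) <= n * y.
  apply: (@leq_trans (4 * Ng * (kk * (Ne * y)))); first by rewrite !leq_mul2l Hy !orbT.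
  by rewrite !mulnA in Hn *; rewrite leq_mul2r Hn orbT.
have H4 : 4 * (Ng * (n * y)) <= 4 * (Ng * (t * ((a + z) * y))) + 3 * (n * y).
  have := leq_mul (leqnn (4 * Ng)) H; move: HR' He' Hk; clear.
  set X := (a + z) * y; move: ((k %/ d).+1 * d) (#|T|) => tt nn; clear; lia.
have Hzy : Ng * (z * y) <= n * y by rewrite mulnA leq_mul2r Hz orbT.
have H5 : Ng * n * y <= (Ng * (t * a) + t.+1 * n) * y.
  have : t * (Ng * (z * y)) <= t * (n * y) by rewrite leq_mul2l Hzy orbT.
  move: H4; clear; move: ((k %/ d).+1 * d) (#|T|) => tt nn; lia.
by rewrite leq_pmul2r in H5.
Qed.

Let uQ : uniq (flatten Q). Proof. by case: TQ. Qed.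

Lemma uniq_tiles : uniq Q.
Proof.
have Hp p : p \in Q -> size p = t * m by case: TQ => H _ _ /H[].
elim: (Q) Hp uQ => //= p Q' IH Hp; rewrite cat_uniq => /and3P[_ /hasPn Hn u'].
rewrite IH ?andbT // => [|p' Hp']; last by apply: Hp; rewrite inE Hp' orbT.
apply/negP => pQ; have : 0 < size p by rewrite Hp ?mem_head // muln_gt0 t0.
case: p Hn pQ {Hp} => // x p Hn pQ _; have : x \in flatten Q' by apply/flattenP; exists (x :: p); rewrite ?mem_head.
by move/Hn; rewrite mem_head.
Qed.

(** Tiles and uncovered vertices are dealt out to [N] groups, and a covered vertex belongs to the
    group of its tile. The exchanges below touch only [k] groups at a time; that is a small
    proportion of the vertices, so links into the uncovered part remain dense when these groups are
    left out. *)
Definition gi (p : seq T) := index p Q %% N.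
Definition gr (v : T) := if v \in cov then find (fun p : seq T => v \in p) Q %% N else index v (enum U) %% N.

Lemma gr_tile p v : p \in Q -> v \in p -> gr v = gi p.
Proof.
move=> pQ vp; rewrite /gr inE (_ : v \in flatten Q); last by apply/flattenP; exists p.
by rewrite (find_tile uQ pQ vp).
Qed.

Lemma gr_lt v : gr v < N.
Proof. by rewrite /gr; case: ifP => _; rewrite ltn_mod. Qed.

Definition WG (G : seq nat) := [set v in A | gr v \in G].
Definition cG (G : seq nat) := count (fun p => gi p \in G) Q.
Definition Bg (g : nat) := [set v | [&& v \notin A, v \notin Z & gr v == g]].
Definition fb := 2 * (n %/ N) + t * m + 2.

Lemma card_covg g : g < N -> #|[set v in cov | gr v == g]| <= n %/ N + t * m.
Proof.
move=> gN; have Hp p : p \in Q -> size p = t * m by case: TQ => H _ _ /H[].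
have -> : [set v in cov | gr v == g] = [set v in flatten (filter (fun p => gi p == g) Q)].
  apply/setP => v; rewrite !inE; apply/andP/flattenP => [[/flattenP[p pQ vp] Hg]|[p]].
    by exists p => //; rewrite mem_filter -(gr_tile pQ vp) Hg.
  rewrite mem_filter => /andP[Hg pQ] vp; rewrite (gr_tile pQ vp) Hg; split=> //.
  by apply/flattenP; exists p.
rewrite cardsE; apply: leq_trans (card_size _) _.
rewrite (size_flatten_const (L := t * m)); last by move=> p; rewrite mem_filter => /andP[_ /Hp].
rewrite size_filter; apply: leq_trans (leq_mul (count_index_modn uniq_tiles gN) (leqnn _)) _.
rewrite mulnDl mul1n leq_add2r leq_divRL //.
apply: (@leq_trans (size Q * (t * m))).
  by rewrite mulnAC leq_mul2r leq_trunc_div orbT.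
by rewrite -(size_covered TQ) max_card.
Qed.

Lemma card_Bg g : g < N -> #|Bg g| <= fb.
Proof.
move=> gN; apply: (@leq_trans (#|[set v in cov | gr v == g]| + #|[set v in U | index v (enum U) %% N == g]|)).
  rewrite -cardsUI; apply: leq_trans (leq_addr _ _); apply: subset_leq_card; apply/subsetP => v.
  rewrite !inE /gr inE => /and3P[_ vZ]; rewrite (negPf vZ) /=.
  by case: (v \in flatten Q) => /= ->; rewrite ?orbT.
apply: (@leq_trans (n %/ N + t * m + (n %/ N + 1))); last by rewrite /fb; lia.
apply: leq_add; first exact: card_covg.
have -> : [set v in U | index v (enum U) %% N == g] = [set v in filter (fun v => index v (enum U) %% N == g) (enum U)].
  by apply/setP => v; rewrite inE [RHS]inE mem_filter mem_enum andbC.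
rewrite cardsE; apply: leq_trans (card_size _) _; rewrite size_filter.
apply: leq_trans (count_index_modn (enum_uniq _) gN) _.
by rewrite leq_add2r -cardE leq_div2r // max_card.
Qed.

Lemma card_bigG (V : {set T}) (G : seq nat) b : (forall g, g \in G -> #|[set v in V | gr v == g]| <= b) ->
  #|[set v in V | gr v \in G]| <= size G * b.
Proof.
elim: G => [|g G IH] H.
  by rewrite (_ : [set v in V | _] = set0) ?cards0 //; apply/setP => v; rewrite !inE andbF.
have -> : [set v in V | gr v \in g :: G] = [set v in V | gr v == g] :|: [set v in V | gr v \in G].
  by apply/setP => v; rewrite !inE -andb_orr.
apply: leq_trans (leq_card_setU _ _) _; rewrite mulSn leq_add // ?H ?mem_head //.
by apply: IH => g' Hg'; apply: H; rewrite inE Hg' orbT.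
Qed.

Lemma A_cov v : v \in A -> v \in cov. Proof. by rewrite inE => /andP[]. Qed.
Lemma cov_Z v : v \in cov -> v \notin Z.
Proof. by rewrite inE => vQ; case: TQ => _ _ /allP/(_ v vQ). Qed.

Variable ns nt : nat.
Hypothesis Hstar : forall (W0 U U0 : {set T}) j,
  [disjoint W0 & U0] -> j * m + 4 * Kw * m <= #|W0| ->
  (forall w, w \in W0 -> dense Kw k.-1 (fun s => all (mem U) s && edg E (w :: s))) ->
  2 * Kw * (k.-1 * (#|U :\: U0| + j * (t * m))) <= n ->
  exists Q, [/\ size Q = j, forall p, p \in Q -> [/\ size p = t * m, lpath k d (edg E) p & {subset p <= W0 :|: U0}] & uniq (flatten Q)].
Hypothesis Htight : forall (U' : {set T}) (E' : pred (seq T)), (forall s, size s = k -> E' s -> all (mem U') s && edg E s) ->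
  dense K2 k E' -> exists p, [/\ size p = t * m, uniq p, lpath k d (edg E) p & {subset p <= U'}].
Hypothesis Hfb : 2 * Kw * (k.-1 * (k * fb * (1 + t))) <= n.

Definition U0 (G : seq nat) := [set v in U | gr v \notin G].
Definition j1 G := (#|WG G| - 4 * Kw * m) %/ m.

(** The heavy vertices of the chosen groups are combined with uncovered vertices of the other groups
    only. Thus the remaining vertices of the chosen groups stay free for a second family of
    tiles. *)
Lemma star_G (G : seq nat) : size G <= k -> all (fun g => g < N) G ->
  exists Q1, [/\ size Q1 = j1 G, forall p, p \in Q1 -> size p = t * m /\ lpath k d (edg E) p,
   uniq (flatten Q1) & {subset flatten Q1 <= WG G :|: U0 G}].
Proof.
move=> sG /allP aG; case: (leqP #|WG G| (4 * Kw * m)) => HW.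
  by exists [::]; split=> //; rewrite /j1 (eqP HW) div0n.
have cW : #|WG G| <= k * fb.
  apply: leq_trans (leq_mul sG (leqnn fb)); apply: card_bigG => g /aG gN.
  apply: leq_trans (leq_trans (card_covg gN) (_ : _ <= fb)); last by rewrite /fb; move: (n %/ N) (t * m) => x y; lia.
  by apply: subset_leq_card; apply/subsetP => v; rewrite inE => /andP[/A_cov vc Hv]; rewrite inE vc.
have Hj : j1 G * m <= #|WG G| - 4 * Kw * m by apply: leq_trunc_div.
have [||||Q1 [sQ gQ uQ1]] := @Hstar (WG G) U (U0 G) (j1 G).
- apply/pred0P => v /=; apply/negP => /andP[]; rewrite inE => /andP[/A_cov vc _].
  by rewrite !inE in vc *; rewrite vc orbT.
- by rewrite -(subnK (ltnW HW)) leq_add2r.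
- by move=> w; rewrite inE => /andP[]; rewrite inE => /andP[_ Hw] _; rewrite /dense; apply: Hw.
- apply: leq_trans Hfb; rewrite !leq_mul2l; apply/orP; right; apply/orP; right; rewrite mulnDr muln1.
  apply: leq_add; last first.
    apply: (@leq_trans (#|WG G| * t)); last by rewrite leq_mul2r cW orbT.
    by rewrite mulnCA mulnC leq_mul2r (leq_trans Hj (leq_subr _ _)) orbT.
  have -> : U :\: U0 G = [set v in U | gr v \in G].
    by apply/setP => v; rewrite /U0 in_setD 2!in_set; case: (v \in U); rewrite ?andbF //= negbK andbT.
  apply: leq_trans (leq_mul sG (leqnn fb)); apply: card_bigG => g /aG gN.
  apply: leq_trans (card_Bg gN); apply: subset_leq_card; apply/subsetP => v; rewrite inE => /andP[vU Hv].
  by rewrite inE Hv andbT; move: vU; rewrite !inE negb_or => /andP[-> vc]; rewrite (negPf vc).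
exists Q1; split=> //; first by move=> p /gQ[].
by move=> v /flattenP[p /gQ[_ _ H] /H].
Qed.

Let kd0 : 0 < k %/ d. Proof. by rewrite divn_gt0 // ltnW. Qed.

Lemma star_sel (G : seq nat) v : v \in WG G :|: U0 G -> v \notin Z /\ forall p, p \in Q -> v \in p -> gi p \in G.
Proof.
rewrite inE => /orP[]; rewrite inE => /andP[] vA vG.
  by split=> [|p pQ vp]; [exact/cov_Z/A_cov|rewrite -(gr_tile pQ vp)].
move: vA; rewrite !inE negb_or => /andP[vZ vc]; split=> // p pQ vp.
by case/negP: vc; apply/flattenP; exists p.
Qed.

Lemma j1_le (G : seq nat) : size G <= k -> all (fun g => g < N) G -> j1 G <= cG G.
Proof.
move=> sG aG; have [Q1 [<- g1 u1 s1]] := star_G sG aG.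
rewrite /cG; apply: (exchange d1 dk ndk m0 kd0 TQ maxQ) => // v /s1; exact: star_sel.
Qed.

Lemma WG_le (G : seq nat) : size G <= k -> all (fun g => g < N) G -> #|WG G| <= m * cG G + (4 * Kw + 2) * m.
Proof.
move=> sG aG; have := j1_le sG aG; rewrite /j1 => H.
have : #|WG G| - 4 * Kw * m < (cG G).+1 * m by rewrite -ltn_divLR.
nia.
Qed.

Definition j2 G := (cG G).+1 - j1 G.
Definition eG G := tsum k (fun s => all2 (fun v g => v \in Bg g) s G && edg E s).

(** If the box spanned by the groups of [G] had more edges avoiding heavy vertices, then [j2 G]
    disjoint tight tiles could be found inside it; together with the [j1 G] star tiles these would
    replace the [cG G] tiles of the groups by one more, against maximality. *)
Lemma e_le (G : seq nat) : size G = k -> all (fun g => g < N) G ->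
  K2 * eG G <= K2 * (k * (j2 G * (t * m)) * fb ^ k.-1) + n ^ k.
Proof.
move=> sG aG; rewrite leqNgt; apply/negP => Hlt.
have [|Q1 [sQ1 g1 u1 s1]] := star_G (G := G) _ aG; first by rewrite sG.
pose F := [set v | [&& v \notin A, v \notin Z & gr v \in G]].
have aB s : all2 (fun v g => v \in Bg g) s G -> all (mem F) s.
  suff H G' : {subset G' <= G} -> all2 (fun v g => v \in Bg g) s G' -> all (mem F) s by apply: H.
  elim: G' s => [|g G' IH] [|v s] //= sub /andP[vB Hs].
  rewrite IH // ?andbT; last by move=> g' Hg'; apply: sub; rewrite inE Hg' orbT.
  move: vB; rewrite inE => /and3P[vA vZ /eqP Hg].
  by rewrite /= inE vA vZ Hg; apply: sub; apply: mem_head.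
have cB g : g \in G -> #|Bg g| <= fb by move/(allP aG); apply: card_Bg.
have [|Q2 [sQ2 g2 u2]] := @greedy_tiles T (fun p => [/\ size p = t * m, lpath k d (edg E) p & {subset p <= F}]) (j2 G).
  move=> Q2 sQ2 g2 u2; pose V := [set x in flatten Q2].
  have cV : #|V| <= j2 G * (t * m).
    rewrite cardsE; apply: leq_trans (card_size _) _.
    rewrite (size_flatten_const (L := t * m)) ?leq_mul2r ?(ltnW sQ2) ?orbT //.
    by move=> p /g2[].
  pose E' s := [&& all2 (fun v g => v \in Bg g) s G, all (mem (F :\: V)) s & edg E s].
  have [||p [sp up Lp Hp]] := @Htight (F :\: V) E'.
  + by move=> s _ /and3P[_ -> ->].
  + rewrite /dense leqNgt; apply/negP => H2.
    have HE' : eG G <= tsum k E' + tsum k (fun s => all2 (fun v g => v \in (if g \in G then Bg g else set0)) s G && has (mem V) s).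
      rewrite -tsumD; apply: leq_tsum => s _; rewrite /E'.
      case: (boolP (all2 _ _ _)) => //= Ha.
      have -> : all2 (fun v g => v \in (if g \in G then Bg g else set0)) s G.
        suff H G' : {subset G' <= G} -> all2 (fun v g => v \in Bg g) s G' -> all2 (fun v g => v \in (if g \in G then Bg g else set0)) s G' by apply: H.
        elim: G' (s) => [|g G' IH] [|v s'] //= sub /andP[vB Hs].
        rewrite sub ?mem_head // vB IH //= => g' Hg'; apply: sub; rewrite inE Hg' orbT //.
      have aF := aB _ Ha; case: (boolP (has (mem V) s)) => hV /=; first by case: (edg _ _); case: (all _ _).
      rewrite (_ : all (mem (F :\: V)) s = true) ?addn0 //; apply/allP => v vs /=; rewrite inE.
      by apply/andP; split; [apply: contra hV => vV; apply/hasP; exists v|exact: (allP aF)].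
    have HbB g : #|if g \in G then Bg g else set0| <= fb by case: ifP => [/cB|_] //; rewrite cards0.
    have := tsum_box V G HbB; rewrite sG; set X := tsum k _ in HE' *.
    rewrite -[in fb ^ k](prednK k0) expnSr mulnA leq_pmul2r; last by rewrite /fb addn2.
    move=> HX; have : K2 * eG G <= K2 * (tsum k E' + k * (j2 G * (t * m)) * fb ^ k.-1).
      rewrite leq_mul2l; apply/orP; right; apply: leq_trans HE' _; rewrite leq_add2l; apply: leq_trans HX _.
      by rewrite leq_mul2r leq_mul2l cV !orbT.
    by move: Hlt H2; rewrite mulnDr; move: (K2 * _) (K2 * _) (K2 * _) => a b c; clear; lia.
  exists p; split=> //; first by split=> // v /Hp; rewrite inE => /andP[].
  by apply/allP => v /Hp; rewrite inE => /andP[]; rewrite inE.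
have : size (Q1 ++ Q2) <= count (fun p => gi p \in G) Q.
  have F12 v : v \in flatten Q2 -> v \in F by case/flattenP => p /g2[_ _ H] /H.
  apply: (exchange d1 dk ndk m0 kd0 TQ maxQ) => //.
  + by move=> p; rewrite mem_cat => /orP[/g1|/g2[]].
  + rewrite flatten_cat cat_uniq u1 u2 andbT; apply/hasPn => v /F12; rewrite inE => /and3P[vA vZ vG].
    apply/negP => /s1; rewrite inE => /orP[]; rewrite inE; first by rewrite (negPf vA).
    by rewrite vG andbF.
  + move=> v; rewrite flatten_cat mem_cat => /orP[/s1/star_sel //|/F12]; rewrite inE => /and3P[vA vZ vG].
    by split=> // p pQ vp; rewrite -(gr_tile pQ vp).
rewrite size_cat sQ1 sQ2 -/(cG G) /j2; have := @j1_le G; rewrite sG => /(_ (leqnn _) aG); lia.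
Qed.

Definition slack := (4 * Kw + 2) * m.
(** A group has at most about [m] heavy vertices per tile, or star tiles would improve the tiling.
    The deficit measures how far it stays below this; the sum over all groups is small because heavy
    vertices number about [n / t] in total. *)
Definition deficit g := m * cG [:: g] + slack - #|WG [:: g]|.

Lemma def_eq g : g < N -> deficit g + #|WG [:: g]| = m * cG [:: g] + slack.
Proof. by move=> gN; rewrite subnK //; apply: WG_le => //=; rewrite gN. Qed.

Lemma cG_def (G : seq nat) : all (fun g => g < N) G -> m * cG G <= #|WG G| + \sum_(g <- G) deficit g.
Proof.
elim: G => [|g G IH] /=; first by rewrite /cG (eq_count (a2 := pred0)) ?count_pred0 ?muln0.
case/andP=> gN aG; rewrite big_cons; case: (boolP (g \in G)) => gG.
  have E1 : cG (g :: G) = cG G by apply: eq_count => p; rewrite inE; case: eqP => // ->; rewrite gG.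
  have E2 : WG (g :: G) = WG G by apply/setP => v; rewrite !inE; case: eqP => // ->; rewrite gG.
  by rewrite E1 E2; have := IH aG; lia.
have -> : cG (g :: G) = cG [:: g] + cG G.
  rewrite /cG; elim: (Q) => //= p Q' ->; rewrite !inE; case: eqP => [->|_] /=; rewrite ?(negPf gG); lia.
have -> : #|WG (g :: G)| = #|WG [:: g]| + #|WG G|.
  rewrite -cardsUI (_ : WG [:: g] :&: WG G = set0) ?cards0 ?addn0; last first.
    apply/setP => v; rewrite !inE; apply/negP => /andP[/andP[_ /eqP->] /andP[_]]; by rewrite (negPf gG).
  by congr #|pred_of_set _|; apply/setP => v; rewrite !inE -andb_orr.
have := IH aG; have := def_eq gN; rewrite mulnDr; lia.
Qed.

Lemma j2_def (G : seq nat) : size G = k -> all (fun g => g < N) G -> m * j2 G <= \sum_(g <- G) deficit g + slack.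
Proof.
move=> sG aG; have H1 := cG_def aG; have := @j1_le G; rewrite sG => /(_ (leqnn _) aG) H2.
have : #|WG G| - 4 * Kw * m < (j1 G).+1 * m by rewrite /j1 ltn_ceil.
rewrite /j2 /slack; move: H1 H2; move: (#|WG G|) (j1 G) (cG G) (\sum_(g <- G) deficit g) => w a b D; nia.
Qed.

Lemma sum_cG : \sum_(g < N) cG [:: val g] = size Q.
Proof.
rewrite /cG; elim: (Q) => [|p Q' IH]; first by apply: big1.
rewrite /= big_split /= IH; rewrite -add1n; congr (_ + _).
have gN : gi p < N by rewrite /gi ltn_mod.
rewrite (bigD1 (Ordinal gN)) //= inE eqxx big1 // => g.
rewrite inE -val_eqE /= eq_sym; by case: eqP.
Qed.

Lemma sum_WG : \sum_(g < N) #|WG [:: val g]| = #|A|.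
Proof.
have -> : #|A| = \sum_(v in A) \sum_(g < N) (gr v == g).
  rewrite -sum1_card; apply: eq_bigr => v _; rewrite (bigD1 (Ordinal (gr_lt v))) //= eqxx big1 // => g.
  by rewrite -val_eqE /= eq_sym; case: eqP.
rewrite exchange_big; apply: eq_bigr => g _ /=; rewrite -sum1_card big_mkcond [RHS]big_mkcond; apply: eq_bigr => v _.
by rewrite !inE; case: (_ && (n ^ _ <= _)) => //=; case: eqP.
Qed.

Lemma sum_def : \sum_(g < N) deficit g + #|A| = m * size Q + N * slack.
Proof.
rewrite -sum_WG -big_split /= -sum_cG big_distrr /= -[in N * slack](card_ord N) -sum_nat_const -big_split.
by apply: eq_bigr => g _ /=; apply: def_eq.
Qed.

(** Each edge avoiding [A] and [Z] lies in the box given by the groups of its vertices. Summing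
    [e_le] over all [k]-tuples of groups leaves only the total deficit. *)
Lemma e_total : K2 * tsum k (fun s => all (fun v => (v \notin A) && (v \notin Z)) s && edg E s) <=
  K2 * (k * t * fb ^ k.-1 * (k * N ^ k.-1 * \sum_(g < N) deficit g + N ^ k * slack)) + N ^ k * n ^ k.
Proof.
set e := tsum k _.
have H1 : e <= tsum k (fun G : seq 'I_N => eG (map val G)).
  rewrite /eG (tsum_exchange2 k k (fun (G : seq 'I_N) (s : seq T) => (all2 (fun v g => v \in Bg g) s (map val G) && edg E s) : nat)).
  apply: leq_tsum => s Hs; case: (boolP (_ && _)) => //= /andP[aS eS].
  pose G := map (fun v => Ordinal (gr_lt v)) s.
  have sG : size G = k by rewrite size_map.
  apply: leq_trans (leq_tsum_term (fun G : seq 'I_N => (all2 (fun v g => v \in Bg g) s (map val G) && edg E s) : nat) sG).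
  rewrite eS andbT /G -map_comp lt0b; elim: (s) aS => //= v s' IH /andP[/andP[vA vZ] Hs'].
  by rewrite IH // andbT inE vA vZ eqxx.
have H2 : tsum k (fun G : seq 'I_N => K2 * eG (map val G)) <= tsum k (fun G : seq 'I_N => K2 * (k * t * fb ^ k.-1) * (\sum_(g <- G) deficit g + slack) + n ^ k).
  apply: leq_tsum => G sG; apply: leq_trans (e_le _ _) _; first by rewrite size_map.
    by rewrite all_map; apply/allP => g' _; exact: (ltn_ord g').
  rewrite leq_add2r; have := @j2_def (map val G); rewrite size_map sG big_map => /(_ erefl) H.
  have {}H : m * j2 (map val G) <= \sum_(g <- G) deficit g + slack by apply: H; rewrite all_map; apply/allP => g' _; exact: (ltn_ord g').
  move: H; move: (j2 _) (fb ^ _) (\sum_(g <- G) _ + slack) ((k %/ d).+1 * d) => a b c tt H.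
  have -> : K2 * (k * (a * (tt * m)) * b) = K2 * (k * tt * b) * (m * a) by lia.
  by rewrite leq_mul2l H orbT.
rewrite tsum_mull tsumD tsum_const tsum_mull tsumD tsum_const card_ord in H2.
apply: leq_trans (_ : _ <= K2 * tsum k (fun G : seq 'I_N => eG (map val G))) _; first by rewrite leq_mul2l H1 orbT.
apply: leq_trans H2 _; rewrite leq_add2r -mulnA leq_mul2l; apply/orP; right.
rewrite leq_mul2l leq_add2r; apply/orP; right.
have := @tsum_sumseq 'I_N k (fun g => deficit g); rewrite card_ord -[in N ^ k](prednK k0) expnSr.
have -> : k * (N ^ k.-1 * N) * \sum_(i < N) deficit i = k * N ^ k.-1 * (\sum_(i < N) deficit i) * N.
  by rewrite mulnA mulnAC.
by move/eqP; rewrite eqn_pmul2r // => /eqP->.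
Qed.

End TilingMain.

Section TilingLemma.
Variables (k d : nat).
Hypotheses (d1 : 1 < d) (dk : d < k) (ndk : ~~ (d %| k)).
Local Notation t := ((k %/ d).+1 * d).

(** The order of the constants matters: the permitted size of [Z] depends only on [Neta], while the
    tile length [m] and the precision [Ne] may be chosen afterwards, depending on the structures
    that are put into [Z]. *)
Lemma tiling_lemma Neta : 0 < Neta -> exists2 Ng, 0 < Ng & forall Ne m, 0 < Ne -> 0 < m ->
  exists n0, forall (T : finType) (E : {set {set T}}) (Z : {set T}), n0 <= #|T| ->
    codegree_ge E k t -> Ng * #|Z| <= #|T| ->
    (exists2 Q, tiling k d E Z m Q & Ne * #|uncovered Z Q| <= #|T|) \/
    (exists2 A : {set T}, Neta * (t * #|A|) <= Neta.+1 * #|T| &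
        Neta * tsum k (fun s => all [predC A] s && edg E s) <= #|T| ^ k).
Proof.
move=> eta0; have d0 : 0 < d := ltnW d1; have k0 : 0 < k := leq_ltn_trans (leq0n _) dk.
have t0 : 0 < t by rewrite muln_gt0.
have kd0 : 0 < k %/ d by rewrite divn_gt0 // ltnW.
have [M EM] : exists M, M = 8 * Neta * (k * k) * 3 ^ k.-1 by eexists.
have M0 : 0 < M by rewrite EM !muln_gt0 eta0 k0 expn_gt0.
have [Ng ENg] : exists Ng, Ng = M * t.+1 by eexists.
have Ng0 : 0 < Ng by rewrite ENg muln_gt0 M0.
exists Ng => // Ne m Ne0 m0.
have [Kw EKw] : exists Kw, Kw = 4 * t * Ng * Ne ^ k.-1 by eexists.
have Kw0 : 0 < Kw by rewrite EKw !muln_gt0 Ng0 d0 expn_gt0 Ne0.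
have [N EN] : exists N, N = 6 * Kw * (k * k) * (1 + t) by eexists.
have N0 : 0 < N by rewrite EN !muln_gt0 Kw0 k0.
have [K2 EK2] : exists K2, K2 = 8 * Neta * N ^ k by eexists.
have K20 : 0 < K2 by rewrite EK2 !muln_gt0 eta0 expn_gt0 N0.
have tm0 : 0 < t * m by rewrite muln_gt0 t0.
have [ns Hs] := star_tiles d1 dk ndk m0 Kw0.
have [nt1 Ht1] := tight_tile d1 dk ndk Kw tm0.
have [nt2 Ht2] := tight_tile d1 dk ndk K2 tm0.
set c := slack m Kw.
exists (1 + ns + nt1 + nt2 + N * (t * m + 2) + 4 * Ng * (k.-1 * k.-1 * Ne ^ k.-1) + 2 * (M * t * N * c) + Neta * t * N * c).
move=> T E Z; set n := #|T| => Hn HE HZ.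
have [n0 [hs [h1 [h2 [h3 [h4 [h5 h6]]]]]]] : 0 < n /\ ns <= n /\ nt1 <= n /\ nt2 <= n /\ N * (t * m + 2) <= n /\
   4 * Ng * (k.-1 * k.-1 * Ne ^ k.-1) <= n /\ 2 * (M * t * N * c) <= n /\ Neta * t * N * c <= n.
  move: Hn; move: (N * _) (4 * Ng * _) (2 * _) (Neta * _ * _ * _) => a1 a2 a3 a4; clear; lia.
have [Q TQ maxQ] := max_tiling E Z tm0 d0.
case: (leqP (Ne * #|uncovered Z Q|) n) => HU; first by left; exists Q.
right; have U0 : 0 < #|uncovered Z Q| by case: (#|_|) HU => //; rewrite muln0.
have [R HR HL] := @lower_heavy k d T E Z Q dk HE Kw.
set e := tsum k _ in HL; set y := #|_| ^ _ in HL.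
(* Were there more edges inside the uncovered set, a tight tile could simply be added to the maximal
   tiling. *)
have HRe : Kw * e <= n * n ^ k.-1.
  rewrite -expnS prednK // leqNgt; apply/negP => /ltnW Hd.
  have [s _ Hs'|p [sp up Lp Hp]] := Ht1 T E (uncovered Z Q) _ h1 _ Hd; first exact: Hs'.
  exact: (tile_in_uncovered d1 dk ndk m0 kd0 TQ maxQ sp up Lp Hp).
set a := #|heavy k E Z Q Kw| in HL.
have Ha : Ng * n <= Ng * (t * a) + t.+1 * n.
  apply: (@arith_lower k d T Kw Ng (Ne ^ k.-1) y a #|Z| e R) => //.
  - by rewrite expn_gt0 U0.
  - by rewrite expn_gt0 Ne0.
  - rewrite /y -expnMn; case: (k.-1) => // k'; by rewrite leq_exp2r // ltnW.
have Hfb : N * @fb k d m T N <= 3 * n.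
  rewrite /fb -addnA mulnDr mulnCA; apply: (@leq_trans (2 * n + n)); last lia.
  by rewrite leq_add // leq_mul2l mulnC leq_trunc_div orbT.
have Hfb2 : 2 * Kw * (k.-1 * (k * @fb k d m T N * (1 + t))) <= n.
  rewrite -(@leq_pmul2l 3) //; apply: leq_trans Hfb.
  apply: (@leq_trans (3 * (2 * Kw * (k * (k * @fb k d m T N * (1 + t)))))).
    by rewrite !leq_mul2l leq_mul2r leq_pred !orbT.
  move: (@fb k d m T N) => f; rewrite EN; move: (1 + t) => t1; clear; lia.
have Hstar := fun W0 U U0 j => Hs T E W0 U U0 j hs.
have Htight := fun U' E' => Ht2 T E U' E' h2.
have HD := sum_def d1 dk ndk m0 TQ maxQ Kw0 K20 N0 Hstar Hfb2.
have HE2 := e_total d1 dk ndk m0 TQ maxQ Kw0 K20 N0 Hstar Htight Hfb2.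
rewrite -/a -/c in HD HE2.
set D := \sum_(g < N) _ in HD HE2.
set e' := tsum k _ in HE2.
have Hq : t * (m * size Q) <= n by rewrite mulnA mulnC -(size_covered TQ) max_card.
(* The deficits sum to [m * size Q + N * c - a], where [m * size Q] is at most [n / t] and [a] is at
   least nearly [n / t]. *)
have HD2 : M * (t * D) <= M * t * N * c + n.
  rewrite -(@leq_pmul2l t.+1) //; move: HD Hq Ha; rewrite ENg; clear; move: (size Q) => q.
  move: ((k %/ d).+1 * d) => tt HD Hq Ha.
  have E1 : tt * D + tt * a = tt * (m * q) + tt * (N * c) by rewrite -!mulnDr HD.
  have : M * tt.+1 * (tt * D + tt * a) <= M * tt.+1 * (n + tt * (N * c)) by rewrite leq_mul2l E1 leq_add2r Hq orbT.
  move: Ha; rewrite !mulnDr; move: (M * tt.+1 * (tt * a)) => x; nia.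
exists (heavy k E Z Q Kw).
  rewrite -/a; move: HD Hq h6; move: (size Q) ((k %/ d).+1 * d) => q tt; clear => HD Hq h6.
  have E1 : tt * D + tt * a = tt * (m * q) + tt * (N * c) by rewrite -!mulnDr HD.
  have : Neta * (tt * a) <= Neta * (n + tt * (N * c)).
    rewrite leq_mul2l; apply/orP; right; move: E1 Hq; lia.
  by rewrite mulSn mulnDr !mulnA in h6 *; lia.
rewrite -/n; set eB := tsum k _; set P := n ^ k.-1.
have nP : n ^ k = n * P by rewrite -expnS prednK.
have HX : N ^ k.-1 * @fb k d m T N ^ k.-1 <= 3 ^ k.-1 * P.
  by rewrite -!expnMn; case: (k.-1) => // k'; rewrite leq_exp2r.
have He' : 8 * Neta * e' <= 3 * (n * P).
  have Nk0 : 0 < N ^ k by rewrite expn_gt0 N0.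
  rewrite -(leq_pmul2l Nk0); move: HE2; rewrite EK2 nP => HE2.
  have ENk : N ^ k = N * N ^ k.-1 by rewrite -expnS prednK.
  have F2 : 8 * Neta * (k * t * @fb k d m T N ^ k.-1 * (k * N ^ k.-1 * D + N ^ k * c)) <= P * (M * (t * D) + M * t * N * c).
    rewrite ENk; have -> : 8 * Neta * (k * t * @fb k d m T N ^ k.-1 * (k * N ^ k.-1 * D + N * N ^ k.-1 * c)) =
      (N ^ k.-1 * @fb k d m T N ^ k.-1) * (8 * Neta * k * t * (k * D + N * c)).
      move: (N ^ _) (fb _ _ _ _ _ ^ _) ((k %/ d).+1 * d) => x y' tt; clear; lia.
    apply: leq_trans (leq_mul HX (leqnn _)) _; rewrite [3 ^ _ * P]mulnC -mulnA leq_mul2l; apply/orP; right.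
    rewrite EM; move: (3 ^ _) ((k %/ d).+1 * d) => x tt; move: k0; clear; case: k => // k' _.
    have : 8 * Neta * x * tt * k'.+1 * (N * c) <= 8 * Neta * x * tt * k'.+1 * (k'.+1 * (N * c)) by rewrite leq_mul2l leq_pmull ?orbT.
    lia.
  have F3 : P * (M * (t * D) + M * t * N * c) <= 2 * (n * P).
    have -> : 2 * (n * P) = P * (n + n) by lia.
    rewrite leq_mul2l; apply/orP; right; move: HD2 h5; move: (M * (t * D)) (M * t * N * c) => x z; clear; lia.
  have -> : N ^ k * (8 * Neta * e') = 8 * Neta * N ^ k * e' by lia.
  apply: leq_trans HE2 _; rewrite (_ : 3 * (n * P) = 2 * (n * P) + n * P); last by lia.
  rewrite [X in _ <= X]mulnDr leq_add2r [8 * Neta * _]mulnC -mulnA leq_mul2l; apply/orP; right; exact: leq_trans F2 F3.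
have HZ2 : eB <= e' + k * #|Z| * P.
  have Hh := tsum_has k (mem Z).
  apply: (@leq_trans (e' + tsum k (fun s => has (mem Z) s))).
    rewrite /eB /e' -tsumD; apply: leq_tsum => s _.
    case: (boolP (edg E s)) => es; rewrite ?andbF // !andbT.
    case: (boolP (has (mem Z) s)) => hs'; first by case: (all [predC _] s); rewrite ?addn1.
    rewrite addn0 (_ : all (fun v => _ && _) s = all [predC heavy k E Z Q Kw] s) //.
    apply: eq_in_all => v vs /=; rewrite (_ : v \notin Z) ?andbT //.
    by apply: contra hs' => vZ; apply/hasP; exists v.
  rewrite leq_add2l -(leq_pmul2r n0); apply: leq_trans Hh _; rewrite -/n nP.
  rewrite [n * P]mulnC mulnA leq_mul2r leq_mul2r leq_mul2l.
  by rewrite (_ : #|mem Z| <= #|Z|) ?orbT //; apply: subset_leq_card; apply/subsetP.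
have HZ3 : 8 * Neta * (k * #|Z| * P) <= n * P.
  rewrite !mulnA leq_mul2r; apply/orP; right; apply: leq_trans HZ.
  rewrite leq_mul2r ENg EM; apply/orP; right.
  rewrite (_ : 8 * Neta * (k * k) * 3 ^ k.-1 * t.+1 = 8 * Neta * k * (k * 3 ^ k.-1 * t.+1)); last by rewrite !mulnA.
  by rewrite leq_pmulr // !muln_gt0 k0 expn_gt0.
rewrite nP; move: He' HZ2 HZ3; move: (n * P) (k * #|Z| * P) => x z; clear; nia.
Qed.

End TilingLemma.

(** * The non-extremal case *)

(** Greedy: every element has at least as many candidates as there are elements to be assigned, so
    the earlier choices never exhaust them. *)
Lemma matching (T S : eqType) (A : S -> pred T) (L : seq T) (Ss : seq S) :
  (forall x, x \in Ss -> size Ss <= count (A x) L) ->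
  exists L' : seq (T * option S), [/\ map fst L' = L, perm_eq (pmap snd L') Ss &
    forall t x, (t, Some x) \in L' -> A x t].
Proof.
elim: Ss => [|x Ss IH] H.
  exists (map (fun t => (t, None)) L); rewrite -map_comp map_id; split=> //.
    by elim: (L).
  by move=> t x /mapP[].
have [|L' [EL pL aL]] := IH; first by move=> y Hy; apply: ltnW; apply: H; rewrite inE Hy orbT.
have [t Ht At] : exists2 t, (t, None) \in L' & A x t.
  have : size (pmap snd L') < count (A x) (map fst L').
    by rewrite EL (perm_size pL); apply: H; rewrite mem_head.
  elim: (L') => //= [[t [y|]]] L2 IH2 /=; rewrite ?inE.
    move=> H2; have [|t' H1 H3] := IH2; first by case: (A x t) H2 => /= H2; lia.
    by exists t'; rewrite // inE H1 orbT.
  case: (boolP (A x t)) => Axt /=; first by exists t; rewrite // mem_head.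
  by move=> /IH2[t' H1 H3]; exists t'; rewrite // inE H1 orbT.
have [L1 [L2 EL']] : exists L1 L2, L' = L1 ++ (t, None) :: L2.
  by case/splitPr: Ht => L1 L2; exists L1, L2.
exists (L1 ++ (t, Some x) :: L2); split.
- by rewrite -EL EL' !map_cat.
- move: pL; rewrite EL' !pmap_cat /= => pL; rewrite -cat1s perm_catCA /= perm_cons; exact: pL.
- move=> t' x'; rewrite mem_cat inE => /or3P[H1|/eqP[-> ->] //|H1]; apply: aL; by rewrite EL' mem_cat inE H1 ?orbT.
Qed.

Lemma split_blocks (T : eqType) d (W : seq T) : d %| size W ->
  exists Ss, flatten Ss = W /\ forall S, S \in Ss -> size S = d.
Proof.
move=> dW; pose sh := nseq (size W %/ d) d.
have E : sumn sh = size W by rewrite sumn_nseq mulnC divnK.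
exists (reshape sh W); split; first by rewrite reshapeKr ?E.
have Hs : shape (reshape sh W) = sh by rewrite reshapeKl ?E.
move=> S SR; have : size S \in shape (reshape sh W) by apply: map_f.
by rewrite Hs => /nseqP[].
Qed.

Lemma disjoint_hits (T : eqType) (L : seq (seq T)) (used : seq T) : uniq (flatten L) ->
  (forall t, t \in L -> has (mem used) t) -> size L <= size used.
Proof.
move=> uL H; apply: (@leq_trans (count (mem used) (flatten L))).
  elim: (L) H => //= t L' IH H; rewrite count_cat -add1n leq_add //; first by rewrite -has_count; apply: H; rewrite mem_head.
  by apply: IH => t' Ht'; apply: H; rewrite inE Ht' orbT.
by rewrite -size_filter uniq_leq_size ?filter_uniq // => x; rewrite mem_filter => /andP[].
Qed.

Lemma uniq_map_nth (T : eqType) (x0 : T) t I C : uniq t -> size t = C -> uniq I -> (forall i, i \in I -> i < C) ->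
  uniq (map (nth x0 t) I) /\ {subset map (nth x0 t) I <= t}.
Proof.
move=> ut st uI HI; split.
  by rewrite map_inj_in_uniq // => i j /HI Hi /HI Hj /eqP; rewrite nth_uniq ?st // => /eqP.
by move=> x /mapP[i /HI Hi ->]; rewrite mem_nth ?st.
Qed.

Lemma flatten_sub (T T' : eqType) (L : seq T') (f g : T' -> seq T) : uniq (flatten (map f L)) ->
  (forall t, t \in L -> uniq (g t) /\ {subset g t <= f t}) ->
  uniq (flatten (map g L)) /\ {subset flatten (map g L) <= flatten (map f L)}.
Proof.
elim: L => //= t L IH; rewrite cat_uniq => /and3P[ut /hasPn Hn uL] H.
have [u1 s1] := H t (mem_head _ _).
have [|u2 s2] := IH uL; first by move=> t' Ht'; apply: H; rewrite inE Ht' orbT.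
split; first by rewrite cat_uniq u1 u2 andbT; apply/hasPn => x /s2/Hn /=; apply: contra => /s1.
by move=> x; rewrite !mem_cat => /orP[/s1->//|/s2->]; rewrite orbT.
Qed.

Lemma flatten_flatten (T S : Type) (f : S -> seq (seq T)) L :
  flatten (flatten (map f L)) = flatten (map (fun u => flatten (f u)) L).
Proof. by elim: L => //= u L <-; rewrite flatten_cat. Qed.

(** * Absorbing paths, the reservoir of connections and their assembly *)

Section AbsorbingPaths.
Variables (T : finType) (E : {set {set T}}) (x0 : T) (k d C : nat) (pA pB : seq (seq nat)).
Local Notation l := (k - d).
Hypotheses (d0 : 0 < d) (shape : absorb_shape k d C pA pB).
Local Notation PP := (fun s : seq T => edg E s : Prop).

Definition paths_out t := map (map (nth x0 t)) pA.
Definition paths_in t S := map (map (nth x0 (t ++ S))) pB.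
Definition good_out t := all (fun p => lpathb k d (edg E) (map (nth x0 t) p)) pA.
Definition good_in S t := good_out t && all (fun p => lpathb k d (edg E) (map (nth x0 (t ++ S)) p)) pB.
Definition chosen (u : seq T * option (seq T)) := if u.2 is Some D then paths_in u.1 D else paths_out u.1.

Lemma mem_pA p : p \in pA -> [/\ l <= size p, d %| size p - l, uniq p & forall i, i \in p -> i < C].
Proof.
case: shape => _ up ltC _ Hj pP; have Hi : index p pA < size pA by rewrite index_mem.
have [[H1 H2] _ _ _] := Hj _ Hi; rewrite nth_index // in H1 H2; split=> //.
  case/splitPr: pP up => a b; rewrite flatten_cat /= !cat_uniq; by case/and3P => _ _ /and3P[].
by move=> i ip; apply: ltC; apply/flattenP; exists p.
Qed.

Lemma mem_pB p : p \in pB -> l <= size p /\ d %| size p - l.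
Proof.
case: shape => sAB _ _ _ Hj pP; have Hi : index p pB < size pA by rewrite sAB index_mem.
by have [_ [H1 H2] _ _] := Hj _ Hi; rewrite nth_index // in H1 H2.
Qed.

Lemma pth_out t p : good_out t -> p \in paths_out t -> pth k d PP p.
Proof.
move=> /allP g /mapP[q qA ->]; have [H1 H2 _ _] := mem_pA qA.
by split; rewrite ?size_map //; apply/(lpathP _ d0)/g.
Qed.

Lemma pth_in S t p : good_in S t -> p \in paths_in t S -> pth k d PP p.
Proof.
move=> /andP[_ /allP g] /mapP[q qB ->]; have [H1 H2] := mem_pB qB.
by split; rewrite ?size_map //; apply/(lpathP _ d0)/g.
Qed.

Lemma flatten_out t : flatten (paths_out t) = map (nth x0 t) (flatten pA).
Proof. by rewrite map_flatten. Qed.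

Lemma perm_in t S : size t = C -> size S = d -> perm_eq (flatten (paths_in t S)) (flatten (paths_out t) ++ S).
Proof.
move=> st sS; case: shape => _ _ ltC pAB _.
rewrite (_ : flatten (paths_in t S) = map (nth x0 (t ++ S)) (flatten pB)); last by rewrite map_flatten.
apply: perm_trans (perm_map _ pAB) _; rewrite map_cat flatten_out.
have -> : map (nth x0 (t ++ S)) (flatten pA) = map (nth x0 t) (flatten pA).
  by apply/eq_in_map => i /ltC Hi; rewrite nth_cat st Hi.
rewrite perm_cat2l map_nth_iota; last by rewrite size_cat st sS addKn.
by rewrite -st drop_size_cat // -sS take_size.
Qed.

Lemma chosen_ends u : size u.1 = C ->
  [/\ size (chosen u) = size (paths_out u.1), map (start k d) (chosen u) = map (start k d) (paths_out u.1) &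
     map (finish k d) (chosen u) = map (finish k d) (paths_out u.1)].
Proof.
case: u => t [S|] //= st; rewrite /chosen /=; case: shape => sAB _ ltC _ Hj.
have Hnth j : j < size pA -> forall s, {subset s <= nth [::] pA j} -> map (nth x0 (t ++ S)) s = map (nth x0 t) s.
  move=> Hj' s Hs; apply/eq_in_map => i /Hs Hi; rewrite nth_cat st ltC //.
  by apply/flattenP; exists (nth [::] pA j) => //; rewrite mem_nth.
split; first by rewrite !size_map.
- apply: (@eq_from_nth _ [::]); rewrite !size_map // => j HB; have HA := HB; rewrite -sAB in HA.
  rewrite !(nth_map [::]) ?size_map // /start -!map_take.
  have [_ _ <- _] := Hj j HA; apply: (Hnth j) => // x; exact: mem_take.
- apply: (@eq_from_nth _ [::]); rewrite !size_map // => j HB; have HA := HB; rewrite -sAB in HA.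
  rewrite !(nth_map [::]) ?size_map // /finish -!map_drop !size_map.
  have [_ _ _ <-] := Hj j HA; apply: (Hnth j) => // x; exact: mem_drop.
Qed.

Lemma ends_flatten (Ls : seq (seq T * option (seq T))) : (forall u, u \in Ls -> size u.1 = C) ->
  [/\ size (flatten (map chosen Ls)) = size (flatten (map (paths_out \o fst) Ls)),
   map (start k d) (flatten (map chosen Ls)) = map (start k d) (flatten (map (paths_out \o fst) Ls)) &
   map (finish k d) (flatten (map chosen Ls)) = map (finish k d) (flatten (map (paths_out \o fst) Ls))].
Proof.
elim: Ls => //= u Ls IH H; have [|s1 s2 s3] := IH; first by move=> v Hv; apply: H; rewrite inE Hv orbT.
have [t1 t2 t3] := chosen_ends (H u (mem_head _ _)).
by split; rewrite ?size_cat ?map_cat ?s1 ?s2 ?s3 ?t1 ?t2 ?t3.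
Qed.

Lemma perm_chosen (Ls : seq (seq T * option (seq T))) : (forall u, u \in Ls -> size u.1 = C) ->
  (forall t S, (t, Some S) \in Ls -> size S = d) ->
  perm_eq (flatten (flatten (map chosen Ls))) (flatten (flatten (map (paths_out \o fst) Ls)) ++ flatten (pmap snd Ls)).
Proof.
elim: Ls => //= [[t o]] Ls IH H1 H2; rewrite !flatten_cat.
have {}IH := IH (fun v Hv => H1 v (mem_behead (s := _ :: _) Hv)) (fun t' S' Hv => H2 t' S' (mem_behead (s := _ :: _) Hv)).
rewrite -catA; case: o H1 H2 => [S|] H1 H2 /=; last by rewrite perm_cat2l.
have P1 := perm_in (H1 _ (mem_head _ _)) (H2 _ _ (mem_head _ _)).
apply/permP => p; have := permP P1 p; have := permP IH p; rewrite {1}/chosen /= !count_cat => -> ->; rewrite -!addnA; congr (_ + _); exact: addnCA.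
Qed.

Lemma same_ends (ps ps' : seq (seq T)) : size ps = size ps' -> map (start k d) ps = map (start k d) ps' ->
  map (finish k d) ps = map (finish k d) ps' ->
  forall i, start k d (nth [::] ps i) = start k d (nth [::] ps' i) /\ finish k d (nth [::] ps i) = finish k d (nth [::] ps' i).
Proof.
move=> s1 E1 E2 i; case: (ltnP i (size ps)) => Hi; last by rewrite !nth_default // -s1.
have := congr1 (fun x => nth [::] x i) E1; have := congr1 (fun x => nth [::] x i) E2.
by rewrite !(nth_map [::]) -?s1.
Qed.

End AbsorbingPaths.

Section Supply.
Variables (T : finType) (E : {set {set T}}) (x0 : T) (k d C K : nat) (idx : seq nat).
Local Notation l := (k - d).
Local Notation n := #|T|.
Local Notation PP := (fun s : seq T => edg E s : Prop).
Hypotheses (d0 : 0 < d) (uI : uniq idx) (HI : forall i, i \in idx -> i < C).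
Definition connects (X Y t : seq T) := lpathb k d (edg E) (X ++ map (nth x0 t) idx ++ Y).

Lemma supply_dense (V : seq T) B : 0 < n ->
  (forall X Y, size X = l -> size Y = l -> uniq X -> uniq Y -> dense K C (connects X Y)) ->
  2 * K * (C * (C + (size V + B))) <= n ->
  forall X Y used : seq T, size X = l -> size Y = l -> uniq X -> uniq Y ->
  size used <= B -> exists z, [/\ size z = size idx, uniq z, all [predC V] z, all [predC used] z & lpath k d PP (X ++ z ++ Y)].
Proof.
move=> n0 HD Hn X Y used sX sY uX uY sU.
have [|t [st Ct ut at']] := dense_exists (Z := [set x in V ++ used]) n0 (HD X Y sX sY uX uY).
  apply: leq_trans Hn; rewrite !leq_mul2l leq_add2l; apply/orP; right; apply/orP; right.
  by rewrite cardsE; apply: leq_trans (card_size _) _; rewrite size_cat leq_add2l.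
have [uz sz] := @uniq_map_nth T x0 t idx C ut st uI HI.
have Hz x : x \in map (nth x0 t) idx -> (x \notin V) && (x \notin used).
  by move/sz/(allP at'); rewrite /= inE mem_cat negb_or.
exists (map (nth x0 t) idx); split; rewrite ?size_map //.
+ by apply/allP => x /Hz/andP[].
+ by apply/allP => x /Hz/andP[].
+ exact/(lpathP _ d0).
Qed.

(** The members of [LC] are disjoint, so every used vertex spoils at most one of them; more than [B]
    members connect the given ends, and one is left. *)
Lemma supply_family (LC : seq (seq T)) B : uniq (flatten LC) -> (forall t, t \in LC -> size t = C) ->
  (forall X Y, size X = l -> size Y = l -> uniq X -> uniq Y -> B < count (connects X Y) LC) ->
  forall X Y used : seq T, size X = l -> size Y = l -> uniq X -> uniq Y ->
  size used <= B -> exists z, [/\ size z = size idx, uniq z, all (mem (flatten LC)) z, all [predC used] z & lpath k d PP (X ++ z ++ Y)].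
Proof.
move=> uL cL HL X Y used sX sY uX uY sU.
have := HL X Y sX sY uX uY; case: (boolP (has (fun t => connects X Y t && ~~ has (mem used) t) LC)).
  case/hasP => t tL /andP[Ct /hasPn Hn] _; have ut : uniq t.
    by case/splitPr: tL uL => a b; rewrite flatten_cat /= !cat_uniq; case/and3P => _ _ /and3P[].
  have [uz sz] := @uniq_map_nth T x0 t idx C ut (cL t tL) uI HI.
  exists (map (nth x0 t) idx); split; rewrite ?size_map //.
  + by apply/allP => x /sz xt; apply/flattenP; exists t.
  + by apply/allP => x /sz/Hn.
  + exact/(lpathP _ d0).
move/hasPn => Hn; rewrite -size_filter => Hc; exfalso.
have : size (filter (connects X Y) LC) <= size used.
  apply: disjoint_hits.
    rewrite -[filter _ _](map_id) in Hc *.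
    elim: (LC) uL {cL HL Hn Hc} => //= t L IH; rewrite cat_uniq => /and3P[ut /hasPn Hn uL].
    case: ifP => _; rewrite ?IH //= cat_uniq ut IH // andbT; apply/hasPn => x /flattenP[t']; rewrite map_id mem_filter => /andP[_ t'L] xt'.
    by apply: Hn; apply/flattenP; exists t'.
  by move=> t; rewrite mem_filter => /andP[Ct /Hn]; rewrite Ct negbK.
by rewrite leqNgt (leq_ltn_trans sU Hc).
Qed.

End Supply.

Section Assembly.
Variables (T : finType) (E : {set {set T}}) (x0 : T) (k d C m1 h : nat) (pA pB : seq (seq nat)).
Local Notation l := (k - d).
Local Notation n := #|T|.
Local Notation PP := (fun s : seq T => edg E s : Prop).
Hypotheses (d0 : 0 < d) (dk : d < k) (dn : d %| n) (shape : absorb_shape k d C pA pB).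
Variables (LA : seq (seq T)) (ps2 zs1 zs2 : seq (seq T)) (z : seq T).
Hypothesis LA_size : forall t, t \in LA -> size t = C.
Hypothesis LA_good : forall t, t \in LA -> good_out E x0 k d pA t.
Hypothesis LA_count : forall S, size S = d -> h <= count (good_in E x0 k d pA pB S) LA.
Hypothesis ps2_pth : forall p, p \in ps2 -> pth k d PP p.
Local Notation ps1 := (flatten (map (paths_out x0 pA) LA)).
Variables (p1 : seq T) (ps1' : seq (seq T)).
Hypothesis Eps1 : ps1 = p1 :: ps1'.
Hypothesis link1 : linked k d PP (finish k d p1) zs1 ps1'.
Hypothesis link2 : linked k d PP (finish k d (last p1 ps1')) zs2 ps2.
Hypothesis zd : d %| l + size z.
Hypothesis closing : lpath k d PP (finish k d (last p1 (ps1' ++ ps2)) ++ z ++ start k d p1).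
Local Notation D := (flatten ps1 ++ flatten zs1 ++ flatten zs2 ++ z ++ flatten ps2).
Hypothesis uD : uniq D.
Hypothesis leftover : #|[set x | x \notin D]| <= h.

Lemma close_up (q1 : seq T) qs : size qs = size ps1' -> start k d q1 = start k d p1 -> finish k d q1 = finish k d p1 ->
  (forall i, start k d (nth [::] qs i) = start k d (nth [::] ps1' i) /\ finish k d (nth [::] qs i) = finish k d (nth [::] ps1' i)) ->
  (forall p, p \in q1 :: qs -> pth k d PP p) ->
  exists c, [/\ perm_eq c (flatten (q1 :: qs) ++ flatten zs1 ++ flatten zs2 ++ z ++ flatten ps2), d %| size c & lpath k d PP (c ++ take l c)].
Proof.
move=> sq S1 F1 Hi Hq.
have L1 : linked k d PP (finish k d q1) (zs1 ++ zs2) (qs ++ ps2).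
  apply: (linked_cat (p0 := q1)) => //.
    rewrite F1; apply: linked_replace link1 (esym sq) _ => i; have [-> ->] := Hi i; by split.
  have -> : finish k d (last q1 qs) = finish k d (last p1 ps1').
    rewrite !(last_nth [::]) sq; case: (size ps1') => [|j] //=; by have [_ ->] := Hi j.
  exact: link2.
have [||c [pc dc Lc]] := cycle_of_linked d0 dk (Hq _ (mem_head _ _)) _ L1 zd.
- by move=> p; rewrite mem_cat => /orP[Hp|/ps2_pth//]; apply: Hq; rewrite inE Hp orbT.
- have -> : finish k d (last q1 (qs ++ ps2)) = finish k d (last p1 (ps1' ++ ps2)).
    rewrite !last_cat; case: (ps2) => //=.
    rewrite !(last_nth [::]) sq; case: (size ps1') => [|j] //=; by have [_ ->] := Hi j.
  by rewrite S1.
exists c; split=> //; apply: perm_trans pc _; apply/permP => p.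
by rewrite /= !flatten_cat !count_cat; move: (count p z) => u; lia.
Qed.

(** The leftover set is cut into [d]-sets, which are matched to absorbing tuples; every matched
    tuple switches to the paths that contain its [d]-set. Ends do not change, so the links still
    fit. *)
Lemma absorb_all : exists c, [/\ uniq c, c =i T & lpath k d PP (c ++ take l c)].
Proof.
have Hp1 p : p \in p1 :: ps1' -> pth k d PP p.
  by rewrite -Eps1 => /flattenP[qs /mapP[t tL ->]]; apply: (pth_out d0 shape (LA_good tL)).
(* The paths are first closed up without absorbing anything, only to learn that [d] divides the
   number of their vertices, and hence the size of the leftover set. *)
have [c0 [pc0 dc0 _]] := @close_up p1 ps1' erefl erefl erefl (fun i => conj erefl erefl) Hp1.
rewrite -Eps1 in pc0.
pose W := filter (predC (mem D)) (enum T).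
have uW : uniq W by rewrite filter_uniq ?enum_uniq.
have sW : size W <= h.
  apply: leq_trans leftover; rewrite -(card_uniqP uW); apply: subset_leq_card; apply/subsetP => x.
  by rewrite mem_filter inE => /andP[].
have sDW : size D + size W = n.
  rewrite -size_cat cardE; apply: perm_size; apply: uniq_perm; rewrite ?enum_uniq //.
    rewrite cat_uniq uD uW andbT; apply/hasPn => x; by rewrite mem_filter => /andP[].
  by move=> x; rewrite mem_enum mem_cat mem_filter mem_enum andbT; case: (boolP (x \in D)) => //= Hx; rewrite Hx.
have dW : d %| size W by move: dn; rewrite -sDW -(perm_size pc0) dvdn_addr.
have [Ss [ESs sSs]] := split_blocks dW.
have cSs : size Ss <= h.
  apply: leq_trans sW; rewrite -ESs (size_flatten_const (L := d)) //; exact: leq_pmulr.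
have [|Ls [E1 pLs aLs]] := @matching _ _ (good_in E x0 k d pA pB) LA Ss.
  by move=> S /sSs/LA_count; apply: leq_trans.
have sLs u : u \in Ls -> size u.1 = C by move=> uL; apply: LA_size; rewrite -E1 map_f.
have Ech : flatten (map (paths_out x0 pA \o fst) Ls) = p1 :: ps1' by rewrite map_comp E1.
have [e1 e2 e3] := ends_flatten x0 shape sLs.
rewrite Ech in e1 e2 e3.
have sS t S : (t, Some S) \in Ls -> size S = d.
  move=> HS; apply: sSs; rewrite -(perm_mem pLs) mem_pmap; apply/mapP; by exists (t, Some S).
have pC := perm_chosen x0 shape sLs sS.
case Eq : (flatten (map (chosen x0 pA pB) Ls)) e1 e2 e3 pC => [|q1 qs] //= [e1] [e2 e2'] [e3 e3'] pC.
have [||c [pc _ Lc]] := @close_up q1 qs e1 e2 e3.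
- exact: same_ends.
- rewrite -Eq => p /flattenP[ps /mapP[[t [S|]] HS ->]]; rewrite /chosen /= => Hp.
    by apply: (pth_in d0 shape (aLs _ _ HS)).
  by apply: (pth_out d0 shape (LA_good _)) Hp; rewrite -E1; apply: (map_f fst HS).
have {}pc : perm_eq c (D ++ W).
  apply: perm_trans pc _; apply/permP => p; have := permP pC p; have := perm_flatten pLs => /permP/(_ p).
  rewrite Ech -Eps1 ESs /= !count_cat => -> ->; lia.
exists c; split=> //.
  rewrite (perm_uniq pc) cat_uniq uD uW andbT; apply/hasPn => x; by rewrite mem_filter => /andP[].
move=> x; rewrite (perm_mem pc) mem_cat mem_filter mem_enum andbT /= inE.
by case: (x \in D).
Qed.

End Assembly.

Lemma uniq_flatten_filter (T : eqType) (P : pred (seq T)) (L : seq (seq T)) : uniq (flatten L) ->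
  uniq (flatten (filter P L)).
Proof.
elim: L => //= t L IH; rewrite cat_uniq => /and3P[ut /hasPn Hn uL].
case: ifP => _; rewrite ?IH //= cat_uniq ut IH // andbT; apply/hasPn => x /flattenP[t']; rewrite mem_filter => /andP[_ t'L] xt'.
by apply: Hn; apply/flattenP; exists t'.
Qed.

Lemma uniq_in_flatten (T : eqType) (L : seq (seq T)) p : uniq (flatten L) -> p \in L -> uniq p.
Proof. by move=> uL pL; case/splitPr: pL uL => a b; rewrite flatten_cat /= !cat_uniq; case/and3P => _ _ /and3P[]. Qed.

Section Leftover.
Variables (T : finType) (Z : {set T}) (Q : seq (seq T)) (V1 V2 LCf D' : seq T) (L0 tm d : nat).
Hypotheses (EZ : Z = [set x in V1 ++ V2 ++ LCf]) (HQ : forall p, p \in Q -> size p = tm) (HL : tm <= L0 + d).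

Lemma leftover_card : #|[set x | x \notin V1 ++ V2 ++ D' ++ flatten (map (take L0) Q)]| <= size LCf + #|uncovered Z Q| + size Q * d.
Proof.
have : [set x | x \notin V1 ++ V2 ++ D' ++ flatten (map (take L0) Q)] \subset
   [set x in LCf] :|: uncovered Z Q :|: [set x in flatten (map (drop L0) Q)].
  apply/subsetP => x; rewrite !inE !mem_cat !negb_or => /and4P[x1 x2 _ x3]; rewrite EZ inE !mem_cat (negPf x1) (negPf x2) /=.
  case: (x \in LCf) => //=; case: (boolP (x \in flatten Q)) => //= /flattenP[p pQ xp].
  apply/flattenP; exists (drop L0 p); first exact: map_f.
  move: xp; rewrite -{1}(cat_take_drop L0 p) mem_cat => /orP[xt|//].
  by case/negP: x3; apply/flattenP; exists (take L0 p) => //; apply: map_f.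
move/subset_leq_card/leq_trans; apply; apply: leq_trans (leq_card_setU _ _) _; apply: leq_add.
  by apply: leq_trans (leq_card_setU _ _) _; rewrite leq_add2r cardsE card_size.
rewrite cardsE; apply: leq_trans (card_size _) _; elim: (Q) HQ => //= p Q' IH H.
rewrite size_cat mulSn leq_add //; first by rewrite size_drop H ?mem_head //; lia.
by apply: IH => p' Hp'; apply: H; rewrite inE Hp' orbT.
Qed.
End Leftover.

Lemma disjoint_cat_uniq (T : eqType) (V1 V2 V3 V4 V5 LC : seq T) :
  uniq V1 -> uniq V2 -> uniq V3 -> uniq V4 -> uniq V5 ->
  all [predC V1 ++ LC] V2 -> all [predC V1] LC -> all (mem LC) V3 -> all (mem LC) V4 -> all [predC V3] V4 ->
  all [predC V1 ++ V2 ++ LC] V5 -> uniq (V1 ++ V2 ++ V3 ++ V4 ++ V5).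
Proof.
move=> u1 u2 u3 u4 u5 /allP a2 /allP aL /allP a3 /allP a4 /allP a43 /allP a5.
rewrite !cat_uniq u1 u2 u3 u4 u5 /=.
have {}a2 x : x \in V2 -> (x \notin V1) && (x \notin LC) by move/a2; rewrite /= mem_cat negb_or.
have {}a5 x : x \in V5 -> [&& x \notin V1, x \notin V2 & x \notin LC] by move/a5; rewrite /= !mem_cat !negb_or.
apply/and4P; split; try apply/andP; try split; rewrite // -?all_predC; apply/allP => x; rewrite ?mem_cat /=.
- case/or4P => [/a2/andP[]//|/a3/aL//|/a4/aL//|/a5/and3P[]//].
- case/or3P => [/a3|/a4|/a5/and3P[]//] xL; apply/negP => /a2/andP[_ /negP]; exact.
- case/orP => [/a43//|/a5/and3P[_ _ xL]]; by apply: contra xL => /a3.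
- by move/a5/and3P => [_ _ xL]; apply: contra xL => /a4.
Qed.

Lemma conn_bound K C S D x n : K * C <= S -> C <= D -> 4 * S * D <= n -> 4 * S * x <= n -> 2 * K * (C * (C + x)) <= n.
Proof.
move=> H1 H2 H3 H4; have H5 := leq_mul H1 H2; have H6 := leq_mul H1 (leqnn x).
move: H3 H4 H5 H6; rewrite -!mulnA; move: (S * D) (S * x) => y z; lia.
Qed.

Lemma prod_bound N G g x : x <= g * G -> x <= (N + 1) * ((G + 1) * g).
Proof. by move=> H; apply: leq_trans H _; rewrite mulnDl mul1n mulnDl mul1n mulnC; lia. Qed.

Section NonExtremal.
Variables (k d : nat).
Hypotheses (d1 : 1 < d) (dk : d < k) (ndk : ~~ (d %| k)).
Local Notation t := ((k %/ d).+1 * d).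
Local Notation l := (k - d).

Lemma nonextremal Neta : 0 < Neta -> exists n0, forall (T : finType) (E : {set {set T}}), n0 <= #|T| ->
  d %| #|T| -> codegree_ge E k t ->
  (exists c, [/\ uniq c, c =i T & lpath k d (fun s => edg E s : Prop) (c ++ take l c)]) \/
  (exists2 A : {set T}, Neta * (t * #|A|) <= Neta.+1 * #|T| &
        Neta * tsum k (fun s => all [predC A] s && edg E s) <= #|T| ^ k).
Proof.
move=> eta0; have d0 : 0 < d := ltnW d1; have k0 : 0 < k := leq_ltn_trans (leq0n _) dk.
have t0 : 0 < t by rewrite muln_gt0.
have kt : k <= t by rewrite ltnW // ltn_ceil.
have [Ng Ng0 Htil] := tiling_lemma d1 dk ndk eta0.
have [C1 [K1 [n1 [idx [uI HI dI K10 Hc]]]]] := connect d1 dk ndk t0.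
have [C2 [K2 [n2 [pA [pB [shape K20 Ha]]]]]] := absorber d1 dk ndk t0.
have [w Ew] : exists w, w = size pA by eexists.
have [m1 Em1] : exists m1, m1 = size idx by eexists.
have [G EG] : exists G, G = 8 * (K2 * C2 + K2 * w * m1 + K1 * C1) by eexists.
have [b1 Eb1] : exists b1, b1 = 4 * (K1 * C1 + K2 * C2 + 1) * (Ng + 1) * (G + 1) by eexists.
have b10 : 0 < b1 by rewrite Eb1 !muln_gt0 !addn1.
have [b2 Eb2] : exists b2, b2 = b1 * (24 * K1 * C1 + 1) by eexists.
have b20 : 0 < b2 by rewrite Eb2 muln_gt0 b10 addn1.
have [m Em] : exists m, m = 3 * d * b1 + 2 * m1 * b2 + 1 by eexists.
have m0 : 0 < m by rewrite Em addn1.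
have Ne0 : 0 < 3 * b1 by rewrite muln_gt0.
have [nt Ht] := Htil (3 * b1) m Ne0 m0.
have [na Hna] := leq_expn_exp2 d b1.-1.
have [nb Hnb] := leq_expn_exp2 (l + l) b2.-1.
rewrite prednK // in Hna; rewrite prednK // in Hnb.
exists (1 + n1 + n2 + nt + na + nb + 4 * (K1 * C1 + K2 * C2 + 1) * (C1 + C2 + 1) + 2 * (m1 + 1) * b2 + b1).
move=> T E; set n := #|T| => Hn dn HE.
have [n0 [h1' [h2' [h3 [h4 [h5 [h6 [h7 h8]]]]]]]] : 0 < n /\ n1 <= n /\ n2 <= n /\ nt <= n /\ na <= n /\ nb <= n /\
   4 * (K1 * C1 + K2 * C2 + 1) * (C1 + C2 + 1) <= n /\ 2 * (m1 + 1) * b2 <= n /\ b1 <= n.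
  move: Hn; move: (4 * _ * _) (2 * _ * _) => a1 a2; clear; lia.
have [x0 _] : exists x0 : T, x0 \in predT by apply/existsP; rewrite -[[exists _, _]]negbK; apply/negP => /existsPn Hx; move: n0; rewrite /n (eq_card0 (A := T)) // => x; apply/negbTE/Hx.
have [g1 Eg1] : exists g, g = n %/ b1 by eexists.
have [g2 Eg2] : exists g, g = n %/ b2 by eexists.
have g1n : g1 * b1 <= n by rewrite Eg1 leq_trunc_div.
have g2n : g2 * b2 <= n by rewrite Eg2 leq_trunc_div.
have g21 : g2 <= g1.
  by rewrite Eg1 leq_divRL //; apply: leq_trans g2n; rewrite leq_mul2l Eb2 leq_pmulr ?orbT // addn1.
have g10 : 0 < g1 by rewrite Eg1 divn_gt0.
have g20 : 0 < g2.
  rewrite Eg2 divn_gt0 //; apply: leq_trans h7; rewrite leq_pmull // muln_gt0 addn1 //.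
have Gn : 4 * (K1 * C1 + K2 * C2 + 1) * (Ng + 1) * ((G + 1) * g1) <= n.
  by apply: leq_trans g1n; rewrite Eb1 mulnA [X in _ <= X]mulnC.
have GK x : x <= g1 * G -> 2 * K1 * (C1 * (C1 + x)) <= n /\ 2 * K2 * (C2 * (C2 + x)) <= n /\ Ng * x <= n.
  move=> Hx; have X : 4 * (K1 * C1 + K2 * C2 + 1) * x <= n.
    apply: leq_trans Gn; rewrite -[X in _ <= X]mulnA leq_mul2l; apply/orP; right; exact: prod_bound.
  split; [|split].
  + by apply: conn_bound h6 X; clear; lia.
  + by apply: conn_bound h6 X; clear; lia.
  + apply: leq_trans Gn; apply: leq_mul; first by move: (K1 * C1 + K2 * C2) => S; clear; lia.
    by rewrite mulnC in Hx; apply: leq_trans Hx _; rewrite leq_mul2r leq_addr orbT.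
have GE : g1 * G = 8 * K2 * g1 * C2 + 8 * K2 * g1 * w * m1 + 8 * K1 * g1 * C1 by rewrite EG; clear; lia.
have GC : 8 * K1 * g2 * C1 <= 8 * K1 * g1 * C1 by rewrite leq_mul2r leq_mul2l g21 !orbT.
have HA (S : d.-tuple T) : dense K2 C2 (good_in E x0 k d pA pB S) by apply: Ha => //; rewrite size_tuple.
have [||LA0 [sLA cLA uLA _ hLA]] := @select T _ C2 K2 _ set0 K20 n0 HA g1.
- by rewrite card_tuple Eg1; apply: Hna.
- by rewrite cards0; apply GK; rewrite GE; clear; lia.
pose LA := filter (good_out E x0 k d pA) LA0.
have LAs t' : t' \in LA -> size t' = C2 by rewrite mem_filter => /andP[_ /cLA].
have LAg t' : t' \in LA -> good_out E x0 k d pA t' by rewrite mem_filter => /andP[].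
have LAc S : size S = d -> g1 <= count (good_in E x0 k d pA pB S) LA.
  move=> sS; rewrite count_filter; have := hLA (tcast sS (in_tuple S)); rewrite val_tcast /=.
  move/leq_trans; apply; apply: sub_count => t' /=; by rewrite /good_in => /andP[-> ->].
have uLA' : uniq (flatten LA) by apply: uniq_flatten_filter.
have size_LA : size LA <= 8 * K2 * g1 by rewrite -sLA size_filter count_size.
pose ps1 := flatten (map (paths_out x0 pA) LA); pose V := flatten ps1.
have EV : V = flatten (map (fun t' => flatten (paths_out x0 pA t')) LA) by rewrite /V /ps1 flatten_flatten.
have [_ upA ltA _ _] := shape.
have [uV sV] : uniq V /\ {subset V <= flatten LA}.
  rewrite EV; have := @flatten_sub _ _ LA id (fun t' => flatten (paths_out x0 pA t')); rewrite map_id; apply => // t' tL.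
  by rewrite flatten_out; apply: (@uniq_map_nth T x0 t' (flatten pA) C2) => //; [exact: uniq_in_flatten tL|exact: LAs].
have cV : size V <= 8 * K2 * g1 * C2.
  apply: leq_trans (uniq_leq_size uV sV) _; rewrite (size_flatten_const LAs) leq_mul2r size_LA orbT //.
have ps1P p : p \in ps1 -> pth k d (fun s => edg E s : Prop) p /\ uniq p.
  move=> pp; split; last exact: uniq_in_flatten pp.
  by case/flattenP: pp => qs /mapP[t' tL ->]; apply: (pth_out d0 shape (LAg _ tL)).
have cps1 : size ps1 <= 8 * K2 * g1 * w.
  rewrite /ps1 (@size_flatten_const _ w) ?size_map ?leq_mul2r ?size_LA ?orbT // => qs /mapP[t' _ ->].
  by rewrite size_map.
have : 0 < size ps1.
  have : 0 < size LA.
    by have := LAc (nseq d x0) (size_nseq _ _); move/(leq_trans g10)/leq_trans; apply; apply: count_size.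
  rewrite /ps1; case: (LA) => //= t' L' _; rewrite size_cat size_map.
  case: (pA) shape => [|p pA'] // [/esym/size0nil-> _ _ + _].
  by move=> /perm_size; rewrite /= size_iota => d00; rewrite -d00 in d0.
case Eps : ps1 => [|p1 ps1'] // _.
have p1P : p1 \in ps1 by rewrite Eps mem_head.
have ps1'P p : p \in ps1' -> p \in ps1 by rewrite Eps inE => ->; rewrite orbT.
pose XY := (l.-tuple T * l.-tuple T)%type.
(* The requirement is void for ends with repeated vertices, so that [select] can range over all
   pairs of tuples. *)
pose AC (x : XY) t' := ~~ (uniq x.1 && uniq x.2) || connects E x0 k d idx x.1 x.2 t'.
have HAC x : dense K1 C1 (AC x).
  case: (boolP (uniq x.1 && uniq x.2)) => [/andP[u1 u2]|nu].
    have := Hc T E x0 x.1 x.2 h1' HE (size_tuple _) (size_tuple _) u1 u2.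
    by move/denseW; apply => // t' _; rewrite /AC u1 u2.
  rewrite /dense (eq_tsum (g := fun=> 1)); last by move=> t' _; rewrite /AC nu.
  by rewrite tsum_const muln1 leq_pmull.
have cVs : #|[set x in V]| <= 8 * K2 * g1 * C2 by rewrite cardsE; apply: leq_trans (card_size _) cV.
have [||LC [sLC cLC uLC aLC hLC]] := @select T _ C1 K1 AC [set x in V] K10 n0 HAC g2.
- by rewrite card_prod !card_tuple -expnD Eg2; apply: Hnb.
- by apply GK; rewrite GE; move: cVs GC; clear; lia.
have cLCf : size (flatten LC) = 8 * K1 * g2 * C1 by rewrite (size_flatten_const cLC) sLC.
have aVL : all [predC V] (flatten LC) by apply: sub_all aLC => x /=; rewrite inE.
have sup1 := @supply_dense T E x0 k d C1 K1 idx d0 uI HI (V ++ flatten LC) (8 * K2 * g1 * w * m1) n0.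
have {}sup1 := sup1 (fun X Y sX sY uX uY => Hc T E x0 X Y h1' HE sX sY uX uY).
have {}sup1 := sup1 (proj1 (GK (size (V ++ flatten LC) + 8 * K2 * g1 * w * m1) _)).
have supB : size (V ++ flatten LC) + 8 * K2 * g1 * w * m1 <= g1 * G.
  by rewrite size_cat cLCf GE; move: cV GC; clear; lia.
have {}sup1 := sup1 supB.
have [||||zs1 [Lz1 uz1 az1 _ cz1]] := linked_exist dI sup1 (X := finish k d p1) (ps := ps1') (used := [::]).
- by apply: size_finish; exact: (ps1P _ p1P).1.
- by apply: drop_uniq; apply: (ps1P _ p1P).2.
- by move=> p /ps1'P/ps1P.
- rewrite add0n -Em1 leq_mul2r; apply/orP; right; apply: leq_trans cps1; by rewrite Eps.
pose Z := [set x in V ++ flatten zs1 ++ flatten LC].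
have cZ : #|Z| <= g1 * G.
  rewrite cardsE; apply: leq_trans (card_size _) _; rewrite !size_cat cLCf cz1 GE -Em1.
  rewrite addnA; apply: leq_add GC; apply: leq_add cV _.
  by rewrite leq_mul2r (leq_trans _ cps1) ?orbT // Eps.
have [] := Ht T E Z h3 HE; first by apply GK.
  2: by move=> HH; right.
case=> Q TQ HU; left; case: (TQ) => HQ1 uQ aQ.
(* The length of a tile is a multiple of [d], whereas a [pth] has length congruent to [l]; the tile
   is cut to the largest admissible length, at a cost of fewer than [d] vertices. *)
have [L0 EL0] : exists L0, L0 = l + ((t * m - l) %/ d) * d by eexists.
have ltm : l <= t * m by apply: leq_trans (leq_subr _ _) (leq_trans kt (leq_pmulr _ m0)).
have L0tm : L0 <= t * m by rewrite EL0 -{2}(subnKC ltm) leq_add2l leq_trunc_div.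
have tmL0 : t * m <= L0 + d.
  by rewrite EL0 -{1}(subnKC ltm) -addnA leq_add2l -mulSnr ltnW // ltn_ceil.
pose ps2 := map (take L0) Q.
have ps2P p : p \in ps2 -> pth k d (fun s => edg E s : Prop) p /\ uniq p.
  case/mapP => p' pQ ->; have [sp Lp] := HQ1 p' pQ; split; last by apply: take_uniq; apply: uniq_in_flatten pQ.
  split; rewrite ?size_takel ?sp //; first exact: lpath_take.
    by rewrite EL0 leq_addr.
  by rewrite EL0 addKn dvdn_mull.
have cQ : size Q * (t * m) <= n by rewrite -(size_covered TQ) max_card.
have cQm : size Q * m <= n by apply: leq_trans cQ; rewrite leq_mul2l leq_pmull ?orbT.
have sup2 := @supply_family T E x0 k d C1 idx d0 uI HI LC g2.-1 uLC cLC.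
have cnt X Y : size X = l -> size Y = l -> uniq X -> uniq Y -> g2.-1 < count (connects E x0 k d idx X Y) LC.
  move=> sX sY uX uY; rewrite prednK //; have := hLC (tcast sX (in_tuple X), tcast sY (in_tuple Y)).
  move/leq_trans; apply; apply: sub_count => t'; rewrite /AC /= !val_tcast /= uX uY //.
have {}sup2 := sup2 cnt.
have cB : (size Q + 1) * m1 <= g2.-1.
  rewrite -ltnS prednK // Eg2 leq_divRL //.
  have : size Q * (2 * m1 * b2) <= n by apply: leq_trans cQm; rewrite leq_mul2l Em; apply/orP; right; clear; lia.
  by move: h7; clear; lia.
have lastP : last p1 ps1' \in ps1 by rewrite Eps mem_last.
have [||||zs2 [Lz2 uz2 az2 _ cz2]] := linked_exist dI sup2 (X := finish k d (last p1 ps1')) (ps := ps2) (used := [::]).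
- by apply: size_finish; exact: (ps1P _ lastP).1.
- by apply: drop_uniq; apply: (ps1P _ lastP).2.
- exact: ps2P.
- by rewrite add0n -Em1 size_map; apply: leq_trans cB; rewrite leq_mul2r leq_addr orbT.
have last2 : pth k d (fun s => edg E s : Prop) (last p1 (ps1' ++ ps2)) /\ uniq (last p1 (ps1' ++ ps2)).
  have : last p1 (ps1' ++ ps2) \in ps1 ++ ps2 by rewrite Eps mem_last.
  by rewrite mem_cat => /orP[/ps1P|/ps2P].
have [||||| z [sz uz az az' Lz]] := sup2 (finish k d (last p1 (ps1' ++ ps2))) (start k d p1) (flatten zs2).
- by apply: size_finish; exact: last2.1.
- by apply: size_start; exact: (ps1P _ p1P).1.
- by apply: drop_uniq; apply: last2.2.
- by apply: take_uniq; apply: (ps1P _ p1P).2.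
- by rewrite cz2 -Em1 size_map; apply: leq_trans cB; rewrite leq_mul2r leq_addr orbT.
have [uf2 sf2] : uniq (flatten ps2) /\ {subset flatten ps2 <= flatten Q}.
  have := @flatten_sub _ _ Q id (take L0); rewrite map_id; apply=> // p pQ; split; last by move=> x /mem_take.
  by apply: take_uniq; apply: uniq_in_flatten pQ.
apply: (@absorb_all T E x0 k d C2 g1 pA pB d0 dk dn shape LA ps2 zs1 zs2 z) => //.
- by move=> p /ps2P[].
- exact: Eps.
- exact: Lz1.
- exact: Lz2.
- by rewrite sz.
- exact: Lz.
- apply: (@disjoint_cat_uniq _ _ _ _ _ _ (flatten LC)) => //.
  apply/allP => x /sf2 /(allP aQ); by rewrite /= inE.
rewrite -/ps1 -/V; have := @leftover_card T Z Q V (flatten zs1) (flatten LC) (flatten zs2 ++ z) L0 (t * m) d erefl (fun p pQ => (HQ1 p pQ).1) tmL0.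
rewrite -/ps2 -catA; move/leq_trans; apply; rewrite cLCf Eg1 leq_divRL //.
have H1 : 24 * K1 * C1 * b1 * g2 <= n.
  by apply: leq_trans g2n; rewrite Eb2 mulnC leq_mul2l; apply/orP; right; clear; lia.
have H2 : size Q * (3 * d * b1) <= n by apply: leq_trans cQm; rewrite leq_mul2l Em; apply/orP; right; clear; lia.
move: H1 H2 HU; rewrite -/n; move: (#|uncovered _ _|) (size Q) => u q; clear; lia.
Qed.

End NonExtremal.

(** * The extremal structure *)

Section Degrees.
Variables (T : finType) (E : {set {set T}}) (k t : nat).
Local Notation n := #|T|.
Local Notation P := (n ^ k.-1).
Hypotheses (k0 : 0 < k) (HE : codegree_ge E k t).
Implicit Types X Y : {set T}.

Definition deg_in X v := tsum k.-1 (fun s => all (mem X) s && edg E (v :: s)).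
Definition nondeg_in X v := tsum k.-1 (fun s => all (mem X) s && ~~ edg E (v :: s)).
Definition edges_in X := tsum k (fun s => all (mem X) s && edg E s).

Lemma deg_nondeg X v : deg_in X v + nondeg_in X v = #|X| ^ k.-1.
Proof.
rewrite -tsumD -(tsum_all k.-1 (mem X)); apply: eq_tsum => s _.
by case: (all _ _); case: (edg _ _).
Qed.

Lemma deg_le X v : deg_in X v <= #|X| ^ k.-1.
Proof. by rewrite -(deg_nondeg X v) leq_addr. Qed.

Lemma edges_in_sum X : \sum_(v in X) deg_in X v = edges_in X.
Proof.
rewrite /edges_in /deg_in; case: k k0 => // k' _ /=; rewrite big_mkcond; apply: eq_bigr => v _.
case: (v \in X); first by apply: eq_tsum => s _.
by rewrite -[LHS](muln0 (n ^ k')) -tsum_const; apply: eq_tsum.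
Qed.

Lemma sum_deg_ge X : n * #|X| ^ k.-1 <= t * (\sum_(v : T) deg_in X v) + k.-1 * k.-1 * P.
Proof.
have H1 : n * #|X| ^ k.-1 <= t * (\sum_(v : T) deg_in X v) + n * tsum k.-1 (fun s : seq T => ~~ uniq s : nat).
  rewrite /deg_in -(tsum_sum k.-1 predT (fun v s => (all (mem X) s && edg E (v :: s) : nat))).
  have -> : #|X| ^ k.-1 = tsum k.-1 (fun s => all (mem X) s) by rewrite (tsum_all k.-1 (mem X)).
  rewrite -[X in X <= _]tsum_mull -[X in _ <= X + _]tsum_mull -[X in _ <= _ + X]tsum_mull -tsumD.
  apply: leq_tsum => s Hs; case: (boolP (uniq s)) => us; last first.
    by apply: leq_trans (leq_addl _ _); rewrite leq_mul2l; case: (all _ _); rewrite orbT.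
  case: (boolP (all (mem X) s)) => aU; last by rewrite muln0.
  rewrite muln1 muln0 addn0; apply: leq_trans (HE us Hs) _; rewrite leq_mul2l -sum1_card big_mkcond; apply/orP; right.
  apply: leq_sum => v _; rewrite inE -(@edg_perm _ E (v :: s)); last by rewrite perm_sym perm_rcons.
  by case: (edg _ _).
by apply: leq_trans H1 _; rewrite leq_add2l mulnC tsum_nuniq.
Qed.

Lemma tsum_moved m X Y (Q : pred (seq T)) : tsum m (fun s => all (mem Y) s && Q s) * n <=
  tsum m (fun s => all (mem X) s && Q s) * n + m * #|Y :\: X| * n ^ m.
Proof.
have E1 : tsum m (fun s => all (mem Y) s && Q s) <= tsum m (fun s => all (mem X) s && Q s) + tsum m (fun s => has (mem (Y :\: X)) s).
  rewrite -tsumD; apply: leq_tsum => s _; case: (boolP (all (mem Y) s)) => //= /allP HU.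
  case: (boolP (all (mem X) s)) => [_|]; first by rewrite leq_addr.
  rewrite -has_predC => /hasP[x xs Hx]; have -> : has (mem (Y :\: X)) s; last by case: (Q s).
  by apply/hasP; exists x => //; rewrite /= inE; apply/andP; split; [exact: Hx|exact: HU].
have Hh := tsum_has m (mem (Y :\: X)).
have HC : tsum m (fun s => has (mem (Y :\: X)) s) * n <= m * #|Y :\: X| * n ^ m.
  by apply: leq_trans Hh _; rewrite leq_mul2r leq_mul2l; apply/orP; right; apply/orP; right; apply: subset_leq_card; apply/subsetP.
by apply: leq_trans (leq_mul E1 (leqnn n)) _; rewrite mulnDl leq_add2l.
Qed.

Lemma deg_moved X Y v : deg_in Y v * n <= deg_in X v * n + k.-1 * #|Y :\: X| * P.
Proof. exact: (tsum_moved k.-1 X Y (fun s => edg E (v :: s))). Qed.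

Lemma edges_moved X Y : edges_in Y * n <= edges_in X * n + k * #|Y :\: X| * n ^ k.
Proof. exact: (tsum_moved k X Y (edg E)). Qed.

End Degrees.

Section Structure.
Variables (k t : nat).
Hypotheses (k1 : 1 < k) (t1 : 2 < t).
Let k0 : 0 < k. Proof. exact: ltnW. Qed.

(** [AA] consists of vertices whose link on [BB] is almost complete. Those of [V0] lie between the
    two classes: their link on [BB] is neither sparse nor almost complete, and they are few. *)
Definition extremal_structure (T : finType) (E : {set {set T}}) N1 N3 N5 (BB AA V0 : {set T}) :=
  [/\ [/\ ~: BB = AA :|: V0 & [disjoint AA & V0]],
      forall b, b \in BB -> N3 * deg_in E k BB b <= 2 * #|T| ^ k.-1,
      forall a, a \in AA -> N1 * nondeg_in E k BB a <= #|T| ^ k.-1,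
      forall v, v \in V0 -> #|T| ^ k.-1 <= 2 * N3 * deg_in E k BB v &
      [/\ N5 * #|V0| <= #|T|, N5 * (t * #|~: BB|) <= N5.+1 * #|T| & N5 * edges_in E k BB <= #|T| ^ k]].

(** Vertices are re-sorted by their degree into the complement of [A]. Few of them change sides,
    since that complement spans few edges while the codegrees force the vertices of [A] to have
    almost full degree on average. *)
Lemma structure N1 N3 N5 : 0 < N1 -> 2 ^ k <= N3 -> 0 < N5 -> exists Neta n0, 0 < Neta /\
  forall (T : finType) (E : {set {set T}}) (A : {set T}), n0 <= #|T| -> codegree_ge E k t ->
   Neta * (t * #|A|) <= Neta.+1 * #|T| -> Neta * tsum k (fun s => all [predC A] s && edg E s) <= #|T| ^ k ->
   exists BB AA V0, extremal_structure E N1 N3 N5 BB AA V0.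
Proof.
move=> N10 HN3 N50; have N30 : 0 < N3 by apply: leq_trans HN3; rewrite expn_gt0.
have [N EN] : exists N, N = 4 * N1 * N5 by eexists.
have N0 : 0 < N by rewrite EN !muln_gt0 N10.
have [M EM] : exists M, M = 2 * N3 * k * N * t by eexists.
have M0 : 0 < M by rewrite EM !muln_gt0 N30 k0 N0 (ltn_trans _ t1).
have [C EC] : exists C, C = N3 + 4 + 2 ^ k.+1 by eexists.
have [Neta Eta] : exists Neta, Neta = M * C by eexists.
have C0 : 0 < C by rewrite EC addn4.
have eta0 : 0 < Neta by rewrite Eta muln_gt0 M0.
exists Neta, (1 + Neta * (k * k) * 2 ^ k + 4 * (k * k) * N1 * N5 * 4); split=> //.
move=> T E A Hn HE HA HeB; set n := #|T| in Hn HA HeB *; set P := n ^ k.-1.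
have nP : n ^ k = n * P by rewrite -expnS prednK.
have [n0 [Hn1 Hn2]] : 0 < n /\ Neta * (k * k) * 2 ^ k <= n /\ 4 * (k * k) * N1 * N5 * 4 <= n.
  by move: Hn; move: (_ * _ * 2 ^ k) (_ * N5 * 4) => x y; clear; lia.
have P0 : 0 < P by rewrite expn_gt0 n0.
pose B := ~: A.
have HeB' : Neta * edges_in E k B <= n * P.
  rewrite -nP; apply: leq_trans HeB; rewrite leq_mul2l; apply/orP; right; apply: leq_tsum => s _.
  by rewrite (eq_all (a2 := [predC A])) // => x; rewrite /= inE.
have cAB : #|A| + #|B| = n by rewrite cardsC.
have HM : [/\ N3 * k * 2 <= M, 2 * N * k <= M & 2 * N * t <= M].
  rewrite EM; have t0 : 0 < t := ltn_trans (isT : 0 < 2) t1; split.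
  - by rewrite (_ : 2 * N3 * k * N * t = N3 * k * 2 * (N * t)) ?leq_pmulr ?muln_gt0 ?N0 //; lia.
  - by rewrite (_ : 2 * N3 * k * N * t = 2 * N * k * (N3 * t)) ?leq_pmulr ?muln_gt0 ?N30 //; lia.
  - by rewrite (_ : 2 * N3 * k * N * t = 2 * N * t * (N3 * k)) ?leq_pmulr ?muln_gt0 ?N30 //; lia.
case: HM => HM1 HM2 HM3.
have HMe : M <= Neta by rewrite Eta leq_pmulr.
have HNe : 2 * N <= Neta by apply: leq_trans HMe; apply: leq_trans HM2; rewrite leq_pmulr.
have HB2 : n <= 2 * #|B|.
  have H3 : Neta * (3 * #|A|) <= Neta * n + n.
    by rewrite addnC -mulSn; apply: leq_trans HA; rewrite leq_mul2l leq_mul2r t1 !orbT.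
  have H2 : 2 * n <= Neta * n by rewrite leq_mul2r (leq_trans _ HNe) ?orbT //; move: N0; clear; lia.
  rewrite -(leq_pmul2l eta0); move: H3 H2; rewrite -cAB; move: (#|A|) (#|B|) eta0 => a b; clear; nia.
pose y := #|B| ^ k.-1.
have Py : P <= 2 ^ k.-1 * y.
  by rewrite /P -expnMn leq_exp2r // -ltnS prednK.
have y0 : 0 < y by case: y Py => //; rewrite muln0 leqNgt P0.
set e := edges_in E k B in HeB'.
pose BB := [set v | N3 * deg_in E k B v <= P].
(* Markov's inequality for the degrees inside [B], whose sum is small. *)
have Hd1 : M * #|B :\: BB| <= n.
  have H : #|B :\: BB| * P <= N3 * e.
    rewrite -sum_nat_const /e -(edges_in_sum _ k0) big_distrr /=.
    apply: (@leq_trans (\sum_(v in B :\: BB) N3 * deg_in E k B v)).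
      by apply: leq_sum => v; rewrite !inE -ltnNge => /andP[/ltnW].
    rewrite [X in _ <= X](bigID (mem BB)) /=; apply: leq_trans (leq_addl _ _).
    by rewrite (eq_bigl (fun v => (v \in B) && (v \notin BB))) // => v; rewrite in_setD andbC.
  rewrite -(leq_pmul2r C0) -(leq_pmul2r P0).
  apply: (@leq_trans (N3 * (n * P))); last by rewrite mulnCA -mulnA leq_mul2l leq_mul2r EC; apply/orP; right; apply/orP; right; lia.
  apply: leq_trans (leq_mul (leqnn N3) HeB'); rewrite mulnCA; apply: leq_trans (leq_mul (leqnn Neta) H).
  by rewrite Eta; lia.
(* A vertex of [A] that falls into [BB] has at most half of the full degree because [2 ^ k <= N3].
   As [A] has hardly more than [n / t] vertices and must supply nearly all neighbours of the tuples
   in [B], there are few such vertices. *)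
have Hd2 : M * #|BB :\: B| <= n.
  have Hpt v : 2 * deg_in E k B v <= (v \in B) * (2 * deg_in E k B v) + (v \in BB :\: B) * y + (v \in A :\: BB) * (2 * y).
    have Hy := deg_le E k B v; rewrite !inE; case: (boolP (v \in A)) => vA /=; last by rewrite mul1n -addnA leq_addr.
    case: (leqP (N3 * deg_in E k B v) P) => HN /=; rewrite !mul0n !mul1n ?addn0 ?add0n ?leq_mul2l //.
    have : 2 ^ k * deg_in E k B v <= 2 ^ k.-1 * y by apply: leq_trans (leq_mul HN3 (leqnn _)) (leq_trans HN Py).
    by rewrite -{1}(prednK k0) expnSr -mulnA leq_pmul2l // expn_gt0.
  have Hsum : 2 * (\sum_(v : T) deg_in E k B v) <= 2 * e + #|BB :\: B| * y + #|A :\: BB| * (2 * y).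
    rewrite big_distrr /=; apply: leq_trans; first by apply: leq_sum => v _; exact: Hpt.
    rewrite !big_split /= -!big_distrl /=.
    have Hc (S : {set T}) : \sum_(v : T) (v \in S : nat) = #|S|.
      by rewrite -sum1_card [RHS]big_mkcond; apply: eq_bigr => v _; case: (v \in S).
    rewrite !Hc /e -(edges_in_sum _ k0) big_distrr [in X in _ <= X]big_mkcond /= !leq_add2r.
    by apply: leq_sum => v _; case: (v \in B); rewrite ?mul1n ?mul0n.
  have cA : #|A :\: BB| + #|BB :\: B| = #|A|.
    rewrite -(cardsID BB A) addnC; congr (_ + _); apply: eq_card => v; rewrite !inE; by case: (v \in A); rewrite ?andbT ?andbF.
  have Hs := sum_deg_ge HE B; rewrite -/n -/P -/y in Hs.
  have t0 : 0 < t := ltn_trans (isT : 0 < 2) t1.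
  have H1 : t * #|BB :\: B| * y + 2 * n * y <= 2 * t * e + 2 * t * #|A| * y + 2 * (k.-1 * k.-1) * P.
    move: Hsum Hs; rewrite -cA; move: (\sum_v _) (#|A :\: BB|) (#|BB :\: B|) (k.-1 * k.-1) => S a x kk Hsum Hs.
    have : t * (2 * S) <= t * (2 * e + x * y + a * (2 * y)) by rewrite leq_mul2l Hsum orbT.
    by move: Hs; clear; lia.
  have H2 : Neta * (k.-1 * k.-1) * (2 * P) <= n * y.
    apply: (@leq_trans (Neta * (k * k) * (2 ^ k * y))).
      apply: leq_mul; first by rewrite leq_mul2l leq_mul ?leq_pred ?orbT.
      by rewrite -{1}(prednK k0) expnS -mulnA leq_mul2l Py.
    by rewrite mulnA leq_mul2r Hn1 orbT.
  have H3 : Neta * (t * #|BB :\: B|) * y <= t * (2 ^ k + 3) * n * y.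
    have K1 := leq_mul (leqnn Neta) H1.
    have K2 : Neta * (2 * t * e) <= t * (2 ^ k * n * y).
      apply: (@leq_trans (2 * t * (n * P))); first by rewrite mulnCA leq_mul2l HeB' orbT.
      rewrite -{1}(prednK k0) expnS; move: (leq_mul (leqnn (2 * t * n)) Py); move: (2 ^ k.-1); clear; lia.
    have K3 : Neta * (2 * t * #|A| * y) <= 2 * Neta * n * y + 2 * (n * y).
      move: (leq_mul HA (leqnn (2 * y))); clear; lia.
    have K4 : n * y <= t * (n * y) by rewrite leq_pmull.
    move: K1 K2 K3 K4 H2; move: (2 ^ k) (k.-1 * k.-1) (#|A|) (#|BB :\: B|) => z kk a x; clear.
    rewrite !mulnDr; lia.
  rewrite leq_pmul2r // mulnCA -mulnA leq_pmul2l // in H3.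
  rewrite -(leq_pmul2r C0) mulnAC -Eta; apply: leq_trans H3 _; rewrite mulnC leq_mul2l EC expnS; apply/orP; right.
  by move: (2 ^ k); clear; lia.
pose AA := [set v | (v \notin BB) && (N1 * nondeg_in E k BB v <= P)].
pose V0 := [set v | (v \notin BB) && (P < N1 * nondeg_in E k BB v)].
have Hk1 : k.-1 <= k by apply: leq_pred.
have bound c x : c <= M -> M * x <= n -> c * x <= n by move=> H1 H2; apply: leq_trans (leq_mul H1 (leqnn _)) H2.
have Ed : N * edges_in E k BB <= n * P.
  have H := edges_moved E k B BB; rewrite -/n -/e nP in H.
  have Hb := bound _ _ HM2 Hd2.
  have He : 2 * N * e <= n * P by apply: leq_trans HeB'; rewrite leq_mul2r HNe orbT.
  rewrite -(leq_pmul2r n0); move: (leq_mul (leqnn (2 * N)) H) (leq_mul Hb (leqnn (n * P))) (leq_mul He (leqnn n)).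
  by move: (n * P) (edges_in E k BB) (#|BB :\: B|) => z a b; clear; lia.
have Hc : N * (t * #|~: BB|) <= N.+1 * n.
  have H1 : #|~: BB| <= #|A| + #|B :\: BB|.
    apply: leq_trans (leq_card_setU _ _); apply: subset_leq_card; apply/subsetP => v; rewrite !inE.
    by case: (v \in A) => //= ->.
  have H2 := bound _ _ HM3 Hd1.
  have H3 : 2 * N * (t * #|A|) <= 2 * N * n + n.
    case: (leqP (t * #|A|) n) => Ha; first by apply: leq_trans (leq_addr _ _); rewrite leq_mul2l Ha orbT.
    have : 2 * N * (t * #|A| - n) <= Neta * (t * #|A| - n) by rewrite leq_mul2r HNe orbT.
    move: HA Ha; rewrite !mulnBr mulSn; move: (t * #|A|) HNe => a; clear; nia.
  have := leq_mul (leqnn (2 * N * t)) H1; move: H2 H3; move: (#|~: BB|) (#|A|) (#|B :\: BB|) => a b c; clear; lia.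
exists BB, AA, V0; split.
- split; first by apply/setP => v; rewrite !inE -andb_orr; case: (leqP (N1 * nondeg_in E k BB v) P); rewrite /= ?orbT ?andbT.
  by apply/pred0P => v /=; rewrite !inE; case: leqP; rewrite ?andbF.
- move=> b; rewrite inE => Hb; have H := deg_moved E k B BB b; rewrite -/n -/P in H.
  have H2 := bound _ _ HM1 Hd2.
  rewrite -(leq_pmul2r n0) -/n -/P.
  have := leq_mul (leqnn N3) H; have := leq_mul Hb (leqnn n); have := leq_mul H2 (leqnn P).
  have : N3 * (k.-1 * #|BB :\: B| * P) <= N3 * (k * #|BB :\: B| * P) by rewrite !(leq_mul2l, leq_mul2r) Hk1 !orbT.
  by move: (#|BB :\: B|) (deg_in _ _ _ _) (deg_in _ _ _ _) => x a c; clear; lia.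
- by move=> a; rewrite inE => /andP[].
- move=> v; rewrite !inE -ltnNge => /andP[Hv _]; have H := deg_moved E k BB B v; rewrite -/n -/P in H.
  have H2 := bound _ _ HM1 Hd1.
  rewrite -(leq_pmul2r n0) -/n -/P.
  have := leq_mul (leqnn N3) H; have := leq_mul (ltnW Hv) (leqnn n); have := leq_mul H2 (leqnn P).
  have : N3 * (k.-1 * #|B :\: BB| * P) <= N3 * (k * #|B :\: BB| * P) by rewrite !(leq_mul2l, leq_mul2r) Hk1 !orbT.
  by move: (#|B :\: BB|) (deg_in _ _ _ _) (deg_in _ _ _ _) => x a c; clear; lia.
have HN5 : N5 * 4 <= N by rewrite EN; move: N10 N50; clear; nia.
split.
(* Degrees and non-degrees outside [BB] add up to about [n / t] full degrees, and the codegree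
   condition already requires about this much for the degrees; so the non-degrees are small in
   total. *)
- pose Sn := \sum_(v | v \notin BB) nondeg_in E k BB v; pose Sd := \sum_(v | v \notin BB) deg_in E k BB v.
  have H1 : #|V0| * P <= N1 * Sn.
    rewrite -sum_nat_const /Sn big_distrr /=.
    apply: (@leq_trans (\sum_(v in V0) N1 * nondeg_in E k BB v)).
      by apply: leq_sum => v; rewrite !inE => /andP[_ /ltnW].
    rewrite [X in _ <= X](bigID (mem V0)) /=; apply: leq_trans (leq_addr _ _).
    rewrite (eq_bigl (fun v => (v \notin BB) && (v \in V0))) // => v.
    by case: (boolP (v \in V0)) => vV; rewrite ?andbF // andbT; move: vV; rewrite inE => /andP[->].
  have H2 : Sd + Sn = #|~: BB| * #|BB| ^ k.-1.
    rewrite -big_split /= -sum_nat_const; apply: eq_big => v; first by rewrite in_setC.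
    by move=> _; rewrite deg_nondeg.
  have H3 := sum_deg_ge HE BB.
  rewrite (bigID (mem BB)) /= (edges_in_sum _ k0) -/Sd -/n -/P in H3.
  have yP : #|BB| ^ k.-1 <= P by rewrite /P leq_exp2r ?max_card // -ltnS prednK.
  have H4 : N * (k.-1 * k.-1) <= n.
    apply: leq_trans Hn2; rewrite EN (_ : 4 * (k * k) * N1 * N5 * 4 = 4 * N1 * N5 * (k * k * 4)); last lia.
    rewrite leq_mul2l; apply/orP; right; apply: (@leq_trans (k * k)); [by apply: leq_mul|by rewrite leq_pmulr].
  have H5 : N * (t * Sn) <= t.+2 * (n * P).
    clear H1; move: H2 H3 H4 Ed Hc yP; move: (#|~: BB|) (#|BB| ^ _) (edges_in _ _ _) (k.-1 * k.-1) Sn Sd => a y' e' kk Sn Sd H2 H3 H4 Ed Hc yP.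
    have L1 : N * (t * (Sd + Sn)) <= N.+1 * n * y' by rewrite H2; move: (leq_mul Hc (leqnn y')); clear; lia.
    have L2 := leq_mul (leqnn N) H3; have L3 := leq_mul H4 (leqnn P); have L4 := leq_mul (leqnn t) Ed.
    have L5 : n * y' <= n * P by rewrite leq_mul2l yP orbT.
    move: L1 L2 L3 L4 L5; clear; rewrite !mulnDr; lia.
  have t0 : 0 < t := ltn_trans (isT : 0 < 2) t1.
  have H6 : 4 * N5 * t * (#|V0| * P) <= t.+2 * (n * P).
    by apply: leq_trans H5; rewrite EN; move: (leq_mul (leqnn (4 * N5 * t)) H1); clear; lia.
  have H7 : 4 * t * (N5 * #|V0|) <= 4 * t * n.
    rewrite -(leq_pmul2r P0); move: H6 (leq_mul (leqnn (n * P)) t1); clear; lia.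
  by rewrite leq_pmul2l ?muln_gt0 // in H7.
- move: Hc HN5 N50; move: (t * #|~: BB|) => x; clear => Hc HN5 N50.
  case: (leqP x n) => Hx; first by rewrite mulSn; apply: leq_trans (leq_addl _ _); rewrite leq_mul2l Hx orbT.
  have : N5 * (x - n) <= N * (x - n) by rewrite leq_mul2r; apply/orP; right; lia.
  rewrite !mulnBr; nia.
- rewrite nP; apply: leq_trans Ed; rewrite leq_mul2r; apply/orP; right; lia.
Qed.
End Structure.

(** * Typical sets *)

Lemma card_covered (T I : finType) (D : {set I}) (F : I -> {set T}) (S : {set T}) N c :
  (forall v, v \in S -> exists2 i, i \in D & v \in F i) -> (forall i, i \in D -> N * #|F i| <= c) ->
  N * #|S| <= #|D| * c.
Proof.
move=> HS HF; apply: (@leq_trans (\sum_(i in D) N * #|F i|)); last first.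
  by rewrite -sum_nat_const; apply: leq_sum.
rewrite -big_distrr /= leq_mul2l; apply/orP; right.
rewrite -sum1_card; apply: (@leq_trans (\sum_(v in S) \sum_(i in D) (v \in F i))).
  apply: leq_sum => v /HS[i iD vF]; by rewrite (bigD1 i) //= vF.
rewrite exchange_big /=; apply: leq_sum => i _; rewrite -sum1_card [X in _ <= X]big_mkcond [X in X <= _]big_mkcond.
by apply: leq_sum => v _; case: (v \in F i); case: (v \in S).
Qed.

Section Rich.
Variables (T : finType) (E : {set {set T}}) (k : nat) (BB AA : {set T}) (N0 Ng : nat).
Local Notation n := #|T|.
Hypotheses (kE : kgraph k E) (k1 : 1 < k) (n0 : 0 < n) (N00 : 0 < N0) (Ng0 : 0 < Ng).
Let k0 : 0 < k. Proof. exact: ltnW. Qed.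
Local Notation B := (2 ^ k.+1).

(* [rich m S] : S grows to an edge by m vertices of BB, chosen one after the other in n / (N0 * B ^ j) ways at least;
   the factor B per step absorbs the number of subsets of S, so that a typical set stays typical when almost any
   vertex of BB is added. *)
Fixpoint rich m (S : {set T}) : bool :=
  if m is m'.+1 then n < N0 * B ^ m * #|[set v in BB | (v \notin S) && rich m' (v |: S)]| else S \in E.
Fixpoint gd a m (Y : {set T}) : bool :=
  if m is m'.+1 then Ng * #|[set v in BB | (v \notin Y) && ~~ gd a m' (v |: Y)]| <= n else a |: Y \in E.

(** Quantifying over all subsets makes typicality hereditary, and it reduces adding a vertex [v] to
    the subsets that contain [v]. *)
Definition OKB (X : {set T}) := [forall Y : {set T}, (Y \subset X) ==> ~~ rich (k - #|Y|) Y].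
Definition OKA a (X : {set T}) := OKB X && [forall Y : {set T}, (Y \subset X) ==> gd a (k.-1 - #|Y|) Y].

Lemma OKBP (X : {set T}) : reflect (forall Y : {set T}, Y \subset X -> ~~ rich (k - #|Y|) Y) (OKB X).
Proof. by apply: (iffP forallP) => H Y; [move/implyP: (H Y)|apply/implyP/H]. Qed.

Lemma OKAP a (X : {set T}) : reflect (OKB X /\ forall Y : {set T}, Y \subset X -> gd a (k.-1 - #|Y|) Y) (OKA a X).
Proof.
apply: (iffP andP) => [[H1 /forallP H2]|[H1 H2]]; split=> //; first by move=> Y; move/implyP: (H2 Y).
by apply/forallP => Y; apply/implyP/H2.
Qed.

Lemma OKB_sub (X Y : {set T}) : Y \subset X -> OKB X -> OKB Y.
Proof. by move=> YX /OKBP H; apply/OKBP => Y' Y'Y; apply: H; apply: subset_trans YX. Qed.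

Lemma set_cons_setU v s (S : {set T}) : [set x in v :: s] :|: S = [set x in s] :|: (v |: S).
Proof. by apply/setP => x; rewrite !inE; case: (x == v); case: (x \in s); case: (x \in S). Qed.

Lemma rich_dense m S : m <= k -> rich m S -> n ^ m <= (N0 * B ^ k) ^ m * tsum m (fun s => all (mem BB) s && ([set x in s] :|: S \in E)).
Proof.
elim: m S => [|m IH] S Hm /=; first by move=> SE; rewrite (_ : [set x in [::]] :|: S = S) ?SE //; apply/setP => x; rewrite !inE.
set G := [set v in BB | _] => HG; rewrite expnS.
have HN : N0 * B ^ m.+1 <= N0 * B ^ k by rewrite leq_mul2l leq_exp2l ?Hm ?orbT // -[1]/(2 ^ 0) ltn_exp2l.
apply: (@leq_trans (N0 * B ^ k * #|G| * n ^ m)).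
  by rewrite leq_mul2r (leq_trans (ltnW HG)) ?orbT // leq_mul2r HN orbT.
rewrite [X in _ <= X * _]expnS -[X in X <= _]mulnA -[X in _ <= X]mulnA leq_mul2l; apply/orP; right.
rewrite big_distrr /= -sum_nat_const big_mkcond; apply: leq_sum => v _.
case: (boolP (v \in G)) => //; rewrite inE => /and3P[vB _ /(IH _ (ltnW Hm)) H].
apply: leq_trans H _; rewrite leq_mul2l; apply/orP; right; apply: leq_tsum => s _.
by rewrite vB /= set_cons_setU.
Qed.

Lemma ngd_dense a m Y : ~~ gd a m Y -> n ^ m <= Ng ^ m * tsum m (fun s => all (mem BB) s && (a |: ([set x in s] :|: Y) \notin E)).
Proof.
elim: m Y => [|m IH] Y /=; first by move=> SE; rewrite (_ : [set x in [::]] :|: Y = Y) ?SE //; apply/setP => x; rewrite !inE.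
rewrite -ltnNge; set G := [set v in BB | _] => HG; rewrite expnS.
apply: (@leq_trans (Ng * #|G| * n ^ m)); first by rewrite leq_mul2r (ltnW HG) orbT.
rewrite expnS -!mulnA leq_mul2l; apply/orP; right.
rewrite big_distrr /= -sum_nat_const big_mkcond; apply: leq_sum => v _.
case: (boolP (v \in G)) => //; rewrite inE => /and3P[vB _ /IH H].
apply: leq_trans H _; rewrite leq_mul2l; apply/orP; right; apply: leq_tsum => s _.
by rewrite vB /= set_cons_setU.
Qed.

Lemma OKB0 N5 : (N0 * B ^ k) ^ k < N5 -> N5 * edges_in E k BB <= n ^ k -> OKB set0.
Proof.
move=> HN H; apply/OKBP => Y; rewrite subset0 => /eqP->; rewrite cards0 subn0; apply/negP => /(rich_dense (leqnn k)) H2.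
have {}H2 : n ^ k <= (N0 * B ^ k) ^ k * edges_in E k BB.
  apply: leq_trans H2 _; rewrite leq_mul2l; apply/orP; right; apply: leq_tsum => s _.
  by rewrite setU0.
have : 0 < n ^ k by rewrite expn_gt0 n0.
have := leq_trans H H2; rewrite leq_mul2r leqNgt HN orbF => /eqP E0; rewrite E0 muln0 in H2.
by rewrite ltnNge H2.
Qed.

Lemma OKB1 N3 b : OKB set0 -> 2 * (N0 * B ^ k) ^ k.-1 < N3 -> N3 * deg_in E k BB b <= 2 * n ^ k.-1 -> OKB [set b].
Proof.
move=> H0 HN H; apply/OKBP => Y; rewrite subset1 => /orP[/eqP->|/eqP->]; last by move/OKBP: H0; apply.
rewrite cards1 subn1; apply/negP => /(rich_dense (leq_pred k)) H2.
have {}H2 : n ^ k.-1 <= (N0 * B ^ k) ^ k.-1 * deg_in E k BB b.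
  apply: leq_trans H2 _; rewrite leq_mul2l; apply/orP; right; apply: leq_tsum => s _.
  rewrite /edg (_ : [set x in b :: s] = [set x in s] :|: [set b]) //; apply/setP => x; by rewrite !inE orbC.
have P0 : 0 < n ^ k.-1 by rewrite expn_gt0 n0.
have := leq_trans H (leq_mul (leqnn 2) H2); rewrite mulnA leq_mul2r leqNgt HN orbF => /eqP E0; rewrite E0 muln0 in H2.
by rewrite leqNgt P0 in H2.
Qed.

Lemma gd0 N1 a : Ng ^ k.-1 < N1 -> N1 * nondeg_in E k BB a <= n ^ k.-1 -> gd a k.-1 set0.
Proof.
move=> HN H; apply: contraT => /ngd_dense H2.
have {}H2 : n ^ k.-1 <= Ng ^ k.-1 * nondeg_in E k BB a.
  apply: leq_trans H2 _; rewrite leq_mul2l; apply/orP; right; apply: leq_tsum => s _.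
  rewrite /edg (_ : [set x in a :: s] = a |: ([set x in s] :|: set0)) //; apply/setP => x; by rewrite !inE orbF.
have P0 : 0 < n ^ k.-1 by rewrite expn_gt0 n0.
have := leq_trans H H2; rewrite leq_mul2r leqNgt HN orbF => /eqP E0; rewrite E0 muln0 in H2.
by rewrite leqNgt P0 in H2.
Qed.

(** A rich subset that appears with [v] contains [v]; without [v] it is a subset [Y] of [X] that is
    not rich, and by the definition of [rich] only few [v] can make it rich. There are at most
    [2 ^ k] sets [Y]. *)
Lemma ext_B (X : {set T}) : OKB X -> #|X| < k -> N0 * #|[set v in BB | (v \notin X) && ~~ OKB (v |: X)]| <= 2 ^ k * n.
Proof.
move=> HX cX; apply: (@leq_trans (#|powerset X| * n)); last by rewrite leq_mul2r card_powerset leq_exp2l // ltnW ?orbT // ltnW.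
apply: (@card_covered _ _ _ (fun Y : {set T} => [set v in BB | (v \notin Y) && rich (k - #|Y|).-1 (v |: Y)])).
- move=> v; rewrite inE => /and3P[vB vX]; case/forallPn => Y'; rewrite negb_imply negbK => /andP[sY' rY'].
  have vY' : v \in Y'.
    apply: contraT => vY'; have : Y' \subset X.
      apply/subsetP => x xY'; have := subsetP sY' x xY'; rewrite !inE => /orP[/eqP xv|//]; by rewrite -xv xY' in vY'.
    by move/OKBP: HX => H /H; rewrite rY'.
  exists (Y' :\ v); first by rewrite powersetE subDset setUC; rewrite setUC.
  rewrite inE vB !inE eqxx /= setD1K //.
  by rewrite (cardsD1 v Y') vY' add1n subnS in rY'.
- move=> Y; rewrite powersetE => YX; have := (OKBP _ HX) Y YX.
  have cY : #|Y| < k by apply: leq_ltn_trans (subset_leq_card YX) cX.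
  rewrite -(prednK (n := k - #|Y|)) ?subn_gt0 //= -leqNgt; apply: leq_trans; rewrite leq_mul2r leq_pmulr ?orbT // expn_gt0 expn_gt0 //.
Qed.

Section ExtA.
Variables (t N5 : nat).
Hypotheses (t0 : 0 < t) (HE : codegree_ge E k t) (dAB : [disjoint AA & BB]) (HN5 : N0 <= N5) (tB : t <= B).
Hypothesis cA : N5 * (t * #|~: BB|) <= N5.+1 * n.

Lemma codegree_set (Y : {set T}) : #|Y| = k.-1 -> n <= t * #|[set v | (v \notin Y) && (v |: Y \in E)]|.
Proof.
move=> cY; apply: leq_trans (HE (enum_uniq (mem Y)) _) _; first by rewrite -cardE.
rewrite leq_mul2l subset_leq_card ?orbT //; apply/subsetP => v; rewrite !inE /edg.
have -> : [set x in rcons (enum Y) v] = v |: Y by apply/setP => x; rewrite !inE mem_rcons inE mem_enum.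
move=> H; rewrite H andbT; apply/negP => vY; have := kE H.
by rewrite (setUidPr _) ?sub1set // cY; move: k0; clear; lia.
Qed.

(** For [m = 0] the set [Y] has at least [n / t] neighbours, few of them in [BB] as [Y] is not rich;
    since the complement of [BB] has hardly more than [n / t] vertices, almost all of [AA] are
    neighbours. The induction step averages over the added vertex, discarding those that destroy
    typicality. *)
Lemma ext_gd m (Y : {set T}) : OKB Y -> #|Y| + m = k.-1 -> N0 * #|[set a in AA | ~~ gd a m Y]| <= (3 * Ng) ^ m * 2 ^ k * n.
Proof.
elim: m Y => [|m IH] Y HY cY.
  rewrite addn0 in cY; rewrite mul1n.
  apply: (@leq_trans (2 * n)); last by rewrite leq_mul2r -{1}(expn1 2) leq_exp2l // k0 orbT.
  have H1 := codegree_set cY; set D := [set v | _] in H1.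
  have H2 : N0 * B * #|D :&: BB| <= n.
    have := (OKBP _ HY) Y (subxx _); rewrite cY (_ : k - k.-1 = 1); last by move: k0; clear; lia.
    rewrite /= -leqNgt expn1; apply: leq_trans; rewrite leq_mul2l subset_leq_card ?orbT //.
    by apply/subsetP => v; rewrite !inE => /andP[-> ->].
  have H3 : #|[set a in AA | ~~ gd a 0 Y]| + #|D :\: BB| <= #|~: BB|.
    rewrite -cardsUI (_ : _ :&: _ = set0) ?cards0 ?addn0.
      apply: subset_leq_card; apply/subsetP => v; rewrite !inE => /orP[/andP[vA _]|/andP[]//].
      by rewrite (disjointFr dAB vA).
    by apply/setP => v; rewrite !inE /=; case: (_ \in E); rewrite ?andbF.
  have H4 : N0 * (t * #|~: BB|) <= N0 * n + n.
    case: (leqP (t * #|~: BB|) n) => Hx; first by apply: leq_trans (leq_addr _ _); rewrite leq_mul2l Hx orbT.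
    have : N0 * (t * #|~: BB| - n) <= N5 * (t * #|~: BB| - n) by rewrite leq_mul2r HN5 orbT.
    move: cA Hx; rewrite !mulnBr mulSn; move: (t * #|~: BB|) => a; clear; nia.
  rewrite -(leq_pmul2l t0); move: H1; rewrite -(cardsID BB D).
  have H5 : t * N0 * #|D :&: BB| <= n.
    by apply: leq_trans H2; rewrite leq_mul2r mulnC leq_mul2l tB !orbT.
  move: H5 (leq_mul (leqnn (t * N0)) H3) H4; move: (#|_ :&: _|) (#|_ :\: _|) (#|~: _|) (#|[set _ in _ | _]|) => x y z w H5 H3' H4 H1.
  have := leq_mul (leqnn N0) H1; have : n <= t * n by rewrite leq_pmull.
  move: H5 H3' H4; clear; lia.
set S := [set a in AA | _].
have SA : S \subset AA by apply/subsetP => a; rewrite inE => /andP[].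
have H1 : #|S| * n <= Ng * \sum_(v in BB :\: Y) #|[set a in AA | ~~ gd a m (v |: Y)]|.
  rewrite -sum_nat_const; apply: (@leq_trans (\sum_(a in S) Ng * #|[set v in BB | (v \notin Y) && ~~ gd a m (v |: Y)]|)).
    by apply: leq_sum => a; rewrite inE /= -ltnNge => /andP[_ /ltnW].
  rewrite -big_distrr /= leq_mul2l; apply/orP; right.
  rewrite (eq_bigr (fun a => \sum_(v in BB :\: Y) (~~ gd a m (v |: Y)))); last first.
    move=> a _; rewrite -sum1_card big_mkcond [RHS]big_mkcond; apply: eq_bigr => v _; rewrite !inE.
    by case: (v \in BB); case: (v \in Y); rewrite //=; case: gd.
  rewrite exchange_big; apply: leq_sum => v _ /=; rewrite -sum1_card big_mkcond [X in _ <= X]big_mkcond; apply: leq_sum => a _.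
  case: (boolP (a \in S)) => // /(subsetP SA) aA; rewrite inE aA /=; by case: (gd a m _).
pose bad := [set v in BB | (v \notin Y) && ~~ OKB (v |: Y)].
have cYk : #|Y| < k.-1 by rewrite -cY; clear; lia.
have Hbad := ext_B HY (leq_trans cYk (leq_pred k)).
have H2 : N0 * \sum_(v in BB :\: Y) #|[set a in AA | ~~ gd a m (v |: Y)]| <= n * ((3 * Ng) ^ m * 2 ^ k * n) + 2 ^ k * n * n.
  rewrite big_distrr /= (bigID (mem bad)) /= addnC; apply: leq_add.
    apply: (@leq_trans (\sum_(v : T) (3 * Ng) ^ m * 2 ^ k * n)); last by rewrite sum_nat_const.
    rewrite big_mkcond; apply: leq_sum => v _; case: ifP => //; rewrite !inE => /andP[/andP[vY vB]].
    rewrite vB vY /= negbK => Hv; apply: IH Hv _; by rewrite cardsU1 vY -cY; clear; lia.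
  apply: (@leq_trans (\sum_(v in bad) N0 * n)); last by rewrite sum_nat_const mulnA leq_mul2r mulnC Hbad orbT.
  rewrite big_mkcond [X in _ <= X]big_mkcond; apply: leq_sum => v _; case: (boolP (v \in bad)) => vb; rewrite ?andbF //.
  by rewrite andbT; case: ifP => // _; rewrite leq_mul2l max_card orbT.
have H3 : N0 * #|S| * n <= Ng * ((3 * Ng) ^ m * 2 ^ k + 2 ^ k) * n * n.
  move: (leq_mul (leqnn N0) H1) (leq_mul (leqnn Ng) H2); move: (2 ^ k) ((3 * Ng) ^ m) (\sum_(_ in _) _) => x y z; clear; lia.
rewrite leq_pmul2r // in H3; apply: leq_trans H3 _; rewrite leq_mul2r expnS -!mulnA; apply/orP; right.
have : 2 ^ k <= (3 * Ng) ^ m * 2 ^ k by rewrite leq_pmull // expn_gt0 muln_gt0 Ng0.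
move: (leq_mul (leqnn Ng) (leqnn 1)); move: ((3 * Ng) ^ m) (2 ^ k) => x y _ H; rewrite mulnCA [3 * _]mulnC -mulnA leq_mul2l.
by apply/orP; right; move: H; clear; lia.
Qed.

Lemma ext_A (X : {set T}) : OKB X -> #|X| < k -> N0 * #|[set a in AA | ~~ OKA a X]| <= 2 ^ k * ((3 * Ng) ^ k * 2 ^ k * n).
Proof.
move=> HX cX; apply: (@leq_trans (#|powerset X| * ((3 * Ng) ^ k * 2 ^ k * n))); last by rewrite leq_mul2r card_powerset leq_exp2l // ltnW ?orbT // ltnW.
apply: (@card_covered _ _ _ (fun Y : {set T} => [set a in AA | ~~ gd a (k.-1 - #|Y|) Y])).
- move=> a; rewrite inE /OKA HX /= => /andP[aA]; case/forallPn => Y; rewrite negb_imply => /andP[sY gY].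
  by exists Y; rewrite ?powersetE // inE aA.
- move=> Y; rewrite powersetE => YX; have cY := subset_leq_card YX.
  apply: leq_trans (ext_gd (OKB_sub YX HX) _) _; first by rewrite subnKC //; move: cY cX; clear; lia.
  rewrite leq_mul2r leq_mul2r leq_exp2l ?orbT //; last by move: Ng0; clear; lia.
  by rewrite (leq_trans (leq_subr _ _) (leq_pred _)) !orbT.
Qed.

End ExtA.

Lemma ext_BA a (X : {set T}) : Ng <= N0 -> OKA a X -> #|X| < k.-1 ->
  Ng * #|[set v in BB | (v \notin X) && ~~ OKA a (v |: X)]| <= 2 ^ k.+1 * n.
Proof.
move=> HN /OKAP[HX HA] cX.
apply: (@leq_trans (Ng * (#|[set v in BB | (v \notin X) && ~~ OKB (v |: X)]| + #|[set v in BB | (v \notin X) && [exists Y : {set T}, (Y \subset v |: X) && ~~ gd a (k.-1 - #|Y|) Y]]|))).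
  rewrite leq_mul2l; apply/orP; right; apply: leq_trans (leq_card_setU _ _); apply: subset_leq_card; apply/subsetP => v.
  rewrite !inE => /and3P[-> -> /=]; rewrite /OKA negb_and => /orP[->//|]; case/forallPn => Y; rewrite negb_imply => HY.
  by apply/orP; right; apply/existsP; exists Y.
rewrite mulnDr expnS mul2n -addnn mulnDl; apply: leq_add.
  by apply: leq_trans (ext_B HX (leq_trans cX (leq_pred k))); rewrite leq_mul2r HN orbT.
apply: (@leq_trans (#|powerset X| * n)); last by rewrite leq_mul2r card_powerset leq_exp2l // (leq_trans (ltnW cX) (leq_pred k)) orbT.
apply: (@card_covered _ _ _ (fun Y : {set T} => [set v in BB | (v \notin Y) && ~~ gd a (k.-1 - #|Y|).-1 (v |: Y)])).
- move=> v; rewrite inE => /and3P[vB vX]; case/existsP => Y' /andP[sY' rY'].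
  have vY' : v \in Y'.
    apply: contraT => vY'; have : Y' \subset X.
      apply/subsetP => x xY'; have := subsetP sY' x xY'; rewrite !inE => /orP[/eqP xv|//]; by rewrite -xv xY' in vY'.
    by move=> /HA; rewrite (negPf rY').
  exists (Y' :\ v); first by rewrite powersetE subDset setUC; rewrite setUC.
  rewrite inE vB !inE eqxx /= setD1K //.
  by rewrite (cardsD1 v Y') vY' add1n subnS in rY'.
- move=> Y; rewrite powersetE => YX; have := HA Y YX.
  have cY : #|Y| < k.-1 by apply: leq_ltn_trans (subset_leq_card YX) cX.
  by rewrite -(prednK (n := k.-1 - #|Y|)) ?subn_gt0.
Qed.

(** Let [Q] be a smallest rich set inside [BB :\: Z]. It has at least two vertices, and it grows to
    an edge whose rich subsets all contain [Q]. With one vertex of [Q] put first and another one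
    last, both ends of the ordering miss a vertex of [Q], so they are typical. *)
Lemma good_edge (Z : {set T}) l : l < k -> OKB set0 -> (forall b, b \in BB -> OKB [set b]) ->
  2 * (N0 * B ^ k * #|Z|) <= n -> (exists2 e, e \in E & e \subset BB :\: Z) ->
  exists s, [/\ size s = k, uniq s, edg E s, {subset s <= BB :\: Z} & OKB [set x in take l s] /\ OKB [set x in drop (k - l) s]].
Proof.
move=> lk H0 H1 HZ [e eE eBZ].
pose P (Q : {set T}) := [&& Q \subset BB :\: Z, #|Q| <= k & rich (k - #|Q|) Q].
have Pe : P e by rewrite /P eBZ (kE eE) leqnn subnn.
case: (arg_minnP (fun Q : {set T} => #|Q|) Pe) => Q /and3P[QBZ cQ rQ] minQ.
have Q2 : 1 < #|Q|.
  case: (ltnP 1 #|Q|) => //; rewrite leq_eqVlt ltnS leqn0 => /orP[/cards1P[b Eb]|].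
    have bB : b \in BB by have := subsetP QBZ b; rewrite Eb !inE eqxx => /(_ isT)/andP[].
    by have := (OKBP _ (H1 b bB)) Q; rewrite Eb subxx -Eb => /(_ isT); rewrite rQ.
  by rewrite cards_eq0 => /eqP E0; have := (OKBP _ H0) Q; rewrite E0 subxx -E0 => /(_ isT); rewrite rQ.
have grow j (R : {set T}) : #|R| + j = k -> Q \subset R -> R \subset BB :\: Z -> rich j R ->
  (forall Y : {set T}, Y \subset R -> ~~ (Q \subset Y) -> ~~ rich (k - #|Y|) Y) ->
  exists e', [/\ e' \in E, Q \subset e', e' \subset BB :\: Z & forall Y : {set T}, Y \subset e' -> ~~ (Q \subset Y) -> ~~ rich (k - #|Y|) Y].
  elim: j R => [|m IH] R cR QR RBZ; first by move=> RE HR; exists R.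
  rewrite /=; set Gd := [set v in BB | _] => HG HR.
  pose F (Y : {set T}) := [set v in BB | (v \notin Y) && rich (k - #|Y|).-1 (v |: Y)].
  pose D := [set Y in powerset R | ~~ (Q \subset Y)].
  pose bad := [set v | [exists Y in D, v \in F Y]].
  (* A subset not containing [Q] is smaller than [R], so its threshold is lower by another factor
     [B = 2 ^ k.+1]; hence the bad vertices, over all [2 ^ k] subsets, are at most half the number
     of good ones guaranteed by the richness of [R]. *)
  have cbad : N0 * B ^ m.+2 * #|bad| <= 2 ^ k * n.
    apply: (@leq_trans (#|D| * n)); last first.
      rewrite leq_mul2r; apply/orP; right; apply: (@leq_trans #|powerset R|).
        by apply: subset_leq_card; apply/subsetP => Y; rewrite inE => /andP[].
      by rewrite card_powerset leq_exp2l // -cR leq_addr.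
    apply: (@card_covered _ _ _ F) => [v|Y].
      by rewrite inE => /exists_inP[Y YD vF]; exists Y.
    rewrite inE powersetE => /andP[YR QY]; have := HR Y YR QY.
    have cY : #|Y| < #|R| by apply: proper_card; rewrite properE YR; apply: contra QY; exact: subset_trans.
    rewrite -(prednK (n := k - #|Y|)) /= -?leqNgt; last by move: cY cR; clear; lia.
    apply: leq_trans; rewrite leq_mul2r leq_mul2l leq_exp2l; last by rewrite -[1]/(2 ^ 0) ltn_exp2l.
    by rewrite (_ : m.+2 <= _) ?orbT //; move: cY cR; clear; lia.
  have [v vG] : exists v, v \in Gd :\: (bad :|: Z).
    apply/card_gt0P; rewrite lt0n; apply/negP; rewrite cards_eq0 setD_eq0 => /subset_leq_card.
    move/leq_trans/(_ (leq_card_setU _ _)) => Hc.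
    have HB : B ^ m.+1 <= B ^ k by rewrite leq_exp2l -?cR ?leq_addl // -[1]/(2 ^ 0) ltn_exp2l.
    have Z2 : 2 * (N0 * B ^ m.+1 * #|Z|) <= n by apply: leq_trans HZ; rewrite leq_mul2l leq_mul2r leq_mul2l HB !orbT.
    have b2 : 2 * (N0 * B ^ m.+1 * #|bad|) <= n.
      rewrite -(@leq_pmul2l (2 ^ k)) ?expn_gt0 //; apply: leq_trans cbad.
      have -> : B ^ m.+2 = 2 * 2 ^ k * B ^ m.+1 by rewrite expnS [B]expnS.
      by move: (B ^ m.+1) (2 ^ k) => y x; clear; lia.
    move: (N0 * B ^ m.+1) HG Z2 b2 => c HG Z2 b2; have := leq_mul (leqnn c) Hc; rewrite mulnDr.
    move: HG Z2 b2; move: (c * #|Gd|) (c * #|bad|) (c * #|Z|) (#|T|) => x y z nn; clear; lia.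
  move: vG; rewrite !inE negb_or => /andP[/andP[vb vZ] /and3P[vB vR rv]].
  apply: (IH (v |: R)) => //.
  - by rewrite cardsU1 vR -cR; clear; lia.
  - by apply: subset_trans QR (subsetUr _ _).
  - by rewrite subUset sub1set RBZ andbT inE vZ vB.
  - move=> Y YvR QY; apply/negP => rY; case: (boolP (v \in Y)) => vY; last first.
      suff YR : Y \subset R by move: (HR Y YR QY); rewrite rY.
      apply/subsetP => x xY; have := subsetP YvR x xY; rewrite !inE => /orP[/eqP xv|//]; by rewrite -xv xY in vY.
    case/negP: vb; apply/existsP; exists (Y :\ v); rewrite !inE eqxx vB setD1K //= andbC; apply/andP; split.
      by rewrite (cardsD1 v Y) vY add1n subnS in rY.
    apply/andP; split; first by rewrite subDset setUC; rewrite setUC.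
    by apply: contra QY => /subset_trans; apply; apply: subsetDl.
have [|e' [e'E Qe' e'BZ He']] := grow (k - #|Q|) Q (subnKC cQ) (subxx _) QBZ rQ.
  move=> Y YQ QY; apply/negP => rY; have : P Y.
    by rewrite /P (subset_trans YQ QBZ) rY (leq_trans (subset_leq_card YQ) cQ).
  move/minQ; rewrite leqNgt => /negP; apply; apply: proper_card; by rewrite properE YQ.
have [x [y [xQ yQ xy]]] : exists x y, [/\ x \in Q, y \in Q & x != y] by case/card_gt1P: Q2 => x [y [? ? ?]]; exists x, y.
have xe := subsetP Qe' x xQ; have ye := subsetP Qe' y yQ.
pose s := x :: rcons (enum (e' :\ x :\ y)) y.
have ms z : (z \in s) = (z \in e').
  rewrite inE mem_rcons inE mem_enum !inE; case: eqVneq => [->|_] //=; by case: eqVneq => [->|_].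
have us : uniq s.
  rewrite /= mem_rcons inE mem_enum !inE eqxx andbF orbF xy rcons_uniq mem_enum !inE eqxx /=; exact: enum_uniq.
have ss : size s = k.
  rewrite -(kE e'E) -(card_uniqP us); by apply: eq_card.
exists s; split=> //.
- by rewrite /edg (_ : [set x0 in s] = e') //; apply/setP => z; rewrite inE ms.
- by move=> z; rewrite ms => /(subsetP e'BZ).
have notQ z (Y : {set T}) : z \in Q -> z \notin Y -> ~~ (Q \subset Y).
  by move=> zQ zY; apply/negP => /subsetP/(_ z zQ); rewrite (negPf zY).
split; apply/OKBP => Y YS.
- apply: He'; first by apply: subset_trans YS _; apply/subsetP => z; rewrite inE => /mem_take; rewrite ms.
  apply: (notQ y) => //; apply/negP => /(subsetP YS); rewrite inE.
  have Es : s = rcons (x :: enum (e' :\ x :\ y)) y by [].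
  rewrite Es -cats1 takel_cat; last by rewrite -ltnS -(size_rcons _ y) -Es ss.
  by move/mem_take => yy; move: us; rewrite Es rcons_uniq yy.
- apply: He'; first by apply: subset_trans YS _; apply/subsetP => z; rewrite inE => /mem_drop; rewrite ms.
  apply: (notQ x) => //; apply/negP => /(subsetP YS); rewrite inE.
  have : 0 < k - l by rewrite subn_gt0.
  case: (k - l) => // j _; rewrite /s /= => /mem_drop yy; by move: us; rewrite cons_uniq yy.
Qed.

End Rich.

(** * Colour patterns *)

Section Words.
Variables (k d : nat).
Hypotheses (d0 : 0 < d) (dk : d < k) (ndk : ~~ (d %| k)).
Local Notation q := (k %/ d).
Local Notation t := ((k %/ d).+1 * d).
Local Notation l := (k - d).
Definition one_true (s : seq bool) : Prop := count id s == 1.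

(* The two ways to continue the colour pattern between two runs of [l] vertices of B:
   [segment false] contains one vertex of A, and [segment true] has two, one of them in [q] windows only. *)
Definition segment (b : bool) : seq bool :=
  if b then nseq (t.-1 - k) false ++ true :: nseq (t - d) false ++ true :: nseq d.-1 false
  else nseq (t - k) false ++ true :: nseq d.-1 false.
Fixpoint word (bs : seq bool) : seq bool :=
  if bs is b :: bs' then (if bs' is [::] then segment b else segment b ++ nseq l false ++ word bs') else [::].

Let Ek : k = q * d + k %% d. Proof. exact: divn_eq. Qed.
Let rd : k %% d < d. Proof. by rewrite ltn_mod. Qed.
Let r0 : 0 < k %% d. Proof. by rewrite lt0n. Qed.
Let kt : k < t. Proof. by rewrite mulSn [X in X < _]Ek addnC ltn_add2r. Qed.

Lemma size_unit b : size (segment b) + l = if b then 2 * t - d else t.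
Proof.
case: b => /=; rewrite size_cat /= ?size_cat /= !size_nseq; move: kt dk d0; rewrite mulSn; move: (k %/ d * d) => x; clear; lia.
Qed.

(** The right side is [t] per A-vertex: an ordinary segment together with [l] vertices of B has
    exactly [t] vertices for its A-vertex, and every [segment true] saves [d] vertices. This is what
    compensates for a surplus of A-vertices. *)
Lemma size_word bs : bs != [::] -> size (word bs) + l + d * count id bs = t * (size bs + count id bs).
Proof.
elim: bs => // b [|b' bs] IH _; first by rewrite /= addn0 size_unit; case: b => /=; move: kt dk; lia.
rewrite [word _]/= -/(word (b' :: bs)) !size_cat size_nseq.
have -> : count id (b :: b' :: bs) = b + count id (b' :: bs) by [].
have -> : size (b :: b' :: bs) = (size (b' :: bs)).+1 by [].
have := IH isT; have := size_unit b; move: (size (segment b)) (size (word _)) (size (b' :: bs)) (count _ _) => x y z c.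
move: ((k %/ d).+1 * d) kt dk => tt; case: b => /=; clear; lia.
Qed.

Lemma count_unit b : count id (segment b) = b.+1.
Proof. by rewrite /segment; case: b; rewrite ?count_cat /= ?count_cat /= !count_nseq. Qed.

Lemma count_word bs : count id (word bs) = size bs + count id bs.
Proof.
elim: bs => // b [|b' bs] IH; first by rewrite /= count_unit addn0 add1n.
rewrite [word _]/= -/(word (b' :: bs)) !count_cat count_unit count_nseq mul0n add0n IH /=; lia.
Qed.

Lemma count_take_false m b : count id (take m (nseq b false)) = 0.
Proof.
apply/eqP; rewrite eqn0Ngt -has_count; apply/negP => /hasP[x /mem_take].
by rewrite mem_nseq => /andP[_ /eqP->].
Qed.

Lemma count_window x a b : x <= a -> a < x + k -> count id (take k (drop x (nseq a false ++ true :: nseq b false))) = 1.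
Proof.
move=> xa ax; have -> : drop x (nseq a false ++ true :: nseq b false) = nseq (a - x) false ++ true :: nseq b false.
  rewrite drop_cat size_nseq; case: ltnP => Hx; first by rewrite drop_nseq.
  have -> : x = a by move: xa Hx; clear; lia.
  by rewrite subnn drop0.
rewrite take_cat size_nseq; case: ltnP => Hk; first by move: ax Hk; clear; lia.
have : 0 < k - (a - x) by move: ax xa; clear; lia.
by case: (k - (a - x)) => // j _; rewrite count_cat count_nseq /= count_take_false.
Qed.

(** Counted from the first [l] vertices, the single A-vertex stands at [q * d], which is in every
    window. In the other case A-vertices stand at [q * d - 1] and [2 * q * d]: the first serves the
    windows starting before [q * d], the second all later ones. *)
Lemma lpath_unit b : lpath k d one_true (nseq l false ++ segment b ++ nseq l false).
Proof.
have H1 : forall a b', nseq l false ++ nseq a false ++ b' = nseq (l + a) false ++ b' by move=> *; rewrite nseqD catA.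
have H2 : true :: nseq d.-1 false ++ nseq l false = true :: nseq k.-1 false.
  by rewrite -nseqD; congr (_ :: nseq _ _); move: d0 dk; clear; lia.
have H2' : forall s : seq bool, (s ++ true :: nseq d.-1 false) ++ nseq l false = s ++ true :: nseq k.-1 false by move=> s; rewrite -catA cat_cons H2.
have Et : t = d + q * d by rewrite mulSn.
case: b; rewrite /segment -catA.
- rewrite cat_cons -catA cat_cons H2 H1; set a1 := l + _.
  have Ea1 : a1 = q * d - 1 by rewrite /a1 Et; move: kt dk d0; rewrite Et; clear; lia.
  have Etd : t - d = q * d by rewrite Et addKn.
  move=> i; rewrite /one_true Etd; rewrite size_cat size_nseq /= size_cat size_nseq /= size_nseq => Hi.
  have qd : d <= q * d by rewrite leq_pmull // divn_gt0 // ltnW.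
  case: (ltnP i q) => Hiq.
    have Hi1 : i * d + d <= q * d by rewrite -mulSnr leq_mul2r Hiq orbT.
    have Hl : i * d + k <= a1 + 1 + q * d by rewrite Ea1; move: Ek rd Hi1 qd; clear; lia.
    rewrite (_ : nseq a1 false ++ true :: nseq (q * d) false ++ true :: nseq k.-1 false = (nseq a1 false ++ true :: nseq (q * d) false) ++ true :: nseq k.-1 false); last by rewrite -catA.
    rewrite take_drop_catl; last by rewrite size_cat /= !size_nseq; move: Hl; clear; lia.
    rewrite count_window //; rewrite Ea1; move: Hi1 Ek r0 qd d0; clear; lia.
  have Hi2 : q * d <= i * d by rewrite leq_mul2r Hiq orbT.
  rewrite (_ : nseq a1 false ++ true :: nseq (q * d) false ++ true :: nseq k.-1 false = (nseq a1 false ++ [:: true]) ++ nseq (q * d) false ++ true :: nseq k.-1 false); last by rewrite -catA.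
  have sq : size (nseq a1 false ++ [:: true]) = q * d by rewrite size_cat size_nseq Ea1 /=; move: qd d0; clear; lia.
  rewrite drop_catr; rewrite ?sq // count_window //; move: Hi Hi2 Ek r0 qd d0; rewrite ?Ea1; clear; lia.
- rewrite cat_cons H2 H1 => i; rewrite size_cat size_nseq /= size_nseq => Hi; rewrite /one_true.
  have El : l + (t - k) = q * d by rewrite Et; move: kt dk; rewrite Et; clear; lia.
  rewrite El in Hi *; rewrite count_window //; move: Hi Ek r0 d0 dk; clear; lia.
Qed.

Lemma dvdn_unit b : d %| l + size (segment b).
Proof. by rewrite addnC size_unit; case: b; rewrite ?dvdn_sub // dvdn_mull // dvdn_mull. Qed.

Lemma lpath_word bs : bs != [::] -> lpath k d one_true (nseq l false ++ word bs ++ nseq l false).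
Proof.
elim: bs => // b [|b' bs] IH _; first exact: lpath_unit.
rewrite [word _]/= -/(word (b' :: bs)) -!catA.
rewrite (_ : nseq l false ++ segment b ++ nseq l false ++ word (b' :: bs) ++ nseq l false =
  (nseq l false ++ segment b) ++ nseq l false ++ (word (b' :: bs) ++ nseq l false)); last by rewrite -!catA.
apply: lpath_cat.
- by rewrite size_cat size_nseq dvdn_unit.
- by rewrite size_nseq; move: dk; clear; lia.
- by rewrite -catA; apply: lpath_unit.
- exact: IH.
Qed.

Lemma dvdn_word bs : bs != [::] -> d %| l + size (word bs).
Proof.
move=> nb; have := size_word nb; rewrite addnC => H.
rewrite -(dvdn_addr _ (dvdn_mulr (count id bs) (dvdnn d))) addnC [l + _]addnC addnC H dvdn_mulr //; exact: dvdn_mull.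
Qed.

End Words.

(** * Filling a colour pattern vertex by vertex *)

Section Fill.
Variables (T : finType) (E : {set {set T}}) (k d : nat) (BB AA : {set T}) (OB : pred {set T}) (OA : T -> pred {set T}) (Nb : nat).
Local Notation n := #|T|.
Local Notation l := (k - d).
Hypotheses (d0 : 0 < d) (dk : d < k).
Hypothesis OB_sub : forall X Y : {set T}, Y \subset X -> OB X -> OB Y.
Hypothesis OA_OB : forall a X, OA a X -> OB X.
Hypothesis extB : forall X, OB X -> #|X| < k.-1 -> Nb * #|[set v in BB | (v \notin X) && ~~ OB (v |: X)]| <= n.
Hypothesis extBA : forall a X, OA a X -> #|X| < k.-1 -> Nb * #|[set v in BB | (v \notin X) && ~~ OA a (v |: X)]| <= n.
Hypothesis extA : forall X, OB X -> #|X| < k -> Nb * #|[set a in AA | ~~ OA a X]| <= n.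
Hypothesis fullA : forall a X, OA a X -> #|X| = k.-1 -> a |: X \in E.

Definition contB (s : seq (bool * option T)) := [set x | (false, Some x) \in s].
Definition contA (s : seq (bool * option T)) := [set x | (true, Some x) \in s].
(** Entries not yet chosen are [None]. The condition is the invariant that lets a partially filled
    window be completed in any order; when the window is full, it gives an edge by [fullA]. *)
Definition okw s := [&& count fst s == 1, OB (contB s) & [forall a in contA s, OA a (contB s)]].
Local Notation okP := (fun s => okw s : Prop).
Definition colour (c : bool) := if c then AA else BB.

Lemma card_contB s : #|contB s| <= count (fun e => ~~ e.1 && isSome e.2) s.
Proof.
rewrite -size_filter -(size_map snd).
apply: (@leq_trans #|[set x | Some x \in map snd (filter (fun e => ~~ e.1 && isSome e.2) s)]|).
  apply: subset_leq_card; apply/subsetP => x; rewrite !inE => Hx; apply/mapP; exists (false, Some x) => //.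
  by rewrite mem_filter.
move: (map snd _) => r; elim: r => [|[y|] r IH] /=.
- by rewrite (_ : [set _ | _] = set0) ?cards0 //; apply/setP => x; rewrite !inE.
- apply: (@leq_trans #|y |: [set x | Some x \in r]|).
    by apply: subset_leq_card; apply/subsetP => x; rewrite !inE => /orP[/eqP[->]|->]; rewrite ?eqxx ?orbT.
  by rewrite cardsU1 addnC -addn1 leq_add //; case: (_ \notin _).
- by apply: leq_trans IH (leqnSn _); apply: subset_leq_card; apply/subsetP => x; rewrite !inE.
Qed.

Lemma step_window c Q1 Q2 : size Q1 + (size Q2).+1 = k -> okw (Q1 ++ (c, None) :: Q2) ->
  exists bad : {set T}, Nb * #|bad| <= k.+1 * n /\ forall v, v \in colour c -> v \notin bad -> okw (Q1 ++ (c, Some v) :: Q2).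
Proof.
set s := Q1 ++ _ :: Q2 => ss /and3P[c1 oB /forall_inP oA].
have sk : size s = k by rewrite size_cat.
pose s' v := Q1 ++ (c, Some v) :: Q2.
have cs' v : count fst (s' v) == 1 by rewrite /s' count_cat; move: c1; rewrite /s count_cat.
have Hsum : count fst s + count (fun e => ~~ e.1 && isSome e.2) s + count (fun e => ~~ e.1 && ~~ isSome e.2) s = k.
  rewrite -sk; elim: (s) => //= e r <-; case: e => [[] [x|]] /=; lia.
have cB := card_contB s.
case: c @s ss c1 oB oA sk @s' cs' Hsum cB => s ss c1 oB oA sk s' cs' Hsum cB.
- exists [set a in AA | ~~ OA a (contB s)]; split.
    have cBk : #|contB s| < k by move: Hsum cB; rewrite (eqP c1); clear; lia.
    by apply: leq_trans (extA oB cBk) _; rewrite leq_pmull.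
  move=> v vA vb; have EB : contB (s' v) = contB s.
    by apply/setP => x; rewrite !inE !mem_cat !inE.
  have EA x : (x \in contA (s' v)) = (x == v) || (x \in contA s).
    by rewrite !inE !mem_cat !inE /= orbCA; congr (_ || _).
  apply/and3P; split; [exact: cs'|by rewrite EB|apply/forall_inP => a; rewrite EB EA => /orP[/eqP->|/oA//]].
  by move: vb; rewrite inE (vA : v \in AA) /= negbK.
- have cBk : #|contB s| < k.-1.
    have : 0 < count (fun e : bool * option T => ~~ e.1 && ~~ isSome e.2) s by rewrite count_cat /= add1n addnS.
    by move: Hsum cB; rewrite (eqP c1); clear; lia.
  exists ([set v in BB | (v \notin contB s) && ~~ OB (v |: contB s)] :|: [set v | [exists a in contA s, v \in [set v in BB | (v \notin contB s) && ~~ OA a (v |: contB s)]]]); split.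
    apply: (@leq_trans (n + k * n)); last by rewrite mulSn.
    apply: leq_trans (leq_mul (leqnn Nb) (leq_card_setU _ _)) _; rewrite mulnDr leq_add //; first exact: extB.
    apply: (@leq_trans (#|contA s| * n)).
      apply: (@card_covered _ _ _ (fun a => [set v in BB | (v \notin contB s) && ~~ OA a (v |: contB s)])).
        by move=> v; rewrite inE => /exists_inP[a aA vF]; exists a.
      by move=> a /oA Ha; apply: extBA.
    rewrite leq_mul2r; apply/orP; right; rewrite -sk; apply: (@leq_trans (size (map snd s))); last by rewrite size_map.
    apply: (@leq_trans #|[set x in pmap snd s]|).
      apply: subset_leq_card; apply/subsetP => x; rewrite !inE => Hx; rewrite mem_pmap; apply/mapP; by exists (true, Some x).
    by rewrite cardsE size_map; apply: leq_trans (card_size _) _; rewrite size_pmap count_size.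
  move=> v vB vb; have EB : contB (s' v) = v |: contB s.
    by apply/setP => x; rewrite !inE !mem_cat !inE /= orbCA; congr (_ || _).
  have EA : contA (s' v) = contA s.
    by apply/setP => x; rewrite !inE !mem_cat !inE.
  case: (boolP (v \in contB s)) => vs.
    have Evs : v |: contB s = contB s by apply/setUidPr; rewrite sub1set.
    by apply/and3P; split; [exact: cs'|rewrite EB Evs|apply/forall_inP => a; rewrite EB Evs EA => /oA].
  move: vb; rewrite in_setU negb_or => /andP[]; rewrite inE (vB : v \in BB) vs /= negbK => ob; rewrite inE => hA.
  apply/and3P; split; [exact: cs'|by rewrite EB|apply/forall_inP => a; rewrite EB EA => aA].
  apply: contraR hA => nOA; apply/exists_inP; exists a => //; by rewrite inE (vB : v \in BB) vs nOA.
Qed.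

(** At most [k] windows contain the free position, and each of them excludes few vertices of the
    right colour. *)
Lemma step_fill c P1 P2 : lpath k d okP (P1 ++ (c, None) :: P2) ->
  exists bad : {set T}, Nb * #|bad| <= k * (k.+1 * n) /\
    forall v, v \in colour c -> v \notin bad -> lpath k d okP (P1 ++ (c, Some v) :: P2).
Proof.
move=> HL; set p := size P1; pose W := P1 ++ (c, None) :: P2.
pose win i := take k (drop (i * d) W).
have Hwin i o : i * d <= p -> p < i * d + k -> i * d + k <= size W ->
  take k (drop (i * d) (P1 ++ (c, o) :: P2)) = drop (i * d) P1 ++ (c, o) :: take (k - (p - i * d)).-1 P2.
  move=> H1 H2 H3; rewrite drop_cat; case: ltnP => Hx.
    rewrite take_cat size_drop -/p; case: ltnP => Hy; first by move: H1 H2 Hy; clear; lia.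
    by have : 0 < k - (p - i * d) by [move: H1 H2; clear; lia]; case: (k - (p - i * d)).
  have E1 : i * d - size P1 = 0 by move: H1 Hx; rewrite -/p; clear; lia.
  have E2 : p - i * d = 0 by move: Hx; rewrite -/p; clear; lia.
  by rewrite E1 E2 (drop_oversize Hx) subn0 /=; case: k dk.
pose okv c' s (bad : {set T}) := forall v, v \in colour c -> v \notin bad -> okw (s ++ (c, Some v) :: c').
have Hbad (j : 'I_k) : exists bad : {set T}, Nb * #|bad| <= k.+1 * n /\
   (let i := p %/ d - j in i * d <= p -> p < i * d + k -> i * d + k <= size W ->
     forall v, v \in colour c -> v \notin bad -> okw (take k (drop (i * d) (P1 ++ (c, Some v) :: P2)))).
  set i := p %/ d - j; case: (boolP [&& i * d <= p, p < i * d + k & i * d + k <= size W]) => [/and3P[H1 H2 H3]|nH]; last first.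
    exists set0; rewrite cards0 muln0; split=> //= H1 H2 H3; by rewrite H1 H2 H3 in nH.
  have := HL i H3; rewrite Hwin // => Hok.
  have [|bad [cb Hb]] := step_window _ Hok.
    rewrite size_drop -/p size_takel; first by move: H1 H2; clear; lia.
    by move: H1 H2 H3; rewrite /W size_cat /= -/p; clear; lia.
  by exists bad; split=> // i' _ _ _ v vc vb; rewrite Hwin //; apply: Hb.
have [F HF] := fin_all_exists Hbad.
exists (\bigcup_j F j); split.
  have := @card_covered _ _ [set: 'I_k] F (\bigcup_j F j) Nb (k.+1 * n); rewrite cardsT card_ord; apply=> [v /bigcupP[j _ vF]|j _].
    by exists j.
  by have [] := HF j.
move=> v vc vb i Hi.
have Hi' : i * d + k <= size W by move: Hi; rewrite !size_cat.
case: (leqP (i * d) p) => H1; last first.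
  rewrite drop_cat -/p ltnNge (ltnW H1) /=; have := HL i Hi'; rewrite drop_cat -/p ltnNge (ltnW H1) /=.
  have : 0 < i * d - p by rewrite subn_gt0.
  by case: (i * d - p).
case: (leqP (i * d + k) p) => H2.
  by rewrite take_drop_catl //; have := HL i Hi'; rewrite take_drop_catl.
have jk : p %/ d - i < k.
  rewrite -(ltn_pmul2r d0) mulnBl; have : k <= k * d by rewrite leq_pmulr.
  have : p %/ d * d <= p by apply: leq_trunc_div.
  by move: (p %/ d * d) H1 H2; clear; lia.
have [_] := HF (Ordinal jk); rewrite /= subKn; last by rewrite leq_divRL.
by apply=> //; apply: contra vb => vF; apply/bigcupP; exists (Ordinal jk).
Qed.

Fixpoint fill (w : seq bool) (u : seq T) : seq (bool * option T) :=
  match w, u with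
  | c :: w', v :: u' => (c, Some v) :: fill w' u'
  | c :: w', [::] => (c, None) :: fill w' [::]
  | [::], _ => [::]
  end.

Lemma fill_rcons w u : size u < size w -> exists P1 P2, [/\ size P1 = size u, fill w u = P1 ++ (nth false w (size u), None) :: P2 &
  forall v, fill w (rcons u v) = P1 ++ (nth false w (size u), Some v) :: P2].
Proof.
elim: w u => // c w IH [|x u] /= Hu; first by exists [::], (fill w [::]); split.
have [P1 [P2 [sP E1 E2]]] := IH u Hu; exists ((c, Some x) :: P1), P2; split; rewrite /= ?sP ?E1 //.
by move=> v; rewrite E2.
Qed.

Lemma fill_nil w : fill w [::] = map (fun c => (c, None)) w.
Proof. by elim: w => //= c w ->. Qed.

Lemma fill_full w u : size u = size w -> fill w u = map (fun e => (e.1, Some e.2)) (zip w u).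
Proof. by elim: w u => [|c w IH] [|x u] //= [/IH->]. Qed.

Definition ctx (X : seq T) := map (fun x => (false, Some x)) X.

(** The length of [w] prevents a window from meeting both ends, so the vertices fixed in a window
    lie in [X] alone or in [Y] alone. *)
Lemma fill_start X w Y : size X = l -> size Y = l -> k.-1 <= size w ->
  lpath k d one_true (nseq l false ++ w ++ nseq l false) -> OB [set x in X] -> OB [set x in Y] ->
  lpath k d okP (ctx X ++ fill w [::] ++ ctx Y).
Proof.
move=> sX sY sw Hw oX oY i Hi.
have Ew : map fst (ctx X ++ fill w [::] ++ ctx Y) = nseq l false ++ w ++ nseq l false.
  rewrite !map_cat fill_nil -!map_comp map_id; congr (_ ++ (_ ++ _)).
    by rewrite -sX; elim: (X) => //= x X' ->.
  by rewrite -sY; elim: (Y) => //= x X' ->.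
set W := _ ++ _ ++ _ in Hi Ew *; set s := take k _.
have c1 : count fst s == 1.
  have := Hw i; rewrite -Ew size_map => /(_ Hi); by rewrite /one_true -map_drop -map_take count_map.
have sA : contA s = set0.
  apply/setP => x; rewrite !inE; apply/negP => /mem_take/mem_drop; rewrite !mem_cat fill_nil.
  by case/or3P => /mapP[].
have sB : contB s \subset [set x in X] \/ contB s \subset [set x in Y].
  case: (leqP l (i * d)) => Hl; [right|left]; apply/subsetP => x; rewrite !inE.
    rewrite /s /W drop_catr ?size_map ?sX // => /mem_take/mem_drop; rewrite mem_cat fill_nil => /orP[/mapP[]//|].
    by case/mapP => y yY [->].
  rewrite /s /W catA take_drop_catl; last first.
    by rewrite size_cat size_map sX fill_nil size_map; move: Hl sw dk; clear; lia.
  move=> /mem_take/mem_drop; rewrite mem_cat fill_nil => /orP[|/mapP[]//].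
  by case/mapP => y yY [->].
rewrite /okw c1 sA; apply/andP; split=> //; apply/andP; split; first by case: sB => /OB_sub; apply.
by apply/forall_inP => a; rewrite inE.
Qed.

Lemma okw_edge (r : seq (bool * T)) : size r = k -> uniq (unzip2 r) -> okw (map (fun e => (e.1, Some e.2)) r) -> edg E (unzip2 r).
Proof.
move=> sr ur /and3P[c1 _ /forall_inP oA].
have Pr : perm_eq (filter fst r ++ filter (predC fst) r) r by apply/permPl/perm_filterC.
have s1 : size (filter fst r) = 1 by rewrite size_filter; apply/eqP; rewrite count_map in c1.
case Ef : (filter fst r) s1 Pr => [|[c a] [|]] // _ Pr.
have ct : c = true by have : (c, a) \in filter fst r by [rewrite Ef mem_head]; rewrite mem_filter /= => /andP[].
rewrite ct in Ef Pr.
set f := fun e => (e.1, Some e.2) in c1 oA *.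
have EB : contB (map f r) = [set x in unzip2 (filter (predC fst) r)].
  apply/setP => x; rewrite !inE; apply/mapP/mapP => [[[c' y] yr [Ec ->]]|[[c' y]]].
    by exists (c', y) => //; rewrite mem_filter yr /= -Ec.
  by rewrite mem_filter /= => /andP[/negPf-> yr] ->; exists (false, y).
have P2 := perm_map snd Pr; rewrite /= in P2.
have u2 : uniq (a :: unzip2 (filter (predC fst) r)) by rewrite (perm_uniq P2).
have cB : #|contB (map f r)| = k.-1.
  rewrite EB cardsE (card_uniqP _); last by case/andP: u2.
  by rewrite -sr -(size_map snd r) -(perm_size P2) /= size_map.
have aA : a \in contA (map f r).
  rewrite inE; apply/mapP; exists (true, a) => //; by rewrite -(perm_mem Pr) mem_head.
have := fullA (oA a aA) cB; rewrite EB -(edg_perm _ P2) /edg.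
by rewrite (_ : [set x in a :: _] = a |: [set x in unzip2 (filter (predC fst) r)]) //; apply/setP => x; rewrite !inE.
Qed.

Lemma full_edges (R : seq (bool * T)) : uniq (unzip2 R) ->
  lpath k d okP (map (fun e => (e.1, Some e.2)) R) -> lpath k d (fun s => edg E s : Prop) (unzip2 R).
Proof.
move=> uR HL i Hi; rewrite /unzip2 -map_drop -map_take; rewrite size_map in Hi; apply: okw_edge.
- by rewrite size_takel // size_drop; move: Hi; move: (size R) => x; clear; lia.
- by rewrite /unzip2 map_take map_drop take_uniq // drop_uniq.
- by rewrite map_take map_drop; apply: HL; rewrite size_map.
Qed.

Lemma fill_end X w u Y : size X = l -> size Y = l -> size u = size w -> uniq (X ++ u ++ Y) ->
  lpath k d okP (ctx X ++ fill w u ++ ctx Y) -> lpath k d (fun s => edg E s : Prop) (X ++ u ++ Y).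
Proof.
move=> sX sY su uu HL.
pose R := zip (nseq l false ++ w ++ nseq l false) (X ++ u ++ Y).
have sR : size (nseq l false ++ w ++ nseq l false) = size (X ++ u ++ Y) by rewrite !size_cat !size_nseq sX sY su.
have ER : ctx X ++ fill w u ++ ctx Y = map (fun e => (e.1, Some e.2)) R.
  have Ec Z : size Z = l -> ctx Z = map (fun e => (e.1, Some e.2)) (zip (nseq l false) Z).
    by move=> <-; elim: Z => //= z Z <-.
  rewrite /R zip_cat ?size_nseq // zip_cat // !map_cat fill_full // -!Ec //.
have E2 : X ++ u ++ Y = unzip2 R by rewrite /R unzip2_zip // sR.
by rewrite E2; apply: full_edges; rewrite -?E2 // -ER.
Qed.

End Fill.

(** * Drawing vertices until none is left, with blocks as an exchange reserve *)

Section Draw.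
Variables (T : finType) (x0 : T) (i : nat) (fits : T -> pred (seq T)) (L0 : seq (seq T)) (col : {set T}) (h b : nat).
Hypothesis hb : 2 * b < h.

Definition current (u : seq T * option T) := odflt (nth x0 u.1 i) u.2.
Definition pool (st : seq T * seq (seq T * option T)) := st.1 ++ map current st.2.
Definition swaps (Ls : seq (seq T * option T)) := count (fun u => isSome u.2) Ls.
(** The free vertices are [st.1]; a block with [Some z] has had its exchangeable vertex replaced by
    [z]. The fourth clause says that swapping starts only when at most [b] vertices are free, so
    that at most [b] blocks are ever used. *)
Definition stock (st : seq T * seq (seq T * option T)) : Prop :=
  [/\ map fst st.2 = L0, forall t z, (t, Some z) \in st.2 -> fits z t,
      forall z, z \in st.1 -> h <= count (fits z) L0,
      swaps st.2 = 0 \/ swaps st.2 + size st.1 <= b &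
      uniq (pool st) /\ {subset pool st <= col}].

(** With more than [b] free vertices one of them is not bad. Otherwise a free vertex [z] is pushed
    into a block that tolerates it, and the vertex it displaces is handed out. Of the [h > 2 * b]
    suitable blocks at most [b] have been swapped or are excluded by [z] itself being counted among
    the free ones, and at most [b] hold a bad vertex. *)
Lemma draw st (bad : {set T}) : stock st -> 0 < size st.1 -> #|bad| <= b ->
  exists v st', [/\ stock st', v \in col, v \notin bad, perm_eq (pool st) (v :: pool st') & size st.1 = (size st'.1).+1].
Proof.
case: st => R Ls [/= E1 H2 H3 H4 [uP sP]] R0 cb.
case: (ltnP b (size R)) => HR.
  have [v vR vb] : exists2 v, v \in R & v \notin bad.
    apply/hasP; rewrite has_predC; apply: contraTN HR => /allP Hall; rewrite -leqNgt; apply: leq_trans cb.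
    move: uP; rewrite cat_uniq => /andP[uR _]; rewrite -(card_uniqP uR); apply: subset_leq_card; exact/subsetP.
  have P : perm_eq (pool (R, Ls)) (v :: pool (rem v R, Ls)).
    by rewrite /pool /= -cat_cons perm_cat2r perm_to_rem.
  exists v, (rem v R, Ls); split=> //=.
  - split=> //=; first by move=> z /mem_rem; apply: H3.
      by case: H4 => [->|]; [left|move=> Hx; move: HR Hx; clear; lia].
    split; first by move: uP; rewrite (perm_uniq P) => /andP[].
    by move=> x Hx; apply: sP; rewrite (perm_mem P) inE Hx orbT.
  - by apply: sP; rewrite mem_cat vR.
  - by rewrite size_rem // prednK.
have H4' : swaps Ls + size R <= b by case: H4 => [->|//].
case: R R0 HR H3 H4 H4' uP sP => // z R _ HR H3 H4 H4' uP sP.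
have [u uL /and3P[fu nu bu]] : exists2 u, u \in Ls & [&& fits z u.1, ~~ isSome u.2 & current u \notin bad].
  apply/hasP; rewrite has_count lt0n; apply/eqP => c0.
  have Hz : h <= count (fun u => fits z u.1) Ls.
    by rewrite -(count_map fst (fits z)) E1; apply: H3; rewrite mem_head.
  have Hb : count (fun u => current u \in bad) Ls <= b.
    apply: leq_trans cb; rewrite -(count_map current (mem bad)) -size_filter.
    have uf : uniq (filter (mem bad) (map current Ls)) by apply: filter_uniq; move: uP; rewrite cat_uniq => /and3P[].
    rewrite -(card_uniqP uf); apply: subset_leq_card; apply/subsetP => x; by rewrite mem_filter => /andP[].
  have : count (fun u => fits z u.1) Ls <= count (fun u => isSome u.2) Ls + count (fun u => current u \in bad) Ls +
     count (fun u => [&& fits z u.1, ~~ isSome u.2 & current u \notin bad]) Ls.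
    elim: (Ls) => //= u Ls' IH; case: (fits z u.1); case: (isSome u.2); case: (current u \in bad); move: IH; rewrite /=; lia.
  rewrite c0; move: H4' Hb Hz hb; rewrite /swaps /=; move: (count (fun u => isSome u.2) Ls) => x; clear; lia.
case: u uL fu nu bu => t [//|] uL fu _ bu; rewrite /= in fu.
have [L1 [L2 EL]] : exists L1 L2, Ls = L1 ++ (t, None) :: L2 by case/splitPr: uL => L1 L2; exists L1, L2.
pose Ls' := L1 ++ (t, Some z) :: L2.
have P : perm_eq (pool (z :: R, Ls)) (nth x0 t i :: pool (R, Ls')).
  rewrite /pool /= EL /Ls' !map_cat /=; apply/permP => p; rewrite /= !count_cat /= /current /=; clear; lia.
exists (nth x0 t i), (R, Ls'); split=> //=.
- split=> /=; first by rewrite -E1 EL /Ls' !map_cat.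
  + by move=> t' z'; rewrite mem_cat inE => /or3P[Hx|/eqP[-> ->]//|Hx]; apply: H2; rewrite EL mem_cat inE Hx ?orbT.
  + by move=> z' Hz'; apply: H3; rewrite inE Hz' orbT.
  + right; move: H4'; rewrite /swaps EL /Ls' !count_cat /=; clear; lia.
  split; first by move: uP; rewrite (perm_uniq P) => /andP[].
  by move=> x Hx; apply: sP; rewrite (perm_mem P) inE Hx orbT.
- by apply: sP; rewrite (perm_mem P) mem_head.
Qed.

End Draw.

Section Connect.
Variables (T : finType) (E : {set {set T}}) (k d : nat) (BB AA : {set T}) (OB : pred {set T}) (OA : T -> pred {set T}) (Nb : nat).
Local Notation n := #|T|.
Local Notation l := (k - d).
Local Notation t := ((k %/ d).+1 * d).
Local Notation PP := (fun s : seq T => edg E s : Prop).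
Hypotheses (d0 : 0 < d) (dk : d < k) (ndk : ~~ (d %| k)) (Nb0 : 0 < Nb).
Hypothesis OB_sub : forall X Y : {set T}, Y \subset X -> OB X -> OB Y.
Hypothesis OA_OB : forall a X, OA a X -> OB X.
Hypothesis extB : forall X, OB X -> #|X| < k.-1 -> Nb * #|[set v in BB | (v \notin X) && ~~ OB (v |: X)]| <= n.
Hypothesis extBA : forall a X, OA a X -> #|X| < k.-1 -> Nb * #|[set v in BB | (v \notin X) && ~~ OA a (v |: X)]| <= n.
Hypothesis extA : forall X, OB X -> #|X| < k -> Nb * #|[set a in AA | ~~ OA a X]| <= n.
Hypothesis fullA : forall a X, OA a X -> #|X| = k.-1 -> a |: X \in E.
Variables (x0 : T) (ci : bool -> nat) (fits : bool -> T -> pred (seq T)) (L0 : bool -> seq (seq T)) (h b : nat).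
Hypotheses (hb : 2 * b < h) (bn : k * (k.+1 * n) <= Nb * b).
Local Notation okP := (fun s => okw OB OA s : Prop).

Definition state := bool -> seq T * seq (seq T * option T).
Implicit Types st : state.
Definition stocked st := forall c, stock x0 (ci c) (fits c) (L0 c) (colour BB AA c) h b (st c).
Definition pools st := pool x0 (ci true) (st true) ++ pool x0 (ci false) (st false).

Lemma fill_word X w Y st : size X = l -> size Y = l -> k.-1 <= size w ->
  lpath k d one_true (nseq l false ++ w ++ nseq l false) -> OB [set x in X] -> OB [set x in Y] ->
  stocked st -> (forall c, count (pred1 c) w <= size (st c).1) ->
  uniq (X ++ Y) -> uniq (pools st) -> all [predC X ++ Y] (pools st) ->
  exists u st', [/\ size u = size w, stocked st', lpath k d PP (X ++ u ++ Y), perm_eq (pools st) (u ++ pools st') &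
    forall c, size (st c).1 = count (pred1 c) w + size (st' c).1].
Proof.
move=> sX sY sw Hw oX oY Hst Hc uXY uP aP.
suff [u [st' [su Hst' HL HP Hs]]] : exists u st', [/\ size u = size w, stocked st', lpath k d okP (ctx X ++ fill w u ++ ctx Y),
   perm_eq (pools st) (u ++ pools st') & forall c, size (st c).1 = count (pred1 c) w + size (st' c).1].
  exists u, st'; split=> //; apply: (fill_end fullA sX sY su) HL.
  have uu : uniq u by move: uP; rewrite (perm_uniq HP) cat_uniq => /andP[].
  have Hu x : x \in u -> (x \notin X) && (x \notin Y).
    by move=> xu; have := allP aP x; rewrite (perm_mem HP) mem_cat xu /= mem_cat negb_or => /(_ isT).
  move: uXY; rewrite !cat_uniq => /and3P[-> /hasPn Hn ->]; rewrite uu /= andbT has_cat negb_or.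
  apply/andP; split; last by apply/hasPn => x xY; apply/negP => /Hu; rewrite xY andbF.
  by apply/andP; split; apply/hasPn => x; [move/Hu => /andP[]|move/Hn].
suff : forall j, j <= size w -> exists u st', [/\ size u = j, stocked st', lpath k d okP (ctx X ++ fill w u ++ ctx Y),
   perm_eq (pools st) (u ++ pools st') & forall c, size (st c).1 = count (pred1 c) (take j w) + size (st' c).1].
  by move/(_ _ (leqnn _)); rewrite take_size.
elim=> [|j IH] Hj.
  exists [::], st; split=> //=; [|by move=> c; rewrite take0].
  by apply: fill_start.
have [u [st' [su Hst' HL HP Hs]]] := IH (ltnW Hj).
have Hu : size u < size w by rewrite su.
have [P1 [P2 [_ E1 E2]]] := fill_rcons Hu; set c := nth false w (size u) in E1 E2.
have [bad [cbad Hbad]] : exists bad : {set T}, Nb * #|bad| <= k * (k.+1 * n) /\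
    forall v, v \in colour BB AA c -> v \notin bad -> lpath k d okP ((ctx X ++ P1) ++ (c, Some v) :: (P2 ++ ctx Y)).
  by apply: step_fill => //; move: HL; rewrite E1 -!catA cat_cons.
have cb : #|bad| <= b by rewrite -(leq_pmul2l Nb0); apply: leq_trans cbad bn.
have Hpos : 0 < size (st' c).1.
  have := Hs c; have := Hc c; rewrite -{1}(cat_take_drop j w) count_cat.
  have : 0 < count (pred1 c) (drop j w).
    by rewrite (drop_nth false) -?su //= /c eqxx.
  move: (size (st' c).1) (size (st c).1); clear; lia.
have [v [stc [H1 H2 H3 H4 H5]]] := draw hb (Hst' c) Hpos cb.
pose st2 c' := if c' == c then stc else st' c'.
exists (rcons u v), st2; split.
- by rewrite size_rcons su.
- by move=> c'; rewrite /st2; case: eqP => [->|_].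
- by rewrite E2 -!catA cat_cons; have := Hbad v H2 H3; rewrite -catA.
- apply: perm_trans HP _; rewrite cat_rcons perm_cat2l /pools /st2.
  move: H4; rewrite -/c; case: (c) => /= H4.
    by rewrite -cat_cons perm_cat2r.
  by rewrite -cat1s perm_sym perm_catCA /= perm_cat2l perm_sym.
- move=> c'; rewrite Hs (take_nth false) // -cats1 count_cat /= addn0 -su -/c /st2 eq_sym.
  by case: eqP => [->|_]; rewrite ?H5 ?addn0 // -addnA add1n.
Qed.

Lemma link_all ps bss X st : size X = l -> OB [set x in X] -> uniq X -> size bss = size ps ->
  (forall bs, bs \in bss -> 1 < size bs) ->
  (forall p, p \in ps -> pth k d PP p /\ OB [set x in start k d p] /\ OB [set x in finish k d p]) ->
  uniq (X ++ flatten ps) ->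
  stocked st -> (forall c, count (pred1 c) (flatten (map (word k d) bss)) <= size (st c).1) -> uniq (pools st) ->
  all [predC X] (pools st) -> (forall p, p \in ps -> all [predC start k d p] (pools st) /\ all [predC finish k d p] (pools st)) ->
  exists zs st', [/\ linked k d PP X zs ps, stocked st', perm_eq (pools st) (flatten zs ++ pools st') &
    forall c, size (st c).1 = count (pred1 c) (flatten (map (word k d) bss)) + size (st' c).1].
Proof.
elim: ps bss X st => [|p ps IH] [|bs bss] X st sX oX uX //= sb Hb Hp uXp Hst Hc uP aX ap.
  by exists [::], st; split.
case: sb => sb; have [Pp [oS oF]] := Hp p (mem_head _ _).
have b2 : 1 < size bs by apply: Hb; rewrite mem_head.
have nb : bs != [::] by case: (bs) b2.
have kt : k < t by rewrite mulSn [X in X < _](divn_eq k d) addnC ltn_add2r ltn_mod.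
have ct : t <= d * t by rewrite leq_pmull.
have sw : k.-1 <= size (word k d bs).
  have := size_word d0 dk ndk nb; have : count id bs <= size bs by apply: count_size.
  have dt : d <= t by rewrite leq_pmull.
  move: (leq_mul dt (leqnn (count id bs))) (leq_mul (leqnn t) b2); rewrite mulnDr.
  by move: kt; move: (size (word k d bs)) (count id bs) (size bs) => x c s; move: ((k %/ d).+1 * d) => tt; clear; lia.
have [||||u [st1 [su Hst1 Lu Pu Su]]] := @fill_word X (word k d bs) (start k d p) st sX (size_start Pp) sw (lpath_word d0 dk ndk nb) oX oS Hst.
- by move=> c; apply: leq_trans (Hc c); rewrite count_cat leq_addr.
- have : uniq (X ++ p) by have := uXp; rewrite catA [X in is_true X -> _]cat_uniq => /andP[].
  rewrite cat_uniq => /and3P[_ /hasPn Hn up]; rewrite cat_uniq uX take_uniq //= andbT.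
  by apply/hasPn => x /mem_take; apply: Hn.
- exact: uP.
- have [aS _] := ap p (mem_head _ _); apply/allP => x xP; rewrite /= mem_cat negb_or; apply/andP; split; [exact: (allP aX)|exact: (allP aS)].
have sub1 : {subset pools st1 <= pools st} by move=> x Hx; rewrite (perm_mem Pu) mem_cat Hx orbT.
have [||||||||||||zs [st' [Lz Hst' Pz Sz]]] := IH bss (finish k d p) st1.
- exact: size_finish Pp.
- exact: oF.
- by apply: drop_uniq; move: uXp; rewrite !cat_uniq => /and3P[_ _ /and3P[]].
- exact: sb.
- by move=> bs' Hbs'; apply: Hb; rewrite inE Hbs' orbT.
- by move=> p' Hp'; apply: Hp; rewrite inE Hp' orbT.
- have uf : uniq (p ++ flatten ps) by have := uXp; rewrite [X in is_true X -> _]cat_uniq => /and3P[].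
  have := uf; rewrite [X in is_true X -> _]cat_uniq => /and3P[up /hasPn Hn u2]; rewrite cat_uniq u2 drop_uniq // andbT /=.
  by apply/hasPn => x /Hn; apply: contra => /mem_drop.
- exact: Hst1.
- by move=> c; have := Hc c; rewrite Su count_cat leq_add2l.
- by move: uP; rewrite (perm_uniq Pu) cat_uniq => /and3P[].
- have [_ aF] := ap p (mem_head _ _); by apply/allP => x /sub1; apply: (allP aF).
- move=> p' Hp'; have [a1 a2] := ap p' (mem_behead (s := p :: ps) Hp').
  by split; apply/allP => x /sub1; [apply: (allP a1)|apply: (allP a2)].
exists (u :: zs), st'; split=> //=.
- by split=> //; rewrite su; apply: dvdn_word.
- by apply: perm_trans Pu _; rewrite -catA perm_cat2l.
- by move=> c; rewrite Su Sz count_cat addnA.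
Qed.

End Connect.

(** * Blocks with an exchangeable vertex *)

Definition substitute (A : Type) i (e : A) s := take i s ++ e :: drop i.+1 s.

Lemma size_subst (A : Type) i (e : A) s : i < size s -> size (substitute i e s) = size s.
Proof. by move=> H; rewrite size_cat /= size_takel 1?ltnW // size_drop; lia. Qed.

Lemma map_subst (A B : Type) (f : A -> B) i e s : map f (substitute i e s) = substitute i (f e) (map f s).
Proof. by rewrite /substitute map_cat /= map_take map_drop. Qed.

Lemma subst_at (A : Type) (e h : A) P1 P2 : substitute (size P1) e (P1 ++ h :: P2) = P1 ++ e :: P2.
Proof. by rewrite /substitute take_size_cat //; congr (_ ++ _ :: _); rewrite -cat_rcons drop_size_cat // size_rcons. Qed.

Lemma subst_off (A : Type) i (e : A) P1 P2 : i != size P1 -> exists Q1 Q2, forall h, substitute i e (P1 ++ h :: P2) = Q1 ++ h :: Q2.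
Proof.
move=> ne; case: (ltnP i (size P1)) => Hi.
  exists (take i P1 ++ e :: drop i.+1 P1), P2 => h; rewrite /substitute takel_cat 1?ltnW // -catA /=; congr (_ ++ _ :: _).
  rewrite drop_cat; case: ltnP => // Hx; have Ex : i.+1 = size P1 by lia.
  by rewrite Ex subnn drop_size.
have {ne}Hi : size P1 < i by rewrite ltn_neqAle eq_sym ne Hi.
exists P1, (take (i - (size P1).+1) P2 ++ e :: drop (i - size P1) P2) => h.
rewrite /substitute take_cat ltnNge (ltnW Hi) /= drop_cat ltnNge (leq_trans (ltnW Hi)) //= -catA; congr (_ ++ _).
by rewrite subnS subSn ?(ltnW Hi) //=; have : 0 < i - size P1 by [rewrite subn_gt0]; case: (i - size P1).
Qed.

Lemma zip_rcons_short (A : Type) w (u : seq A) v : size u < size w ->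
  zip w (rcons u v) = rcons (zip w u) (nth false w (size u), v).
Proof. by elim: w u => // c w IH [|x u] /= Hu; [case: (w)|rewrite IH]. Qed.

Section Blocks.
Variables (T : finType) (E : {set {set T}}) (k d : nat) (BB AA : {set T}) (OB : pred {set T}) (OA : T -> pred {set T}) (Nb : nat).
Local Notation n := #|T|.
Local Notation l := (k - d).
Local Notation q := (k %/ d).
Hypotheses (d1 : 1 < d) (dk : d < k) (ndk : ~~ (d %| k)) (Nb0 : 0 < Nb).
Hypothesis OB_sub : forall X Y : {set T}, Y \subset X -> OB X -> OB Y.
Hypothesis OA_OB : forall a X, OA a X -> OB X.
Hypothesis extB : forall X, OB X -> #|X| < k.-1 -> Nb * #|[set v in BB | (v \notin X) && ~~ OB (v |: X)]| <= n.
Hypothesis extBA : forall a X, OA a X -> #|X| < k.-1 -> Nb * #|[set v in BB | (v \notin X) && ~~ OA a (v |: X)]| <= n.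
Hypothesis extA : forall X, OB X -> #|X| < k -> Nb * #|[set a in AA | ~~ OA a X]| <= n.
Hypothesis fullA : forall a X, OA a X -> #|X| = k.-1 -> a |: X \in E.
Hypothesis OB0 : OB set0.
Hypothesis OB1 : forall b, b \in BB -> OB [set b].
Hypothesis OA0 : forall a, a \in AA -> OA a set0.
Local Notation okP := (fun s => okw OB OA s : Prop).
Local Notation col := (colour BB AA).
Let d0 : 0 < d. Proof. exact: ltnW. Qed.

(** Every one of its windows contains position [q * d]. The length [q * d + k] equals [t + l], so a
    block fits the balance of one A-vertex for [t] vertices; the exchangeable places [ci c], one per
    colour, lie outside both ends of length [l]. *)
Definition blockword := nseq (q * d) false ++ true :: nseq k.-1 false.
Definition ci (c : bool) := if c then q * d else (q * d).+1.
Definition fits c z (s : seq T) := lpathb k d (edg E) (substitute (ci c) z s).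
Definition good_block s := [&& uniq s, lpathb k d (edg E) s, OB [set x in start k d s], OB [set x in finish k d s] &
  all (fun e => e.2 \in col e.1) (zip blockword s)].
Local Notation M := (q * d + k).

Let k1 : 1 < k. Proof. exact: ltn_trans dk. Qed.
Let Ek : k = q * d + k %% d. Proof. exact: divn_eq. Qed.
Let rd : k %% d < d. Proof. by rewrite ltn_mod. Qed.
Let r0 : 0 < k %% d. Proof. by rewrite lt0n. Qed.

Lemma size_blockword : size blockword = M.
Proof. by rewrite size_cat /= !size_nseq prednK // ltnW. Qed.

Lemma nth_blockword c : nth false blockword (ci c) = c.
Proof.
rewrite nth_cat size_nseq; case: c; rewrite /ci ?ltnn ?subnn // ltnNge leqnSn /= subSnn /= nth_nseq.
by rewrite if_same.
Qed.

Lemma ci_lt c : ci c < M.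
Proof. by case: c; rewrite /ci; move: (q * d) k1 => x; clear; lia. Qed.

Lemma lpath_blockword : lpath k d one_true blockword.
Proof.
move=> i; rewrite size_blockword => Hi; rewrite /one_true count_window //.
  by move: Hi; clear; lia.
by move: r0 Ek; clear; lia.
Qed.

Lemma okw_start c z : z \in col c -> lpath k d okP (substitute (ci c) (c, Some z) (fill blockword [::])).
Proof.
move=> zc i Hi; set s := take k _.
have Ef : map fst (substitute (ci c) (c, Some z) (fill blockword [::])) = blockword.
  rewrite map_subst fill_nil -map_comp map_id /= /substitute -{2}(nth_blockword c) -drop_nth ?size_blockword ?ci_lt //.
  exact: cat_take_drop.
have c1 : count fst s == 1.
  have := lpath_blockword (i := i); rewrite -Ef size_map => /(_ Hi); by rewrite /one_true -map_drop -map_take count_map.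
have Hs c' x : (c', Some x) \in s -> c' = c /\ x = z.
  move/mem_take/mem_drop; rewrite /substitute mem_cat inE fill_nil => /or3P[/mem_take/mapP[]//|/eqP[-> ->]//|/mem_drop/mapP[]//].
rewrite /okw c1; case Ec : c zc Hs => zc Hs /=.
  have -> : contB s = set0 by apply/setP => x; rewrite !inE; apply/negP => /Hs[].
  by rewrite OB0; apply/forall_inP => a; rewrite inE => /Hs[_ ->]; apply: OA0.
have -> : contA s = set0 by apply/setP => x; rewrite !inE; apply/negP => /Hs[].
rewrite (_ : OB (contB s)); last by apply: OB_sub (OB1 zc); apply/subsetP => x; rewrite !inE => /Hs[_ ->].
by apply/forall_inP => a; rewrite inE.
Qed.

Lemma okw_start0 : lpath k d okP (fill blockword [::]).
Proof.
move=> i Hi; set s := take k _.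
have Ef : map fst (fill blockword ([::] : seq T)) = blockword by rewrite fill_nil -map_comp map_id.
have c1 : count fst s == 1.
  have := lpath_blockword (i := i); rewrite -Ef size_map => /(_ Hi); by rewrite /one_true -map_drop -map_take count_map.
have Hs c' x : (c', Some x) \in s -> False.
  by move/mem_take/mem_drop; rewrite fill_nil => /mapP[].
rewrite /okw c1 (_ : contB s = set0) ?OB0 /=; last by apply/setP => x; rewrite !inE; apply/negP => /Hs.
by apply/forall_inP => a; rewrite inE => /Hs.
Qed.

Lemma zip_subst w (u : seq T) i c z : size u = size w -> i < size w -> nth false w i = c ->
  substitute i (c, z) (zip w u) = zip w (substitute i z u).
Proof.
elim: w u i => // c' w IH [|x u] // [|i] //= [su] Hi Hc.
  by rewrite /substitute /= !drop0 Hc.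
by have := IH u i su Hi Hc; rewrite /substitute /= => ->.
Qed.

Lemma block_dense c z c0 b : z \in col c -> (forall c', n <= c0 * #|col c'|) -> k * (k.+1 * n) <= Nb * b ->
  2 * c0 * (2 * b + M + 1) <= n -> dense ((2 * c0) ^ M) M (fun s => good_block s && fits c z s).
Proof.
move=> zc Hc0 Hb Hn.
(* The block and its variant with [z] already placed at [ci c] are filled simultaneously; each of
   the two excludes at most [b] vertices at every step. *)
pose Inv u := [&& uniq u, z \notin u, all (fun e => e.2 \in col e.1) (zip blockword u), lpathb k d (okw OB OA) (fill blockword u) &
   lpathb k d (okw OB OA) (substitute (ci c) (c, Some z) (fill blockword u))].
have D : dense ((2 * c0) ^ M) M Inv.
  apply: dense_seq; first by apply/and5P; split=> //; [by case: (blockword)|exact/(lpathP _ d0)/okw_start0|exact/(lpathP _ d0)/okw_start].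
  move=> u su /and5P[uu zu au /(lpathP _ d0) L1 /(lpathP _ d0) L2].
  have su' : size u < size blockword by rewrite size_blockword.
  have [P1 [P2 [sP E1 E2]]] := fill_rcons su'; set cj := nth false blockword (size u) in E1 E2.
  have [bad1 [cb1 Hb1]] : exists bad : {set T}, Nb * #|bad| <= k * (k.+1 * n) /\
      forall v, v \in col cj -> v \notin bad -> lpath k d okP (fill blockword (rcons u v)).
    rewrite E1 in L1; have [bad [cb HH]] := step_fill d0 dk extB extBA extA L1.
    by exists bad; split=> // v v1 v2; rewrite E2; apply: HH.
  have [bad2 [cb2 Hb2]] : exists bad : {set T}, Nb * #|bad| <= k * (k.+1 * n) /\
      forall v, v \in col cj -> v \notin bad -> lpath k d okP (substitute (ci c) (c, Some z) (fill blockword (rcons u v))).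
    case: (eqVneq (ci c) (size P1)) => Hci.
      exists set0; rewrite cards0 muln0; split=> // v _ _; rewrite E2; move: L2; by rewrite E1 Hci !subst_at.
    have [Q1 [Q2 EQ]] := @subst_off _ (ci c) (c, Some z) P1 P2 Hci.
    rewrite E1 EQ in L2; have [bad [cb HH]] := step_fill d0 dk extB extBA extA L2.
    by exists bad; split=> // v v1 v2; rewrite E2 EQ; apply: HH.
  have b1 : #|bad1| <= b by rewrite -(leq_pmul2l Nb0); apply: leq_trans cb1 Hb.
  have b2 : #|bad2| <= b by rewrite -(leq_pmul2l Nb0); apply: leq_trans cb2 Hb.
  pose F := z :: u ++ enum bad1 ++ enum bad2.
  have sF : size F <= 2 * b + M + 1.
    rewrite /= !size_cat -!cardE; move: su b1 b2; move: (q * d) => x; clear; lia.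
  have HF : 2 * c0 * size F <= n by apply: leq_trans Hn; rewrite leq_mul2l sF orbT.
  apply: leq_trans (card_avoid (P := mem (col cj)) _ HF) _; first exact: Hc0.
  rewrite leq_mul2l; apply/orP; right; apply: subset_leq_card; apply/subsetP => v; rewrite !inE !mem_cat !mem_enum !negb_or.
  move=> /andP[vc /and4P[vz vu v1 v2]]; apply/and5P; split.
  + by rewrite rcons_uniq vu.
  + by rewrite mem_rcons inE negb_or eq_sym vz.
  + rewrite zip_rcons_short // -/cj.
    by rewrite all_rcons /= au andbT.
  + exact/(lpathP _ d0)/Hb1.
  + exact/(lpathP _ d0)/Hb2.
apply: denseW D (leqnn _) _ => s ss; case: (boolP (Inv s)) => //= /and5P[us zs cs /(lpathP _ d0) L1 /(lpathP _ d0) L2].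
have sb : size s = size blockword by rewrite size_blockword.
have u2 : unzip2 (zip blockword s) = s by rewrite unzip2_zip // sb.
rewrite fill_full // in L1 L2; rewrite lt0b.
have qd : l <= q * d by rewrite leq_subLR {1}Ek addnC leq_add2r ltnW.
have win i : i * d + k <= M -> OB (contB (take k (drop (i * d) (map (fun e => (e.1, Some e.2)) (zip blockword s))))).
  move=> Hi; have := L1 i; rewrite size_map size_zip sb minnn size_blockword => /(_ Hi) /and3P[_ ? _] //.
have memB i x p : p < M -> i * d <= p -> p < i * d + k -> nth false blockword p = false -> nth x s p \in contB (take k (drop (i * d) (map (fun e => (e.1, Some e.2)) (zip blockword s)))).
  move=> pM ip pi pf; rewrite inE -pf.
  have -> : (nth false blockword p, Some (nth x s p)) = nth (false, None) (take k (drop (i * d) (map (fun e => (e.1, Some e.2)) (zip blockword s)))) (p - i * d).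
    rewrite nth_take; last by move: ip pi; clear; lia.
    rewrite nth_drop subnKC // (nth_map (false, x)); last by rewrite size_zip sb minnn size_blockword.
    by rewrite nth_zip.
  apply: mem_nth; rewrite size_take_min size_drop size_map size_zip sb minnn size_blockword; move: pM ip pi; clear; lia.
apply/andP; split; first (apply/and5P; split=> //).
- by apply/(lpathP _ d0); rewrite -u2; apply: (full_edges fullA) L1; rewrite u2.
- apply: OB_sub (win 0 _); last by rewrite mul0n leq_addl.
  apply/subsetP => x; rewrite inE /start => /(nthP x)[p]; rewrite size_takel ?ss; last by move: qd; clear; lia.
  move=> pl <-; rewrite nth_take //; apply: memB; rewrite ?mul0n //; try (by move: pl qd; clear; lia).
  by rewrite nth_cat size_nseq (leq_trans pl qd) nth_nseq if_same.
- apply: OB_sub (win q (leqnn _)).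
  apply/subsetP => x; rewrite inE /finish => /(nthP x)[p]; rewrite size_drop ss subKn; last by move: qd; clear; lia.
  move=> pl <-; rewrite nth_drop; apply: memB; try (by move: pl qd d1 dk; clear; lia).
  rewrite nth_cat size_nseq ltnNge (_ : q * d <= _) /=; last by move: pl qd d1 dk; clear; lia.
  have : 0 < M - l + p - q * d by move: pl qd d1 dk; clear; lia.
  by case: (M - l + p - q * d) => // j _ /=; rewrite nth_nseq if_same.
- apply/(lpathP _ d0).
  have -> : substitute (ci c) z s = unzip2 (zip blockword (substitute (ci c) z s)).
    by rewrite unzip2_zip // size_subst ?ss ?ci_lt // size_blockword.
  apply: (full_edges fullA).
    rewrite unzip2_zip; last by rewrite size_subst ?ss ?ci_lt // size_blockword.
    have Hs : uniq (z :: s) by rewrite /= zs us.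
    apply: (@subseq_uniq _ _ (take (ci c) s ++ z :: drop (ci c) s)); last first.
      by rewrite -cat1s uniq_catCA /= cat_take_drop.
    apply: cat_subseq => //=; rewrite eqxx -addn1 addnC -drop_drop; exact: drop_subseq.
  rewrite -(zip_subst (c := c)) ?sb ?size_blockword ?ci_lt ?nth_blockword // map_subst; exact: L2.
Qed.

End Blocks.

(** * Exceptional vertices and edges *)

Lemma tsum_mask (T : finType) (b : seq bool) (f : seq T -> nat) :
  tsum (size b) (fun s => f (mask b s)) = #|T| ^ (size b - count id b) * tsum (count id b) f.
Proof.
elim: b f => [|c b IH] f; first by rewrite mul1n.
rewrite [size _]/= [LHS]/=; case: c => /=.
  by rewrite add1n subSS big_distrr; apply: eq_bigr => v _; rewrite (IH (fun s => f (v :: s))).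
rewrite add0n subSn ?count_size // expnS -mulnA -IH -sum_nat_const; exact: eq_bigr.
Qed.

Section Tuples.
Variables (T : finType) (E : {set {set T}}) (k : nat) (BB : {set T}) (N0 : nat).
Local Notation n := #|T|.
Hypotheses (kE : kgraph k E) (k1 : 1 < k) (n0 : 0 < n) (N00 : 0 < N0).
Local Notation NB := (N0 * (2 ^ k.+1) ^ k).
Let NB0 : 0 < NB. Proof. by rewrite muln_gt0 N00 !expn_gt0. Qed.

Lemma rich_tuples j : j <= k ->
  tsum j (fun s => all (mem BB) s && rich E k BB N0 (k - j) [set x in s]) * n ^ (k - j) <= NB ^ k * edges_in E k BB.
Proof.
move=> jk; rewrite -tsum_mulr.
apply: (@leq_trans (tsum j (fun s => NB ^ k * tsum (k - j) (fun s' => all (mem BB) (s ++ s') && edg E (s ++ s'))))).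
  apply: leq_tsum => s _; case: (boolP (all (mem BB) s)) => //= aB; case: (boolP (rich _ _ _ _ _ _)) => // Hr.
  rewrite mul1n; apply: leq_trans (rich_dense (leq_subr _ _) Hr) _; apply: leq_mul; first by rewrite leq_pexp2l // leq_subr.
  apply: leq_tsum => s' _; rewrite all_cat aB /= /edg.
  by rewrite (_ : [set x in s ++ s'] = [set x in s'] :|: [set x in s]) //; apply/setP => x; rewrite !inE mem_cat orbC.
rewrite tsum_mull leq_mul2l /edges_in; have := tsum_cat j (k - j) (fun s => (all (mem BB) s && edg E s : nat)).
by rewrite subnKC // => ->; rewrite leqnn orbT.
Qed.

(** An atypical tuple has a rich subset, whose positions are recorded by a mask. Rich tuples are
    rare, since each extends to many of the few edges inside [BB]. *)
Lemma notOKB_tuples m N5 : m <= k -> N5 * edges_in E k BB <= n ^ k ->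
  N5 * tsum m (fun s => [&& all (mem BB) s, uniq s & ~~ OKB E k BB N0 [set x in s]]) <= 2 ^ m * NB ^ k * n ^ m.
Proof.
move=> mk HN.
pose F (b : m.-tuple bool) (s : seq T) := all (mem BB) s && rich E k BB N0 (k - count id b) [set x in s].
have H1 : tsum m (fun s => [&& all (mem BB) s, uniq s & ~~ OKB E k BB N0 [set x in s]]) <= \sum_(b : m.-tuple bool) tsum m (fun s => F b (mask b s)).
  rewrite -(tsum_sum _ predT (fun b s => F b (mask (tval b) s) : nat)); apply: leq_tsum => s ss.
  case: (boolP (all _ s)) => //= aB; case: (boolP (uniq s)) => //= us; case: (boolP (OKB _ _ _ _ _)) => //=.
  case/forallPn => Y; rewrite negb_imply negbK => /andP[YS rY].
  pose b := map_tuple (fun x => x \in Y) (tcast ss (in_tuple s)).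
  have Hb : mask b s = filter (mem Y) s by rewrite filter_mask; congr mask; rewrite /= val_tcast.
  have EY : [set x in filter (mem Y) s] = Y.
    apply/setP => x; rewrite inE mem_filter /=; case: (boolP (x \in Y)) => //= xY.
    by have := subsetP YS x xY; rewrite inE.
  have cY : count id b = #|Y|.
    rewrite -EY cardsE (card_uniqP _) ?filter_uniq // size_filter /= val_tcast count_map; exact: eq_count.
  rewrite (bigD1 b) //= /F Hb EY cY rY andbT (_ : all _ (filter _ _)) ?leq_addr //.
  by apply/allP => x; rewrite mem_filter => /andP[_ xs]; apply: (allP aB).
have H2 (b : m.-tuple bool) : N5 * tsum m (fun s => F b (mask b s)) <= NB ^ k * n ^ m.
  have := tsum_mask b (fun s => F b s : nat); rewrite size_tuple => ->.
  have cm : count id b <= m by rewrite -[X in _ <= X](size_tuple b) count_size.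
  have ck := leq_trans cm mk; have H := rich_tuples ck.
  have pn : 0 < n ^ (k - count id b) by rewrite expn_gt0 n0.
  have H3 : N5 * tsum (count id b) (F b) <= NB ^ k * n ^ count id b.
    rewrite -(leq_pmul2r pn) -mulnA -(mulnA (NB ^ k)) -expnD subnKC //.
    apply: leq_trans (leq_mul (leqnn N5) H) _; rewrite mulnCA leq_mul2l HN orbT //.
  rewrite -[in X in _ <= X](subnKC cm) expnD mulnCA; move: (leq_mul (leqnn (n ^ (m - count id b))) H3); move: (n ^ _) (n ^ _) => x y; clear; lia.
apply: leq_trans (leq_mul (leqnn N5) H1) _; rewrite big_distrr /=.
apply: (@leq_trans (\sum_(b : m.-tuple bool) NB ^ k * n ^ m)); first by apply: leq_sum => b _; apply: H2.
by rewrite sum_nat_const card_tuple card_bool mulnA.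
Qed.

Definition link_ok v s := [&& all (mem BB) s, edg E (v :: s) & OKB E k BB N0 [set x in s]].

Lemma link_dense v N3 N5 : 4 * N3 * (2 ^ k * NB ^ k) <= N5 -> N5 * edges_in E k BB <= n ^ k ->
  n ^ k.-1 <= 2 * N3 * deg_in E k BB v -> dense (4 * N3) k.-1 (link_ok v).
Proof.
move=> HN5 He Hv; have H := notOKB_tuples (leq_pred k) He; rewrite /dense.
set X := tsum _ _ in H; have H1 : deg_in E k BB v <= tsum k.-1 (link_ok v) + X.
  rewrite -tsumD; apply: leq_tsum => s ss; rewrite /link_ok; case: (all _ s) => //=; case: (boolP (edg E (v :: s))) => //= es.
  have : uniq (v :: s) by apply: edg_uniq kE _ es; rewrite /= ss prednK // ltnW.
  by rewrite cons_uniq => /andP[_ ->]; case: OKB.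
have H2 : 4 * N3 * X <= n ^ k.-1.
  have p0 : 0 < 2 ^ k * NB ^ k by rewrite muln_gt0 !expn_gt0 NB0.
  rewrite -(leq_pmul2l p0) mulnA [_ * (4 * N3)]mulnC; apply: leq_trans (leq_mul HN5 (leqnn X)) _; apply: leq_trans H _.
  by rewrite !leq_mul2r leq_exp2l // leq_pred !orbT.
move: Hv (leq_mul (leqnn (2 * N3)) H1) H2; move: (tsum _ _) (deg_in _ _ _ _) => x y; clear; lia.
Qed.

(** By the codegree condition each [(k - 1)]-set in [BB :\: Z] has at least [d * N3c / t] neighbours
    in [BB]. If no edge avoided [Z], all of them would lie in [Z]; but [Z] has at most [k * N3c]
    vertices, whose degrees inside [BB] are too small for that. *)
Lemma edge_avoiding (Z : {set T}) t d N3 N3c : codegree_ge E k t -> 0 < d -> 0 < N3c ->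
  t * #|~: BB| + d * N3c <= n -> #|Z| <= k * N3c -> (forall b, b \in BB -> N3 * deg_in E k BB b <= 2 * n ^ k.-1) ->
  n <= 4 * #|BB :\: Z| -> 4 ^ k * (k * k) <= n -> t * k * 4 ^ k < N3 ->
  exists2 e, e \in E & e \subset BB :\: Z.
Proof.
move=> HE d0 N3c0 Hn cZ Hb HY Hn2 HN3; apply/exists_inP; apply: contraT => /exists_inPn Hno.
set Y := BB :\: Z in HY Hno; set P := n ^ k.-1 in Hb.
pose U := tsum k.-1 (fun s => all (mem Y) s && uniq s).
have k0 : 0 < k := ltnW k1.
have P0 : 0 < P by rewrite expn_gt0 n0.
have H1 : U * (d * N3c) <= t * \sum_(z in BB :&: Z) deg_in E k BB z.
  rewrite /deg_in -(tsum_sum k.-1 (fun z => z \in BB :&: Z) (fun z s => all (mem BB) s && edg E (z :: s) : nat)) -tsum_mull -tsum_mulr.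
  apply: leq_tsum => s ss; case: (boolP (all (mem Y) s)) => //= /allP aY; case: (boolP (uniq s)) => //= us; rewrite mul1n.
  have aB : all (mem BB) s by apply/allP => x /aY; apply: (subsetP (subsetDl BB Z)).
  have := HE s us ss; set D := [pred v | _].
  have cD : #|D| <= #|~: BB| + \sum_(z in BB :&: Z) (all (mem BB) s && edg E (z :: s)).
    rewrite -2!sum1_card [X in _ <= X + _]big_mkcond [X in X <= _]big_mkcond [X in _ <= _ + X]big_mkcond -big_split /=; apply: leq_sum => v _.
    rewrite aB !inE -(@edg_perm _ E (v :: s)); last by rewrite perm_sym perm_rcons.
    case: (boolP (edg E (v :: s))) => //= ev; case: (boolP (v \in BB)) => //= vB; case: (boolP (v \in Z)) => //= vZ.
    have : ~~ ([set x in v :: s] \subset Y) by apply: Hno; exact: ev.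
    by case/negP; apply/subsetP => x; rewrite inE in_cons => /orP[/eqP->|/aY //]; rewrite in_setD vZ vB.
  move=> H2; have := leq_trans H2 (leq_mul (leqnn t) cD); move: Hn; move: (\sum_(_ in _) _) (#|~: BB|) => x y; clear; lia.
have H2 : N3 * \sum_(z in BB :&: Z) deg_in E k BB z <= k * N3c * (2 * P).
  rewrite big_distrr /=; apply: (@leq_trans (\sum_(z in BB :&: Z) 2 * P)).
    by apply: leq_sum => z; rewrite inE => /andP[/Hb].
  by rewrite sum_nat_const leq_mul2r (leq_trans _ cZ) ?orbT // subset_leq_card // subsetIr.
have H3 : N3 * U <= t * k * (2 * P).
  have p0 : 0 < d * N3c by rewrite muln_gt0 d0.
  rewrite -(leq_pmul2r p0); apply: (@leq_trans (t * k * (2 * P) * N3c)); last by rewrite leq_mul2l leq_pmull ?orbT.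
  move: (leq_mul (leqnn N3) H1) (leq_mul (leqnn t) H2); move: (\sum_(_ in _) _) => x; clear; lia.
have H4 : n * #|Y| ^ k.-1 <= n * U + k * k * P.
  have Hu := tsum_nuniq T k.-1.
  have : #|Y| ^ k.-1 <= U + tsum k.-1 (fun s : seq T => ~~ uniq s).
    rewrite -(tsum_all k.-1 (mem Y)) -tsumD; apply: leq_tsum => s _; by case: (all _ s); case: (uniq s).
  have kk : k.-1 * k.-1 <= k * k by rewrite leq_mul ?leq_pred.
  move: Hu (leq_mul kk (leqnn P)); rewrite -/P => Hu Hk H; have := leq_mul (leqnn n) H; move: Hu Hk; move: (tsum _ _) => x; clear; lia.
have H5 : P <= 4 ^ k.-1 * #|Y| ^ k.-1 by rewrite -expnMn /P leq_exp2r // -ltnS prednK.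
have H6 : P <= 2 * 4 ^ k.-1 * U.
  rewrite -(leq_pmul2l n0).
  have E4 : 4 ^ k = 4 * 4 ^ k.-1 by rewrite -expnS prednK.
  have := leq_mul (leqnn n) H5; have := leq_mul (leqnn (4 ^ k.-1)) H4; have := leq_mul Hn2 (leqnn P); rewrite E4.
  move: (4 ^ k.-1) (k * k) (#|Y| ^ _) => x kk y; clear; lia.
have H7 : N3 * P <= t * k * 4 ^ k * P.
  have E4 : 4 ^ k = 4 * 4 ^ k.-1 by rewrite -expnS prednK.
  have := leq_mul (leqnn N3) H6; have := leq_mul (leqnn (2 * 4 ^ k.-1)) H3; rewrite E4; move: (4 ^ k.-1) => x; clear; lia.
by move: H7; rewrite leq_mul2r leqNgt HN3 orbF => /eqP HP; rewrite HP in P0.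
Qed.

End Tuples.

Lemma dropl_cat (A : Type) x (a b : seq A) : x <= size a -> drop x (a ++ b) = drop x a ++ b.
Proof.
move=> H; rewrite drop_cat; case: ltnP => // H2; have -> : x = size a by lia.
by rewrite subnn drop0 drop_size.
Qed.

Section VertexPiece.
Variables (k d : nat).
Hypotheses (d1 : 1 < d) (dk : d < k) (ndk : ~~ (d %| k)).
Local Notation q := (k %/ d).
Local Notation M := (q * d + k).
Local Notation N := (k.-1).
Local Notation l := (k - d).
Let d0 : 0 < d. Proof. exact: ltnW. Qed.
Let N0 : 0 < N. Proof. by rewrite -ltnS prednK; [exact: ltn_trans dk|exact: leq_ltn_trans dk]. Qed.
Let qk : q * d < k. Proof. by rewrite {2}(divn_eq k d) -[X in X < _]addn0 ltn_add2l lt0n. Qed.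
Let lq : l <= q * d. Proof. by rewrite leq_subLR {1}(divn_eq k d) addnC leq_add2r ltnW // ltn_mod. Qed.

(** The vertex [v] stands at position [q * d] and so belongs to every window; around it the [k - 1]
    variables of a link tuple recur cyclically, each time with a new copy. Like a block, the piece
    has one vertex outside [BB] when [v] is exceptional, and [t + l] vertices. *)
Lemma vertex_piece (T : finType) (E : {set {set T}}) (v : T) (OB : pred {set T}) (BB : {set T}) (s : seq T) :
  (forall X Y : {set T}, Y \subset X -> OB X -> OB Y) ->
  blown M N (fun u => [&& all (mem BB) u, edg E (v :: u) & OB [set x in u]]) s -> size s = N * M -> uniq s -> v \notin s ->
  exists p, [/\ [/\ size p = M, uniq p & lpath k d (fun u => edg E u : Prop) p], OB [set x in start k d p], OB [set x in finish k d p],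
    v \in p & forall x, x \in p -> x != v -> x \in BB /\ x \in s].
Proof.
move=> OBs Hbl ss us vs.
set P := (fun u => _) in Hbl.
pose F p' := nth v s (p' %% N * M + p').
have Pperm u u' : perm_eq u u' -> P u -> P u'.
  move=> Hp; rewrite /P (perm_all _ Hp) (@edg_perm _ E (v :: u) (v :: u')) ?perm_cons // (_ : [set x in u] = [set x in u']) //.
  by apply/setP => x; rewrite !inE (perm_mem Hp).
have win x : x <= q * d -> P (map F (iota x N)).
  move=> xq; pose c i := x + (i + (N - x %% N)) %% N.
  have cM i : c i < M by rewrite /c; have : (i + (N - x %% N)) %% N < N by [rewrite ltn_mod]; move: xq; move: ((i + _) %% N) (q * d) => a b; clear; lia.
  apply: Pperm (blown_choice v Hbl ss cM).
  rewrite /mkseq; apply: (perm_trans (perm_map _ (_ : perm_eq (iota 0 N) (map (modn^~ N) (iota x N))))).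
    by rewrite perm_sym perm_iota_modn.
  rewrite -map_comp; apply/permP => a; congr count; apply/eq_in_map => p'; rewrite mem_iota => /andP[xp px] /=.
  rewrite /F; congr (nth v s (_ + _)); rewrite /c modnDml.
  have -> : p' + (N - x %% N) = (p' - x) + (x %/ N).+1 * N.
    by have := divn_eq x N; have : x %% N < N by [rewrite ltn_mod]; rewrite mulSn; move: (x %/ N * N) (x %% N) xp => y z; clear; lia.
  rewrite [_ - x + _]addnC modnMDl modn_small; first by rewrite subnKC.
  by move: px xp; clear; lia.
have FM p' : p' < M.-1 -> p' %% N * M + p' < size s.
  move=> Hp; rewrite ss; have H : p' %% N < N by rewrite ltn_mod.
  apply: (@leq_trans ((p' %% N).+1 * M)); last by rewrite leq_mul2r H orbT.
  by rewrite mulSn addnC ltn_add2r; move: Hp; move: (q * d) => a; clear; lia.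
pose pl := map F (iota 0 M.-1).
have upl : uniq pl.
  rewrite map_inj_in_uniq ?iota_uniq // => i j; rewrite !mem_iota /= => Hi Hj /eqP.
  rewrite nth_uniq ?FM // => /eqP H.
  have Hi' : i < M by move: Hi; clear; lia.
  have Hj' : j < M by move: Hj; clear; lia.
  by have := congr1 (modn^~ M) H; rewrite /= !modnMDl !modn_small.
have spl : size pl = M.-1 by rewrite size_map size_iota.
have pls x : x \in pl -> x \in s by case/mapP => i; rewrite mem_iota /= => Hi ->; apply/mem_nth/FM; rewrite add0n in Hi.
have qM : q * d <= M.-1 by move: N0; move: (q * d) => a; clear; lia.
pose a := take (q * d) pl; pose b := drop (q * d) pl.
have sa : size a = q * d by rewrite size_takel // spl.
have sb : size b = N by rewrite size_drop spl; move: (q * d) => x; clear; lia.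
have Eab x : x <= q * d -> drop x a ++ take (N - (q * d - x)) b = map F (iota x N).
  move=> xq; have -> : drop x a ++ take (N - (q * d - x)) b = take N (drop x pl).
    rewrite -(cat_take_drop (q * d) pl) dropl_cat -/a -/b ?sa // take_cat size_drop sa.
    by case: ltnP => // Hx; move: Hx qk xq; clear; lia.
  rewrite /pl -map_drop -map_take drop_iota take_iota; congr (map F (iota _ _)).
  by move: xq qM; move: (q * d) => y; clear; lia.
have ub : uniq (a ++ b) by rewrite cat_take_drop.
have sM : size (a ++ v :: b) = M by rewrite size_cat /= sa sb; move: N0; move: (q * d) => x; clear; lia.
have W0 := win 0 (leq0n _); have Wq := win (q * d) (leqnn _).
have ina x : x \in a -> x \in map F (iota 0 N).
  rewrite -Eab // drop0 mem_cat => ->; by [].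
have inb x : x \in b -> x \in map F (iota (q * d) N).
  by rewrite -Eab // subnn subn0 drop_oversize ?sa // take_oversize ?sb.
exists (a ++ v :: b); split.
- split=> //.
    rewrite -cat_rcons cat_uniq rcons_uniq; move: ub; rewrite cat_uniq => /and3P[-> /hasPn Hn ->].
    have na : v \notin a by apply: contra vs => /mem_take/pls.
    rewrite na /= ?andbT; apply/hasPn => x xb /=; rewrite mem_rcons inE negb_or; apply/andP; split; last exact: Hn.
    by apply: contraNneq vs => <-; apply: pls; apply: mem_drop xb.
  move=> i; rewrite sM leq_add2r => Hi.
  have := win _ Hi => /and3P[_ eW _]; rewrite dropl_cat ?sa //.
  rewrite take_cat size_drop sa ifF; last by apply/negbTE; rewrite -leqNgt; move: qk Hi; clear; lia.
  have -> : k - (q * d - i * d) = (N - (q * d - i * d)).+1 by move: qk Hi; clear; lia.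
  rewrite /= -(@edg_perm _ E (v :: map F (iota (i * d) N))) // -Eab //.
  by rewrite -cat1s perm_catCA.
- apply: OBs (proj2 (andP (proj2 (andP W0)))); apply/subsetP => x; rewrite !inE /start takel_cat ?sa //.
  by move/mem_take/ina.
- apply: OBs (proj2 (andP (proj2 (andP Wq)))); apply/subsetP => x; rewrite !inE /finish sM -cat_rcons drop_catr ?size_rcons ?sa; first by move/mem_drop/inb.
  by move: d1 dk; move: (q * d) => y; clear; lia.
- by rewrite mem_cat mem_head orbT.
- move=> x; rewrite mem_cat inE => Hx xv; have {}Hx : (x \in a) || (x \in b) by case/or3P: Hx => [->|/eqP xe|->]; rewrite ?orbT //; rewrite xe eqxx in xv.
  case/andP: W0 => /allP A0 _; case/andP: Wq => /allP Aq _.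
  by split; [case/orP: Hx => [/ina/A0|/inb/Aq]|apply: pls; case/orP: Hx => [/mem_take|/mem_drop]].
Qed.

End VertexPiece.

(** * The extremal case *)

Lemma flatten_share (T : eqType) (L : seq (seq T)) p p' x : uniq (flatten L) -> p \in L -> p' \in L -> x \in p -> x \in p' -> p = p'.
Proof.
elim: L => // a L IH /=; rewrite cat_uniq => /and3P[_ /hasPn Hn uL]; rewrite !inE => /orP[/eqP->|pL] /orP[/eqP->|pL'] xp xp' //.
- by have xf : x \in flatten L; [apply/flattenP; exists p'|have := Hn x xf; rewrite /= xp].
- by have xf : x \in flatten L; [apply/flattenP; exists p|have := Hn x xf; rewrite /= xp'].
- exact: IH.
Qed.

Section Assemble.
Variables (T : finType) (E : {set {set T}}) (k d : nat) (BB AA V0 : {set T}) (OB : pred {set T}) (OA : T -> pred {set T}) (Nb : nat) (x0 : T).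
Local Notation n := #|T|.
Local Notation l := (k - d).
Local Notation q := (k %/ d).
Local Notation t := ((k %/ d).+1 * d).
Local Notation M := (q * d + k).
Local Notation PP := (fun s : seq T => edg E s : Prop).
Hypotheses (d1 : 1 < d) (dk : d < k) (ndk : ~~ (d %| k)) (Nb0 : 0 < Nb).
Hypothesis OB_sub : forall X Y : {set T}, Y \subset X -> OB X -> OB Y.
Hypothesis OA_OB : forall a X, OA a X -> OB X.
Hypothesis extB : forall X, OB X -> #|X| < k.-1 -> Nb * #|[set v in BB | (v \notin X) && ~~ OB (v |: X)]| <= n.
Hypothesis extBA : forall a X, OA a X -> #|X| < k.-1 -> Nb * #|[set v in BB | (v \notin X) && ~~ OA a (v |: X)]| <= n.
Hypothesis extA : forall X, OB X -> #|X| < k -> Nb * #|[set a in AA | ~~ OA a X]| <= n.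
Hypothesis fullA : forall a X, OA a X -> #|X| = k.-1 -> a |: X \in E.
Local Notation col := (colour BB AA).
Local Notation cidx := (ci k d).
Let d0 : 0 < d. Proof. exact: ltnW. Qed.
Let rd : k %% d < d. Proof. by rewrite ltn_mod. Qed.
Let lq : l <= q * d. Proof. by rewrite leq_subLR {1}(divn_eq k d) addnC leq_add2r ltnW // ltn_mod. Qed.

Variables (L : bool -> seq (seq T)) (pv pe : seq (seq T)) (h b N2 : nat).
Local Notation ps := (L true ++ L false ++ pv ++ pe).
Hypotheses (hb : 2 * b < h) (bn : k * (k.+1 * n) <= Nb * b).
Hypothesis Hpart : ~: BB = AA :|: V0.
Hypotheses (dAV : [disjoint AA & V0]) (AA0 : AA != set0) (BB0 : BB != set0).
Hypothesis Lsize : forall c s, s \in L c -> size s = M.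
Hypothesis Lgood : forall c s, s \in L c -> good_block E k d BB AA OB s.
Hypothesis Lcount : forall c z, z \in col c -> h <= count (fits E k d c z) (L c).
Hypothesis ups : uniq (flatten ps).
Hypothesis pvP : forall p, p \in pv -> [/\ size p = M, lpath k d PP p, OB [set x in start k d p], OB [set x in finish k d p] & all [predC AA] p].
Hypothesis V0sub : forall v, v \in V0 -> v \in flatten pv.
Hypothesis size_pv : size pv = #|V0|.
Hypothesis peP : forall p, p \in pe -> [/\ size p = k, lpath k d PP p, OB [set x in start k d p], OB [set x in finish k d p] & all (mem BB) p].
Hypothesis Hn : n + d * N2 = t * #|~: BB| + d * size pe.
Hypothesis HA : 2 * size ps + 2 * N2 + size (L true) + size (L false) <= #|AA|.

Let center c (s : seq T) := nth x0 s (cidx c).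
Let R c := filter (fun x => x \notin flatten ps) (enum (col c)).
Let st0 : state T := fun c => (R c, map (fun s => (s, None)) (L c)).
Definition replaced c (u : seq T * option T) := if u.2 is Some z then substitute (cidx c) z u.1 else u.1.

Let ci_M c : cidx c < M. Proof. by rewrite ci_lt. Qed.
Let ci_l c : l <= cidx c. Proof. by case: c; rewrite /ci // leqW. Qed.
Let ci_f c : cidx c < M - l. Proof. by case: c; rewrite /ci; move: lq dk d1; move: (q * d) => x; clear; lia. Qed.

Let L_ps c s : s \in L c -> s \in ps.
Proof. by case: c => sL; rewrite !mem_cat sL ?orbT. Qed.
Let mR c x : (x \in R c) = (x \notin flatten ps) && (x \in col c).
Proof. by rewrite mem_filter mem_enum. Qed.
Let us s : s \in ps -> uniq s. Proof. exact: uniq_in_flatten ups. Qed.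

Let center_in c s : s \in L c -> center c s \in s /\ center c s \in col c.
Proof.
move=> sL; have ss := Lsize sL; split; first by rewrite mem_nth // ss ci_M.
have /and5P[_ _ _ _ /allP Hc] := Lgood sL.
have sz : size (blockword k d) = size s by rewrite ss size_blockword.
have := Hc (nth (false, x0) (zip (blockword k d) s) (cidx c)); rewrite nth_zip // nth_blockword; apply.
by rewrite -[X in (X, _)](nth_blockword k d c) -nth_zip // mem_nth // size_zip sz minnn ss ci_M.
Qed.

Let pthps p : p \in ps -> pth k d PP p /\ OB [set x in start k d p] /\ OB [set x in finish k d p].
Proof.
have HM : l <= M /\ d %| M - l.
  split; first exact: leq_trans lq (leq_addr _ _).
  rewrite (_ : M - l = q * d + d); last by move: dk; move: (q * d) => x; clear; lia.
  by rewrite dvdn_addr // dvdn_mull.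
rewrite !mem_cat => /or4P[].
- move=> pL; have /and5P[_ /(lpathP _ d0) L1 o1 o2 _] := Lgood pL.
  by split=> //; rewrite /pth (Lsize pL); case: HM.
- move=> pL; have /and5P[_ /(lpathP _ d0) L1 o1 o2 _] := Lgood pL.
  by split=> //; rewrite /pth (Lsize pL); case: HM.
- by case/pvP => sp Lp o1 o2 _; split=> //; rewrite /pth sp; case: HM.
- by case/peP => sp Lp o1 o2 _; split=> //; rewrite /pth sp leq_subr subKn ?dvdnn // ltnW.
Qed.

Let stock0 : stocked BB AA x0 cidx (fits E k d) L h b st0.
Proof.
move=> c; rewrite /stock /pool /st0 /=.
have Ec : map (current x0 (cidx c)) (map (fun s => (s, None)) (L c)) = map (center c) (L c) by rewrite -map_comp.
split.
- by rewrite -map_comp map_id.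
- by move=> s z /mapP[].
- by move=> z; rewrite mem_filter mem_enum => /andP[_ /Lcount].
- by left; rewrite /swaps count_map; elim: (L c).
rewrite Ec; split; last first.
  by move=> x; rewrite mem_cat mem_filter mem_enum => /orP[/andP[]//|/mapP[s /center_in[_ Hs] ->]].
rewrite cat_uniq filter_uniq ?enum_uniq //=; apply/andP; split.
  apply/hasPn => x /mapP[s sL ->]; rewrite mem_filter negb_and negbK; apply/orP; left.
  by apply/flattenP; exists s; [exact: L_ps sL|have [] := center_in sL].
have Hin : {in L c &, injective (center c)}.
  move=> s s' sL sL' Es; apply: (flatten_share ups (L_ps sL) (L_ps sL') (x := center c s)); first by have [] := center_in sL.
  by rewrite Es; have [] := center_in sL'.
rewrite map_inj_in_uniq //.
have : uniq (flatten (L c)) by move: ups; rewrite !flatten_cat !cat_uniq; case: c {Ec Hin} => /and3P[H1 _] //; case/and3P.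
elim: (L c) (fun s => @Lsize c s) => //= s L' IH Hs; rewrite cat_uniq => /and3P[_ /hasPn Hnn uL].
rewrite IH // ?andbT; last by move=> s' Hs'; apply: Hs; rewrite inE Hs' orbT.
apply/negP => sL; have xs : nth x0 s 0 \in s by rewrite mem_nth // Hs ?mem_head //; move: dk; clear; lia.
by have := Hnn (nth x0 s 0); rewrite xs => /(_ _)/negP; case=> //; apply/flattenP; exists s.
Qed.

Let pools0 x : x \in pools x0 cidx st0 -> (x \notin flatten ps) \/ exists c s, s \in L c /\ x = center c s.
Proof.
have Hp c : x \in pool x0 (cidx c) (st0 c) -> (x \notin flatten ps) \/ exists c s, s \in L c /\ x = center c s.
  rewrite /pool mem_cat mem_filter => /orP[/andP[xp _]|]; first by left.
  by rewrite -map_comp => /mapP[s sL ->]; right; exists c, s.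
by rewrite /pools mem_cat => /orP[] /Hp.
Qed.

Let avoid p : p \in ps -> all [predC start k d p] (pools x0 cidx st0) /\ all [predC finish k d p] (pools x0 cidx st0).
Proof.
move=> pp; split; apply/allP => x /pools0 Hx; apply/negP => xs.
- have xp : x \in p by apply: mem_take xs.
  case: Hx => [/negP|[c [s [sL Ex]]]]; first by apply; apply/flattenP; exists p.
  have [xs' _] := center_in sL; rewrite -Ex in xs'.
  have Eps := flatten_share ups pp (L_ps sL) xp xs'; have {}xs : x \in take l p := xs; move: xs; rewrite Eps Ex /center.
  rewrite -{1}(cat_take_drop l s) nth_cat size_takel ?(Lsize sL) ?ltnNge ?ci_l /=; last exact: leq_trans lq (leq_addr _ _).
  have := us (L_ps sL); rewrite -{1}(cat_take_drop l s) cat_uniq => /and3P[_ /hasPn Hnn _].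
  apply/negP; apply: Hnn; apply: mem_nth; rewrite size_drop (Lsize sL); move: (ci_M c) (ci_l c); clear; lia.
- have xp : x \in p by apply: mem_drop xs.
  case: Hx => [/negP|[c [s [sL Ex]]]]; first by apply; apply/flattenP; exists p.
  have [xs' _] := center_in sL; rewrite -Ex in xs'.
  have Eps := flatten_share ups pp (L_ps sL) xp xs'; have {}xs : x \in drop (size p - l) p := xs; move: xs; rewrite Eps (Lsize sL) Ex /center.
  have lM : M - l <= size s by rewrite (Lsize sL) leq_subr.
  rewrite -{1}(cat_take_drop (M - l) s) nth_cat size_takel // ci_f.
  have := us (L_ps sL); rewrite -{1}(cat_take_drop (M - l) s) cat_uniq => /and3P[_ /hasPn Hnn _].
  by move=> /Hnn /negP; apply; apply: mem_nth; rewrite size_takel // ci_f.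
Qed.

Let upools : uniq (pools x0 cidx st0).
Proof.
rewrite /pools cat_uniq; have [_ _ _ _ [-> s1]] := stock0 true; have [_ _ _ _ [-> s2]] := stock0 false.
rewrite andbT /=; apply/hasPn => x /s2 xB; apply/negP => /s1 xA.
have : x \in ~: BB by rewrite Hpart inE xA.
by rewrite inE; have -> : x \in BB := xB.
Qed.

Let count_t (s : seq T) c : s \in L c -> count (mem AA) s = 1.
Proof.
move=> sL; have /and5P[_ _ _ _ /allP Hc] := Lgood sL.
have sz : size (blockword k d) = size s by rewrite (Lsize sL) size_blockword.
have -> : count (mem AA) s = count id (blockword k d).
  elim: (blockword k d) (s) sz Hc => [|c' w IH] [|x s'] //= [sz] Hc.
  rewrite IH // => [|e He]; last by apply: Hc; rewrite inE He orbT.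
  congr (_ + _); have /= := Hc (c', x) (mem_head _ _); case: c' {Hc} => /= [->//|xB].
  case: (boolP (x \in AA)) => // xA; have : x \in ~: BB by rewrite Hpart inE xA.
  by rewrite inE; have -> : x \in BB := xB.
by rewrite count_cat /= !count_nseq.
Qed.

Let count_R c : size (R c) + count (mem (col c)) (flatten ps) = #|col c|.
Proof.
have uf : uniq (filter (mem (col c)) (flatten ps)) by rewrite filter_uniq.
rewrite -size_filter -size_cat cardE; apply: perm_size; apply: uniq_perm; rewrite ?enum_uniq //.
  rewrite cat_uniq filter_uniq ?enum_uniq // uf andbT /=; apply/hasPn => x; rewrite mem_filter => /andP[_ xp].
  by rewrite mem_filter xp.
move=> x; rewrite mem_cat mR [x \in filter (mem (col c)) _]mem_filter mem_enum /=; case: (x \in flatten ps); case: (x \in col c) => //=.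
Qed.

Let sizes : [/\ size (R true) + (size (L true) + size (L false)) = #|AA|,
  #|AA| + #|V0| + #|BB| = n, #|~: BB| = #|AA| + #|V0| &
  size (R true) + size (R false) + (size (L true) + size (L false) + size pv) * M + size pe * k = n].
Proof.
have cV : #|~: BB| = #|AA| + #|V0|.
  rewrite Hpart -cardsUI (_ : AA :&: V0 = set0) ?cards0 ?addn0 //; apply/eqP; rewrite setI_eq0 //.
have cn : #|AA| + #|V0| + #|BB| = n by rewrite -cV addnC cardsC.
have c1 (Q : seq (seq T)) : (forall s, s \in Q -> count (mem AA) s = 1) -> count (mem AA) (flatten Q) = size Q.
  elim: Q => //= s Q IH H; rewrite count_cat H ?mem_head // IH ?add1n // => s' Hs'; apply: H; by rewrite inE Hs' orbT.
have c0 (Q : seq (seq T)) : (forall s, s \in Q -> all [predC AA] s) -> count (mem AA) (flatten Q) = 0.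
  move=> H; apply/eqP; rewrite eqn0Ngt -has_count; apply/hasPn => x /flattenP[s /H/allP Hs /Hs]; by [].
have HA' : count (mem AA) (flatten ps) = size (L true) + size (L false).
  rewrite !flatten_cat !count_cat (c1 _ (fun s H => @count_t s true H)) (c1 _ (fun s H => @count_t s false H)).
  rewrite (c0 pv) => [|s /pvP[] //]; rewrite (c0 pe) ?addn0 // => s /peP[_ _ _ _ /allP Hs].
  by apply/allP => x /Hs xB /=; apply/negP => xA; have : x \in ~: BB by [rewrite Hpart inE (xA : x \in AA)]; rewrite inE (xB : x \in BB).
have RT := count_R true; rewrite /= HA' in RT; split=> //.
have sF : size (flatten ps) = (size (L true) + size (L false) + size pv) * M + size pe * k.
  rewrite !flatten_cat !size_cat (size_flatten_const (fun s => @Lsize true s)) (size_flatten_const (fun s => @Lsize false s)).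
  rewrite (size_flatten_const (L := M)); last by move=> s /pvP[].
  rewrite (size_flatten_const (L := k)); last by move=> s /peP[].
  by rewrite !mulnDl !addnA.
rewrite -addnA -sF -!size_cat cardE; apply: perm_size; apply: uniq_perm; rewrite ?enum_uniq //.
  have dR : forall x, x \in R true -> x \notin R false.
    move=> x; rewrite !mR => /andP[_ xA]; rewrite negb_and; apply/orP; right.
    have : x \in ~: BB by rewrite Hpart inE (xA : x \in AA). by rewrite inE.
  rewrite cat_uniq ups andbT; apply/andP; split.
    rewrite cat_uniq; apply/and3P; split; try by rewrite filter_uniq ?enum_uniq.
    by apply/hasPn => x xR; apply/negP => xR'; have := dR x xR'; rewrite xR.
  by apply/hasPn => x xp /=; rewrite mem_cat !mR xp.
move=> x; rewrite mem_enum inE !mem_cat !mR.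
case: (boolP (x \in flatten ps)) => xp; rewrite ?orbT //= orbF.
case: (boolP (x \in BB)) => xB; first by rewrite /= ?xB ?orbT.
have : x \in ~: BB by rewrite inE.
rewrite Hpart inE => /orP[xA|/V0sub xV]; first by rewrite /= ?xA.
by case/negP: xp; rewrite !flatten_cat !mem_cat xV !orbT.
Qed.

(** The links between consecutive paths and the closing link together draw every free vertex of
    either colour. Afterwards all pools consist of displaced block vertices that have been accounted
    for, so the cycle is spanning. *)
Lemma assemble : exists c, [/\ uniq c, c =i T & lpath k d PP (c ++ take l c)].
Proof.
have [zA zA'] : exists z, z \in AA by apply/set0Pn.
have Lt0 : 0 < size (L true).
  by apply: leq_trans (count_size (fits E k d true zA) _); apply: leq_trans (Lcount (c := true) zA'); apply: leq_ltn_trans hb.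
case Eps : ps => [|p0 rest]; first by move: Lt0; case: (L true) Eps.
have p0P : p0 \in ps by rewrite Eps mem_head.
have restP p : p \in rest -> p \in ps by rewrite Eps inE => ->; rewrite orbT.
have [Pp0 [oS0 oF0]] := pthps p0P.
have [sz1 sz2 sz3 sz4] := sizes.
have t_eq : t = q * d + d by rewrite mulSn addnC.
pose rA := size (R true); pose rB := size (R false).
have sps : size ps = (size rest).+1 by rewrite Eps.
(* The exact balance after removing the prepared paths: blocks and vertex pieces have [t + l]
   vertices and one vertex outside [BB], edges inside [BB] have [d + l] and none, so only the [l] of
   each path remains from the equation [Hn]. *)
have HE : rA + rB + size ps * l + d * N2 = t * rA.
  have spsE : size ps = size (L true) + size (L false) + size pv + size pe by rewrite !size_cat; clear; lia.
  move: sz1 sz3 sz4 Hn; rewrite spsE size_pv -/rA -/rB => <- ->.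
  move: (size (L true) + size (L false)) (#|V0|) (size pe) => be v e.
  rewrite t_eq; move: lq dk; move: (q * d) => Q H1 H2 H3 H4.
  have Ek : k = l + d by rewrite subnK // ltnW.
  move: H3 H4; rewrite {1 2}Ek; move: (k - d) => l'; clear; nia.
have HrA : 2 * size ps + 2 * N2 <= rA by move: HA sz1; rewrite -/rA; move: (size (L true)) (size (L false)) => x y; clear; lia.
have nb2 : [:: false; false] != [::] by [].
(* Every other link has two ordinary segments. The closing link takes all the remaining A-vertices,
   with the [N2] short spacings, and by [HE] it then needs exactly the remaining B-vertices. *)
pose bs0 := nseq N2 true ++ nseq (rA - 2 * size rest - 2 * N2) false.
have cb0 : count id bs0 = N2 by rewrite count_cat !count_nseq mul1n mul0n addn0.
have sb0 : size bs0 = rA - 2 * size rest - N2.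
  by rewrite size_cat !size_nseq; move: HrA; rewrite sps; clear; lia.
have nb0 : bs0 != [::] by rewrite -size_eq0 sb0; move: HrA; rewrite sps; clear; lia.
have w0 := size_word d0 dk ndk nb0; rewrite cb0 sb0 in w0.
have w2 : size (word k d [:: false; false]) + l = t * 2.
  by have := size_word d0 dk ndk nb2; rewrite [count _ _]/= [size [:: _; _]]/= muln0 !addn0.
have ct0 : count id (word k d bs0) = rA - 2 * size rest.
  rewrite count_word // cb0 sb0; move: HrA; rewrite sps; clear; lia.
have ct2 : count id (word k d [:: false; false]) = 2 by rewrite count_word.
pose W2 := flatten (map (word k d) (nseq (size rest) [:: false; false])).
have cW2 a : count a W2 = size rest * count a (word k d [:: false; false]).
  by rewrite /W2 count_flatten !map_nseq sumn_nseq mulnC.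
have tf (w : seq bool) : count (pred1 false) w + count (pred1 true) w = size w.
  by rewrite -(count_predC (pred1 true) w) addnC; congr (_ + _); apply: eq_count; case.
have ctE (w : seq bool) : count (pred1 true) w = count id w by apply: eq_count; case.
have HBs : size rest * (size (word k d [:: false; false]) - 2) + (size (word k d bs0) - (rA - 2 * size rest)) = rB
   /\ 2 <= size (word k d [:: false; false]) /\ rA - 2 * size rest <= size (word k d bs0).
  have h2 : 2 <= size (word k d [:: false; false]) by rewrite -ct2 count_size.
  have h0 : rA - 2 * size rest <= size (word k d bs0) by rewrite -ct0 count_size.
  split=> //; move: w0 w2 HE HrA h2 h0; rewrite sps; move: (size (word k d bs0)) (size (word k d [:: false; false])) (size rest) => a b2 m.
  have dl : l + d = k by rewrite subnK // ltnW.
  move: ((k %/ d).+1 * d) (k - d) => tt l'.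
  move=> w0 w2 HE' HrA' h2 h0; have w0' : a + l' + d * N2 = tt * (rA - 2 * m).
    by rewrite w0; congr (_ * _); move: HrA'; clear; lia.
  have E1 : tt * (rA - 2 * m) + tt * (2 * m) = tt * rA by rewrite -mulnDr subnK //; move: HrA'; clear; lia.
  have E2 : m * (b2 - 2) + 2 * m = m * b2 by rewrite mulnBr [2 * m]mulnC subnK // leq_mul2l h2 orbT.
  have E3 : m * b2 + m * l' = tt * (2 * m) by rewrite -mulnDr w2; clear; lia.
  move: HE' w0' E1 E2 E3 HrA' h0; rewrite mulSn; move: (m * l') (tt * (2 * m)) (tt * rA) (tt * (rA - 2 * m)) (m * (b2 - 2)) (m * b2) => x1 x2 x3 x4 x5 x6; clear; lia.
case: HBs => HB [h2 h0].
have ups' : uniq (p0 ++ flatten rest) by have := ups; rewrite Eps.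
have up0 : uniq p0 by move: ups'; rewrite cat_uniq => /andP[].
have [aS0 aF0] := avoid p0P.
have X1 : uniq (finish k d p0 ++ flatten rest).
  move: ups'; rewrite !cat_uniq => /and3P[_ /hasPn Hnn ->]; rewrite drop_uniq // andbT /=.
  by apply/hasPn => x /Hnn; apply: contra => /mem_drop.
have Hc2 c : count (pred1 c) W2 <= size (st0 c).1.
  rewrite cW2; case: c => /=; rewrite -/rA -/rB.
    by rewrite ctE ct2 mulnC; move: HrA; rewrite sps; clear; lia.
  have -> : count (pred1 false) (word k d [:: false; false]) = size (word k d [:: false; false]) - 2.
    by rewrite -(tf (word k d [:: false; false])) ctE ct2 addnK.
  by rewrite -HB leq_addr.
have [|zs [st1 [Lz Hst1 Pz Sz]]] := @link_all T E k d BB AA OB OA Nb d0 dk ndk Nb0 OB_sub extB extBA extA fullA x0 cidx (fits E k d) L h b hb bn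
  rest (nseq (size rest) [:: false; false]) (finish k d p0) st0 (size_finish Pp0) oF0 (drop_uniq _ up0) (size_nseq _ _)
  _ (fun p Hp => pthps (restP p Hp)) X1 stock0 Hc2 upools aF0 (fun p Hp => avoid (restP p Hp)).
  by move=> bs /nseqP[-> _].
have lastP : last p0 rest \in ps by rewrite Eps mem_last.
have [Pl [_ oFl]] := pthps lastP.
have sub1 : {subset pools x0 cidx st1 <= pools x0 cidx st0} by move=> x Hx; rewrite (perm_mem Pz) mem_cat Hx orbT.
have sw0 : k.-1 <= size (word k d bs0).
  have kt : k < t by rewrite mulSn [X in X < _](divn_eq k d) addnC ltn_add2r ltn_mod.
  have b2 : 2 <= size bs0 by rewrite sb0; move: HrA; rewrite sps; clear; lia.
  have ct : d <= t by rewrite leq_pmull.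
  have := size_word d0 dk ndk nb0; have : count id bs0 <= size bs0 by apply: count_size.
  move: (leq_mul ct (leqnn (count id bs0))) (leq_mul (leqnn t) b2); rewrite mulnDr.
  by move: kt; move: (size (word k d bs0)) (count id bs0) (size bs0) => x c s; move: ((k %/ d).+1 * d) => tt; clear; lia.
have aFl := (avoid lastP).2.
(* The closing link needs disjoint ends. They belong to different paths, because the two families of
   blocks already give at least two paths. *)
have lne : last p0 rest != p0 \/ rest = [::].
  case: rest lastP {Eps restP sps HE HrA bs0 cb0 sb0 nb0 w0 ct0 W2 cW2 HB h0 X1 Hc2 Lz Sz Pz st1 Hst1 sub1 sw0 aFl Pl oFl zs} ups' => [|p1 r] lastP ups'; [by right|left].
  apply/negP => /eqP Ep; move: ups'; rewrite cat_uniq => /and3P[_ /hasPn Hnn _].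
  have p0n : 0 < size p0 by case: Pp0 => _ Hp _; apply: leq_trans Hp; rewrite subn_gt0.
  have xs : nth x0 p0 0 \in p0 by rewrite mem_nth.
  have := Hnn (nth x0 p0 0); rewrite xs => /(_ _)/negP; case=> //.
  by apply/flattenP; exists p0 => //; rewrite -{1}Ep /= mem_last.
have uXY : uniq (finish k d (last p0 rest) ++ start k d p0).
  case: lne => [ne|].
    rewrite cat_uniq drop_uniq ?take_uniq ?us //= andbT; apply/hasPn => x /mem_take xp; apply/negP => /mem_drop xl.
    by move: ne; rewrite (flatten_share ups lastP p0P xl xp) eqxx.
  have [zB zB'] : exists z, z \in BB by apply/set0Pn.
  have Lf0 : 0 < size (L false).
    by apply: leq_trans (count_size (fits E k d false zB) _); apply: leq_trans (Lcount (c := false) zB'); apply: leq_ltn_trans hb.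
  move=> E0; have : 1 < size ps by rewrite !size_cat; move: Lt0 Lf0; clear; lia.
  by rewrite Eps E0.
have C0f : count (pred1 false) (word k d bs0) = size (word k d bs0) - (rA - 2 * size rest).
  by rewrite -(tf (word k d bs0)) ctE ct0 addnK.
have C2f : count (pred1 false) (word k d [:: false; false]) = size (word k d [:: false; false]) - 2.
  by rewrite -(tf (word k d [:: false; false])) ctE ct2 addnK.
have S1 c : size (st1 c).1 = count (pred1 c) (word k d bs0).
  have := Sz c; rewrite -/W2 cW2; case: c => /=; rewrite -/rA -/rB.
    by rewrite !ctE ct2 ct0 => ->; move: (size rest) (size _) => x y; clear; lia.
  by rewrite C2f C0f -{1}HB => /addnI.
have [|||z [st2 [sz Hst2 Lu Pu Su]]] := @fill_word T E k d BB AA OB OA Nb d0 dk Nb0 OB_sub extB extBA extA fullA x0 cidx (fits E k d) L h b hb bn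
   (finish k d (last p0 rest)) (word k d bs0) (start k d p0) st1 (size_finish Pl) (size_start Pp0) sw0 (lpath_word d0 dk ndk nb0) oFl oS0 Hst1 _ uXY.
- by move=> c; rewrite S1.
- by move: upools; rewrite (perm_uniq Pz) cat_uniq => /and3P[].
- apply/allP => x /sub1 Hx; rewrite /= mem_cat negb_or; apply/andP; split; [exact: (allP aFl)|exact: (allP aS0)].
have S2 c : (st2 c).1 = [::] by apply: size0nil; have := Su c; rewrite S1 -{1}(addn0 (count _ _)) => /addnI.
have F2 c : map fst (st2 c).2 = L c by have [] := Hst2 c.
have inL c u : u \in (st2 c).2 -> u.1 \in L c by move=> uL; rewrite -(F2 c) map_f.
have rep_size c u : u \in (st2 c).2 -> size (replaced c u) = M.
  move=> /inL uL; case: u uL => s [w|] /= sL; rewrite /replaced /= ?(Lsize sL) //.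
  by rewrite size_subst (Lsize sL) ?ci_M.
have rep_start c u : u \in (st2 c).2 -> start k d (replaced c u) = start k d u.1.
  move=> /inL; case: u => s [w|] //= sL; rewrite /replaced /= /start /substitute takel_cat.
    by rewrite take_takel ?ci_l.
  by rewrite size_takel ?ci_l // (Lsize sL) ltnW // ci_M.
have rep_finish c u : u \in (st2 c).2 -> finish k d (replaced c u) = finish k d u.1.
  move=> uL; rewrite /finish (rep_size c u uL); move/inL: uL; case: u => s [w|] /= sL; rewrite /replaced /= (Lsize sL) //.
  have H : size (rcons (take (cidx c) s) w) = (cidx c).+1 by rewrite size_rcons size_takel // (Lsize sL) ltnW // ci_M.
  by rewrite /substitute -cat_rcons drop_catr H ?ci_f // drop_drop subnK ?ci_f.
have rep_pth c u : u \in (st2 c).2 -> pth k d PP (replaced c u).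
  move=> uL; have := rep_size c u uL; have sL := inL c u uL; have [Pq _] := pthps (L_ps sL).
  case: u uL sL Pq => s [w|] uL sL Pq; rewrite /replaced //= => sR.
  have [_ Hf _ _ _] := Hst2 c; case: Pq => _; rewrite (Lsize sL) => q1 q2.
  by split; rewrite ?sR //; apply/(lpathP _ d0); exact: (Hf s w uL).
pose ps' := map (replaced true) (st2 true).2 ++ map (replaced false) (st2 false).2 ++ pv ++ pe.
have e1 : size ps' = size ps by rewrite !size_cat !size_map -(size_map fst) F2 -(size_map fst (st2 false).2) F2.
have e2 : map (start k d) ps' = map (start k d) ps.
  rewrite /ps' !map_cat -!map_comp; congr (_ ++ (_ ++ _)).
    by rewrite -(F2 true) -map_comp; apply/eq_in_map => u /rep_start.
  by rewrite -(F2 false) -map_comp; apply/eq_in_map => u /rep_start.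
have e3 : map (finish k d) ps' = map (finish k d) ps.
  rewrite /ps' !map_cat -!map_comp; congr (_ ++ (_ ++ _)).
    by rewrite -(F2 true) -map_comp; apply/eq_in_map => u /rep_finish.
  by rewrite -(F2 false) -map_comp; apply/eq_in_map => u /rep_finish.
have Pps' p : p \in ps' -> pth k d PP p.
  rewrite !mem_cat => /or3P[/mapP[u /rep_pth Hu ->] //|/mapP[u /rep_pth Hu ->] //|Hp].
  by have [] := @pthps p; rewrite // !mem_cat Hp !orbT.
have perm1 c : perm_eq (flatten (map (replaced c) (st2 c).2) ++ map (center c) (L c)) (flatten (L c) ++ map (current x0 (cidx c)) (st2 c).2).
  rewrite -(F2 c); have : forall u, u \in (st2 c).2 -> size u.1 = M by move=> u /inL/Lsize.
  elim: ((st2 c).2) => //= u Ls IH Hs.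
  have {}IH := IH (fun u' Hu' => Hs u' (mem_behead (s := u :: Ls) Hu')).
  have Hu : perm_eq (replaced c u ++ [:: center c u.1]) (u.1 ++ [:: current x0 (cidx c) u]).
    have := Hs u (mem_head _ _); case: u {IH Hs} => s [w|] //= ss; rewrite /replaced /current /center /= /substitute.
    have Es : s = take (cidx c) s ++ nth x0 s (cidx c) :: drop (cidx c).+1 s by rewrite -drop_nth ?cat_take_drop // ss ci_M.
    apply/permP => a; have := congr1 (count a) Es; rewrite !count_cat /= ?count_cat /=; clear; lia.
  apply/permP => a; have := permP Hu a; have := permP IH a; rewrite /= !count_cat /= ?count_cat /=; clear; lia.
case Eps' : ps' e1 e2 e3 Pps' => [|p0' rest']; rewrite Eps //= => [[e1]] [e2 e2'] [e3 e3'] Pps'.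
have same := same_ends e1 e2' e3'.
have Elast : finish k d (last p0' rest') = finish k d (last p0 rest).
  by rewrite !(last_nth [::]) e1; case: (size rest) => [|j] //=; have [_ ->] := same j.
have [|||||c [pc _ Lc]] := @cycle_of_linked T k d PP d0 dk p0' z zs rest'.
- by apply: Pps'; rewrite mem_head.
- by move=> p Hp; apply: Pps'; rewrite inE Hp orbT.
- rewrite e3; apply: linked_replace Lz (esym e1) _ => i; by have [-> ->] := same i.
- by rewrite sz; apply: dvdn_word.
- by rewrite Elast e2.
have Pfin : perm_eq c (flatten ps ++ R true ++ R false).
  apply: perm_trans pc _; apply/permP => a.
  have E1 : flatten ps' = flatten (map (replaced true) (st2 true).2) ++ flatten (map (replaced false) (st2 false).2) ++ flatten pv ++ flatten pe.
    by rewrite /ps' !flatten_cat.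
  rewrite Eps' /= in E1.
  have E0 : flatten ps = flatten (L true) ++ flatten (L false) ++ flatten pv ++ flatten pe by rewrite !flatten_cat.
  have H1 := permP (perm1 true) a; have H2 := permP (perm1 false) a.
  have H3 := permP Pz a; have H4 := permP Pu a; have H5 := congr1 (count a) E1.
  move: H3 H4; rewrite /pools /pool !S2 /st0 /= -!map_comp.
  rewrite !count_cat /= in H1 H2 H5 *; rewrite E0 ?count_cat => H3 H4.
  move: H1 H2 H3 H4 H5; rewrite -/(R true) -/(R false).
  set aa := count a (map (center true) _); set bb := count a (map (center false) _).
  clear; lia.
exists c; split=> //.
  rewrite (perm_uniq Pfin) cat_uniq ups /=; apply/andP; split.
    by apply/hasPn => x; rewrite mem_cat !mR => /orP[/andP[]|/andP[]].
  rewrite cat_uniq; apply/and3P; split; try by rewrite filter_uniq ?enum_uniq.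
  apply/hasPn => x; rewrite !mR => /andP[_ xB]; rewrite negb_and; apply/orP; right.
  apply/negP => xA; have : x \in ~: BB by rewrite Hpart inE (xA : x \in AA).
  by rewrite inE (xB : x \in BB).
move=> x; rewrite (perm_mem Pfin) mem_cat mem_cat !mR inE.
case: (boolP (x \in flatten ps)) => xp //=.
case: (boolP (x \in BB)) => xB; first by rewrite /= ?xB ?orbT.
have : x \in ~: BB by rewrite inE.
rewrite Hpart inE => /orP[xA|/V0sub xV]; first by rewrite /= ?xA.
by case/negP: xp; rewrite !flatten_cat !mem_cat xV !orbT.
Qed.

End Assemble.

Section Extremal.
Variables (k d : nat).
Hypotheses (d1 : 1 < d) (dk : d < k) (ndk : ~~ (d %| k)).
Local Notation q := (k %/ d).
Local Notation t := ((k %/ d).+1 * d).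
Local Notation M := (q * d + k).
Local Notation l := (k - d).
Let d0 : 0 < d. Proof. exact: ltnW. Qed.
Let k1 : 1 < k. Proof. exact: ltn_trans dk. Qed.
Let k0 : 0 < k. Proof. exact: ltnW. Qed.

Lemma edge_pieces (T : finType) (E : {set {set T}}) (BB : {set T}) N0 N3 N3c : kgraph k E -> codegree_ge E k t -> 0 < #|T| -> 0 < N0 ->
  t * #|~: BB| + d * N3c <= #|T| -> (forall b, b \in BB -> N3 * deg_in E k BB b <= 2 * #|T| ^ k.-1) ->
  4 ^ k * (k * k) <= #|T| -> t * k * 4 ^ k < N3 -> (forall Z : {set T}, #|Z| <= k * N3c -> #|T| <= 4 * #|BB :\: Z|) ->
  2 * (N0 * (2 ^ k.+1) ^ k * (k * N3c)) <= #|T| -> OKB E k BB N0 set0 -> (forall b, b \in BB -> OKB E k BB N0 [set b]) ->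
  exists pe, [/\ size pe = N3c, forall p, p \in pe -> [/\ size p = k, lpath k d (fun s => edg E s : Prop) p,
    OKB E k BB N0 [set x in start k d p], OKB E k BB N0 [set x in finish k d p] & all (mem BB) p] & uniq (flatten pe)].
Proof.
move=> kE HE n0 N00 Hn Hb Hn2 HN3 HZ HZ2 o0 o1.
apply: greedy_tiles => pe spe Hpe upe.
have cZ : #|[set x in flatten pe]| <= k * N3c.
  rewrite cardsE; apply: leq_trans (card_size _) _; rewrite (size_flatten_const (L := k)); last by move=> p /Hpe[].
  by rewrite mulnC leq_mul2l (ltnW spe) orbT.
have lk : l < k by move: k0 d0; clear; lia.
have [||s [ss us es sBZ [o2 o3]]] := @good_edge T E k BB N0 kE [set x in flatten pe] l lk o0 o1.
- by apply: leq_trans HZ2; rewrite !leq_mul2l cZ !orbT.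
- apply: (@edge_avoiding T E k BB k1 n0 _ t d N3 N3c) => //; first by apply: leq_ltn_trans spe.
  exact: HZ.
exists s; split=> //; last by apply/allP => x /sBZ; rewrite !inE => /andP[].
split=> //; first exact: lpath_size_k; first by rewrite /finish ss subKn // ltnW in o3 *.
by apply/allP => x /sBZ; rewrite inE => /andP[].
Qed.

Lemma vertex_pieces (T : finType) (E : {set {set T}}) (BB V0 : {set T}) N0 K' (Z0 : seq T) B : 0 < #|T| ->
  (forall v, v \in V0 -> dense K' (k.-1 * M) (blown M k.-1 (link_ok E k BB N0 v))) ->
  [disjoint V0 & BB] -> {subset Z0 <= BB} -> size Z0 + M * #|V0| + 1 <= B -> 2 * K' * (k.-1 * M * (k.-1 * M + B)) <= #|T| ->
  exists pv, [/\ size pv = #|V0|, forall p, p \in pv -> [/\ size p = M, lpath k d (fun s => edg E s : Prop) p,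
    OKB E k BB N0 [set x in start k d p], OKB E k BB N0 [set x in finish k d p] & forall x, x \in p -> (x \in BB) || (x \in V0)],
    uniq (flatten pv), forall v, v \in V0 -> v \in flatten pv & all [predC Z0] (flatten pv)].
Proof.
move=> n0 HD dVB ZB HB Hn.
suff H (vs : seq T) : uniq vs -> {subset vs <= V0} -> exists pv, [/\ size pv = size vs, forall p, p \in pv -> [/\ size p = M, lpath k d (fun s => edg E s : Prop) p,
    OKB E k BB N0 [set x in start k d p], OKB E k BB N0 [set x in finish k d p] & forall x, x \in p -> (x \in BB) || (x \in V0)],
    uniq (flatten pv), forall v, v \in vs -> v \in flatten pv & all (fun x => (x \notin Z0) && ((x \in BB) || (x \in vs))) (flatten pv)].
  have [|pv [H1 H2 H3 H4 H5]] := H (enum V0) (enum_uniq _); first by move=> x; rewrite mem_enum.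
  exists pv; split=> //; first by rewrite H1 -cardE.
    by move=> v vV; apply: H4; rewrite mem_enum.
  by apply: sub_all H5 => x /andP[].
elim: vs => [|v vs IH] /=; first by move=> _ _; exists [::]; split.
case/andP=> vvs uvs Hsub; have [|pv [H1 H2 H3 H4 /allP H5]] := IH uvs; first by move=> x Hx; apply: Hsub; rewrite inE Hx orbT.
have vV : v \in V0 by apply: Hsub; rewrite mem_head.
have vB : v \notin BB by rewrite (disjointFr dVB vV).
have svs : size vs <= #|V0|.
  by rewrite -(card_uniqP uvs); apply: subset_leq_card; apply/subsetP => x Hx; apply: Hsub; rewrite inE Hx orbT.
have [|s [ss Hs us /allP as_]] := dense_exists (Z := [set x in v :: Z0 ++ flatten pv]) n0 (HD v vV).
  apply: leq_trans Hn; rewrite !leq_mul2l leq_add2l; apply/orP; right; apply/orP; right.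
  rewrite cardsE; apply: leq_trans (card_size _) _; rewrite /= size_cat (size_flatten_const (L := M)); last by move=> p /H2[].
  apply: leq_trans HB; rewrite addn1 ltnS leq_add2l H1 mulnC leq_mul2l svs orbT //.
have vs' : v \notin s by apply/negP => /as_; rewrite /= inE mem_head.
have [p [[sp up Lp] o1 o2 vp Hp]] := vertex_piece d1 dk ndk (fun X Y => @OKB_sub T E k BB N0 X Y) Hs ss us vs'.
exists (p :: pv); split.
- by rewrite /= H1.
- move=> p'; rewrite inE => /orP[/eqP->|/H2 //]; split=> // x xp.
  by case: (eqVneq x v) => [->|xv]; [rewrite vV orbT|have [-> _] := Hp x xp xv].
- rewrite /= cat_uniq up H3 andbT; apply/hasPn => x xf; apply/negP => xp.
  case: (eqVneq x v) => [xv|xv].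
    by have := H5 x xf; rewrite xv (negPf vB) (negPf vvs) andbF.
  by have [_ /as_] := Hp x xp xv; rewrite /= inE in_cons mem_cat xf !orbT.
- by move=> v'; rewrite inE => /orP[/eqP->|/H4 Hv]; rewrite /= mem_cat ?vp // Hv orbT.
- rewrite /= all_cat; apply/andP; split; apply/allP => x.
    case: (eqVneq x v) => [->|xv] xp; first by rewrite mem_head orbT andbT; apply: contra vB => /ZB.
    have [-> /as_] := Hp x xp xv; by rewrite /= inE in_cons mem_cat !negb_or => /and3P[_ -> _].
  by move/H5 => /andP[-> /orP[->|xvs]]; rewrite ?inE ?xvs ?orbT.
Qed.

(** If the complement of [BB] were much smaller than [n / t], every tuple in [BB] would have many
    neighbours inside [BB], which spans few edges. This bounds the number of correcting edges. *)
Lemma codeg_lower (T : finType) (E : {set {set T}}) (BB : {set T}) N5 : codegree_ge E k t -> 0 < #|T| -> #|T| <= 2 * #|BB| ->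
  N5 * edges_in E k BB <= #|T| ^ k -> N5 * (k * k) <= #|T| ->
  N5 * (#|T| - t * #|~: BB|) <= 2 ^ k.-1 * (t.+1 * #|T|).
Proof.
set n := #|T| => HE n0 HB He Hn; set y := #|BB| ^ k.-1; set P := n ^ k.-1.
have nP : n ^ k = n * P by rewrite -expnS prednK.
have Py : P <= 2 ^ k.-1 * y by rewrite /P /y -expnMn leq_exp2r // -ltnS prednK.
have y0 : 0 < y by case: y Py => //; rewrite muln0 leqNgt expn_gt0 n0.
have H1 := sum_deg_ge HE BB; rewrite (bigID (mem BB)) /= (edges_in_sum _ k0) -/n -/P -/y in H1.
have H2 : \sum_(v | v \notin BB) deg_in E k BB v <= #|~: BB| * y.
  rewrite -sum_nat_const; apply: (@leq_trans (\sum_(v in ~: BB) deg_in E k BB v)).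
    by rewrite (eq_bigl (mem (~: BB))) // => v; rewrite /= in_setC.
  by apply: leq_sum => v _; apply: deg_le.
have kk : k.-1 * k.-1 <= k * k by rewrite leq_mul ?leq_pred.
rewrite -(leq_pmul2r y0).
case: (leqP n (t * #|~: BB|)) => Hc; first by rewrite (eqP Hc) muln0.
have Hs : (n - t * #|~: BB|) * y <= t * edges_in E k BB + k * k * P.
  rewrite mulnBl leq_subLR; apply: leq_trans H1 _.
  move: (leq_mul (leqnn t) H2) (leq_mul kk (leqnn P)); move: (\sum_(_ | _) _) (edges_in _ _ _) => x e; clear; lia.
rewrite -mulnA; apply: leq_trans (leq_mul (leqnn N5) Hs) _.
rewrite nP in He.
apply: (@leq_trans (t.+1 * n * P)).
  move: (leq_mul (leqnn t) He) (leq_mul Hn (leqnn P)); move: (edges_in _ _ _) (k * k) => e kk'; rewrite mulSn; clear; lia.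
by rewrite mulnC; move: (leq_mul (leqnn (t.+1 * n)) Py); move: (2 ^ _) => x; clear; lia.
Qed.

Lemma block_family (T : finType) (E : {set {set T}}) (BB AA : {set T}) (OB : pred {set T}) (P : T -> pred (seq T)) (Z : seq T) K h c :
  0 < K -> 0 < #|T| -> #|T| <= 2 ^ h -> 2 * K * (M * (M + (size Z + 8 * K * h * M))) <= #|T| ->
  (forall z, z \in colour BB AA c -> dense K M (fun s => good_block E k d BB AA OB s && P z s)) ->
  exists L, [/\ size L <= 8 * K * h, forall s, s \in L -> size s = M /\ good_block E k d BB AA OB s,
    uniq (flatten L), all [predC Z] (flatten L) & forall z, z \in colour BB AA c -> h <= count (P z) L].
Proof.
move=> K0 n0 Hh Hn HD.
pose A z s := (z \notin colour BB AA c) || (good_block E k d BB AA OB s && P z s).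
have HA z : dense K M (A z).
  case: (boolP (z \in colour BB AA c)) => zc.
    by move/denseW: (HD z zc); apply=> // s _; rewrite /A zc.
  rewrite /dense (eq_tsum (g := fun=> 1)); last by move=> s _; rewrite /A zc.
  by rewrite tsum_const muln1 leq_pmull.
have [||L0 [sL cL uL aL hL]] := @select T T M K A [set x in Z] K0 n0 HA h.
- exact: Hh.
- apply: leq_trans Hn; rewrite !leq_mul2l leq_add2l leq_add2r; apply/orP; right; apply/orP; right.
  by rewrite cardsE card_size.
exists (filter (good_block E k d BB AA OB) L0); split.
- by rewrite size_filter -sL count_size.
- by move=> s; rewrite mem_filter => /andP[g /cL].
- exact: uniq_flatten_filter.
- apply/allP => x /flattenP[s]; rewrite mem_filter => /andP[_ sL0] xs.
  have := allP aL x; rewrite /= inE; apply; apply/flattenP; by exists s.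
- move=> z zc; apply: leq_trans (hL z) _; rewrite count_filter; apply: sub_count => s.
  by rewrite /A zc /= => /andP[-> ->].
Qed.

End Extremal.

Section Extremal.
Variables (k d : nat).
Hypotheses (d1 : 1 < d) (dk : d < k) (ndk : ~~ (d %| k)).
Local Notation q := (k %/ d).
Local Notation t := ((k %/ d).+1 * d).
Local Notation M := (q * d + k).
Local Notation l := (k - d).
Let d0 : 0 < d. Proof. exact: ltnW. Qed.
Let k1 : 1 < k. Proof. exact: ltn_trans dk. Qed.
Let k0 : 0 < k. Proof. exact: ltnW. Qed.

Lemma succ_divn_mul_le e m : e <= m -> (m %/ e).+1 * e <= 2 ^ m.+1.
Proof.
move=> em; have := leq_divM m e; have := ltn_expl m (leqnn 2).
by rewrite expnS mulSn; move: (2 ^ m) (m %/ e * e) em => x y; clear; lia.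
Qed.

Lemma uniq_cat4 (T : eqType) (s1 s2 s3 s4 : seq T) : uniq s1 -> uniq s2 -> uniq s3 -> uniq s4 ->
  all [predC s3 ++ s4] s1 -> all [predC s1 ++ s3 ++ s4] s2 -> all [predC s4] s3 -> uniq (s1 ++ s2 ++ s3 ++ s4).
Proof.
move=> u1 u2 u3 u4 /allP H1 /allP H2 /allP H3; rewrite !cat_uniq u1 u2 u3 u4 /= !andbT.
apply/and3P; split; apply/hasPn => x; rewrite ?mem_cat => Hx; apply/negP => x1.
- case/or3P: Hx => Hx; first by have := H2 x Hx; rewrite /= mem_cat x1.
    by have := H1 x x1; rewrite /= mem_cat Hx.
  by have := H1 x x1; rewrite /= mem_cat Hx orbT.
- by have := H2 x x1; rewrite /= !mem_cat Hx orbT.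
- by have := H3 x x1; rewrite /= Hx.
Qed.

(** The constants are fixed backwards from the final assembly: density of blocks, number of blocks,
    tolerance for bad vertices, thresholds of typicality, and last the precision [Neta] of the
    extremal structure. *)
Lemma extremal : exists Neta n0, 0 < Neta /\ forall (T : finType) (E : {set {set T}}) (A : {set T}), n0 <= #|T| -> d %| #|T| ->
  kgraph k E -> codegree_ge E k t ->
  Neta * (t * #|A|) <= Neta.+1 * #|T| -> Neta * tsum k (fun s => all [predC A] s && edg E s) <= #|T| ^ k ->
  exists c, [/\ uniq c, c =i T & lpath k d (fun s => edg E s : Prop) (c ++ take l c)].
Proof.
have q0 : 0 < q by rewrite divn_gt0 // ltnW.
have t4 : 4 <= t by apply: (@leq_trans (2 * 2)) => //; apply: leq_mul.
have t0 : 0 < t by apply: leq_trans t4.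
have M0 : 0 < M by rewrite addn_gt0 k0 orbT.
have [c0 Ec0] : exists c0, c0 = 4 * t by eexists.
have [Kb EKb] : exists Kb, Kb = (2 * c0) ^ M by eexists.
have Kb0 : 0 < Kb by rewrite EKb expn_gt0 Ec0 !muln_gt0 d0.
have [b1 Eb1] : exists b1, b1 = 128 * Kb * Kb * M * M + 384 * t * Kb + 8 * c0 by eexists.
have b10 : 0 < b1 by rewrite Eb1 addn_gt0 orbC muln_gt0 Ec0 muln_gt0 t0.
have [Nb ENb] : exists Nb, Nb = 8 * b1 * (k * k.+1) by eexists.
have Nb0 : 0 < Nb by rewrite ENb !muln_gt0 b10 k0.
have [Ng ENg] : exists Ng, Ng = 2 ^ k.+1 * Nb by eexists.
have Ng0 : 0 < Ng by rewrite ENg muln_gt0 expn_gt0.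
have [N0 EN0] : exists N0, N0 = 2 ^ k * ((3 * Ng) ^ k * 2 ^ k) * Nb by eexists.
have N00 : 0 < N0 by rewrite EN0 !muln_gt0 !expn_gt0 !muln_gt0 Ng0.
have NgN0 : Ng <= N0.
  rewrite EN0 ENg expnS; set x := 2 ^ k; have x2 : 2 <= x by rewrite -{1}(expn1 2) leq_exp2l.
  have : 1 <= (3 * (2 * x * Nb)) ^ k by rewrite expn_gt0 !muln_gt0 Nb0 expn_gt0.
  move: (_ ^ k) => y y1; rewrite leq_mul2r (leq_trans _ (_ : x * x <= _)) ?orbT //; first by rewrite leq_mul2r x2 orbT.
  by rewrite leq_mul2l leq_pmull ?orbT.
have [NB ENB] : exists NB, NB = N0 * (2 ^ k.+1) ^ k by eexists.
have [N1 EN1] : exists N1, N1 = (Ng ^ k.-1).+1 by eexists.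
have [N3 EN3] : exists N3, N3 = 2 ^ k + 2 * NB ^ k.-1 + t * k * 4 ^ k + 1 by eexists.
have [K' HK'] := dense_blown M k.-1 (4 * N3).
have [C EC] : exists C, C = k.-1 * M by eexists.
have [N6 EN6] : exists N6, N6 = 8 * K' * C * (k + M) + 16 * Kb * M * (k + M) + 48 * t + 16 * k + 2 * NB * k by eexists.
have [N5 EN5] : exists N5, N5 = N0 + NB ^ k + 4 * N3 * (2 ^ k * NB ^ k) + N6 * (2 ^ k.-1 * t.+1) + N6 + 4 by eexists.
have N50 : 0 < N5 by rewrite EN5 addn4.
have N10 : 0 < N1 by rewrite EN1.
have t2 : 2 < t by apply: leq_trans t4.
have HN3k : 2 ^ k <= N3 by rewrite EN3 -!addnA leq_addr.
have [Neta [ns [eta0 Hst]]] := structure k1 t2 N10 HN3k N50.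
have [na Hna] := leq_expn_exp2 1 b1.-1; rewrite prednK // in Hna.
exists Neta, (ns + na + N5 * (k * k) + 4 ^ k * (k * k) + 8 * b1 + 2 * c0 * (2 * M + 2) + 4 * K' * C * (C + 1) + 8 * Kb * M * M + 1); split=> //.
move=> T E A Hn dn kE HE HA HeA; set n := #|T| in Hn dn HA HeA *.
have Hns : [/\ ns <= n, na <= n, N5 * (k * k) <= n, 4 ^ k * (k * k) <= n & 8 * b1 <= n].
  by move: Hn; move: (N5 * _) (4 ^ k * _) (2 * c0 * _) (4 * K' * _ * _) (8 * Kb * _ * _) => x1 x2 x3 x4 x5; clear; split; lia.
have Hns' : [/\ 2 * c0 * (2 * M + 2) <= n, 4 * K' * C * (C + 1) <= n, 8 * Kb * M * M <= n & 0 < n].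
  by move: Hn; move: (N5 * _) (4 ^ k * _) (2 * c0 * _) (4 * K' * _ * _) (8 * Kb * _ * _) => x1 x2 x3 x4 x5; clear; split; lia.
case: Hns => hns hna hN5 h4k hb1; case: Hns' => hc0 hK' hKb n0.
have [BB [AA [V0 [[Hpart dAV] HbB HaA HvV [cV cBB eBB]]]]] := Hst T E A hns HE HA HeA.
rewrite -/n in HbB HaA HvV cV cBB eBB.
have dVB : [disjoint V0 & BB].
  rewrite disjoint_sym disjoints_subset; apply/subsetP => x xB; rewrite inE; apply/negP => xV.
  by have : x \in ~: BB by [rewrite Hpart inE xV orbT]; rewrite inE xB.
have dAB : [disjoint AA & BB].
  rewrite disjoint_sym disjoints_subset; apply/subsetP => x xB; rewrite inE; apply/negP => xA.
  by have : x \in ~: BB by [rewrite Hpart inE xA]; rewrite inE xB.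
pose a := #|~: BB|.
have cn : a + #|BB| = n by rewrite addnC cardsC.
have ca : a = #|AA| + #|V0|.
  by rewrite /a Hpart -cardsUI (_ : AA :&: V0 = set0) ?cards0 ?addn0 //; apply/eqP; rewrite setI_eq0.
have N54 : 4 <= N5 by rewrite EN5 leq_addl.
have a516 : 16 * a <= 5 * n.
  have : N5 * (4 * a) <= N5 * n + n by rewrite addnC -mulSn; apply: leq_trans cBB; rewrite leq_mul2l leq_mul2r t4 !orbT.
  have : 4 * n <= N5 * n by rewrite leq_mul2r N54 orbT.
  move: N50; clear; nia.
have nBB : n <= 2 * #|BB| by move: a516 cn; clear; lia.
have Hlow := codeg_lower d1 dk HE n0 nBB eBB hN5; rewrite -/a -/n in Hlow.
have N65 : N6 * (2 ^ k.-1 * t.+1) <= N5 by rewrite EN5; move: (N6 * _) => x; clear; lia.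
have low6 : N6 * (n - t * a) <= n.
  have p0 : 0 < 2 ^ k.-1 * t.+1 by rewrite muln_gt0 expn_gt0.
  rewrite -(leq_pmul2l p0); apply: leq_trans (_ : _ <= N5 * (n - t * a)) _.
    by rewrite mulnA leq_mul2r [_ * N6]mulnC N65 orbT.
  by apply: leq_trans Hlow _; rewrite mulnA.
have up6 : N6 * (t * a - n) <= n.
  have N6N5 : N6 <= N5 by rewrite EN5; move: (N6 * _) => x; clear; lia.
  apply: (@leq_trans (N5 * (t * a - n))); first by rewrite leq_mul2r N6N5 orbT.
  by rewrite mulnBr leq_subLR addnC -mulSn.
have V6 : N6 * #|V0| <= n.
  by apply: leq_trans cV; rewrite leq_mul2r EN5; apply/orP; right; move: (N6 * _) => x; clear; lia.
have N6t : 48 * t <= N6 by rewrite EN6; move: (8 * _ * _ * _) (16 * _ * _ * _) (48 * _) => x y z; clear; lia.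
have nAA : n <= 4 * t * #|AA|.
  have H1 : 48 * (n - t * a) <= n.
    by apply: leq_trans low6; rewrite leq_mul2r; apply/orP; right; apply: leq_trans N6t; rewrite leq_pmulr.
  have H2 : 48 * (t * #|V0|) <= n by apply: leq_trans V6; rewrite mulnA leq_mul2r N6t orbT.
  move: H1 H2; rewrite ca; move: (#|AA|) (#|V0|) ((k %/ d).+1 * d) => x y tt; clear; nia.
have AA0 : AA != set0 by rewrite -card_gt0; move: nAA n0; case: (#|AA|) => //; rewrite muln0 leqNgt => /negP.
have BB0 : BB != set0 by rewrite -card_gt0; move: nBB n0; case: (#|BB|) => //; rewrite muln0 leqNgt => /negP.
have [x0 _] : exists x, x \in AA by apply/set0Pn.
(* Truncated subtraction makes one of the two zero: edges inside [BB] if there are too few vertices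
   outside it, short spacings if there are too many. Both quotients are exact as [d] divides [n] and
   [t]. *)
pose N3c := (n - t * a) %/ d; pose N2 := (t * a - n) %/ d.
have dt : d %| t by rewrite dvdn_mull.
have E3 : d * N3c = n - t * a by rewrite mulnC divnK // dvdn_sub // dvdn_mulr.
have E2 : d * N2 = t * a - n by rewrite mulnC divnK // dvdn_sub // dvdn_mulr.
have N3c6 : N6 * N3c <= n by apply: leq_trans low6; rewrite -E3 leq_mul2l leq_pmull ?orbT.
have N26 : N6 * N2 <= n by apply: leq_trans up6; rewrite -E2 leq_mul2l leq_pmull ?orbT.
have use6 x v : x <= N6 -> N6 * v <= n -> x * v <= n by move=> H1 H2; apply: leq_trans H2; rewrite leq_mul2r H1 orbT.
pose OB := OKB E k BB N0; pose OA := OKA E k BB N0 Ng.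
have N3d b : b \in BB -> N3 * deg_in E k BB b <= 2 * n ^ k.-1 by apply: HbB.
have o0 : OB set0.
  by apply: (@OKB0 T E k BB N0 n0 N5); rewrite -?ENB // EN5; move: (NB ^ k) (N6 * _) (4 * N3 * _) => x y z; clear; lia.
have o1 b : b \in BB -> OB [set b].
  move=> bB; apply: (@OKB1 T E k BB N0 n0 N3 b) => //; last exact: N3d.
  by rewrite -ENB EN3; move: (2 * NB ^ _) (t * k * _) => x y; clear; lia.
have W0 : 0 < (3 * Ng) ^ k * 2 ^ k by rewrite muln_gt0 !expn_gt0 muln_gt0 Ng0.
have OA0 x : x \in AA -> OA x set0.
  move=> xA; apply/OKAP; split=> // Y; rewrite subset0 => /eqP->; rewrite cards0 subn0.
  by apply: (@gd0 T E k BB Ng n0 N1); [rewrite EN1|apply: HaA].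
have OB_sub (X Y : {set T}) : Y \subset X -> OB X -> OB Y := @OKB_sub T E k BB N0 X Y.
have extB (X : {set T}) : OB X -> #|X| < k.-1 -> Nb * #|[set v in BB | (v \notin X) && ~~ OB (v |: X)]| <= n.
  move=> oX cX; have := ext_B oX (leq_trans cX (leq_pred k)); rewrite -/OB -/n; move: (#|_|) => x; rewrite EN0.
  rewrite -!mulnA leq_pmul2l ?expn_gt0 // => H; apply: leq_trans H.
  by rewrite !mulnA leq_mul2r leq_pmull ?orbT.
have extBA x (X : {set T}) : OA x X -> #|X| < k.-1 -> Nb * #|[set v in BB | (v \notin X) && ~~ OA x (v |: X)]| <= n.
  move=> oX cX; have := ext_BA NgN0 oX cX; rewrite -/OA -/n; move: (#|_|) => y; rewrite ENg.
  by rewrite -mulnA leq_pmul2l ?expn_gt0.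
have extA (X : {set T}) : OB X -> #|X| < k -> Nb * #|[set x in AA | ~~ OA x X]| <= n.
  move=> oX cX; have N05 : N0 <= N5 by rewrite EN5; move: (NB ^ k) (N6 * _) (4 * N3 * _) => x y z; clear; lia.
  have tk := succ_divn_mul_le (ltnW dk).
  have := @ext_A T E k BB AA N0 Ng kE k1 n0 Ng0 t N5 t0 HE dAB N05 tk cBB X oX cX.
  rewrite -/OA -/n; move: (#|_|) => x; rewrite EN0; move: W0; move: (_ * 2 ^ k) => W W0 H.
  have p0 : 0 < 2 ^ k * W by rewrite muln_gt0 expn_gt0.
  by rewrite -(leq_pmul2l p0) mulnA; apply: leq_trans H _; rewrite mulnA.
have fullA x (X : {set T}) : OA x X -> #|X| = k.-1 -> x |: X \in E.
  by move=> /OKAP[_ /(_ X (subxx _))] + cX; rewrite cX subnn.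
have [pe [spe Hpe upe]] : exists pe, [/\ size pe = N3c, forall p, p \in pe -> [/\ size p = k, lpath k d (fun s => edg E s : Prop) p,
    OB [set x in start k d p], OB [set x in finish k d p] & all (mem BB) p] & uniq (flatten pe)].
  case: (leqP (t * a) n) => tan; last by exists [::]; split=> //; rewrite /N3c (eqP (ltnW tan)) div0n.
  have HN3 : t * k * 4 ^ k < N3 by rewrite EN3; move: (t * k * _) (2 * _) => x y; clear; lia.
  have H16 : 16 * k <= N6 by rewrite EN6; move: (8 * _ * _ * _) (16 * _ * _ * _) (48 * _) => x y z; clear; lia.
  have H2N : 2 * NB * k <= N6 by rewrite EN6 leq_addl.
  apply: (@edge_pieces k d d1 dk T E BB N0 N3 N3c) => //.
  - by rewrite E3 subnKC.
  - move=> Z cZ; have := use6 _ _ H16 N3c6; rewrite -mulnA => H.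
    have := cardsID Z BB; have := subset_leq_card (subsetIr BB Z).
    by move: cZ H a516 cn; rewrite -/n; move: (k * N3c) (#|BB :&: Z|) (#|BB :\: Z|) (#|BB|) (#|Z|) => x y z u v; clear; lia.
  - by rewrite -ENB !mulnA; apply: use6.
have sfe : size (flatten pe) = k * N3c by rewrite (size_flatten_const (L := k)) ?spe 1?mulnC // => p /Hpe[].
have [pv [spv Hpv upv Vpv apv]] : exists pv, [/\ size pv = #|V0|, forall p, p \in pv -> [/\ size p = M, lpath k d (fun s => edg E s : Prop) p,
    OB [set x in start k d p], OB [set x in finish k d p] & forall x, x \in p -> (x \in BB) || (x \in V0)],
    uniq (flatten pv), forall v, v \in V0 -> v \in flatten pv & all [predC flatten pe] (flatten pv)].
  apply: (@vertex_pieces k d d1 dk ndk T E BB V0 N0 K' (flatten pe) (k * N3c + M * #|V0| + 1)) => //.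
  - move=> v vV; apply: HK' => //; apply: (@link_dense T E k BB N0 kE k1 n0 N00 v N3 N5) => //; last exact: HvV.
    by rewrite -ENB EN5; move: (NB ^ k) (N6 * _) => x y; move: (4 * N3 * _) => z; clear; lia.
  - by move=> x /flattenP[p /Hpe[_ _ _ _ /allP pB] /pB].
  - by rewrite sfe.
  have H8 : 8 * K' * C * (k + M) <= N6 by rewrite EN6 -!addnA leq_addr.
  have H1 : 8 * K' * C * k * N3c <= n by apply: use6 N3c6; apply: leq_trans H8; rewrite leq_mul2l leq_addr orbT.
  have H2 : 8 * K' * C * M * #|V0| <= n by apply: use6 V6; apply: leq_trans H8; rewrite leq_mul2l leq_addl orbT.
  by rewrite -EC -/n; move: H1 H2 hK'; move: (M) (#|V0|) (N3c) => m v x; clear; lia.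
pose h := n %/ b1.
have bh : b1 * h <= n by rewrite mulnC leq_divM.
have h8 : 8 <= h by rewrite leq_divRL.
have nh : n < b1 * h.+1 by rewrite mulnC ltn_ceil.
(* The largest value with [2 * b < h]; [Nb] was chosen so that the vertices excluded by a filling
   step number at most [b]. *)
pose b := h.-1 %/ 2.
have hb : 2 * b < h by have := leq_divM h.-1 2; rewrite mulnC -/b; move: h8; move: (b) (h) => u v; clear; lia.
have bb : h <= 2 * b + 2 by have := @ltn_ceil h.-1 2 isT; rewrite mulnC -/b; move: h8; move: (b) (h) => u v; clear; lia.
have bn : k * (k.+1 * n) <= Nb * b.
  rewrite ENb mulnA [X in _ <= X]mulnAC [X in _ <= X]mulnC leq_mul2l; apply/orP; right; apply: ltnW; apply: leq_trans nh _.
  rewrite [8 * b1]mulnC -mulnA leq_mul2l; apply/orP; right.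
  by move: h8 bb; move: (b) (h) => u v; clear; lia.
have hb2 : 2 * c0 * (2 * b + M + 1) <= n.
  have : 8 * c0 * h <= n by apply: leq_trans bh; rewrite leq_mul2r Eb1 leq_addl orbT.
  move: hc0 (leq_mul (leqnn c0) (ltnW hb)); move: (M) (b) (h) => m x y; clear; lia.
have colc c' : n <= c0 * #|colour BB AA c'|.
  case: c'; rewrite /colour Ec0 //.
  by apply: leq_trans nBB _; rewrite leq_mul2r; apply/orP; right; move: t0; move: (t) => tt; clear; lia.
have blk c z : z \in colour BB AA c -> dense Kb M (fun s => good_block E k d BB AA OB s && fits E k d c z s).
  by move=> zc; rewrite EKb; apply: (@block_dense T E k d BB AA OB OA Nb) hb2.
have nh2 : n <= 2 ^ h by rewrite -[n]expn1; apply: Hna.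
have Hb128 : 128 * Kb * Kb * M * M * h <= n by apply: leq_trans bh; rewrite leq_mul2r Eb1 -addnA leq_addr orbT.
have H16N : 16 * Kb * M * (k + M) <= N6 by rewrite EN6; move: (8 * _ * _ * _) (48 * _) => x y; move: (16 * _ * _ * _) => z; clear; lia.
have Hx1 : 16 * Kb * M * k * N3c <= n by apply: use6 N3c6; apply: leq_trans H16N; rewrite leq_mul2l leq_addr orbT.
have Hx2 : 16 * Kb * M * M * #|V0| <= n by apply: use6 V6; apply: leq_trans H16N; rewrite leq_mul2l leq_addl orbT.
have sfv : size (flatten pv) = M * #|V0| by rewrite (size_flatten_const (L := M)); [rewrite spv [LHS]mulnC|move=> p /Hpv[]].
have Hbud x : x <= k * N3c + M * #|V0| + 8 * Kb * h * M -> 2 * Kb * (M * (M + (x + 8 * Kb * h * M))) <= n.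
  move=> Hx; apply: (@leq_trans (2 * Kb * (M * (M + (k * N3c + M * #|V0| + 8 * Kb * h * M + 8 * Kb * h * M))))).
    by rewrite !leq_mul2l leq_add2l leq_add2r Hx !orbT.
  move: hKb Hb128 Hx1 Hx2; move: (#|V0|) (N3c) (M) (h) => v x3 m hh; clear; lia.
have [L1 [sL1 gL1 uL1 aL1 hL1]] := @block_family k d T E BB AA OB (fits E k d true) (flatten pv ++ flatten pe) Kb h true Kb0 n0 nh2 
  (Hbud _ (leq_trans (eq_leq (etrans (size_cat _ _) (etrans (addnC _ _) (congr2 addn sfe sfv)))) (leq_addr _ _))) (blk true).
have sf1 : size (flatten L1) <= 8 * Kb * h * M.
  by rewrite (size_flatten_const (L := M)) ?leq_mul2r ?sL1 ?orbT // => s /gL1[].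
have [|L2 [sL2 gL2 uL2 aL2 hL2]] := @block_family k d T E BB AA OB (fits E k d false) (flatten L1 ++ flatten pv ++ flatten pe) Kb h false Kb0 n0 nh2 _ (blk false).
  by apply: Hbud; rewrite !size_cat sfe sfv addnC [M * _ + _]addnC leq_add2l.
apply: (@assemble T E k d BB AA V0 OB OA Nb x0 d1 dk ndk Nb0 OB_sub extB extBA extA fullA
  (fun c => if c then L1 else L2) pv pe h b N2) => //.
- by case=> s; [move/gL1|move/gL2] => -[].
- by case=> s; [move/gL1|move/gL2] => -[].
- by case=> z zc; [apply: hL1|apply: hL2].
- by rewrite !flatten_cat; apply: uniq_cat4.
- move=> p pp; have [H1 H2 H3 H4 H5] := Hpv p pp; split=> //; apply/allP => x /H5 /= /orP[xB|xV].
    by rewrite (disjointFl dAB xB).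
  by rewrite (disjointFl dAV xV).
- rewrite spe -/n E2 E3 -/a; move: (t * a) => u; clear; lia.
rewrite !size_cat spv spe.
have H48 : 384 * t * Kb * h <= n by apply: leq_trans bh; rewrite leq_mul2r Eb1 addnAC leq_addl orbT.
have U1 := use6 _ _ N6t V6; have U2 := use6 _ _ N6t N3c6; have U3 := use6 _ _ N6t N26.
have t40 : 0 < 4 * t by rewrite muln_gt0.
rewrite -(leq_pmul2l t40); apply: leq_trans nAA; rewrite -/n.
move: sL1 sL2 H48 U1 U2 U3; move: (size L1) (size L2) (#|V0|) (N3c) (N2) (t) => x1 x2 v y1 y2 tt; clear => s1 s2.
have : 4 * tt * (x1 + x2) <= 4 * tt * (2 * (8 * Kb * h)) by rewrite leq_mul2l mul2n -addnn leq_add ?orbT.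
lia.
Qed.

End Extremal.

(** * The minimum codegree *)

Lemma bigminn_le (I : eqType) (r : seq I) (P : pred I) F x j : j \in r -> P j -> \big[minn/x]_(i <- r | P i) F i <= F j.
Proof.
elim: r => // i r IH; rewrite inE big_cons => /orP[/eqP<- ->|jr Pj]; first exact: geq_minl.
by case: ifP => _; [apply: leq_trans (geq_minr _ _) _|]; apply: IH.
Qed.

Lemma codegree_geW (T : finType) (E : {set {set T}}) k t : 0 < k -> kgraph k E -> #|T| <= t * min_codeg k E -> codegree_ge E k t.
Proof.
move=> k0 kE H s us ss; apply: leq_trans H _; rewrite leq_mul2l; apply/orP; right.
have cs : #|[set x in s]| = k.-1 by rewrite cardsE (card_uniqP us).
apply: (@leq_trans (codeg E [set x in s])).
  by rewrite /min_codeg; apply: bigminn_le; rewrite ?mem_index_enum ?cs.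
apply: subset_leq_card; apply/subsetP => v; rewrite !inE /edg => /andP[_ vE].
by rewrite (_ : [set x in rcons s v] = v |: [set x in s]) //; apply/setP => x; rewrite !inE mem_rcons.
Qed.

Lemma has_hamilton_of_min_codeg k l (t := (k %/ (k - l)).+1 * (k - l)) : l < k -> 1 < k - l -> 0 < l -> ~~ (k - l %| k) ->
  exists n0, forall (T : finType) (E : {set {set T}}), n0 <= #|T| -> k - l %| #|T| -> kgraph k E ->
    #|T| <= t * min_codeg k E -> has_hamilton_lcycle k l E.
Proof.
move=> lk d1 l0 ndk; have dk : k - l < k by lia.
have k0 : 0 < k by apply: leq_ltn_trans lk.
have kl : k - (k - l) = l by rewrite subKn // ltnW.
have [Neta [n1 [eta0 H1]]] := extremal d1 dk ndk.
have [n2 H2] := nonextremal d1 dk ndk eta0.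
exists (n1 + n2 + 2 * k) => T E Hn dn kE Hdeg.
have Hns : [/\ n1 <= #|T|, n2 <= #|T| & 2 * k <= #|T|] by move: Hn; move: (2 * k) => x; clear; split; lia.
case: Hns => h1 h2 h3; have HE := codegree_geW k0 kE Hdeg.
have [c [uc cT Hc]] : exists c, [/\ uniq c, c =i T & lpath k (k - l) (fun s => edg E s : Prop) (c ++ take (k - (k - l)) c)].
  by case: (H2 T E h2 dn HE) => // -[A HA HeA]; apply: (H1 T E A).
by apply: (hamilton_of_cycle kE l0 lk dn h3 uc cT); rewrite kl in Hc.
Qed.

(** As the quotient is not an integer, its ceiling is one more than its floor; this identifies
    [s * d] with the number [t] used throughout. *)
Lemma ceil_divn k d s : 0 < d -> ~~ (d %| k) -> (s%:Z = Num.ceil (k%:R / d%:R : rat))%R -> s = (k %/ d).+1.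
Proof.
move=> d0 nd Hs; have d0' : (0 < d%:R :> rat)%R by rewrite ltr0n.
apply/eqP; rewrite eqn_leq; apply/andP; split.
  rewrite -lez_nat Hs ceil_le_int ler_pdivrMr // -pmulrn -natrM ler_nat.
  by rewrite ltnW // ltn_ceil.
rewrite -ltz_nat Hs ceil_gt_int ltr_pdivlMr // -pmulrn -natrM ltr_nat.
by rewrite ltn_neqAle leq_divM andbT; apply: contra nd => /eqP<-; rewrite dvdn_mull.
Qed.

Theorem theorem1p3 (k l s : nat)
    (hk : 3 <= k)
    (hkl : (k%:R / 2%:R < l%:R :> rat)%R)
    (hlk : (l%:R < 3%:R * k%:R / 4%:R :> rat)%R)
    (hndvd : ~~ (k - l %| k))
    (hs : s%:Z%R = Num.ceil (k%:R / (k - l)%N%:R : rat)%R) :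
  exists n0 : nat, forall n : nat, n0 <= n -> k - l %| n ->
    forall (T : finType) (E : {set {set T}}),
      #|T| = n -> kgraph k E ->
      (n%:R / (s * (k - l))%N%:R <= (min_codeg k E)%:R :> rat)%R ->
      has_hamilton_lcycle k l E.
Proof.
have kl : k < 2 * l by move: hkl; rewrite ltr_pdivrMr ?ltr0n // -natrM ltr_nat mulnC.
have lk : 4 * l < 3 * k by move: hlk; rewrite ltr_pdivlMr ?ltr0n // -!natrM ltr_nat mulnC.
have d0 : 0 < k - l by lia.
(* The value 1 is excluded because it divides [k]. *)
have d1 : 1 < k - l.
  by case: (k - l) d0 hndvd => [|[|e]] //; rewrite dvd1n.
have [||n0 H] := has_hamilton_of_min_codeg _ d1 _ hndvd; try lia.
exists n0 => n Hn dn T E Tn kE Hdeg; rewrite -Tn in Hn dn Hdeg; apply: (H T E Hn dn kE).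
rewrite -(ceil_divn d0 hndvd hs); move: Hdeg.
have s0 : 0 < s by rewrite (ceil_divn d0 hndvd hs).
by rewrite ler_pdivrMr ?ltr0n ?muln_gt0 ?s0 // -natrM ler_nat mulnC.
Qed.
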